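(* Let $U=\mathbb{D}$ or $U=\mathbb{D}^*=\mathbb{D}\setminus\{0\}$, $1<p<\infty$, $q=p/(p-1)$, and $\eta_q(\zeta)=(q-1)|\zeta|^{2q-4}$. Then the dual space of $A^p(U)$ is identified with $A^q(U,\eta_q)$ via the pairing $\{f,g\}_p=\int_U f\cdot\overline{g\circ\chi_p}\,dV$, $f\in A^p(U)$, $g\in A^q(U,\eta_q)$; that is, the map $g\mapsto\{\cdot,g\}_p$ is a conjugate-linear isomorphism of Banach spaces from $A^q(U,\eta_q)$ onto $A^p(U)'$.
   Context: $\mathbb{D}$ is the unit disc in $\mathbb{C}$, $dV$ Lebesgue measure, $\chi_p(\zeta)=\zeta|\zeta|^{p-2}$. For a weight $\lambda$, $A^r(U,\lambda)$ is the space of holomorphic $f$ on $U$ with $\int_U|f|^r\lambda\,dV<\infty$, normed by the $r$-th root of this integral; $A^p(U)=A^p(U,1)$. *)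

(* Defs.v *)
(* MathComp + MathComp-Analysis, complex numbers R[i] from mathcomp-real-closed. *)
From HB Require Import structures.
From mathcomp Require Import all_boot all_order all_algebra.
From mathcomp Require Import all_classical all_reals all_analysis.
From mathcomp Require Import complex.

Set Implicit Arguments.
Unset Strict Implicit.
Unset Printing Implicit Defensive.

Import Order.TTheory GRing.Theory Num.Theory.
Import numFieldNormedType.Exports.

Local Open Scope classical_set_scope.
Local Open Scope ring_scope.

Section BergmanDefs.
Variable R : realType.

(* The complex plane is R[i]; points of R x R are identified with x +i* y. *)
Definition toC (xy : R * R) : R[i] := (xy.1 +i* xy.2)%C.

(* Modulus |z| as a real number. *)
Definition cabs (z : R[i]) : R := complex.Re `|z|.

(* Lebesgue measure dV on C = R^2 (product of one-dimensional Lebesgue measures). *)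
Definition dV := ((@lebesgue_measure R) \x (@lebesgue_measure R))%E.

(* The unit disc and the punctured unit disc. *)
Definition disc : set R[i] := [set z | cabs z < 1].
Definition pdisc : set R[i] := [set z | 0 < cabs z < 1].

(* Holomorphy on U: complex differentiability at every point of U. *)
Definition holomorphic_on (U : set R[i]) (f : R[i] -> R[i]) : Prop :=
  forall z, U z -> exists d : R[i], forall eps : R, 0 < eps ->
    exists2 delta : R, 0 < delta &
      forall h : R[i], h != 0 -> cabs h < delta ->
        cabs ((f (z + h) - f z) / h - d) < eps.

(* The integral  int_U |f|^r lambda dV  (an extended real). *)
Definition wint (U : set R[i]) (r : R) (lam : R[i] -> R) (f : R[i] -> R[i]) : \bar R :=
  (\int[dV]_(xy in toC @^-1` U) ((cabs (f (toC xy))) `^ r * lam (toC xy))%:E)%E.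

(* Weighted Bergman space A^r(U, lambda) (as a predicate on functions). *)
Definition Aspace (U : set R[i]) (r : R) (lam : R[i] -> R) (f : R[i] -> R[i]) : Prop :=
  holomorphic_on U f /\ (wint U r lam f < +oo)%E.

(* Its norm: (int_U |f|^r lambda dV)^(1/r). *)
Definition Anorm (U : set R[i]) (r : R) (lam : R[i] -> R) (f : R[i] -> R[i]) : R :=
  (fine (wint U r lam f)) `^ (r^-1).

(* Unweighted versions A^p(U) = A^p(U,1). *)
Definition Ap (U : set R[i]) (p : R) := Aspace U p (fun _ => 1).
Definition Apnorm (U : set R[i]) (p : R) := Anorm U p (fun _ => 1).

(* chi_p(z) = z |z|^(p-2)  (with chi_p(0) = 0). *)
Definition chi (p : R) (z : R[i]) : R[i] := z * ((cabs z) `^ (p - 2))%:C%C.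

(* eta_q(z) = (q-1) |z|^(2q-4). *)
Definition eta_q (q : R) (z : R[i]) : R := (q - 1) * (cabs z) `^ (2 * q - 4).

(* Integral over U of a complex-valued function (real and imaginary parts). *)
Definition cint (U : set R[i]) (F : R[i] -> R[i]) : R[i] :=
  (Rintegral dV (toC @^-1` U) (fun xy => complex.Re (F (toC xy))) +i*
   Rintegral dV (toC @^-1` U) (fun xy => complex.Im (F (toC xy))))%C.

(* The pairing {f, g}_p = int_U f * conj (g o chi_p) dV. *)
Definition pairing (U : set R[i]) (p : R) (f g : R[i] -> R[i]) : R[i] :=
  cint U (fun z => f z * ((g (chi p z))^*)%C).

(* Continuous (= bounded) linear functionals on A^p(U): elements of the dual A^p(U)'. *)
Definition linear_on_Ap (U : set R[i]) (p : R) (L : (R[i] -> R[i]) -> R[i]) : Prop :=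
  forall (a : R[i]) f g, Ap U p f -> Ap U p g ->
    L (fun z => a * f z + g z) = a * L f + L g.

Definition bounded_on_Ap (U : set R[i]) (p : R) (L : (R[i] -> R[i]) -> R[i]) : Prop :=
  exists C : R, forall f, Ap U p f -> cabs (L f) <= C * Apnorm U p f.

Definition dual_Ap (U : set R[i]) (p : R) (L : (R[i] -> R[i]) -> R[i]) : Prop :=
  linear_on_Ap U p L /\ bounded_on_Ap U p L.

(* Operator (dual) norm of L on A^p(U). *)
Definition dual_norm (U : set R[i]) (p : R) (L : (R[i] -> R[i]) -> R[i]) : R :=
  sup [set cabs (L f) | f in [set f | Ap U p f /\ Apnorm U p f <= 1]].

End BergmanDefs.

(* Main.v *)
Require Import Defs.
From HB Require Import structures.
From mathcomp Require Import all_boot all_order all_algebra.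
From mathcomp Require Import all_classical all_reals all_analysis.
From mathcomp Require Import complex measurable_realfun.
From mathcomp Require Import ring lra.
Import Order.TTheory GRing.Theory Num.Theory.
Import numFieldNormedType.Exports.
Local Open Scope classical_set_scope.
Local Open Scope ring_scope.
Set Implicit Arguments.
Unset Strict Implicit.
Unset Printing Implicit Defensive.

(** Let [m] be the largest order of a pole at 0 that functions of [A^p(U)] may
    have, and [e_k z = z^(k-m)].  In polar coordinates [{e_k, g}_p] is the
    conjugate of the [k]-th Taylor coefficient of [z^m g] divided by the positive
    number [kappa_k = (p(k-m)+2)/(2 pi)].  This gives injectivity, and it forces
    the function representing a functional [L] to be
    [g w = w^-m sum_k kappa_k (L e_k)^* w^k].

    The norm of [g] is bounded by duality: if [G] is a partial sum of
    [g o chi_p] with coefficients damped by [r^k], one tests [L] against the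
    combination of the [e_k] with coefficients
    [kappa_k r^k int G |G|^(q-2) (e_k o chi_p)^*].  This reduces the estimate to
    the [L^p] boundedness of the positive kernel
    [|z v|^-m / |1 - r z v^*|^2], [v = chi_p w], which follows from Young's
    inequality with Schur weights, uniformly in [r].  Fatou's lemma removes the
    truncation and the damping.  The function [z^m g] is holomorphic because it
    is [w |-> (L K_w)^*] for a rational kernel [K_w] with pole at [1 / w^*].

    Finally [L] and [{., g}_p] agree on the [e_k], whose span is dense in
    [A^p(U)]: dilations [f (r z)] are uniform limits of partial sums of their
    Laurent series (after multiplication by [z^m]) and converge to [f] in norm. *)


(** The map [chi_p] is not holomorphic, but it keeps arguments, so angular orthogonality of
    monomials survives composition with it; this is why everything is read off on monomials. The
    numbers [kappa_k] grow linearly in [k], so the full kernel [sum kappa_k t^k] has size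
    [|1 - t|^-2], while its truncations carry a remainder of size [N |t|^N |1 - t|^-2]. The damping
    by [r^k] is there to kill this remainder, since [N r^N] tends to 0. The exponent 2 is the one of
    the Poisson kernel, whose angular integral is explicit, so the Schur test becomes
    one-dimensional. A free scale in Young's inequality produces a term that is absorbed on the
    left; this requires finite norms, hence finite sums. The condition [p m < 2] is also
    [m q < 2 q - 2], so both Schur integrals converge at 0. The constant of the estimate does not
    depend on [L]; together with injectivity this yields the bounded inverse directly. The Laurent
    theory on the punctured disc is obtained in the coordinates [exp (s + i t)], in which circles
    are segments and the puncture is at infinity. *)

(** * Measures with a density *)

Section density.
Local Open Scope ereal_scope.
Import HBNNSimple.
Context d (T : measurableType d) (R : realType).
Variables (mu : {measure set T -> \bar R}) (f : T -> R).
Hypotheses (mf : measurable_fun [set: T] f) (f0 : forall x, (0 <= f x)%R).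

(** The two proofs are arguments so that the measure structure, which rests on them, can be attached
    to the term itself. *)
Definition density of measurable_fun [set: T] f & (forall x, (0 <= f x)%R) :=
  fun A => \int[mu]_(x in A) (f x)%:E.
Local Notation nu := (density mf f0).

Let density0 : nu set0 = 0. Proof. by rewrite /density integral_set0. Qed.
Let density_ge0 A : 0 <= nu A.
Proof. by apply: integral_ge0 => x _; rewrite lee_fin. Qed.
Let density_sigma_additive : semi_sigma_additive nu.
Proof.
move=> F mF tF mUF; rewrite /density ge0_integral_bigcup//.
- by apply: is_cvg_ereal_nneg_natsum_cond => n _ _; exact: density_ge0.
- by apply: measurable_funTS; exact/measurable_EFinP.
- by move=> x _; rewrite lee_fin.
Qed.
HB.instance Definition _ := isMeasure.Build _ _ _ nu
  density0 density_ge0 density_sigma_additive.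

(** Both sides are limits of the integrals of simple functions increasing to [h], and on an
    indicator the formula is the definition of the measure. *)
Lemma ge0_integral_density (h : T -> \bar R) : measurable_fun [set: T] h ->
  (forall x, 0 <= h x) -> \int[nu]_x h x = \int[mu]_x (h x * (f x)%:E).
Proof.
move=> mh h0; pose h_ := nnsfun_approx measurableT mh.
have hE x : (h_ n x)%:E @[n --> \oo] --> h x.
  by apply: cvg_nnsfun_approx => //= y _; exact: h0.
have mfE : measurable_fun [set: T] (EFin \o f) by exact/measurable_EFinP.
transitivity (limn (fun n => \int[nu]_x (h_ n x)%:E)).
  rewrite -monotone_convergence//.
  - by apply: eq_integral => x _; apply/esym/cvg_lim => //; exact: hE.
  - by move=> n; apply/measurable_EFinP.
  - by move=> n x _; rewrite lee_fin.
  - by move=> x _ m n mn; rewrite lee_fin; exact/lefP/nd_nnsfun_approx.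
transitivity (limn (fun n => \int[mu]_x ((h_ n x)%:E * (f x)%:E))); last first.
  rewrite -monotone_convergence//.
  - apply: eq_integral => x _; apply/cvg_lim => //.
    by apply: cvgeZr => //; exact: hE.
  - by move=> n; apply: emeasurable_funM => //; exact/measurable_EFinP.
  - by move=> n x _; rewrite mule_ge0 ?lee_fin.
  - move=> x _ m n mn; rewrite lee_wpmul2r ?lee_fin//.
    by exact/lefP/nd_nnsfun_approx.
congr (limn _); apply/funext => n.
transitivity (\int[nu]_x
   (\sum_(y \in range (h_ n)) (y * \1_(h_ n @^-1` [set y]) x)%:E)).
  by apply: eq_integral => t tE; rewrite /= fimfunE -fsumEFin.
have indich m r : measurable_fun [set: T] (fun x => (r * \1_(h_ m @^-1` [set r]) x)%:E).
  by apply: (measurable_comp measurableT) => //; exact: measurable_funM.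
rewrite ge0_integral_fsum//; last by move=> m y Ey; exact: nnfun_muleindic_ge0.
transitivity (\int[mu]_x (\sum_(y \in range (h_ n))
    (y * \1_(h_ n @^-1` [set y]) x)%:E * (f x)%:E)); last first.
  under [LHS]eq_integral => x xE.
    rewrite -ge0_mule_fsuml => [|y]; last exact: nnfun_muleindic_ge0.
    rewrite fsumEFin // -(fimfunE _ x); over.
  by [].
rewrite ge0_integral_fsum//; last 2 first.
  - by move=> y; exact: emeasurable_funM.
  - by move=> m y _; apply: mule_ge0; rewrite ?lee_fin//; exact: nnfun_muleindic_ge0.
apply: eq_fsbigr => r rhn.
under [LHS]eq_integral do rewrite EFinM.
rewrite integralZl_indic_nnsfun//.
under [RHS]eq_integral do rewrite EFinM -muleA.
rewrite ge0_integralZl//.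
- under [in RHS]eq_integral do rewrite muleC.
  rewrite [in RHS](eq_integral ((EFin \o f) \_ (h_ n @^-1` [set r]))); last first.
    by move=> x xE; rewrite epatch_indic.
  by rewrite -integral_mkcond integral_indic// setIT.
- by apply: emeasurable_funM => //; exact/measurable_EFinP.
- by move=> x _; rewrite mule_ge0 ?lee_fin// indicE.
- by move: rhn; rewrite inE lee_fin => -[y _ <-].
Qed.
End density.

(** * Change of variables on the line *)

Section substitution.
Context {R : realType}.
Local Open Scope ereal_scope.
Local Notation mu := (@lebesgue_measure R).

(** Half-open intervals generate the Borel sets and are stable under intersection; the measures of
    [ge0_subst_oc] are compared on them, hence this form of the fundamental theorem. *)
Lemma FTC2_oc (F f : R -> R) (a b : R) : (a <= b)%R ->
  (forall x, a <= x <= b -> is_derive x 1%R F (f x))%R ->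
  (forall x, a <= x <= b -> {for x, continuous f})%R ->
  \int[mu]_(x in `]a, b]) (f x)%:E = (F b - F a)%:E.
Proof.
rewrite le_eqVlt => /predU1P[->|ab] dF cf.
  by rewrite set_itv_ge ?bnd_simp ?ltxx// integral_set0 subrr.
have Fd x : (x \in `[a, b] -> derivable F x 1)%R.
  by rewrite in_itv/= => /dF dFx; exact: ex_derive.
have Fc x : x \in `[a, b] -> {for x, continuous F}.
  move=> xab; apply/differentiable_continuous; rewrite -derivable1_diffP.
  exact: Fd.
have aab : a \in `[a, b] by rewrite in_itv/= lexx ltW.
have bab : b \in `[a, b] by rewrite in_itv/= lexx ltW.
rewrite integral_itv_obnd_cbnd; last first.
  apply/measurable_EFinP; apply: subspace_continuous_measurable_fun => //.
  apply: continuous_in_subspaceT => x; rewrite inE/= in_itv/= => /andP[ax xb].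
  by apply: cf; rewrite (ltW ax).
rewrite EFinB; apply: continuous_FTC2 => //.
- apply: continuous_in_subspaceT => x; rewrite inE/= in_itv/= => axb.
  exact: cf.
- split.
  + by move=> x xab; apply: Fd; exact: subset_itv_oo_cc xab.
  + by apply: cvg_at_right_filter; exact: Fc.
  + by apply: cvg_at_left_filter; exact: Fc.
- move=> x; rewrite in_itv/= => /andP[ax xb]; rewrite derive1E.
  by apply: (@derive_val _ _ _ _ _ _ _ (dF x _)); rewrite !ltW.
Qed.

Variables (phi dphi : R -> R) (a b : R).
Hypotheses (ab : (a <= b)%R)
  (incr : forall x y, (a <= x <= b -> a <= y <= b -> x < y -> phi x < phi y)%R)
  (dphiE : forall x, (a <= x <= b)%R -> is_derive x 1%R phi (dphi x))
  (cdphi : forall x, (a <= x <= b)%R -> {for x, continuous dphi})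
  (dphi0 : forall x, (a <= x <= b -> 0 <= dphi x)%R).

Let phi_le x y : (a <= x <= b -> a <= y <= b -> (phi x <= phi y) = (x <= y))%R.
Proof.
move=> xab yab; apply/idP/idP.
  by apply: contraTT; rewrite -!ltNge; exact: incr.
by rewrite le_eqVlt => /predU1P[->//|/incr]; rewrite xab yab => /(_ isT isT)/ltW.
Qed.

Let phi_lt x y : (a <= x <= b -> a <= y <= b -> (phi x < phi y) = (x < y))%R.
Proof. by move=> xab yab; rewrite !ltNge phi_le. Qed.

Let cphi x : (a <= x <= b)%R -> {for x, continuous phi}.
Proof.
move=> xab; apply/differentiable_continuous; rewrite -derivable1_diffP.
have := dphiE xab; by move=> ?; exact: ex_derive.
Qed.

Let wcphi : {within `[a, b], continuous phi}.
Proof.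
apply: continuous_in_subspaceT => x; rewrite inE/= in_itv/= => xab.
exact: cphi.
Qed.

Let preim y : (phi a <= y <= phi b)%R -> exists2 x, (a <= x <= b)%R & phi x = y.
Proof.
move=> yab; have [|c] := IVT ab wcphi _ (v := y).
  have pab : (phi a <= phi b)%R by rewrite phi_le// lexx ab.
  by rewrite (min_idPl pab) (max_idPr pab).
by rewrite in_itv/=; exists c.
Qed.

(** Extensions by zero. Outside []a, b]] the value 0 of [psi] may fall into the target interval, but
    the density [f] vanishes there, so these points carry no mass in [nu]. *)
Let f := dphi \_ `]a, b].
Let psi : measurableTypeR R -> measurableTypeR R := phi \_ `]a, b].

Let f0 x : (0 <= f x)%R.
Proof.
rewrite /f patchE; case: ifPn => //; rewrite inE/= in_itv/= => /andP[ax xb].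
by apply: dphi0; rewrite ltW.
Qed.

Let mf : measurable_fun [set: R] f.
Proof.
apply/(measurable_restrictT _ _).1 => //.
apply: (@measurable_funS _ _ _ _ `[a, b]) => //; first exact: subset_itv_oc_cc.
apply: subspace_continuous_measurable_fun => //.
apply: continuous_in_subspaceT => x; rewrite inE/= in_itv/=; exact: cdphi.
Qed.

Let mpsi : measurable_fun [set: R] psi.
Proof.
apply/(measurable_restrictT _ _).1 => //.
apply: (@measurable_funS _ _ _ _ `[a, b]) => //; first exact: subset_itv_oc_cc.
exact: subspace_continuous_measurable_fun.
Qed.

Let nu := pushforward (density mu mf f0) psi.

Let nu_ocitv c d : nu `]c, d] = mu (`]c, d] `&` `]phi a, phi b]).
Proof.
have pab : (phi a <= phi b)%R by rewrite phi_le// lexx ab.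
(* A threshold in the target is pulled back to the source: [y] truncated to [[phi a, phi b]] is a
   value of [phi], and the truncation does not change which [z] of []a, b]] satisfy [y < phi z]. *)
have clamp y : exists2 x, (a <= x <= b)%R &
    forall z, (a < z <= b)%R -> ((y < phi z) = (x < z))%R.
  have [|x xab xE] := @preim (Num.max (phi a) (Num.min y (phi b))); last first.
    exists x => // z /andP[az zb].
    have zab : (a <= z <= b)%R by rewrite ltW.
    rewrite -(phi_lt xab zab) xE gt_max gt_min.
    rewrite phi_lt ?lexx// az/= (ltNge (phi b)) phi_le ?lexx ?ab// zb/=.
    by rewrite orbF.
  by rewrite le_max lexx/= ge_max pab ge_min lexx orbT.
have psiE (z : R) : (z \in `]a, b])%R -> psi z = phi z.
  by move=> zab; rewrite /psi patchE mem_set.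
have [x xab xE] := clamp c; have [y yab yE] := clamp d.
have /andP[ax xb] := xab; have /andP[ay yb] := yab.
have -> : nu `]c, d] = \int[mu]_(x in `]x, y]) (dphi x)%:E.
  rewrite /nu /pushforward /density.
  rewrite (_ : (fun z => (f z)%:E) = (EFin \o dphi) \_ `]a, b]); last first.
    by rewrite restrict_EFin.
  rewrite -integral_mkcondr; congr (integral _ _ _); apply/seteqP; split => z /=.
    move=> [+ zab]; rewrite psiE//; move: zab; rewrite !in_itv/= => zab.
    by rewrite xE// [(phi z <= d)%R]leNgt yE// -leNgt.
  rewrite !in_itv/= => /andP[xz zy].
  have zab : (a < z <= b)%R by rewrite (le_lt_trans ax xz) (le_trans zy yb).
  rewrite zab; split => //.
  rewrite psiE/= ?in_itv//= xE// [(phi z <= d)%R]leNgt yE// -leNgt xz.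
  by rewrite zy.
have [yx|xy] := leP y x.
  rewrite [`]x, y]%classic]set_itv_ge ?bnd_simp -?leNgt// integral_set0; apply/esym.
  rewrite (_ : _ `&` _ = set0) ?measure0// -subset0 => w /=.
  rewrite !in_itv/= => -[/andP[cw wd] /andP[aw wb]].
  have [|z zab zw] := @preim w; last first.
    move: cw wd aw; rewrite -zw phi_lt ?lexx ?ab// => + + az.
    case/andP: zab => _ zb; rewrite xE ?az// => xz; rewrite leNgt yE ?az//.
    by rewrite (le_lt_trans yx).
  by rewrite (ltW aw).
have dE z : (x <= z <= y)%R -> is_derive z 1%R phi (dphi z).
  by move=> /andP[xz zy]; apply: dphiE; rewrite (le_trans ax) ?(le_trans zy).
have cE z : (x <= z <= y)%R -> {for z, continuous dphi}.
  by move=> /andP[xz zy]; apply: cdphi; rewrite (le_trans ax) ?(le_trans zy).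
rewrite (FTC2_oc (ltW xy) dE cE).
rewrite (_ : _ `&` _ = `]phi x, phi y]%classic).
  by rewrite lebesgue_measure_itv/= lte_fin phi_lt// xy.
apply/seteqP; split => w /=; rewrite !in_itv/=.
  move=> [/andP[cw wd] /andP[aw wb]].
  have [|z zab zw] := @preim w; last first.
    move: cw wd aw; rewrite -zw phi_lt ?lexx ?ab// => + + az.
    have /andP[_ zb] := zab; rewrite xE ?az// => xz; rewrite leNgt yE ?az//.
    by rewrite phi_lt// xz phi_le// -leNgt.
  by rewrite (ltW aw).
move=> /andP[xw wy].
have [|z zab zw] := @preim w; last first.
  move: xw wy; rewrite -zw phi_lt// phi_le// => xz zy.
  have az : (a < z)%R by rewrite (le_lt_trans ax).
  have /andP[_ zb] := zab.
  rewrite xE ?az// xz [(phi z <= d)%R]leNgt yE ?az// -leNgt zy; split => //.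
  by rewrite phi_lt ?lexx ?ab// az phi_le// lexx ab.
by rewrite (le_trans _ (ltW xw)) ?(le_trans wy)// ?phi_le ?lexx ?ab.
Qed.

(** Lebesgue measure on []phi a, phi b]] and the image under [phi] of [dphi dx] on []a, b]] agree on
    half-open intervals by the fundamental theorem, hence on all Borel sets. *)
Lemma ge0_subst_oc (h : R -> \bar R) : measurable_fun [set: R] h ->
  (forall x, 0 <= h x) ->
  \int[mu]_(x in `]phi a, phi b]) h x =
  \int[mu]_(x in `]a, b]) (h (phi x) * (dphi x)%:E).
Proof.
move=> mh h0.
have nuE A : measurable A -> mrestr mu (measurable_itv `]phi a, phi b]) A = nu A.
  move=> mA.
  pose M1 : {measure set (measurableTypeR R) -> \bar R} :=
    mrestr mu (measurable_itv `]phi a, phi b]).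
  have [M2 M2E] : exists M2 : {measure set (measurableTypeR R) -> \bar R},
      forall A, M2 A = nu A.
    by unshelve refine (ex_intro _ (pushforward (density mu mf f0) psi
      : {measure set _ -> \bar R}) _).
  rewrite -M2E -[LHS]/(M1 A).
  apply: (measure_unique (@ocitv R : set (set (measurableTypeR R)))
    (fun k => `](- k%:R)%R, k%:R]%classic) _ _ _ _ M1 M2) => //.
  - exact: ocitvI.
  - by move=> k; exists (- k%:R, k%:R)%R.
  - apply/seteqP; split => // x _; exists (Num.bound `|x|%R) => //=.
    have := archi_boundP (normr_ge0 (x : R)); rewrite ltr_norml in_itv/=.
    by case/andP => -> /ltW ->.
  - by move=> _ [[c d] _ <-]; rewrite M2E nu_ocitv.
  - move=> k; apply: (@le_lt_trans _ _ (mu `](phi a), (phi b)])).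
      by apply: le_measure; rewrite ?inE//; exact: measurableI.
    by rewrite lebesgue_measure_itv/=; case: ifP => _; rewrite ?ltry// -EFinB ltry.
pose K : set R := `]phi a, phi b]%classic.
have mK : measurable K by exact: measurable_itv.
have hK0 x : 0 <= (h \_ K) x by rewrite patchE; case: ifP.
have mhK : measurable_fun [set: R] (h \_ K).
  by apply/(measurable_restrictT h mK); exact: measurable_funS mh.
transitivity (\int[nu]_y (h \_ K) y).
  rewrite -integral_mkcond; apply: eq_measure_integral => A mA AK.
  by rewrite -[RHS]/(nu A) -nuE// /mrestr setIidl.
rewrite ge0_integral_pushforward//.
have mc : measurable_fun [set: measurableTypeR R] ((h \_ K) \o psi).
  exact: measurableT_comp.
rewrite preimage_setT (ge0_integral_density _ _ _ mc)//.
  rewrite [RHS]integral_mkcond; apply: eq_integral => x _ /=.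
  have [xab|xab] := boolP (x \in `]a, b]%classic); last first.
    by rewrite /f !patchE (negbTE xab) mule0.
  have -> : psi x = phi x by rewrite /psi patchE xab.
  rewrite /f !patchE xab mem_set//.
  move: xab; rewrite inE/= !in_itv/= => /andP[ax xb].
  have xab : (a <= x <= b)%R by rewrite ltW.
  by rewrite /K/= in_itv/= phi_lt ?lexx// phi_le ?lexx ?ab// ax.
by move=> x /=; exact: hK0.
Qed.
End substitution.

(** Unbounded or open [J] are exhausted by the intervals []c n, d n]]; on each of them
    [ge0_subst_oc] applies, and both sides pass to the limit monotonically. *)
Lemma ge0_subst_bij (R : realType) (I J : set R) (phi dphi psi : R -> R)
    (c d : R^nat) (h : R -> \bar R) :
  (forall x y z, I x -> I y -> x <= z <= y -> I z) ->
  (forall x, I x -> J (phi x) /\ psi (phi x) = x) ->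
  (forall y, J y -> I (psi y) /\ phi (psi y) = y) ->
  (forall x y, I x -> I y -> x < y -> phi x < phi y) ->
  (forall x, I x -> is_derive x 1 phi (dphi x)) ->
  (forall x, I x -> {for x, continuous dphi}) ->
  (forall x, I x -> 0 <= dphi x) ->
  {homo c : m n / (m <= n)%N >-> n <= m} -> {homo d : m n / (m <= n)%N >-> m <= n} ->
  (forall n, c n <= d n) -> (forall n, J (c n)) -> (forall n, J (d n)) ->
  J = \bigcup_n `]c n, d n]%classic ->
  measurable_fun [set: R] h -> (forall x, (0 <= h x)%E) ->
  (\int[lebesgue_measure]_(x in J) h x =
   \int[lebesgue_measure]_(x in I) (h (phi x) * (dphi x)%:E))%E.
Proof.
move=> Iitv IJ JI incr dphiE cdphi dphi0 cnonincr dnondecr cd Jc Jd JE mh h0.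
have psi_le x y : J x -> J y -> (psi x <= psi y) = (x <= y).
  move=> Jx Jy; have [[Ix xE] [Iy yE]] := (JI _ Jx, JI _ Jy).
  rewrite -{2}xE -{2}yE; apply/idP/idP.
    by rewrite le_eqVlt => /predU1P[->//|/incr/ltW]; exact.
  by apply: contraTT; rewrite -!ltNge; exact: incr.
have psi_lt x y : J x -> J y -> (psi x < psi y) = (x < y).
  by move=> Jx Jy; rewrite !ltNge psi_le.
have IE : I = \bigcup_n `]psi (c n), psi (d n)]%classic.
  apply/seteqP; split => x /=.
    move=> Ix; have [Jx xE] := IJ _ Ix.
    have : (\bigcup_n `]c n, d n]%classic) (phi x) by rewrite -JE.
    case=> n _ /=; rewrite in_itv/= => /andP[cx xd]; exists n => //=.
    by rewrite in_itv/= -xE psi_lt// psi_le// cx.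
  move=> [n _ /=]; rewrite in_itv/= => /andP[cx xd].
  have [Ic _] := JI _ (Jc n); have [Id _] := JI _ (Jd n).
  by apply: (Iitv _ _ _ Ic Id); rewrite ltW.
have step n : (\int[lebesgue_measure]_(x in `]c n, d n]) h x =
   \int[lebesgue_measure]_(x in `]psi (c n), psi (d n)]) (h (phi x) * (dphi x)%:E))%E.
  have [Ic cE] := JI _ (Jc n); have [Id dE] := JI _ (Jd n).
  have sub x : psi (c n) <= x <= psi (d n) -> I x by exact: Iitv.
  rewrite -{1}cE -{1}dE; apply: ge0_subst_oc => //.
  - by rewrite psi_le.
  - by move=> x y /sub Ix /sub Iy; exact: incr.
  - by move=> x /sub; exact: dphiE.
  - by move=> x /sub; exact: cdphi.
  - by move=> x /sub; exact: dphi0.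
have mfI n : measurable_fun `]psi (c n), psi (d n)]
    (fun x => (h (phi x) * (dphi x)%:E)%E).
  have [Ic cE] := JI _ (Jc n); have [Id dE] := JI _ (Jd n).
  have sub x : x \in `[psi (c n), psi (d n)] -> I x.
    by rewrite in_itv/=; exact: Iitv.
  apply: (@measurable_funS _ _ _ _ `[psi (c n), psi (d n)]) => //.
    exact: subset_itv_oc_cc.
  apply: emeasurable_funM; last first.
    apply/measurable_EFinP; apply: subspace_continuous_measurable_fun => //.
    by apply: continuous_in_subspaceT => x /[1!inE]/= /sub; exact: cdphi.
  apply: measurableT_comp => //.
  apply: subspace_continuous_measurable_fun => //.
  apply: continuous_in_subspaceT => x /[1!inE]/= /sub /dphiE dx.
  apply/differentiable_continuous; rewrite -derivable1_diffP.
  exact: ex_derive.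
have cvgJ : (\int[lebesgue_measure]_(x in `]c n, d n]) h x @[n --> \oo] -->
    \int[lebesgue_measure]_(x in J) h x)%E.
  rewrite JE; apply: ge0_nondecreasing_set_cvg_integral => //.
  - by move=> m n mn; apply/subsetPset => x /=; rewrite !in_itv/= => /andP[cx xd]; rewrite (le_lt_trans (cnonincr _ _ mn))// (le_trans xd)// dnondecr.
  - by move=> n; exact: measurable_funS mh.
have cvgI : (\int[lebesgue_measure]_(x in `]psi (c n), psi (d n)])
    (h (phi x) * (dphi x)%:E) @[n --> \oo] -->
    \int[lebesgue_measure]_(x in I) (h (phi x) * (dphi x)%:E))%E.
  rewrite IE; apply: ge0_nondecreasing_set_cvg_integral => //.
  - move=> m n mn; apply/subsetPset => x /=; rewrite !in_itv/= => /andP[cx xd].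
    rewrite (le_lt_trans _ cx) ?psi_le ?cnonincr// (le_trans xd)//.
    by rewrite psi_le ?dnondecr.
  - move=> n x /=; rewrite in_itv/= => /andP[cx xd].
    have [Ic _] := JI _ (Jc n); have [Id _] := JI _ (Jd n).
    rewrite mule_ge0// lee_fin; apply: dphi0.
    by apply: (Iitv _ _ _ Ic Id); rewrite ltW.
move: cvgI; under eq_fun do rewrite -step.
by move=> /(cvg_unique _ cvgJ); exact.
Qed.

(** * Polar coordinates *)

Section tonelli_set.
Local Open Scope ereal_scope.
Context d1 d2 (T1 : measurableType d1) (T2 : measurableType d2) (R : realType).
Variables (m1 : {sigma_finite_measure set T1 -> \bar R})
  (m2 : {sigma_finite_measure set T2 -> \bar R}).

(** Extending [f] by zero outside the rectangle reduces this to Tonelli's theorem on the whole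
    product; measurability is then required on the rectangle only. *)
Lemma ge0_tonelli_set (A : set T1) (B : set T2) (f : T1 * T2 -> \bar R) :
  measurable A -> measurable B -> measurable_fun (A `*` B) f ->
  (forall x y, A x -> B y -> 0 <= f (x, y)) ->
  \int[m1]_(x in A) \int[m2]_(y in B) f (x, y) =
  \int[m2]_(y in B) \int[m1]_(x in A) f (x, y).
Proof.
move=> mA mB mf f0; have mAB : measurable (A `*` B) by exact: measurableX.
pose g := f \_ (A `*` B).
have mg : measurable_fun [set: T1 * T2] g by exact/(measurable_restrictT f mAB).
have g0 z : 0 <= g z.
  by rewrite /g patchE; case: ifPn => //; rewrite inE; case: z => x y [/=]; exact: f0.
have gE x y : g (x, y) = if (x \in A) && (y \in B) then f (x, y) else 0.
  by rewrite /g patchE in_setX.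
transitivity (\int[m1]_x \int[m2]_y g (x, y)).
  rewrite integral_mkcond; apply: eq_integral => x _; rewrite patchE.
  case: ifPn => [xA|/negbTE xA]; last first.
    by rewrite integral0_eq// => y _; rewrite gE xA.
  rewrite integral_mkcond; apply: eq_integral => y _.
  by rewrite gE xA patchE.
rewrite (fubini_tonelli g mg g0) [RHS]integral_mkcond.
apply: eq_integral => y _; rewrite patchE.
case: ifPn => [yB|/negbTE yB]; last first.
  by rewrite integral0_eq// => x _; rewrite gE yB andbF.
rewrite [RHS]integral_mkcond; apply: eq_integral => x _.
by rewrite gE yB andbT patchE.
Qed.

End tonelli_set.

Section measurable_inv.
Context d (T : measurableType d) (R : realType).

Lemma measurable_funV (D : set T) (f : T -> R) :
  measurable_fun D f -> measurable_fun D (fun x => (f x)^-1).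
Proof.
move=> mf; rewrite (_ : (fun x => _) = fun x => f x * (f x ^+ 2) `^ (-1)).
  apply: measurable_funM => //.
  apply: (measurableT_comp (measurable_powR _)); exact: measurable_funX.
apply/funext => x; rewrite powR_inv1 ?sqr_ge0// expr2 invfM mulrA.
have [->|fx0] := eqVneq (f x) 0; first by rewrite invr0 mulr0.
by rewrite divff// mul1r.
Qed.

End measurable_inv.

Lemma measurable_sin (R : realType) (D : set R) : measurable_fun D (@sin R).
Proof.
by apply: measurable_funTS; apply: continuous_measurable_fun; exact: continuous_sin.
Qed.

Lemma measurable_cos (R : realType) (D : set R) : measurable_fun D (@cos R).
Proof.
by apply: measurable_funTS; apply: continuous_measurable_fun; exact: continuous_cos.
Qed.

(** * Substitutions by dilations, powers, the tangent and reflection *)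

Section substitution_instances.
Context {R : realType}.
Local Notation mu := (@lebesgue_measure R).
Local Open Scope ereal_scope.

Let set_0y_bigcup :
  `]0%R, +oo[%classic = \bigcup_n `](n.+2%:R^-1 : R)%R, n.+2%:R%R]%classic.
Proof.
apply/seteqP; split => x /=; rewrite in_itv/= ?andbT; last first.
  by move=> [n _ /=]; rewrite in_itv/= => /andP[+ _]; apply: lt_trans; rewrite invr_gt0.
move=> x0; pose n := maxn (Num.bound x) (Num.bound x^-1); exists n => //=.
have nx : (x < n%:R)%R.
  by rewrite (lt_le_trans (archi_boundP (ltW x0)))// ler_nat leq_maxl.
have nx' : (x^-1 < n%:R)%R.
  have x'0 : (0 <= x^-1)%R by rewrite invr_ge0 ltW.
  by rewrite (lt_le_trans (archi_boundP x'0))// ler_nat leq_maxr.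
have nn : (n%:R <= n.+2%:R :> R)%R by rewrite ler_nat ltnW// ltnW.
rewrite in_itv/= (ltW (lt_le_trans nx nn)) andbT.
by rewrite -[ltRHS]invrK ltf_pV2 ?posrE ?invr_gt0// (lt_le_trans nx' nn).
Qed.

Lemma ge0_subst_0y (phi dphi psi : R -> R) (h : R -> \bar R) :
  (forall x, 0 < x -> 0 < phi x /\ psi (phi x) = x)%R ->
  (forall x, 0 < x -> 0 < psi x /\ phi (psi x) = x)%R ->
  (forall x y, 0 < x -> x < y -> phi x < phi y)%R ->
  (forall x : R, 0 < x -> is_derive x 1 phi (dphi x))%R ->
  (forall x : R, 0 < x -> {for x, continuous dphi})%R ->
  (forall x, 0 < x -> 0 <= dphi x)%R ->
  measurable_fun [set: R] h -> (forall x, 0 <= h x) ->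
  \int[mu]_(x in `]0%R, +oo[) h x =
  \int[mu]_(x in `]0%R, +oo[) (h (phi x) * (dphi x)%:E).
Proof.
move=> phi0 psi0 incr dE cd d0 mh h0.
apply: (@ge0_subst_bij _ _ _ phi dphi psi (fun n => n.+2%:R^-1)%R (fun n => n.+2%:R)%R) => //.
- move=> x y z /=; rewrite !in_itv/= !andbT => x0 y0 /andP[xz _].
  exact: lt_le_trans xz.
- by move=> x /=; rewrite !in_itv/= !andbT => /phi0.
- by move=> x /=; rewrite !in_itv/= !andbT => /psi0.
- by move=> x y /=; rewrite !in_itv/= !andbT => x0 _; exact: incr.
- by move=> x /=; rewrite !in_itv/= !andbT => /dE.
- by move=> x /=; rewrite !in_itv/= !andbT => /cd.
- by move=> x /=; rewrite !in_itv/= !andbT => /d0.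
- by move=> m n mn; rewrite lef_pV2 ?posrE// ler_nat.
- by move=> m n mn; rewrite ler_nat.
- by move=> n; rewrite (@le_trans _ _ (1 : R)%R)// ?invf_le1 ?ler1n.
- by move=> n /=; rewrite in_itv/= andbT invr_gt0.
- by move=> n /=; rewrite in_itv/= andbT.
Qed.

Lemma ge0_subst_scale (c : R) (h : R -> \bar R) : (0 < c)%R ->
  measurable_fun [set: R] h -> (forall x, 0 <= h x) ->
  \int[mu]_(x in `]0%R, +oo[) h x =
  \int[mu]_(x in `]0%R, +oo[) (h (c * x)%R * c%:E).
Proof.
move=> c0 mh h0.
apply: (@ge0_subst_0y (fun x => c * x)%R (fun=> c) (fun x => c^-1 * x)%R) => //.
- by move=> x x0; rewrite mulr_gt0// mulKf ?gt_eqF.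
- by move=> x x0; rewrite mulr_gt0 ?invr_gt0// mulVKf ?gt_eqF.
- by move=> x y _ xy; rewrite ltr_pM2l.
- move=> x _; have := is_deriveZ c (is_derive_id x (1 : R)%R).
  by rewrite [_ *: 1]mulr1.
- by move=> x _; exact: cst_continuous.
- by move=> x _; exact: ltW.
Qed.

Lemma ge0_subst_powR (a : R) (h : R -> \bar R) : (0 < a)%R ->
  measurable_fun [set: R] h -> (forall x, 0 <= h x) ->
  \int[mu]_(x in `]0%R, +oo[) h x =
  \int[mu]_(x in `]0%R, +oo[) (h (x `^ a)%R * (a * x `^ (a - 1))%:E).
Proof.
move=> a0 mh h0.
have dpow (b x : R) : (0 < x)%R -> is_derive x 1%R (fun x : R => x `^ b)%R (b * x `^ (b - 1))%R.
  move=> x0; apply: DeriveDef.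
    by apply: derivable_powR; rewrite in_itv/= x0.
  by rewrite -derive1E powR_derive1// in_itv/= x0.
apply: (@ge0_subst_0y (fun x => x `^ a)%R (fun x => a * x `^ (a - 1))%R (fun x => x `^ a^-1)%R) => //.
- by move=> x x0; rewrite powR_gt0// -powRrM mulfV ?gt_eqF// powRr1// ltW.
- by move=> x x0; rewrite powR_gt0// -powRrM mulVf ?gt_eqF// powRr1// ltW.
- move=> x y x0 xy; rewrite gt0_ltr_powR// nnegrE ltW//.
  exact: lt_trans xy.
- move=> x x0; apply: cvgM; first exact: cvg_cst.
  have : {for x, continuous (fun y : R => y `^ (a - 1))%R}.
    apply/differentiable_continuous; rewrite -derivable1_diffP.
    by apply: derivable_powR; rewrite in_itv/= x0.
  exact.
- by move=> x x0; rewrite mulr_ge0 ?powR_ge0// ltW.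
Qed.

(** With [c] a fixed positive abscissa, this turns the integral over a vertical line into one over
    angles, [y = x tan t]. *)
Lemma ge0_subst_tan (c : R) (h : R -> \bar R) : (0 < c)%R ->
  measurable_fun [set: R] h -> (forall x, 0 <= h x) ->
  \int[mu]_x h x =
  \int[mu]_(x in `](- (pi / 2))%R, (pi / 2)%R[) (h (c * tan x)%R * (c * (cos x)^-2)%:E).
Proof.
move=> c0 mh h0.
apply: (@ge0_subst_bij _ _ _ (fun x => c * tan x)%R (fun x => c * (cos x)^-2)%R
  (fun y => atan (c^-1 * y)) (fun n => - n%:R)%R (fun n => n%:R)%R) => //.
- move=> x y z /=; rewrite !in_itv/= => /andP[ax _] /andP[_ yb] /andP[xz zy].
  by rewrite (lt_le_trans ax xz) (le_lt_trans zy yb).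
- move=> x /= xI; split => //; rewrite mulKf ?gt_eqF// tanK//.
- move=> y _; rewrite /= in_itv/= atan_gtNpi2 atan_ltpi2; split => //.
  by rewrite atanK mulVKf ?gt_eqF.
- by move=> x y /= xI yI xy; rewrite ltr_pM2l// ltr_tan.
- move=> x /=; rewrite in_itv/= => xI.
  have cx : cos x != 0%R by rewrite gt_eqF// cos_gt0_pihalf.
  have dtan := is_derive_tan cx.
  by have := @is_deriveZ _ _ _ _ c _ _ _ dtan.
- move=> x /=; rewrite in_itv/= => xI.
  have cx : cos x != 0%R by rewrite gt_eqF// cos_gt0_pihalf.
  apply: cvgM; first exact: cvg_cst.
  apply: cvgV; first by rewrite expf_neq0.
  by apply: cvgM; exact: continuous_cos.
- move=> x /=; rewrite in_itv/= => xI.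
  by rewrite mulr_ge0 ?(ltW c0)// invr_ge0 sqr_ge0.
- by move=> m n mn; rewrite lerN2 ler_nat.
- by move=> m n mn; rewrite ler_nat.
- by move=> n; rewrite (@le_trans _ _ (0 : R)%R)// oppr_le0.
- apply/seteqP; split => // x _; exists (Num.bound `|x|%R) => //=.
  have := archi_boundP (normr_ge0 (x : R)); rewrite ltr_norml in_itv/=.
  by case/andP => -> /ltW ->.
Qed.

Lemma ge0_integral_opp (h : R -> \bar R) :
  measurable_fun [set: R] h -> (forall x, 0 <= h x) ->
  \int[mu]_x h x = \int[mu]_x h (- x)%R.
Proof.
move=> mh h0.
have mN : measurable_fun [set: measurableTypeR R] (-%R : measurableTypeR R -> measurableTypeR R).
  exact: oppr_measurable.
transitivity (\int[pushforward mu (-%R : measurableTypeR R -> measurableTypeR R)]_x h x).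
  by apply: eq_measure_integral => //= A mA _; exact/esym/lebesgue_measureN.
by rewrite ge0_integral_pushforward.
Qed.

Lemma ge0_integral_split0 (h : R -> \bar R) :
  measurable_fun [set: R] h -> (forall x, 0 <= h x) ->
  \int[mu]_x h x = \int[mu]_(x in `]0%R, +oo[) h (- x)%R + \int[mu]_(x in `]0%R, +oo[) h x.
Proof.
move=> mh h0.
rewrite (_ : [set: _] = `]-oo, 0%R[%classic `|` (`]0%R, +oo[%classic `|` [set 0%R])); last first.
  apply/seteqP; split => // x _ /=; rewrite !in_itv/= andbT.
  by case: (ltgtP x 0%R) => [||->]; [left|right; left|right; right].
have mU : measurable (`]0%R, +oo[%classic `|` [set 0%R] : set R).
  exact: measurableU.
rewrite ge0_integral_setU//=; last 2 first.
- exact: measurable_funS mh.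
- apply/disj_set2P/seteqP; split => // x [/=]; rewrite !in_itv/= andbT => x0.
  by case=> [xx|xx]; [move: (lt_trans x0 xx)|move: x0; rewrite xx]; rewrite ltxx.
congr (_ + _).
  rewrite integral_mkcond ge0_integral_opp; last 2 first.
  + apply/(measurable_restrictT h) => //; exact: measurable_funS mh.
  + by move=> x; rewrite patchE; case: ifP.
  rewrite [RHS]integral_mkcond; apply: eq_integral => x _; rewrite !patchE.
  rewrite (_ : (_ \in _) = (x \in `]0%R, +oo[%classic))//.
  by apply/idP/idP; rewrite !inE/= !in_itv/= andbT oppr_lt0.
rewrite ge0_integral_setU//=; last 2 first.
- exact: measurable_funS mh.
- apply/disj_set2P/seteqP; split => // x [/=]; rewrite in_itv/= andbT => x0 xx.
  by move: x0; rewrite xx ltxx.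
by rewrite integral_set1 adde0.
Qed.

End substitution_instances.

Section polar.
Context {R : realType}.
Local Notation mu := (@lebesgue_measure R).
Local Open Scope ereal_scope.
Implicit Type F : R * R -> \bar R.

Let J : set R := `](- (pi / 2))%R, (pi / 2)%R[%classic.

Let tJ : R -> R := tan \_ J.
Let kJ : R -> R := (fun x => (cos x)^-2) \_ J.

Let mtJ : measurable_fun [set: R] tJ.
Proof.
apply/(measurable_restrictT tan (measurable_itv _)) => //.
rewrite /tan; apply: measurable_funM.
  exact: measurable_sin.
by apply: measurable_funV; exact: measurable_cos.
Qed.

Let mkJ : measurable_fun [set: R] kJ.
Proof.
apply/(measurable_restrictT _ (measurable_itv _)) => //.
by apply: measurable_funV; apply: measurable_funX; exact: measurable_cos.
Qed.

Let kJ0 x : (0 <= kJ x)%R.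
Proof. by rewrite /kJ patchE; case: ifP => // _; rewrite invr_ge0 sqr_ge0. Qed.

Let mfst2 : measurable_fun [set: R * R] (fun z : R * R => z.1).
Proof. exact: measurable_fst. Qed.
Let msnd2 : measurable_fun [set: R * R] (fun z : R * R => z.2).
Proof. exact: measurable_snd. Qed.

Let mcos : measurable_fun [set: R] (@cos R).
Proof. exact: measurable_cos. Qed.
Let msin : measurable_fun [set: R] (@sin R).
Proof. exact: measurable_sin. Qed.

(** On the right half plane: substitute [y = x tan t] at fixed [x], exchange the integrals, then
    substitute [x = r cos t] at fixed [t]. The Jacobians [x / cos^2 t] and [cos t] multiply to
    [r]. *)
Let polar_half F : measurable_fun [set: R * R] F -> (forall z, 0 <= F z) ->
  \int[mu]_(x in `]0%R, +oo[) \int[mu]_y F (x, y) =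
  \int[mu]_(t in J) \int[mu]_(r in `]0%R, +oo[) (F (r * cos t, r * sin t)%R * r%:E).
Proof.
move=> mF F0.
have mF1 x : measurable_fun [set: R] (fun y => F (x, y)).
  exact: measurableT_comp.
(* The absolute value makes [G] nonnegative on the whole plane, as Tonelli and the dilation require;
   on positive abscissas it changes nothing. *)
pose G (z : R * R) := F (z.1, z.1 * tJ z.2)%R * (`|z.1| * kJ z.2)%:E.
have mG : measurable_fun [set: R * R] G.
  apply: emeasurable_funM.
    apply: (measurableT_comp mF); apply: measurable_fun_pair => //.
    by apply: measurable_funM => //; exact: (measurableT_comp mtJ).
  apply/measurable_EFinP; apply: measurable_funM.
    by apply: (measurableT_comp (@normr_measurable R setT)).
  exact: (measurableT_comp mkJ).
have G0 z : 0 <= G z by rewrite mule_ge0// lee_fin mulr_ge0.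
transitivity (\int[mu]_(x in `]0%R, +oo[) \int[mu]_(t in J) G (x, t)).
  apply: eq_integral => x; rewrite inE/= in_itv/= andbT => x0.
  rewrite (@ge0_subst_tan _ x)//; apply: eq_integral => t tJ'.
  by rewrite /G/= /tJ /kJ !patchE tJ' gtr0_norm.
have -> : \int[mu]_(x in `]0%R, +oo[) \int[mu]_(t in J) G (x, t) =
    \int[mu]_(t in J) \int[mu]_(x in `]0%R, +oo[) G (x, t).
  apply: (ge0_tonelli_set mu mu) => //; first exact: measurable_itv.
  exact: measurable_funS mG.
apply: eq_integral => t; rewrite inE/= => tJ'.
have ct : (0 < cos t)%R by apply: cos_gt0_pihalf; move: tJ'; rewrite /J/= in_itv.
have ctn : cos (t : R) != 0%R by rewrite gt_eqF.
rewrite (@ge0_subst_scale _ (cos t))//; last exact: measurableT_comp.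
apply: eq_integral => r; rewrite inE/= in_itv/= andbT => r0.
rewrite /G/= /tJ /kJ !patchE mem_set// -muleA -EFinM.
rewrite gtr0_norm ?mulr_gt0//; congr (F (_, _)%R * _%:E)%E; first exact: mulrC.
  by rewrite /tan; field.
by field.
Qed.

(** This choice of period splits, up to null sets, into the angles [J] of the right half plane and
    their translate by [pi]. *)
Definition polar_range : set R := `](- (pi / 2))%R, (3 * (pi / 2))%R]%classic.

Lemma polar_range_split (h : R -> \bar R) :
  measurable_fun [set: R] h -> (forall x, 0 <= h x) ->
  \int[mu]_(t in polar_range) h t =
  \int[mu]_(t in J) h t + \int[mu]_(t in J) h (t + pi)%R.
Proof.
move=> mh h0; have pi0 := @pi_gt0 R.
rewrite (_ : polar_range = `](- (pi / 2))%R, (pi / 2)%R]%classic `|` `](pi / 2)%R, (3 * (pi / 2))%R]%classic); last first.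
  by rewrite -itv_bndbnd_setU// !bnd_simp; lra.
rewrite ge0_integral_setU//=; last 2 first.
- exact: measurable_funS mh.
- apply/disj_set2P/seteqP; split => // x [/=]; rewrite !in_itv/= => /andP[_ xp] /andP[px _].
  by move: (lt_le_trans px xp); rewrite ltxx.
congr (_ + _).
  by rewrite /J -integral_itv_bndo_bndc//; exact: measurable_funS mh.
transitivity (\int[mu]_(t in `](- (pi / 2))%R, (pi / 2)%R]) h (t + pi)%R); last first.
  rewrite /J -integral_itv_bndo_bndc//; apply: (@measurable_funS _ _ _ _ setT) => //.
  apply: (measurableT_comp mh); exact: measurable_funD.
rewrite (_ : `](pi / 2)%R, (3 * (pi / 2))%R]%classic =
  `](- (pi / 2) + pi)%R, (pi / 2 + pi)%R]%classic); last first.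
  have -> : (- (pi / 2) + pi = pi / 2 :> R)%R by field.
  by have -> : (pi / 2 + pi = 3 * (pi / 2) :> R)%R by field.
have dE (t : R) : (- (pi / 2) <= t <= pi / 2)%R ->
    is_derive t 1%R (fun t : R => t + pi)%R 1%R.
  move=> _; have := is_deriveD (is_derive_id t (1 : R)%R) (is_derive_cst (pi : R) t (1 : R)%R).
  by rewrite addr0.
rewrite (@ge0_subst_oc _ (fun t => t + pi)%R (fun=> 1%R) _ _ _ _ dE)//.
- by apply: eq_integral => t _; rewrite mule1.
- by lra.
- by move=> x y _ _; rewrite ltrD2r.
- by move=> x _; exact: cst_continuous.
Qed.

(** The left half plane is reflected through the origin onto the right one, which shifts the angle
    by [pi]; the vertical axis is a null set. *)
Lemma polarE F : measurable_fun [set: R * R] F -> (forall z, 0 <= F z) ->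
  \int[@dV R]_z F z =
  \int[mu]_(t in polar_range)
    \int[mu]_(r in `]0%R, +oo[) (F (r * cos t, r * sin t)%R * r%:E).
Proof.
move=> mF F0; 
have -> : \int[@dV R]_z F z = \int[mu]_x \int[mu]_y F (x, y) :=
  fubini_tonelli1 (m1 := mu) (m2 := mu) F mF F0.
pose Fp x := \int[mu]_y F (x, y).
have Fp0 x : 0 <= Fp x by exact: integral_ge0.
have mFp : measurable_fun [set: R] Fp by exact: measurable_fun_fubini_tonelli_F.
pose F' (z : R * R) := F (- z.1, - z.2)%R.
have mF' : measurable_fun [set: R * R] F'.
  apply: (measurableT_comp mF); apply: measurable_fun_pair => //.
    exact: measurableT_comp.
  exact: measurableT_comp.
have mF1 x : measurable_fun [set: R] (fun y => F (x, y)).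
  exact: measurableT_comp.
pose H (G : R * R -> \bar R) t := \int[mu]_(r in `]0%R, +oo[) (G (r * cos t, r * sin t)%R * r%:E).
have mH G : measurable_fun [set: R * R] G -> (forall z, 0 <= G z) -> measurable_fun [set: R] (H G).
  move=> mG G0.
  pose g (z : R * R) := G (z.2 * cos z.1, z.2 * sin z.1)%R * (Num.max z.2 0)%:E.
  have mg : measurable_fun [set: R * R] (fun z => g z * (\1_(`]0%R, +oo[) z.2)%:E).
    apply: emeasurable_funM; first apply: emeasurable_funM.
    - apply: (measurableT_comp mG); apply: measurable_fun_pair => //.
        by apply: measurable_funM; [exact: msnd2|exact: (measurableT_comp mcos mfst2)].
      by apply: measurable_funM; [exact: msnd2|exact: (measurableT_comp msin mfst2)].
    - by apply/measurable_EFinP; exact: measurable_maxr.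
    - apply/measurable_EFinP; apply: (measurableT_comp _ msnd2).
      exact: measurable_indic.
  rewrite (_ : H G = fun t => \int[mu]_r (g (t, r) * (\1_(`]0%R, +oo[) r)%:E)).
    apply: (measurable_fun_fubini_tonelli_F (m2 := mu) (fun z => g z * (\1_(`]0%R, +oo[) z.2)%:E)) => //.
    by move=> z; rewrite mule_ge0 ?lee_fin// mule_ge0// lee_fin le_max lexx orbT.
  apply/funext => t; rewrite /H integral_mkcond; apply: eq_integral => r _.
  rewrite patchE indicE; case: ifPn => [|_]; last by rewrite mule0.
  rewrite inE/= in_itv/= andbT => r0.
  by rewrite mule1 /g/= max_l// ltW.
have H0 G t : (forall z, 0 <= G z) -> 0 <= H G t.
  move=> G0; apply: integral_ge0 => r /=; rewrite in_itv/= andbT => r0.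
  by rewrite mule_ge0// lee_fin ltW.
have E1 : \int[mu]_(x in `]0%R, +oo[) Fp x = \int[mu]_(t in J) H F t.
  exact: polar_half.
have E2 : \int[mu]_(x in `]0%R, +oo[) Fp (- x)%R = \int[mu]_(t in J) H F' t.
  transitivity (\int[mu]_(x in `]0%R, +oo[) \int[mu]_y F' (x, y)); last first.
    by apply: polar_half => // z; exact: F0.
  by apply: eq_integral => x _; rewrite /Fp ge0_integral_opp.
have E3 t : H F' t = H F (t + pi)%R.
  by apply: eq_integral => r _; rewrite cosDpi sinDpi /F'/= !mulrN.
have mHF := mH F mF F0; have HF0 t := H0 F t F0.
have E4 : \int[mu]_x \int[mu]_y F (x, y) =
    \int[mu]_(t in J) H F t + \int[mu]_(t in J) H F (t + pi)%R.
  under [X in _ + X]eq_integral do rewrite -E3.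
  by rewrite -E1 -E2 [RHS]addeC; exact: ge0_integral_split0.
by rewrite E4 -(polar_range_split mHF HF0).
Qed.

End polar.

(** * Complex differentiability *)

Section cabs.
Context {R : realType}.
Implicit Types z w : R[i].

Lemma normcC z : `|z| = ((cabs z)%:C)%C.
Proof. by rewrite /cabs normc_def. Qed.

Lemma cabsE z : cabs z = Num.sqrt (complex.Re z ^+ 2 + complex.Im z ^+ 2).
Proof. by rewrite /cabs normc_def. Qed.

Lemma cabs_ge0 z : 0 <= cabs z. Proof. by rewrite cabsE sqrtr_ge0. Qed.

Lemma cabsM z w : cabs (z * w) = cabs z * cabs w.
Proof. by apply: complexI; rewrite -normcC normrM !normcC rmorphM. Qed.

Lemma cabs0 : cabs (0 : R[i]) = 0.
Proof. by apply: complexI; rewrite -normcC normr0. Qed.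

Lemma cabs1 : cabs (1 : R[i]) = 1.
Proof. by apply: complexI; rewrite -normcC normr1. Qed.

Lemma cabsN z : cabs (- z) = cabs z.
Proof. by apply: complexI; rewrite -!normcC normrN. Qed.

Lemma cabsX z n : cabs (z ^+ n) = cabs z ^+ n.
Proof. by apply: complexI; rewrite -normcC normrX normcC rmorphXn. Qed.

Lemma cabsV z : cabs z^-1 = (cabs z)^-1.
Proof. by apply: complexI; rewrite -normcC normfV normcC fmorphV. Qed.

Lemma cabs_div z w : cabs (z / w) = cabs z / cabs w.
Proof. by rewrite cabsM cabsV. Qed.

Lemma ler_cabsD z w : cabs (z + w) <= cabs z + cabs w.
Proof. by rewrite -lecR rmorphD -!normcC ler_normD. Qed.

Lemma cabs_eq0 z : (cabs z == 0) = (z == 0).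
Proof. by rewrite -(inj_eq (@complexI R)) -normcC normr_eq0. Qed.

Lemma cabs_gt0 z : (0 < cabs z) = (z != 0).
Proof. by rewrite lt0r cabs_eq0 cabs_ge0 andbT. Qed.

Lemma cabs_real (x : R) : cabs (x%:C)%C = `|x|.
Proof. by rewrite cabsE/= expr0n addr0 sqrtr_sqr. Qed.

Lemma cabs_conj z : cabs (z^*)%C = cabs z.
Proof. by rewrite !cabsE; case: z => a b /=; rewrite sqrrN. Qed.

Lemma ler_cabsB z w : cabs (z - w) <= cabs z + cabs w.
Proof. by rewrite -(cabsN w) ler_cabsD. Qed.

Lemma cabs_distC z w : cabs (z - w) = cabs (w - z).
Proof. by rewrite -cabsN opprB. Qed.

Lemma ler_cabs_sub z w : cabs z - cabs w <= cabs (z - w).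
Proof. by rewrite lerBlDr (le_trans _ (ler_cabsD _ _))// subrK. Qed.

Lemma Re_le_cabs z : `|complex.Re z| <= cabs z.
Proof. by rewrite cabsE -sqrtr_sqr ler_wsqrtr// lerDl sqr_ge0. Qed.

Lemma Im_le_cabs z : `|complex.Im z| <= cabs z.
Proof. by rewrite cabsE -sqrtr_sqr ler_wsqrtr// lerDr sqr_ge0. Qed.

Lemma cabs_le_ReIm z : cabs z <= `|complex.Re z| + `|complex.Im z|.
Proof.
rewrite cabsE -[leRHS]ger0_norm ?addr_ge0// -sqrtr_sqr ler_wsqrtr//.
rewrite sqrrD !real_normK ?num_real// addrAC lerDl.
by rewrite mulrn_wge0// mulr_ge0.
Qed.

Lemma cabs_sum (I : Type) (s : seq I) (F : I -> R[i]) :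
  cabs (\sum_(i <- s) F i) <= \sum_(i <- s) cabs (F i).
Proof.
elim/big_ind2 : _ => //; first by rewrite cabs0.
by move=> x a y b xa yb; rewrite (le_trans (ler_cabsD _ _))// lerD.
Qed.

Lemma mul_conj z : z * (z^*)%C = ((cabs z ^+ 2)%:C)%C.
Proof. by rewrite -sqr_normc normcC rmorphXn. Qed.

Lemma cReD z w : complex.Re (z + w) = complex.Re z + complex.Re w.
Proof. by case: z; case: w. Qed.
Lemma cImD z w : complex.Im (z + w) = complex.Im z + complex.Im w.
Proof. by case: z; case: w. Qed.
Lemma cReB z w : complex.Re (z - w) = complex.Re z - complex.Re w.
Proof. by case: z; case: w. Qed.
Lemma cImB z w : complex.Im (z - w) = complex.Im z - complex.Im w.
Proof. by case: z; case: w. Qed.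
Lemma cReM z w : complex.Re (z * w) =
  complex.Re z * complex.Re w - complex.Im z * complex.Im w.
Proof. by case: z; case: w. Qed.
Lemma cImM z w : complex.Im (z * w) =
  complex.Re z * complex.Im w + complex.Im z * complex.Re w.
Proof. by case: z; case: w. Qed.
Lemma complex_eq z w : complex.Re z = complex.Re w ->
  complex.Im z = complex.Im w -> z = w.
Proof. by case: z; case: w => ? ? ? ? /= -> ->. Qed.

Definition cis (t : R) : R[i] := (cos t +i* sin t)%C.

Lemma cabs_cis t : cabs (cis t) = 1.
Proof. by rewrite cabsE/= cos2Dsin2 sqrtr1. Qed.

Lemma cisD s t : cis (s + t) = cis s * cis t.
Proof.
by apply: complex_eq; rewrite ?cReM ?cImM/= ?cosD ?sinD// addrC.
Qed.

Lemma cis_neq0 t : cis t != 0.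
Proof. by rewrite -cabs_gt0 cabs_cis. Qed.

Lemma cabs_polar (r t : R) : cabs (r%:C%C * cis t) = `|r|.
Proof. by rewrite cabsM cabs_real cabs_cis mulr1. Qed.

Lemma conj_cis t : ((cis t)^*)%C = (cis t)^-1.
Proof.
apply: (mulfI (cis_neq0 t)); rewrite divff ?cis_neq0//.
by rewrite mul_conj cabs_cis expr1n.
Qed.

Lemma toC_polar (r t : R) : toC (r * cos t, r * sin t) = r%:C%C * cis t.
Proof. by apply: complex_eq; rewrite ?cReM ?cImM/= mul0r ?subr0 ?addr0. Qed.

End cabs.

(** * Measurability of complex-valued functions *)

Section complex_measurable.
Context d (T : measurableType d) (R : realType).
Implicit Types (D : set T) (F G : T -> R[i]).

Definition cmeasurable D F :=
  measurable_fun D (fun x => complex.Re (F x)) /\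
  measurable_fun D (fun x => complex.Im (F x)).

Lemma cmeasurable_cst D (c : R[i]) : cmeasurable D (fun=> c).
Proof. by split. Qed.

Lemma cmeasurableD D F G : cmeasurable D F -> cmeasurable D G ->
  cmeasurable D (fun x => F x + G x).
Proof.
move=> [F1 F2] [G1 G2]; split.
  by under eq_fun do rewrite cReD; exact: measurable_funD.
by under eq_fun do rewrite cImD; exact: measurable_funD.
Qed.

Lemma cmeasurableM D F G : cmeasurable D F -> cmeasurable D G ->
  cmeasurable D (fun x => F x * G x).
Proof.
move=> [F1 F2] [G1 G2]; split.
  by under eq_fun do rewrite cReM; apply: measurable_funB; exact: measurable_funM.
by under eq_fun do rewrite cImM; apply: measurable_funD; exact: measurable_funM.
Qed.

Lemma cmeasurable_conj D F : cmeasurable D F ->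
  cmeasurable D (fun x => (F x)^*%C).
Proof.
move=> [F1 F2]; split.
  by rewrite (_ : (fun x => _) = fun x => complex.Re (F x))//; apply/funext => x; case: (F x).
rewrite (_ : (fun x => _) = fun x => - complex.Im (F x)).
  exact: measurable_funN.
by apply/funext => x; case: (F x).
Qed.

Lemma cmeasurable_real D (f : T -> R) : measurable_fun D f ->
  cmeasurable D (fun x => (f x)%:C%C).
Proof. by move=> mf; split. Qed.

Lemma measurable_cabs D F : cmeasurable D F ->
  measurable_fun D (fun x => cabs (F x)).
Proof.
move=> [F1 F2]; rewrite (_ : (fun x => _) = fun x =>
    (complex.Re (F x) ^+ 2 + complex.Im (F x) ^+ 2) `^ 2^-1).
  apply: (measurableT_comp (measurable_powR _)).
  by apply: measurable_funD; exact: measurable_funX.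
by apply/funext => x; rewrite cabsE powR12_sqrt// addr_ge0// sqr_ge0.
Qed.

Lemma measurable_cabs_powR D F p : cmeasurable D F ->
  measurable_fun D (fun x => cabs (F x) `^ p).
Proof. by move=> mF; exact: (measurableT_comp (measurable_powR _) (measurable_cabs mF)). Qed.

Lemma cmeasurableV D F : cmeasurable D F -> cmeasurable D (fun x => (F x)^-1).
Proof.
move=> mF; rewrite (_ : (fun x => _) = fun x =>
    (F x)^*%C * ((cabs (F x) ^+ 2)^-1)%:C%C).
  apply: cmeasurableM; first exact: cmeasurable_conj.
  by apply: cmeasurable_real; apply: measurable_funV; apply: measurable_funX; exact: measurable_cabs.
by apply/funext => x; rewrite invc_norm normcC mulrC fmorphV rmorphXn.
Qed.

Lemma cmeasurableX D F n : cmeasurable D F -> cmeasurable D (fun x => F x ^+ n).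
Proof.
move=> mF; elim: n => [|n IHn]; first exact: cmeasurable_cst.
by under eq_fun do rewrite exprS; exact: cmeasurableM.
Qed.

Lemma cmeasurable_sum D (I : Type) (s : seq I) (F : I -> T -> R[i]) :
  (forall i, cmeasurable D (F i)) -> cmeasurable D (fun x => \sum_(i <- s) F i x).
Proof.
move=> mF; elim: s => [|i s IH].
  by under eq_fun do rewrite big_nil; exact: cmeasurable_cst.
by under eq_fun do rewrite big_cons; exact: cmeasurableD.
Qed.

Lemma cmeasurableS (E D : set T) F : measurable E -> D `<=` E ->
  cmeasurable E F -> cmeasurable D F.
Proof. by move=> mE DE [F1 F2]; split; exact: measurable_funS DE _. Qed.

End complex_measurable.

Lemma cmeasurable_comp d d' (T : measurableType d) (S : measurableType d')
    (R : realType) (E : set S) (D : set T) (F : S -> R[i]) (g : T -> S) :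
  measurable E -> g @` D `<=` E -> cmeasurable E F -> measurable_fun D g ->
  cmeasurable D (F \o g).
Proof.
by move=> mE gE [F1 F2] mg; split; [exact: measurable_comp mE gE F1 mg|exact: measurable_comp mE gE F2 mg].
Qed.

(** * Borel measurability of open sets and continuous functions in the plane *)

Section open_measurable.
Context {R : realType}.

Definition box (z : R * R) (e : R) : set (R * R) :=
  [set w | `|w.1 - z.1| < e /\ `|w.2 - z.2| < e].

Lemma measurable_box z e : measurable (box z e).
Proof.
rewrite (_ : box z e = `](z.1 - e), (z.1 + e)[%classic `*` `](z.2 - e), (z.2 + e)[%classic).
  by apply: measurableX; exact: measurable_itv.
apply/seteqP; split => w /=; rewrite /box/= !in_itv/= !ltr_norml.
  by move=> [/andP[? ?] /andP[? ?]]; split; apply/andP; split; lra.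
by move=> [/andP[? ?] /andP[? ?]]; split; apply/andP; split; lra.
Qed.

(** Such a set is the countable union of the boxes with rational centre and radius [1 / (n + 1)]
    that it contains. A radius below [e / 2] guarantees that a box around a nearby rational point
    stays in the [e]-box of [z]. *)
Lemma open_box_measurable (A : set (R * R)) :
  (forall z, A z -> exists2 e, 0 < e & box z e `<=` A) -> measurable A.
Proof.
move=> Ao.
pose B (a b : rat) (n : nat) : set (R * R) :=
  if `[< box (ratr a, ratr b) n.+1%:R^-1 `<=` A >] then box (ratr a, ratr b) n.+1%:R^-1 else set0.
rewrite (_ : A = \bigcup_a \bigcup_b \bigcup_n B a b n).
  apply: bigcupT_measurable_rat => a; apply: bigcupT_measurable_rat => b.
  apply: bigcupT_measurable => n; rewrite /B; case: ifP => // _.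
  exact: measurable_box.
apply/seteqP; split => z; last first.
  by move=> [a _ [b _ [n _]]]; rewrite /B; case: ifP => // /asboolP; exact.
move=> /Ao[e e0 eA]; pose n := Num.bound (2 / e).
have ne : n.+1%:R^-1 < e / 2 :> R.
  have e20 : 0 <= 2 / e by rewrite divr_ge0// ltW.
  rewrite -[ltRHS]invrK invf_div ltf_pV2 ?posrE ?divr_gt0//.
  by rewrite (lt_trans (archi_boundP e20))// ltr_nat.
have n0 : 0 < n.+1%:R^-1 :> R by rewrite invr_gt0.
have ex_rat (x d : R) : 0 < d -> exists a : rat, `|x - ratr a| < d.
  move=> d0; have xx : x - d < x + d by lra.
  have [a] := rat_in_itvoo xx.
  by rewrite in_itv/= => /andP[? ?]; exists a; rewrite ltr_norml; apply/andP; split; lra.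
have [a az] := ex_rat z.1 _ n0; have [b bz] := ex_rat z.2 _ n0.
exists a => //; exists b => //; exists n => //; rewrite /B ifT//.
apply/asboolP => w [/= w1 w2]; apply: eA; split.
  rewrite (_ : w.1 - z.1 = (w.1 - ratr a) - (z.1 - ratr a)); last by ring.
  by rewrite (le_lt_trans (ler_normB _ _))// (lt_trans (ltrD w1 az))// [e]splitr ltrD.
rewrite (_ : w.2 - z.2 = (w.2 - ratr b) - (z.2 - ratr b)); last by ring.
by rewrite (le_lt_trans (ler_normB _ _))// (lt_trans (ltrD w2 bz))// [e]splitr ltrD.
Qed.

Lemma open_continuous_measurable (A : set (R * R)) (f : R * R -> R) :
  (forall z, A z -> exists2 e, 0 < e & box z e `<=` A) ->
  (forall z, A z -> forall eps, 0 < eps -> exists2 e, 0 < e &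
    forall w, box z e w -> `|f w - f z| < eps) ->
  measurable_fun A f.
Proof.
move=> Ao cf; apply: (measurability _ (@RGenOInfty.measurableE R)).
move=> _ [_ [y ->] <-]; apply: open_box_measurable => z [Az /=].
rewrite in_itv/= andbT => yfz.
have [e1 e10 e1A] := Ao _ Az.
have [|e2 e20 e2f] := cf _ Az (f z - y); first by rewrite subr_gt0.
exists (Num.min e1 e2); first by rewrite lt_min e10.
move=> w [/=]; rewrite !lt_min => /andP[w11 w12] /andP[w21 w22]; split.
  by apply: e1A.
rewrite /= in_itv/= andbT; have : `|f w - f z| < f z - y by apply: e2f.
by rewrite ltr_norml => /andP[? _]; lra.
Qed.

End open_measurable.

(** * Holomorphic functions: continuity, measurability, algebraic operations *)

Section holomorphic.
Context {R : realType}.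
Implicit Types (U : set R[i]) (f g : R[i] -> R[i]).

Lemma holomorphic_continuous U f z : holomorphic_on U f -> U z ->
  forall eps, 0 < eps -> exists2 delta, 0 < delta &
    forall w, cabs (w - z) < delta -> cabs (f w - f z) < eps.
Proof.
move=> hf Uz eps eps0; have [d hd] := hf z Uz.
have [delta delta0 hdelta] := hd 1 ltr01.
have K0 : 0 < cabs d + 1 by rewrite ltr_wpDl// cabs_ge0.
exists (Num.min delta (eps / (cabs d + 1))).
  by rewrite lt_min delta0 divr_gt0.
move=> w; rewrite lt_min => /andP[w1 w2].
have [->|wz] := eqVneq w z; first by rewrite subrr cabs0.
have h0 : w - z != 0 by rewrite subr_eq0.
have := hdelta _ h0 w1; rewrite [z + _]addrC subrK => H.
have -> : f w - f z = ((f w - f z) / (w - z) - d + d) * (w - z).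
  by rewrite subrK divfK.
rewrite cabsM -ltr_pdivlMr ?cabs_gt0//.
apply: (le_lt_trans (ler_cabsD _ _)); apply: (@lt_trans _ _ (1 + cabs d)).
  by rewrite ltrD2r.
by rewrite addrC ltr_pdivlMr ?cabs_gt0// mulrC -ltr_pdivlMr.
Qed.

Definition copen U :=
  forall z, U z -> exists2 e, 0 < e & forall w, cabs (w - z) < e -> U w.

Lemma copen_box U (z : R * R) : copen U -> U (toC z) ->
  exists2 e, 0 < e & box z e `<=` [set w | U (toC w)].
Proof.
move=> oU /oU[e e0 eU]; exists (e / 2); first by rewrite divr_gt0.
move=> w [w1 w2]; apply: eU; rewrite (le_lt_trans (cabs_le_ReIm _))//=.
by rewrite (splitr e) ltrD.
Qed.

Lemma measurable_copen U : copen U -> measurable (@toC R @^-1` U).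
Proof. by move=> oU; apply: open_box_measurable => z; exact: copen_box. Qed.

Lemma continuous_cmeasurable U f : copen U ->
  (forall z, U z -> forall eps, 0 < eps -> exists2 delta, 0 < delta &
    forall w, cabs (w - z) < delta -> cabs (f w - f z) < eps) ->
  cmeasurable (@toC R @^-1` U) (f \o @toC R).
Proof.
move=> oU cf.
have cts z : U (toC z) -> forall eps, 0 < eps -> exists2 e, 0 < e &
    forall w, box z e w -> cabs (f (toC w) - f (toC z)) < eps.
  move=> Uz eps eps0; have [e e0 he] := cf _ Uz _ eps0.
  exists (e / 2); first by rewrite divr_gt0.
  move=> w [w1 w2]; apply: he; rewrite (le_lt_trans (cabs_le_ReIm _))//=.
  by rewrite (splitr e) ltrD.
split; apply: open_continuous_measurable.
- by move=> z; exact: copen_box.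
- move=> z /cts + eps eps0 => /(_ _ eps0)[e e0 he]; exists e => // w /he.
  by apply: le_lt_trans; rewrite -cReB Re_le_cabs.
- by move=> z; exact: copen_box.
- move=> z /cts + eps eps0 => /(_ _ eps0)[e e0 he]; exists e => // w /he.
  by apply: le_lt_trans; rewrite -cImB Im_le_cabs.
Qed.

Lemma holomorphic_cmeasurable U f : copen U -> holomorphic_on U f ->
  cmeasurable (@toC R @^-1` U) (f \o @toC R).
Proof.
by move=> oU hf; apply: continuous_cmeasurable => // z; exact: holomorphic_continuous.
Qed.

Lemma copen_disc : copen (@disc R).
Proof.
move=> z zD; exists (1 - cabs z); first by rewrite subr_gt0.
move=> w wz; rewrite /disc/= -(subrK z w) (le_lt_trans (ler_cabsD _ _))//.
by rewrite -ltrBrDr.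
Qed.

Lemma copen_pdisc : copen (@pdisc R).
Proof.
move=> z /andP[z0 z1]; exists (Num.min (cabs z) (1 - cabs z)).
  by rewrite lt_min z0 subr_gt0.
move=> w; rewrite lt_min => /andP[w1 w2]; apply/andP; split.
  have := ler_cabs_sub z w; rewrite cabs_distC; lra.
by have := ler_cabsD (w - z) z; rewrite subrK; lra.
Qed.

(* Differentiability in the quotient-free form [f (z + h) = f z + d h + o(h)]. *)
Definition cderiv f z (d : R[i]) := forall eps, 0 < eps ->
  exists2 delta, 0 < delta & forall h, cabs h < delta ->
    cabs (f (z + h) - f z - d * h) <= eps * cabs h.

Lemma holomorphicP U f : holomorphic_on U f <->
  forall z, U z -> exists d, cderiv f z d.
Proof.
split=> hf z Uz; have [d hd] := hf z Uz; exists d => eps eps0.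
  have [delta delta0 H] := hd _ eps0; exists delta => // h hdelta.
  have [->|h0] := eqVneq h 0; first by rewrite addr0 subrr mulr0 subr0 cabs0 mulr0.
  rewrite (_ : _ - _ = ((f (z + h) - f z) / h - d) * h); last by field.
  by rewrite cabsM ler_wpM2r ?cabs_ge0// ltW// H.
have [delta delta0 H] := hd _ (divr_gt0 eps0 (ltr0Sn R 1)); exists delta => // h h0 hdelta.
have hc0 : 0 < cabs h by rewrite cabs_gt0.
rewrite (_ : _ - d = (f (z + h) - f z - d * h) / h); last by field.
rewrite cabs_div ltr_pdivrMr// (le_lt_trans (H _ hdelta))// ltr_pM2r//.
by rewrite ltr_pdivrMr// ltr_pMr// ltr1n.
Qed.

Lemma cderiv_cst (c : R[i]) z : cderiv (fun=> c) z 0.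
Proof.
by move=> eps eps0; exists 1 => // h _; rewrite subrr mul0r subrr cabs0 mulr_ge0 ?cabs_ge0// ltW.
Qed.

Lemma cderiv_id z : cderiv id z 1.
Proof.
move=> eps eps0; exists 1 => // h _.
by rewrite mul1r [z + h]addrC addrK subrr cabs0 mulr_ge0 ?cabs_ge0// ltW.
Qed.

Lemma cderivD f g z df dg : cderiv f z df -> cderiv g z dg ->
  cderiv (fun w => f w + g w) z (df + dg).
Proof.
move=> hf hg eps eps0; have e20 : 0 < eps / 2 by rewrite divr_gt0.
have [d1 d10 H1] := hf _ e20; have [d2 d20 H2] := hg _ e20.
exists (Num.min d1 d2); first by rewrite lt_min d10.
move=> h; rewrite lt_min => /andP[hd1 hd2].
rewrite (_ : _ - _ = (f (z + h) - f z - df * h) + (g (z + h) - g z - dg * h)); last by ring.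
rewrite (le_trans (ler_cabsD _ _))// [eps](splitr eps) mulrDl.
by rewrite lerD ?H1 ?H2.
Qed.

Lemma cderiv_bounded f z df : cderiv f z df -> exists2 delta, 0 < delta &
  forall h, cabs h < delta -> cabs (f (z + h) - f z) <= (cabs df + 1) * cabs h.
Proof.
move=> hf; have [d d0 H] := hf _ ltr01; exists d => // h /H.
move=> {}H; rewrite -[f _ - _](subrK (df * h)) (le_trans (ler_cabsD _ _))//.
by rewrite cabsM mulrDl addrC lerD2l.
Qed.

Lemma cderivM f g z df dg : cderiv f z df -> cderiv g z dg ->
  cderiv (fun w => f w * g w) z (df * g z + f z * dg).
Proof.
move=> hf hg eps eps0.
(* The three error terms of the product have coefficients [|g z|], [|f z|] and
   [(|df| + 1) (|dg| + 1)]. Their sum is [K - 1]; the extra 1 keeps [K] positive. *)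
pose K := cabs (f z) + cabs (g z) + (cabs df + 1) * (cabs dg + 1) + 1.
have K0 : 0 < K.
  by rewrite /K ltr_wpDl// !addr_ge0 ?cabs_ge0// mulr_ge0 ?addr_ge0 ?cabs_ge0.
have eK0 : 0 < eps / K by rewrite divr_gt0.
have [d1 d10 H1] := hf _ eK0; have [d2 d20 H2] := hg _ eK0.
have [d3 d30 H3] := cderiv_bounded hf; have [d4 d40 H4] := cderiv_bounded hg.
exists (Num.min (Num.min d1 d2) (Num.min (Num.min d3 d4) (eps / K))).
  by rewrite !lt_min d10 d20 d30 d40.
move=> h; rewrite !lt_min => /andP[/andP[hd1 hd2] /andP[/andP[hd3 hd4] hd5]].
rewrite (_ : _ - _ = (f (z + h) - f z - df * h) * g z +
  f z * (g (z + h) - g z - dg * h) + (f (z + h) - f z) * (g (z + h) - g z)); last by ring.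
have {}H1 := H1 _ hd1; have {}H2 := H2 _ hd2; have {}H3 := H3 _ hd3; have {}H4 := H4 _ hd4.
have c0 := cabs_ge0.
apply: (@le_trans _ _ (eps / K * cabs h * cabs (g z) + cabs (f z) * (eps / K * cabs h)
   + (cabs df + 1) * cabs h * ((cabs dg + 1) * (eps / K)))).
  rewrite (le_trans (ler_cabsD _ _))// lerD//.
    by rewrite (le_trans (ler_cabsD _ _))// !cabsM lerD// ?ler_wpM2r ?ler_wpM2l ?c0.
  rewrite cabsM ler_pM ?c0// (le_trans H4)// ler_wpM2l ?addr_ge0 ?c0// ltW//.
rewrite (_ : _ + _ = eps / K * cabs h * (K - 1)); last by rewrite /K; ring.
rewrite mulrAC ler_wpM2r ?c0// mulrAC ler_pdivrMr// ler_wpM2l ?(ltW eps0)//.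
by rewrite gerBl.
Qed.

Lemma cderivX f z df n : cderiv f z df -> exists d, cderiv (fun w => f w ^+ n) z d.
Proof.
move=> hf; elim: n => [|n [d hd]]; first by exists 0; exact: cderiv_cst.
by eexists; under eq_fun do rewrite exprS; exact: (cderivM hf hd).
Qed.

Lemma cderiv_inv z : z != 0 -> cderiv (fun w => w^-1) z (- z ^- 2).
Proof.
move=> z0 eps eps0; have cz0 : 0 < cabs z by rewrite cabs_gt0.
(* The first radius keeps [|z + h| >= |z| / 2]; the second then bounds the remainder
   [h^2 / (z^2 (z + h))] by [eps |h|]. *)
exists (Num.min (cabs z / 2) (eps * cabs z ^+ 3 / 2)).
  by rewrite lt_min !divr_gt0// mulr_gt0// exprn_gt0.
move=> h; rewrite lt_min => /andP[h1 h2].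
have zh : cabs z / 2 <= cabs (z + h).
  by have := ler_cabs_sub z (- h); rewrite opprK cabsN; lra.
have zh0 : z + h != 0 by rewrite -cabs_gt0; lra.
rewrite (_ : _ - _ = h ^+ 2 / (z ^+ 2 * (z + h))); last by field; rewrite ?z0 ?zh0.
rewrite cabs_div 2!expr2 !cabsM.
have wc0 : 0 < cabs (z + h) by rewrite cabs_gt0.
rewrite ler_pdivrMr ?mulr_gt0// mulrAC mulrC ler_wpM2r ?cabs_ge0//.
apply: (le_trans (ltW h2)).
rewrite (_ : _ / 2 = eps * (cabs z * cabs z * (cabs z / 2))); last by field.
by rewrite ler_wpM2l ?(ltW eps0)// ler_wpM2l// mulr_ge0 ?cabs_ge0.
Qed.

Lemma holomorphic_cst U (c : R[i]) : holomorphic_on U (fun=> c).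
Proof. by apply/holomorphicP => z _; exists 0; exact: cderiv_cst. Qed.

Lemma holomorphic_id U : holomorphic_on U id.
Proof. by apply/holomorphicP => z _; exists 1; exact: cderiv_id. Qed.

Lemma holomorphicD U f g : holomorphic_on U f -> holomorphic_on U g ->
  holomorphic_on U (fun z => f z + g z).
Proof.
move=> /holomorphicP hf /holomorphicP hg; apply/holomorphicP => z Uz.
have [df Hf] := hf _ Uz; have [dg Hg] := hg _ Uz.
by eexists; exact: (cderivD Hf Hg).
Qed.

Lemma holomorphicM U f g : holomorphic_on U f -> holomorphic_on U g ->
  holomorphic_on U (fun z => f z * g z).
Proof.
move=> /holomorphicP hf /holomorphicP hg; apply/holomorphicP => z Uz.
have [df Hf] := hf _ Uz; have [dg Hg] := hg _ Uz.
by eexists; exact: (cderivM Hf Hg).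
Qed.

Lemma holomorphicX U f n : holomorphic_on U f -> holomorphic_on U (fun z => f z ^+ n).
Proof.
move=> /holomorphicP hf; apply/holomorphicP => z Uz.
by have [df Hf] := hf _ Uz; exact: (cderivX n Hf).
Qed.

Lemma holomorphicVX U n : (forall z, U z -> z != 0) ->
  holomorphic_on U (fun z => z ^- n).
Proof.
move=> U0; under eq_fun do rewrite -exprVn; apply: holomorphicX.
by apply/holomorphicP => z /U0 z0; eexists; exact: cderiv_inv.
Qed.

Lemma holomorphic_sum U (I : Type) (s : seq I) (F : I -> R[i] -> R[i]) :
  (forall i, holomorphic_on U (F i)) ->
  holomorphic_on U (fun z => \sum_(i <- s) F i z).
Proof.
move=> hF; elim: s => [|i s IH].
  by under eq_fun do rewrite big_nil; exact: holomorphic_cst.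
by under eq_fun do rewrite big_cons; exact: holomorphicD.
Qed.

Lemma holomorphicS U V f : U `<=` V -> holomorphic_on V f -> holomorphic_on U f.
Proof. by move=> UV hf z /UV; exact: hf. Qed.

End holomorphic.

(** * Green's formula on rectangles *)

Section bisection.
Context {R : realType}.
Variables (Phi : R -> R -> R -> R -> R) (a0 b0 c0 d0 : R).
Hypotheses (ab0 : a0 <= b0) (cd0 : c0 <= d0).
Hypothesis Phi_split1 : forall a m b c d, a0 <= a -> a <= m -> m <= b -> b <= b0 ->
  c0 <= c -> c <= d -> d <= d0 -> Phi a b c d = Phi a m c d + Phi m b c d.
Hypothesis Phi_split2 : forall a b c n d, a0 <= a -> a <= b -> b <= b0 ->
  c0 <= c -> c <= n -> n <= d -> d <= d0 -> Phi a b c d = Phi a b c n + Phi a b n d.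
Hypothesis Phi_small : forall x y, a0 <= x <= b0 -> c0 <= y <= d0 ->
  forall eps, 0 < eps -> exists2 delta, 0 < delta &
  forall a b c d, a0 <= a -> a <= x <= b -> b <= b0 ->
    c0 <= c -> c <= y <= d -> d <= d0 -> b - a < delta -> d - c < delta ->
    `|Phi a b c d| <= eps * ((b - a) + (d - c)) ^+ 2.

Let rect := (R * R * (R * R))%type.
Let valid (Q : rect) := [/\ a0 <= Q.1.1, Q.1.1 <= Q.1.2 & Q.1.2 <= b0] /\
  [/\ c0 <= Q.2.1, Q.2.1 <= Q.2.2 & Q.2.2 <= d0].
Let ev (Q : rect) := Phi Q.1.1 Q.1.2 Q.2.1 Q.2.2.

Let quarter (Q Q' : rect) := valid Q -> [/\ valid Q',
  Q.1.1 <= Q'.1.1 /\ Q'.1.2 <= Q.1.2, Q.2.1 <= Q'.2.1 /\ Q'.2.2 <= Q.2.2,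
  Q'.1.2 - Q'.1.1 = (Q.1.2 - Q.1.1) / 2 /\ Q'.2.2 - Q'.2.1 = (Q.2.2 - Q.2.1) / 2 &
  `|ev Q| <= 4 * `|ev Q'|].

(** By additivity the four quarters sum to the rectangle, so one of them carries at least a quarter
    of the absolute value. Validity is a premise inside [quarter], so that a choice function exists
    on all rectangles. *)
Let ex_quarter Q : exists Q', quarter Q Q'.
Proof.
have [vQ|nvQ] := pselect (valid Q); last by exists Q => /nvQ.
case: Q vQ => -[a b] [c d] [[/= aa ab bb] [/= cc cd dd]].
pose m := (a + b) / 2; pose n := (c + d) / 2.
have [am mb cn nd] : [/\ a <= m, m <= b, c <= n & n <= d].
  by rewrite /m /n; split; lra.
have E : Phi a b c d = Phi a m c n + Phi a m n d + (Phi m b c n + Phi m b n d).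
  rewrite (@Phi_split1 a m b c d)// (@Phi_split2 a m c n d)//; last exact: le_trans bb.
  by rewrite (@Phi_split2 m b c n d)//; exact: le_trans am.
have [|H1] := leP `|Phi a b c d| (4 * `|Phi a m c n|).
  by exists ((a, m), (c, n)) => _; split => //=; rewrite /m /n; repeat split; rewrite //=; lra.
have [|H2] := leP `|Phi a b c d| (4 * `|Phi a m n d|).
  by exists ((a, m), (n, d)) => _; split => //=; rewrite /m /n; repeat split; rewrite //=; lra.
have [|H3] := leP `|Phi a b c d| (4 * `|Phi m b c n|).
  by exists ((m, b), (c, n)) => _; split => //=; rewrite /m /n; repeat split; rewrite //=; lra.
have [|H4] := leP `|Phi a b c d| (4 * `|Phi m b n d|).
  by exists ((m, b), (n, d)) => _; split => //=; rewrite /m /n; repeat split; rewrite //=; lra.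
have := ler_normD (Phi a m c n + Phi a m n d) (Phi m b c n + Phi m b n d).
rewrite -E => T1; have T2 := ler_normD (Phi a m c n) (Phi a m n d).
have T3 := ler_normD (Phi m b c n) (Phi m b n d).
by exfalso; lra.
Qed.

(** Goursat's argument: a nonzero value would survive, divided by at most 4 each time, in a sequence
    of nested quarters, while near their common point the value is [o] of the squared side
    lengths. *)
Lemma bisection_eq0 : Phi a0 b0 c0 d0 = 0.
Proof.
have [g gP] := choice ex_quarter.
pose Q n := iter n g ((a0, b0), (c0, d0)).
have QP n : quarter (Q n) (Q n.+1) by exact: gP.
have vQ n : valid (Q n).
  elim: n => [|n IHn]; first by split; split.
  by have [] := QP n IHn.
have wQ n : (Q n).1.2 - (Q n).1.1 = (b0 - a0) / 2 ^+ n.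
  elim: n => [|n IHn]; first by rewrite expr0 divr1.
  have [_ _ _ [-> _] _] := QP n (vQ n).
  by rewrite IHn exprSr; field; rewrite expf_neq0.
have hQ n : (Q n).2.2 - (Q n).2.1 = (d0 - c0) / 2 ^+ n.
  elim: n => [|n IHn]; first by rewrite expr0 divr1.
  have [_ _ _ [_ ->] _] := QP n (vQ n).
  by rewrite IHn exprSr; field; rewrite expf_neq0.
have eQ n : `|Phi a0 b0 c0 d0| <= 4 ^+ n * `|ev (Q n)|.
  elim: n => [|n IHn]; first by rewrite expr0 mul1r.
  have [_ _ _ _ H] := QP n (vQ n).
  by rewrite (le_trans IHn)// exprSr -mulrA ler_wpM2l// exprn_ge0.
have mono m n : [/\ (Q m).1.1 <= (Q (m + n)%N).1.1, (Q (m + n)%N).1.2 <= (Q m).1.2,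
    (Q m).2.1 <= (Q (m + n)%N).2.1 & (Q (m + n)%N).2.2 <= (Q m).2.2].
  elim: n => [|n [h1 h2 h3 h4]]; first by rewrite addn0.
  rewrite addnS; have [_ [k1 k2] [k3 k4] _ _] := QP (m + n)%N (vQ _).
  by split; [exact: le_trans k1|exact: le_trans h2|exact: le_trans k3|exact: le_trans h4].
have cross m n : (Q m).1.1 <= (Q n).1.2 /\ (Q m).2.1 <= (Q n).2.2.
  have [v1 v2] := vQ (m + n)%N; have [_ w1 _] := v1; have [_ w2 _] := v2.
  have [m1 _ m3 _] := mono m n; have [_ n2 _ n4] := mono n m.
  rewrite addnC in n2 n4; split.
    by rewrite (le_trans m1)// (le_trans w1).
  by rewrite (le_trans m3)// (le_trans w2).
(* The suprema of the left and of the lower ends are the coordinates of a point common to all the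
   nested rectangles. *)
pose X := [set (Q n).1.1 | n in [set: nat]]; pose Y := [set (Q n).2.1 | n in [set: nat]].
have X0 : X !=set0 by exists (Q 0%N).1.1; exists 0%N.
have Y0 : Y !=set0 by exists (Q 0%N).2.1; exists 0%N.
have ubX n : ubound X (Q n).1.2 by move=> _ [m _ <-]; have [] := cross m n.
have ubY n : ubound Y (Q n).2.2 by move=> _ [m _ <-]; have [] := cross m n.
have xQ n : (Q n).1.1 <= sup X <= (Q n).1.2.
  rewrite ge_sup ?andbT//; apply: ub_le_sup; last by exists n.
  by exists (Q 0%N).1.2; exact: ubX.
have yQ n : (Q n).2.1 <= sup Y <= (Q n).2.2.
  rewrite ge_sup ?andbT//; apply: ub_le_sup; last by exists n.
  by exists (Q 0%N).2.2; exact: ubY.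
apply/eqP; rewrite -normr_le0 leNgt; apply/negP => eta0.
set eta := `|Phi a0 b0 c0 d0| in eta0 eQ.
pose L := (b0 - a0) + (d0 - c0).
have L0 : 0 <= L by rewrite addr_ge0 ?subr_ge0.
have L1 : 0 < L ^+ 2 + 1 by rewrite ltr_wpDl// sqr_ge0.
(* With this [eps] the local bound gives [4^n |ev (Q n)| <= eta L^2 / (2 (L^2 + 1)) < eta], against
   [eQ]. *)
have e0 : 0 < eta / (2 * (L ^+ 2 + 1)) by rewrite divr_gt0// mulr_gt0.
have [delta delta0 H] := Phi_small (xQ 0%N) (yQ 0%N) e0.
pose n := Num.bound ((L + 1) / delta).
have n2 : (L + 1) / delta < 2 ^+ n.
  have L10 : 0 <= (L + 1) / delta by rewrite divr_ge0 ?(ltW delta0)// addr_ge0.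
  rewrite (lt_le_trans (archi_boundP L10))// -natrX ler_nat -/n.
  by rewrite ltnW// ltn_expl.
have Ln : (L + 1) / 2 ^+ n < delta.
  by rewrite ltr_pdivrMr ?exprn_gt0// mulrC -ltr_pdivrMr.
have Lle (x : R) : x <= L + 1 -> x / 2 ^+ n < delta.
  by move=> xL; rewrite (le_lt_trans _ Ln)// ler_wpM2r// invr_ge0 exprn_ge0.
have [[v1 _ v2] [v3 _ v4]] := vQ n.
have := H _ _ _ _ v1 (xQ n) v2 v3 (yQ n) v4; rewrite wQ hQ -mulrDl -/L.
have w1 : (b0 - a0) / 2 ^+ n < delta.
  by apply: Lle; rewrite /L -addrA lerDl addr_ge0// subr_ge0.
have w2 : (d0 - c0) / 2 ^+ n < delta.
  by apply: Lle; rewrite /L addrAC lerDr addr_ge0// subr_ge0.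
move=> /(_ w1 w2) small; have := eQ n.
have n4 : 0 < 4 ^+ n :> R by rewrite exprn_gt0.
move=> /le_trans /(_ (ler_wpM2l (ltW n4) small)).
have E4 : 4 ^+ n = (2 ^+ n) ^+ 2 :> R by rewrite -exprM mulnC exprM; congr (_ ^+ n); ring.
have L1n : L ^+ 2 + 1 != 0 by rewrite gt_eqF.
have n2n : 2 ^+ n != 0 :> R by rewrite expf_neq0.
rewrite (_ : 4 ^+ n * _ = eta * (L ^+ 2 / (2 * (L ^+ 2 + 1)))); last first.
  by rewrite E4; field; rewrite L1n n2n.
rewrite leNgt => /negP; apply; rewrite gtr_pMr// ltr_pdivrMr ?mulr_gt0//.
by have := sqr_ge0 L; lra.
Qed.

End bisection.

Section green.
Context {R : realType}.
Local Notation mu := (@lebesgue_measure R).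

Lemma continuous_integrable_oc (f : R -> R) a b :
  (forall x, a <= x <= b -> {for x, continuous f}) ->
  mu.-integrable `]a, b] (EFin \o f).
Proof.
move=> cf; have : mu.-integrable `[a, b] (EFin \o f).
  apply: continuous_compact_integrable; first exact: segment_compact.
  by apply: continuous_in_subspaceT => x; rewrite inE/= in_itv/=; exact: cf.
by apply: integrableS => //; exact: subset_itv_oc_cc.
Qed.

Lemma Rintegral_oc_split (f : R -> R) a m b : a <= m -> m <= b ->
  (forall x, a <= x <= b -> {for x, continuous f}) ->
  (\int[mu]_(x in `]a, b]) f x =
   \int[mu]_(x in `]a, m]) f x + \int[mu]_(x in `]m, b]) f x)%R.
Proof.
move=> am mb cf; rewrite -(@Rintegral_itvB _ f (BRight a) (BRight b) m).
- by rewrite addrC subrK.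
- exact: continuous_integrable_oc.
- by rewrite bnd_simp.
- by rewrite bnd_simp.
Qed.

Lemma Rintegral_oc_bound (f : R -> R) a b M : a <= b ->
  (forall x, a <= x <= b -> {for x, continuous f}) ->
  (forall x, a <= x <= b -> `|f x| <= M) ->
  `|\int[mu]_(x in `]a, b]) f x|%R <= M * (b - a).
Proof.
move=> ab cf fM.
have intf := continuous_integrable_oc cf.
have M0 : 0 <= M by rewrite (le_trans _ (fM a _)) ?lexx.
rewrite (le_trans (le_normr_Rintegral _ intf))//.
apply: (@le_trans _ _ (\int[mu]_(x in `]a, b]) M)%R).
  apply: le_Rintegral => //.
  - exact: integrable_norm.
  - by apply: continuous_integrable_oc => x _; exact: cst_continuous.
  - by move=> x /=; rewrite in_itv/= => /andP[ax xb]; apply: fM; rewrite ltW.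
rewrite Rintegral_cst//= lebesgue_measure_itv/= lte_fin.
by case: ifPn => //=; rewrite -leNgt mulr0 => _; rewrite mulr_ge0// subr_ge0.
Qed.

(** The boundary integral of [P ds + Q dt] is additive in the rectangle. The last hypothesis says
    that at each point the derivatives of [P] in [t] and of [Q] in [s] share the value [beta], with
    an error uniform over nearby segments. No continuity of these derivatives is assumed, hence the
    bisection. *)
Lemma green_rectangle (P Q : R -> R -> R) a0 b0 c0 d0 : a0 <= b0 -> c0 <= d0 ->
  (forall s t, a0 <= s <= b0 -> {for s, continuous (P ^~ t)}) ->
  (forall s t, a0 <= s <= b0 -> {for t, continuous (Q s)}) ->
  (forall x y, a0 <= x <= b0 -> exists beta, forall eps, 0 < eps ->
    exists2 delta, 0 < delta & forall s s' t t',
      a0 <= s <= b0 -> a0 <= s' <= b0 ->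
      `|s - x| < delta -> `|s' - x| < delta -> `|t - y| < delta -> `|t' - y| < delta ->
      `|P s t - P s t' - beta * (t - t')| <= eps * (`|s - x| + `|t - y| + `|t' - y|) /\
      `|Q s t - Q s' t - beta * (s - s')| <= eps * (`|s - x| + `|s' - x| + `|t - y|)) ->
  (\int[mu]_(s in `]a0, b0]) (P s c0 - P s d0) +
   \int[mu]_(t in `]c0, d0]) (Q b0 t - Q a0 t))%R = 0.
Proof.
move=> ab0 cd0 cP cQ PQ.
pose Phi a b c d := (\int[mu]_(s in `]a, b]) (P s c - P s d) +
   \int[mu]_(t in `]c, d]) (Q b t - Q a t))%R.
have cPB c d s : a0 <= s <= b0 -> {for s, continuous (fun s => P s c - P s d)}.
  by move=> ss; apply: cvgB; exact: cP.
have cQB a b t : a0 <= a <= b0 -> a0 <= b <= b0 ->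
    {for t, continuous (fun t => Q b t - Q a t)}.
  by move=> aa bb; apply: cvgB; exact: cQ.
apply: (@bisection_eq0 _ Phi) => //.
- move=> a m b c d a0a am mb bb0 c0c cd dd0.
  have aI : a0 <= a <= b0 by rewrite a0a (le_trans am)// (le_trans mb).
  have mI : a0 <= m <= b0 by rewrite (le_trans a0a)//= (le_trans mb).
  have bI : a0 <= b <= b0 by rewrite bb0 (le_trans a0a)//= (le_trans am).
  rewrite /Phi (@Rintegral_oc_split _ a m b)//; last first.
    by move=> s /andP[as' sb]; apply: cPB; rewrite (le_trans a0a) ?(le_trans sb).
  have -> : (\int[mu]_(t in `]c, d]) (Q b t - Q a t) =
     \int[mu]_(t in `]c, d]) (Q m t - Q a t) + \int[mu]_(t in `]c, d]) (Q b t - Q m t))%R.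
    rewrite -RintegralD//; last 2 first.
    + by apply: continuous_integrable_oc => t _; exact: cQB.
    + by apply: continuous_integrable_oc => t _; exact: cQB.
    by apply: eq_Rintegral => t _; rewrite [RHS]addrC subrKA.
  by rewrite addrACA.
- move=> a b c n d a0a ab bb0 c0c cn nd dd0.
  have aI : a0 <= a <= b0 by rewrite a0a (le_trans ab).
  have bI : a0 <= b <= b0 by rewrite bb0 (le_trans a0a).
  rewrite /Phi (@Rintegral_oc_split _ c n d)//; last by move=> t _; exact: cQB.
  have cPB' : forall c d s, a <= s <= b -> {for s, continuous (fun s => P s c - P s d)}.
    by move=> c' d' s /andP[as' sb]; apply: cPB; rewrite (le_trans a0a) ?(le_trans sb).
  have -> : (\int[mu]_(t in `]a, b]) (P t c - P t d) =
     \int[mu]_(t in `]a, b]) (P t c - P t n) + \int[mu]_(t in `]a, b]) (P t n - P t d))%R.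
    rewrite -RintegralD//; last 2 first.
    + by apply: continuous_integrable_oc => t; exact: cPB'.
    + by apply: continuous_integrable_oc => t; exact: cPB'.
    by apply: eq_Rintegral => t _; rewrite subrKA.
  by rewrite addrACA.
- move=> x y xI yI eps eps0; have [beta H] := PQ x y xI.
  have [|delta delta0 {}H] := H (eps / 2); first by rewrite divr_gt0.
  exists delta => // a b c d a0a /andP[ax xb] bb0 c0c /andP[cy yd] dd0 bad dcd.
  have ab : a <= b by rewrite (le_trans ax).
  have cd : c <= d by rewrite (le_trans cy).
  have aI : a0 <= a <= b0 by rewrite a0a (le_trans ab).
  have bI : a0 <= b <= b0 by rewrite bb0 (le_trans a0a).
  have sub s : a <= s <= b -> a0 <= s <= b0.
    by move=> /andP[as' sb]; rewrite (le_trans a0a) ?(le_trans sb).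
  have near1 s : a <= s <= b -> `|s - x| <= b - a.
    by move=> /andP[as' sb]; rewrite ler_norml; apply/andP; split; lra.
  have near2 t : c <= t <= d -> `|t - y| <= d - c.
    by move=> /andP[ct td]; rewrite ler_norml; apply/andP; split; lra.
  pose L := (b - a) + (d - c).
  have cst_oc (k u v : R) : u <= v -> (\int[mu]_(x in `]u, v]) k)%R = k * (v - u).
    move=> uv; rewrite Rintegral_cst//= lebesgue_measure_itv/= lte_fin.
    case: ifPn => //=; rewrite -leNgt => vu.
    by rewrite (@le_anti _ _ u v) ?uv// subrr mulr0.
  have cPB' : forall s, a <= s <= b -> {for s, continuous (fun s => P s c - P s d)}.
    by move=> s /sub; exact: cPB.
  (* The constants may be subtracted from both integrands because their contributions
     [beta (c - d) (b - a)] and [beta (b - a) (d - c)] cancel. *)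
  have -> : Phi a b c d =
    (\int[mu]_(s in `]a, b]) (P s c - P s d - beta * (c - d)) +
     \int[mu]_(t in `]c, d]) (Q b t - Q a t - beta * (b - a)))%R.
    rewrite RintegralB//; last 2 first.
    + exact: continuous_integrable_oc.
    + by apply: continuous_integrable_oc => s _; exact: cst_continuous.
    rewrite [X in _ = _ + X]RintegralB//; last 2 first.
    + by apply: continuous_integrable_oc => t _; exact: cQB.
    + by apply: continuous_integrable_oc => s _; exact: cst_continuous.
    by rewrite !cst_oc// /Phi; ring.
  have L0 : 0 <= L by rewrite addr_ge0// subr_ge0.
  apply: (@le_trans _ _ (eps * L * (b - a) + eps * L * (d - c))); last first.
    by rewrite -mulrDr -mulrA -expr2.
  rewrite (le_trans (ler_normD _ _))// lerD//.
    apply: Rintegral_oc_bound => //.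
      by move=> s /sub ss; apply: cvgB; [exact: cPB|exact: cst_continuous].
    move=> s sab; have ss := near1 _ sab.
    have nc : `|c - y| <= d - c by apply: near2; rewrite lexx.
    have nd : `|d - y| <= d - c by apply: near2; rewrite lexx cd.
    have [] := H s s c d (sub _ sab) (sub _ sab) (le_lt_trans ss bad) (le_lt_trans ss bad)
      (le_lt_trans nc dcd) (le_lt_trans nd dcd).
    move=> /le_trans + _; apply; rewrite (_ : eps * L = eps / 2 * (2 * L)); last by field.
    by rewrite ler_wpM2l ?divr_ge0 ?(ltW eps0)//; rewrite /L; lra.
  apply: Rintegral_oc_bound => //.
    by move=> t _; apply: cvgB; [exact: cQB|exact: cst_continuous].
  move=> t tcd; have tt := near2 _ tcd.
  have na : `|a - x| <= b - a by apply: near1; rewrite lexx.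
  have nb : `|b - x| <= b - a by apply: near1; rewrite lexx ab.
  have [] := H b a t t bI aI (le_lt_trans nb bad) (le_lt_trans na bad)
      (le_lt_trans tt dcd) (le_lt_trans tt dcd).
  move=> _ /le_trans; apply; rewrite (_ : eps * L = eps / 2 * (2 * L)); last by field.
  by rewrite ler_wpM2l ?divr_ge0 ?(ltW eps0)//; rewrite /L; lra.
Qed.

End green.

(** * Integrals of complex-valued functions *)

Lemma integrable_ext d (T : measurableType d) (R : realType)
    (mu : {measure set T -> \bar R}) (D : set T) (f g : T -> \bar R) :
  f =1 g -> mu.-integrable D f -> mu.-integrable D g.
Proof. by move=> /funext ->. Qed.

Section complex_integral.
Context d (T : measurableType d) (R : realType).
Implicit Types (D : set T) (F G : T -> R[i]).

Definition cI (mu : {measure set T -> \bar R}) D F : R[i] :=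
  (Rintegral mu D (fun x => complex.Re (F x)) +i*
   Rintegral mu D (fun x => complex.Im (F x)))%C.

Variable mu : {measure set T -> \bar R}.

Definition cintegrable D F :=
  mu.-integrable D (EFin \o (fun x => complex.Re (F x))) /\
  mu.-integrable D (EFin \o (fun x => complex.Im (F x))).

Lemma cintegrable_cmeasurable D F : cintegrable D F -> cmeasurable D F.
Proof.
by move=> [/measurable_int F1 /measurable_int F2]; split; exact/measurable_EFinP.
Qed.

Lemma cintegrable_le D F (g : T -> R) : measurable D -> cmeasurable D F ->
  (forall x, D x -> cabs (F x) <= g x) -> mu.-integrable D (EFin \o g) ->
  cintegrable D F.
Proof.
move=> mD [mF1 mF2] Fg ig; split; apply: le_integrable ig => //.
- exact/measurable_EFinP.
- move=> x Dx /=; rewrite lee_fin (le_trans (Re_le_cabs _))//.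
  by rewrite (le_trans (Fg x Dx))// ler_norm.
- exact/measurable_EFinP.
- move=> x Dx /=; rewrite lee_fin (le_trans (Im_le_cabs _))//.
  by rewrite (le_trans (Fg x Dx))// ler_norm.
Qed.

Lemma cintegrable_cabs D F : measurable D -> cintegrable D F ->
  mu.-integrable D (EFin \o (fun x => cabs (F x))).
Proof.
move=> mD iF; have mF := cintegrable_cmeasurable iF; have [iF1 iF2] := iF.
apply: (le_integrable mD _ _ (integrableD mD (integrable_abse iF1) (integrable_abse iF2))).
  by apply/measurable_EFinP; exact: measurable_cabs.
move=> x Dx /=; rewrite lee_fin ger0_norm ?cabs_ge0// ger0_norm ?addr_ge0//.
exact: cabs_le_ReIm.
Qed.

Lemma cintegrable_lty D F : measurable D -> cmeasurable D F ->
  (\int[mu]_(x in D) (cabs (F x))%:E < +oo)%E -> cintegrable D F.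
Proof.
move=> mD mF Foo; apply: (@cintegrable_le _ _ (fun x => cabs (F x))) => //.
apply/integrableP; split; first by apply/measurable_EFinP; exact: measurable_cabs.
by under eq_integral do rewrite /= ger0_norm ?cabs_ge0//.
Qed.

Lemma cintegrableD D F G : measurable D -> cintegrable D F -> cintegrable D G ->
  cintegrable D (fun x => F x + G x).
Proof.
move=> mD [F1 F2] [G1 G2]; split.
  apply: integrable_ext (integrableD mD F1 G1) => x /=.
  by rewrite cReD.
apply: integrable_ext (integrableD mD F2 G2) => x /=.
by rewrite cImD.
Qed.

Lemma cintegrableZ D F (c : R[i]) : measurable D -> cintegrable D F ->
  cintegrable D (fun x => c * F x).
Proof.
move=> mD iF; have mF := cintegrable_cmeasurable iF.
apply: (@cintegrable_le _ _ (fun x => cabs c * cabs (F x))) => //.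
- by apply: cmeasurableM => //; exact: cmeasurable_cst.
- by move=> x _; rewrite cabsM.
- apply: integrable_ext (integrableZl mD (cabs c) (cintegrable_cabs mD iF)) => x /=.
  by rewrite EFinM.
Qed.

Lemma cintegrable0 D : measurable D -> cintegrable D (fun=> 0).
Proof. by move=> mD; split; exact: integrable0. Qed.

Lemma cintegrable_sum D (I : Type) (s : seq I) (F : I -> T -> R[i]) :
  measurable D -> (forall i, cintegrable D (F i)) ->
  cintegrable D (fun x => \sum_(i <- s) F i x).
Proof.
move=> mD iF; elim: s => [|i s IH].
  by under eq_fun do rewrite big_nil; exact: cintegrable0.
by under eq_fun do rewrite big_cons; exact: cintegrableD.
Qed.

Lemma eq_cI D F G : (forall x, D x -> F x = G x) -> cI mu D F = cI mu D G.
Proof.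
move=> FG; congr (_ +i* _)%C; apply: eq_Rintegral => x /set_mem Dx;
by rewrite FG.
Qed.

Lemma cID D F G : measurable D -> cintegrable D F -> cintegrable D G ->
  cI mu D (fun x => F x + G x) = cI mu D F + cI mu D G.
Proof.
move=> mD [F1 F2] [G1 G2]; apply: complex_eq; rewrite ?cReD ?cImD /=.
  by rewrite -RintegralD//; apply: eq_Rintegral => x _; rewrite cReD.
by rewrite -RintegralD//; apply: eq_Rintegral => x _; rewrite cImD.
Qed.

Lemma cIZ D F (c : R[i]) : measurable D -> cintegrable D F ->
  cI mu D (fun x => c * F x) = c * cI mu D F.
Proof.
move=> mD [F1 F2].
have Z (k : R) (f : T -> R) : mu.-integrable D (EFin \o f) ->
    mu.-integrable D (EFin \o (fun x => k * f x)).
  move=> i; apply: integrable_ext (integrableZl mD k i) => x /=.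
  by rewrite EFinM.
apply: complex_eq; rewrite ?cReM ?cImM /=.
  rewrite -!RintegralZl// -RintegralB//; [|exact: Z|exact: Z].
  by apply: eq_Rintegral => x _; rewrite cReM.
rewrite -!RintegralZl// -RintegralD//; [|exact: Z|exact: Z].
by apply: eq_Rintegral => x _; rewrite cImM.
Qed.

Lemma cI0 D : cI mu D (fun=> 0) = 0.
Proof. by apply: complex_eq; rewrite /= /Rintegral integral0. Qed.

Lemma cI_sum D (I : Type) (s : seq I) (F : I -> T -> R[i]) :
  measurable D -> (forall i, cintegrable D (F i)) ->
  cI mu D (fun x => \sum_(i <- s) F i x) = \sum_(i <- s) cI mu D (F i).
Proof.
move=> mD iF; elim: s => [|i s IH].
  rewrite big_nil -[RHS](cI0 D); apply: eq_cI => x _; exact: big_nil.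
rewrite big_cons -IH -cID//; last exact: cintegrable_sum.
by apply: eq_cI => x _; rewrite big_cons.
Qed.

Lemma cI_conj D F : measurable D -> cintegrable D F ->
  cI mu D (fun x => (F x)^*%C) = ((cI mu D F)^*)%C.
Proof.
move=> mD [F1 F2]; apply: complex_eq => /=.
  by apply: eq_Rintegral => x _; case: (F x).
rewrite -mulN1r -RintegralZl//; apply: eq_Rintegral => x _.
by case: (F x) => a b /=; rewrite mulN1r.
Qed.

(* Rotating [cI F] onto the positive real axis reduces the bound to real parts. *)
Lemma cabs_cI D F : measurable D -> cintegrable D F ->
  cabs (cI mu D F) <= Rintegral mu D (fun x => cabs (F x)).
Proof.
move=> mD iF; have [I0|I0] := eqVneq (cI mu D F) 0.
  by rewrite I0 cabs0 Rintegral_ge0// => x _; exact: cabs_ge0.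
set I := cI mu D F; pose c := (I^*)%C / ((cabs I)%:C)%C.
have cI0 : ((cabs I)%:C)%C != 0 :> R[i] by rewrite (inj_eq (@complexI R)) cabs_eq0.
have c1 : cabs c = 1.
  by rewrite cabs_div cabs_conj cabs_real ger0_norm ?cabs_ge0// divff// cabs_eq0.
have -> : cabs I = complex.Re (cI mu D (fun x => c * F x)).
  rewrite cIZ// -/I /c mulrAC (mulrC _ I) mul_conj rmorphXn expr2 mulfK//.
have [iR _] := cintegrableZ c mD iF.
rewrite (le_trans (ler_norm _))// (le_trans (le_normr_Rintegral mD iR))//.
apply: le_Rintegral => //.
- exact: integrable_norm.
- exact: cintegrable_cabs.
- by move=> x _; rewrite (le_trans (Re_le_cabs _))// cabsM c1 mul1r.
Qed.

End complex_integral.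

(** * Integrals over the circle and their geometric expansions *)

Section angular.
Context {R : realType}.
Local Notation mu := (@lebesgue_measure R).
Implicit Types (f h : R[i] -> R[i]) (phi u : R -> R[i]).

Definition ang phi := cI mu polar_range phi.

Definition ccont phi := forall t,
  complex.Re (phi s) @[s --> t] --> complex.Re (phi t) /\
  complex.Im (phi s) @[s --> t] --> complex.Im (phi t).

Lemma ccont_cst c : ccont (fun=> c).
Proof. by move=> t; split; exact: cst_continuous. Qed.

Lemma ccontD phi u : ccont phi -> ccont u -> ccont (fun t => phi t + u t).
Proof.
move=> cp cu t; have [p1 p2] := cp t; have [u1 u2] := cu t; split.
  by under eq_fun do rewrite cReD; rewrite cReD; apply: cvgD.
by under eq_fun do rewrite cImD; rewrite cImD; apply: cvgD.
Qed.

Lemma ccontM phi u : ccont phi -> ccont u -> ccont (fun t => phi t * u t).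
Proof.
move=> cp cu t; have [p1 p2] := cp t; have [u1 u2] := cu t; split.
  under eq_fun do rewrite cReM; rewrite cReM; apply: cvgB.
    by apply: cvgM.
  by apply: cvgM.
under eq_fun do rewrite cImM; rewrite cImM; apply: cvgD.
  by apply: cvgM.
by apply: cvgM.
Qed.

Lemma ccontX phi n : ccont phi -> ccont (fun t => phi t ^+ n).
Proof.
move=> cp; elim: n => [|n IH]; first exact: ccont_cst.
by under eq_fun do rewrite exprS; exact: ccontM.
Qed.

Lemma ccont_sum (I : Type) (s : seq I) (F : I -> R -> R[i]) :
  (forall i, ccont (F i)) -> ccont (fun t => \sum_(i <- s) F i t).
Proof.
move=> cF; elim: s => [|i s IH].
  by under eq_fun do rewrite big_nil; exact: ccont_cst.
by under eq_fun do rewrite big_cons; exact: ccontD.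
Qed.

Lemma ccont_conj phi : ccont phi -> ccont (fun t => (phi t)^*%C).
Proof.
move=> cp t; have [p1 p2] := cp t; split.
  have E s : complex.Re (phi s)^*%C = complex.Re (phi s) by case: (phi s).
  by under eq_fun do rewrite E; rewrite E.
have E s : complex.Im (phi s)^*%C = - complex.Im (phi s) by case: (phi s).
by under eq_fun do rewrite E; rewrite E; exact: cvgN.
Qed.

Lemma ccontV phi : (forall t, phi t != 0) -> ccont phi -> ccont (fun t => (phi t)^-1).
Proof.
move=> p0 cp.
have VE t : (phi t)^-1 = (phi t)^*%C *
    ((complex.Re (phi t) ^+ 2 + complex.Im (phi t) ^+ 2)^-1 +i* 0)%C.
  by rewrite invc_norm normcC -rmorphXn -fmorphV mulrC cabsE sqr_sqrtr// addr_ge0// sqr_ge0.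
under eq_fun do rewrite VE; apply: ccontM; first exact: ccont_conj.
move=> t; have [p1 p2] := cp t; split; last exact: cst_continuous.
apply: cvgV.
  have := p0 t; rewrite -cabs_eq0 cabsE sqrtr_eq0 -ltNge => H.
  by rewrite gt_eqF.
by apply: cvgD; apply: cvgM.
Qed.

Lemma ccont_cis : ccont (@cis R).
Proof. by move=> t; split; [exact: continuous_cos|exact: continuous_sin]. Qed.

Lemma measurable_polar_range : measurable (@polar_range R).
Proof. exact: measurable_itv. Qed.

Lemma ccont_cintegrable phi : ccont phi -> cintegrable mu polar_range phi.
Proof.
by move=> cp; split; apply: continuous_integrable_oc => t _; have [] := cp t.
Qed.

Lemma angD phi u : ccont phi -> ccont u -> ang (fun t => phi t + u t) = ang phi + ang u.
Proof.
by move=> cp cu; apply: cID; [exact: measurable_polar_range|exact: ccont_cintegrable..].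
Qed.

Lemma angZ c phi : ccont phi -> ang (fun t => c * phi t) = c * ang phi.
Proof.
by move=> cp; apply: cIZ; [exact: measurable_polar_range|exact: ccont_cintegrable].
Qed.

Lemma ang_sum (I : Type) (s : seq I) (F : I -> R -> R[i]) : (forall i, ccont (F i)) ->
  ang (fun t => \sum_(i <- s) F i t) = \sum_(i <- s) ang (F i).
Proof.
move=> cF; apply: cI_sum; first exact: measurable_polar_range.
by move=> i; exact: ccont_cintegrable.
Qed.

Lemma polar_range_measure : mu (@polar_range R) = (2 * pi)%:E.
Proof.
have pi0 := @pi_gt0 R.
rewrite lebesgue_measure_itv/= lte_fin ifT; last by lra.
by rewrite -EFinB; congr EFin; field.
Qed.

Lemma ang_cst c : ang (fun=> c) = c * ((2 * pi)%:C)%C.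
Proof.
have E k : Rintegral mu polar_range (fun=> k) = k * (2 * pi).
  by rewrite Rintegral_cst//=; [rewrite polar_range_measure|exact: measurable_polar_range].
by apply: complex_eq; rewrite ?cReM ?cImM/= E mulr0 ?subr0 ?add0r.
Qed.

Lemma ang_bound phi B : ccont phi -> (forall t, cabs (phi t) <= B) ->
  cabs (ang phi) <= B * (2 * pi).
Proof.
move=> cp pB; have ip := ccont_cintegrable cp.
rewrite (le_trans (cabs_cI _ ip))//; first exact: measurable_polar_range.
apply: (@le_trans _ _ (Rintegral mu polar_range (fun=> B))).
  apply: le_Rintegral => //; first exact: measurable_polar_range.
  - by apply: cintegrable_cabs => //; exact: measurable_polar_range.
  - by apply: continuous_integrable_oc => t _; exact: cst_continuous.
by rewrite Rintegral_cst//=; [rewrite polar_range_measure|exact: measurable_polar_range].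
Qed.

(** Serves to conclude that a quantity vanishes when it is bounded by every remainder of a geometric
    expansion. *)
Lemma geometric_le0 (x K c : R) : 0 <= c < 1 -> (forall n, x <= K * c ^+ n) -> x <= 0.
Proof.
move=> /andP[c0 c1] H.
have cv : K * c ^+ n @[n --> \oo] --> (0 : R).
  rewrite -(mulr0 K); apply: cvgM; first exact: cvg_cst.
  by apply: cvg_expr; rewrite ger0_norm.
rewrite leNgt; apply/negP => x0.
have /cvgrPdist_lt/(_ _ x0)[N _ /(_ _ (leqnn N))] := cv.
by rewrite sub0r normrN ltNge (le_trans (H N) (ler_norm _)).
Qed.

Lemma geometric_sum (b : R[i]) N : b != 1 ->
  (1 - b)^-1 = \sum_(k < N) b ^+ k + b ^+ N / (1 - b).
Proof.
move=> b1; have b10 : 1 - b != 0 by rewrite subr_eq0 eq_sym.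
apply: (mulfI b10); rewrite mulrDr divff// mulrCA mulfV// mulr1.
by rewrite -opprB mulNr -subrX1 opprB subrK.
Qed.

Lemma cabs_lt1_neq1 (b : R[i]) : cabs b < 1 -> b != 1.
Proof. by apply: contraTneq => ->; rewrite cabs1 ltxx. Qed.

Lemma cabs_1B (b : R[i]) : 1 - cabs b <= cabs (1 - b).
Proof. by have := ler_cabs_sub 1 b; rewrite cabs1. Qed.

(** The finite geometric sum is integrated together with its remainder, so no limit is exchanged
    with the integral; the remainder is controlled by [|1 - b u| >= 1 - |b|]. *)
Lemma ang_geometric phi u b B N : ccont phi -> ccont u -> (forall t, cabs (u t) = 1) ->
  (forall t, cabs (phi t) <= B) -> cabs b < 1 ->
  cabs (ang (fun t => phi t / (1 - b * u t)) - \sum_(k < N) b ^+ k * ang (fun t => phi t * u t ^+ k))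
    <= B * (2 * pi) / (1 - cabs b) * cabs b ^+ N.
Proof.
move=> cp cu u1 pB b1.
have bu t : cabs (b * u t) = cabs b by rewrite cabsM u1 mulr1.
have bu1 t : b * u t != 1 by apply: cabs_lt1_neq1; rewrite bu.
have bu0 t : 1 - b * u t != 0 by rewrite subr_eq0 eq_sym.
have cden : ccont (fun t => (1 - b * u t)^-1).
  apply: ccontV => //; apply: (ccontD (ccont_cst 1)).
  under eq_fun do rewrite -mulNr; apply: ccontM => //; exact: ccont_cst.
have cterm k : ccont (fun t => b ^+ k * (phi t * u t ^+ k)).
  by apply: ccontM; [exact: ccont_cst|apply: ccontM => //; exact: ccontX].
have crem : ccont (fun t => b ^+ N * (phi t * u t ^+ N * (1 - b * u t)^-1)).
  by apply: ccontM; [exact: ccont_cst|apply: ccontM => //; apply: ccontM => //; exact: ccontX].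
have -> : ang (fun t => phi t / (1 - b * u t)) =
    \sum_(k < N) b ^+ k * ang (fun t => phi t * u t ^+ k) +
    ang (fun t => b ^+ N * (phi t * u t ^+ N * (1 - b * u t)^-1)).
  have -> : \sum_(k < N) b ^+ k * ang (fun t => phi t * u t ^+ k) =
      \sum_(k < N) ang (fun t => b ^+ k * (phi t * u t ^+ k)).
    by apply: eq_bigr => k _; rewrite angZ//; apply: ccontM => //; exact: ccontX.
  rewrite -ang_sum// -angD//; last exact: ccont_sum.
  apply: eq_cI => t _; rewrite [in LHS](geometric_sum N (bu1 t)) mulrDr mulr_sumr; congr (_ + _).
    by apply: eq_bigr => k _; rewrite exprMn; ring.
  by rewrite exprMn; ring.
rewrite addrAC subrr add0r.
rewrite (_ : _ * _ = B * cabs b ^+ N / (1 - cabs b) * (2 * pi)); last by ring.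
apply: ang_bound => // t; rewrite !cabsM !cabsX u1 expr1n mulr1 cabsV.
have b10 : 0 < 1 - cabs b by rewrite subr_gt0.
rewrite mulrCA -!mulrA ler_pM ?cabs_ge0// ?mulr_ge0 ?exprn_ge0 ?invr_ge0 ?cabs_ge0//.
rewrite ler_wpM2l ?exprn_ge0 ?cabs_ge0// lef_pV2 ?posrE ?cabs_gt0//.
by have := cabs_1B (b * u t); rewrite bu.
Qed.

End angular.

(** * Circular means and the Poisson kernel *)

Lemma is_derive_small (R : realType) (f : R -> R) (x df : R) : is_derive x 1 f df ->
  forall eps, 0 < eps -> exists2 delta, 0 < delta & forall h, `|h| < delta ->
    `|f (x + h) - f x - df * h| <= eps * `|h|.
Proof.
move=> hf eps eps0.
have cv : h^-1 *: ((f \o shift x) (h *: 1) - f x) @[h --> 0^'] --> df.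
  have := @ex_derive _ _ _ _ _ _ _ hf.
  by move=> dfx; rewrite -[X in _ --> X](@derive_val _ _ _ _ _ _ _ hf); exact: dfx.
have /cvgrPdist_lt/(_ _ eps0) := cv.
move=> [delta /= delta0 H]; exists delta => // h hdelta.
have [->|h0] := eqVneq h 0; first by rewrite addr0 subrr mulr0 subr0 normr0 mulr0.
have := H h; rewrite /ball_/= sub0r normrN => /(_ hdelta h0) {}H.
rewrite (_ : _ - _ = - ((df - h^-1 * (f (h * 1 + x) - f x)) * h)); last first.
  by rewrite mulr1 [h + x]addrC; field.
by rewrite normrN normrM ler_wpM2r// ltW.
Qed.

Section circle_mean.
Context {R : realType}.
Local Notation mu := (@lebesgue_measure R).
Implicit Types (f h : R[i] -> R[i]).

(** Differentiability of [exp (s + i t)] at 0 in the two real variables. *)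
Lemma cexp_small eps : 0 < eps -> exists2 delta : R, 0 < delta & forall s t,
  `|s| < delta -> `|t| < delta ->
  cabs ((expR s)%:C%C * cis t - 1 - (s +i* t)%C) <= eps * (`|s| + `|t|).
Proof.
move=> eps0; pose e := Num.min 1 (eps / 8).
have e0 : 0 < e by rewrite lt_min ltr01 divr_gt0.
have e1 : e <= 1 by rewrite ge_min lexx.
have e8 : e <= eps / 8 by rewrite ge_min lexx orbT.
have [d1 d10 H1] := is_derive_small (is_derive_expR 0) e0.
have [d2 d20 H2] := is_derive_small (is_derive_cos 0) e0.
have [d3 d30 H3] := is_derive_small (is_derive_sin 0) e0.
exists (Num.min (Num.min d1 d2) (Num.min d3 (e / 2))).
  by rewrite !lt_min d10 d20 d30 divr_gt0.
move=> s t; rewrite !lt_min => /andP[/andP[s1 _] /andP[_ s4]].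
move=> /andP[/andP[_ t2] /andP[t3 _]].
have := H1 _ s1; have := H2 _ t2; have := H3 _ t3.
rewrite !add0r cos0 sin0 expR0 oppr0 mul0r !subr0 !mul1r ?addr0 => h3 h2 h1.
have hs : `|expR s - 1| <= 2 * `|s|.
  rewrite -[_ - 1](subrK s) (le_trans (ler_normD _ _))//.
  have := ler_wpM2r (normr_ge0 s) e1; move: h1; lra.
have ex2 : `|expR s| <= 2.
  by rewrite -[expR s](subrK 1) (le_trans (ler_normD _ _))// normr1; lra.
apply: (le_trans (cabs_le_ReIm _)).
have -> : complex.Re ((expR s)%:C%C * cis t - 1 - (s +i* t)%C) =
    (expR s - 1 - s) + expR s * (cos t - 1).
  by rewrite !cReB cReM/=; ring.
have -> : complex.Im ((expR s)%:C%C * cis t - 1 - (s +i* t)%C) =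
    expR s * (sin t - t) + (expR s - 1) * t.
  by rewrite !cImB cImM/=; ring.
have A1 := ler_normD (expR s - 1 - s) (expR s * (cos t - 1)).
have A2 := ler_normD (expR s * (sin t - t)) ((expR s - 1) * t).
have B1 : `|expR s * (cos t - 1)| <= 2 * (e * `|t|).
  by rewrite normrM ler_pM.
have B2 : `|expR s * (sin t - t)| <= 2 * (e * `|t|).
  by rewrite normrM ler_pM.
have B3 : `|(expR s - 1) * t| <= e * `|t|.
  by rewrite normrM ler_wpM2r//; lra.
have C1 := ler_wpM2r (normr_ge0 s) e8; have C2 := ler_wpM2r (normr_ge0 t) e8.
have s0 := normr_ge0 s; have t0 := normr_ge0 t.
have es0 := mulr_ge0 (ltW eps0) s0; have et0 := mulr_ge0 (ltW eps0) t0.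
by lra.
Qed.

Lemma cis_2pi (t : R) : cis (t + 2 * pi) = cis t.
Proof. by rewrite /cis mulr_natl cosD2pi sinD2pi. Qed.

Lemma circle_continuous (U : set R[i]) f r :
  (forall z, U z -> forall eps, 0 < eps -> exists2 delta, 0 < delta &
    forall w, cabs (w - z) < delta -> cabs (f w - f z) < eps) ->
  (forall t, U (r%:C%C * cis t)) -> ccont (fun t => f (r%:C%C * cis t)).
Proof.
move=> cf Ur.
have H t eps : 0 < eps -> \forall s \near t, cabs (f (r%:C%C * cis s) - f (r%:C%C * cis t)) < eps.
  move=> eps0; have [delta delta0 hd] := cf _ (Ur t) _ eps0.
  have r1 : 0 < `|r| + 1 by rewrite ltr_wpDl.
  have e2 : 0 < delta / (2 * (`|r| + 1)) by rewrite divr_gt0// mulr_gt0.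
  have /cvgrPdist_lt/(_ _ e2) c1 := @continuous_cos R t.
  have /cvgrPdist_lt/(_ _ e2) c2 := @continuous_sin R t.
  near=> s; apply: hd; rewrite -mulrBr cabsM cabs_real.
  apply: (@le_lt_trans _ _ (`|r| * (`|cos s - cos t| + `|sin s - sin t|))).
    by rewrite ler_wpM2l// (le_trans (cabs_le_ReIm _))//.
  have k1 : `|cos s - cos t| < delta / (2 * (`|r| + 1)).
    by rewrite distrC; near: s.
  have k2 : `|sin s - sin t| < delta / (2 * (`|r| + 1)).
    by rewrite distrC; near: s.
  apply: (@le_lt_trans _ _ (`|r| * (delta / (`|r| + 1)))).
    rewrite ler_wpM2l//; rewrite (_ : delta / (`|r| + 1) =
      delta / (2 * (`|r| + 1)) + delta / (2 * (`|r| + 1))); last first.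
      by field; rewrite gt_eqF.
    by rewrite lerD// ltW.
  by rewrite mulrCA gtr_pMr// ltr_pdivrMr// mul1r ltrDl.
move=> t; split; apply/cvgrPdist_lt => eps eps0; near=> s.
  rewrite -cReB (le_lt_trans (Re_le_cabs _))// cabs_distC.
  by near: s; exact: H.
rewrite -cImB (le_lt_trans (Im_le_cabs _))// cabs_distC.
by near: s; exact: H.
Unshelve. all: by end_near. Qed.

Let E s t : R[i] := (expR s)%:C%C * cis t.

Let cabsE' s t : cabs (E s t) = expR s.
Proof. by rewrite cabs_polar ger0_norm// expR_ge0. Qed.

(** Chain rule for [f (exp (s + i t))]: its differential is [d E (ds + i dt)]. Hence its real part
    and the opposite of its imaginary part satisfy the hypothesis of [green_rectangle]. *)
Lemma cderiv_polar f d x y : cderiv f (E x y) d -> forall eps, 0 < eps ->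
  exists2 delta : R, 0 < delta & forall s t, `|s - x| < delta -> `|t - y| < delta ->
    cabs (f (E s t) - f (E x y) - d * E x y * ((s - x) +i* (t - y))%C)
      <= eps * (`|s - x| + `|t - y|).
Proof.
move=> hf eps eps0; set z := E x y in hf *.
have z0 : 0 < cabs z by rewrite cabsE' expR_gt0.
pose e := eps / (2 * cabs z * (2 + cabs d)).
have d2 : 0 < 2 + cabs d by rewrite ltr_pwDl// cabs_ge0.
have e0 : 0 < e by rewrite divr_gt0// !mulr_gt0.
pose e' := Num.min e 1.
have e'0 : 0 < e' by rewrite lt_min e0 ltr01.
have [d1 d10 H1] := hf _ e0.
have [dd dd0 H2] := cexp_small e'0.
exists (Num.min dd (d1 / (4 * cabs z))).
  by rewrite lt_min dd0 divr_gt0// mulr_gt0.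
move=> s t; rewrite !lt_min => /andP[s1 s2] /andP[t1 t2].
set u := s - x in s1 s2 *; set v := t - y in t1 t2 *.
have uv0 : 0 <= `|u| + `|v| by rewrite addr_ge0.
have EE : E s t = z * ((expR u)%:C%C * cis v).
  rewrite /E /z /E mulrACA -rmorphM -expRD -cisD /u /v.
  by rewrite ![_ + (_ - _)]addrC !subrK.
pose w := (expR u)%:C%C * cis v - 1.
have wE : cabs (w - (u +i* v)%C) <= e' * (`|u| + `|v|) by exact: H2.
have e'1 : e' <= 1 by rewrite ge_min lexx orbT.
have e'e : e' <= e by rewrite ge_min lexx.
have uvc : cabs (u +i* v)%C <= `|u| + `|v| by exact: cabs_le_ReIm.
have wb : cabs w <= 2 * (`|u| + `|v|).
  rewrite -[w](subrK (u +i* v)%C) (le_trans (ler_cabsD _ _))//.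
  rewrite (_ : 2 * _ = 1 * (`|u| + `|v|) + (`|u| + `|v|)); last by ring.
  by rewrite lerD// (le_trans wE)// ler_wpM2r.
have hz : cabs (z * w) < d1.
  rewrite cabsM mulrC -ltr_pdivlMr// (le_lt_trans wb)//.
  rewrite (_ : d1 / cabs z = 2 * (d1 / (4 * cabs z) + d1 / (4 * cabs z))); last first.
    by field; rewrite gt_eqF.
  by rewrite ltr_pM2l// ltrD.
have -> : f (E s t) - f z - d * z * (u +i* v)%C =
    (f (z + z * w) - f z - d * (z * w)) + d * z * (w - (u +i* v)%C).
  have -> : E s t = z + z * w by rewrite EE /w; ring.
  by ring.
rewrite (le_trans (ler_cabsD _ _))//.
apply: (@le_trans _ _ (e * (cabs z * (2 * (`|u| + `|v|))) + cabs d * cabs z * (e * (`|u| + `|v|)))).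
  rewrite lerD//.
    by rewrite (le_trans (H1 _ hz))// cabsM !ler_wpM2l// ?ltW.
  by rewrite !cabsM ler_wpM2l ?mulr_ge0 ?cabs_ge0// (le_trans wE)// ler_wpM2r.
rewrite (_ : _ + _ = e * (cabs z * (2 + cabs d)) * (`|u| + `|v|)); last by ring.
rewrite ler_wpM2r// /e (_ : _ * _ = eps / 2); last by field; rewrite !gt_eqF.
by rewrite ler_pdivrMr// ler_pMr// ler1n.
Qed.

Let c0 : R := - (pi / 2).
Let d0 : R := 3 * (pi / 2).

Let E_periodic s : E s d0 = E s c0.
Proof.
rewrite /E; congr (_ * _); rewrite -[in RHS]cis_2pi; congr cis.
by rewrite /c0 /d0; field.
Qed.

(** Green's formula for [Re (f (exp w) dw)], that is [P = Re f] and [Q = - Im f], on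
    [[ln r1, ln r2]] times one period. The two sides of constant angle cancel by periodicity; the
    sides of constant radius give the two integrals. *)
Let circle_im_const f r1 r2 : holomorphic_on (@pdisc R) f -> 0 < r1 -> r1 <= r2 -> r2 < 1 ->
  (\int[mu]_(t in polar_range) complex.Im (f (r1%:C%C * cis t)) =
   \int[mu]_(t in polar_range) complex.Im (f (r2%:C%C * cis t)))%R.
Proof.
move=> hf r10 r12 r21; have r20 : 0 < r2 by exact: lt_le_trans r12.
pose a0 := ln r1; pose b0 := ln r2.
have ab0 : a0 <= b0 by rewrite ler_ln.
have pi0 := @pi_gt0 R.
have cd0 : c0 <= d0 by rewrite /c0 /d0; lra.
have Ein s t : s <= b0 -> @pdisc R (E s t).
  move=> sb; rewrite /pdisc/= cabsE' expR_gt0/= (le_lt_trans _ r21)//.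
  by rewrite -(lnK r20) ler_expR.
have hloc x y : a0 <= x <= b0 -> exists2 d, cderiv f (E x y) d & True.
  move=> /andP[_ xb]; have [d hd] := (holomorphicP _ _).1 hf _ (Ein x y xb).
  by exists d.
have cE x y : a0 <= x <= b0 -> forall eps, 0 < eps ->
    exists2 delta : R, 0 < delta & forall s t, `|s - x| < delta -> `|t - y| < delta ->
    cabs (f (E s t) - f (E x y)) < eps.
  move=> xab eps eps0; have [d hd _] := hloc x y xab.
  have [delta delta0 H] := cderiv_polar hd ltr01.
  pose K := 1 + cabs (d * E x y).
  have K0 : 0 < K by rewrite ltr_pwDl// cabs_ge0.
  exists (Num.min delta (eps / (2 * K))); first by rewrite lt_min delta0 divr_gt0// mulr_gt0.
  move=> s t; rewrite !lt_min => /andP[s1 s2] /andP[t1 t2].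
  rewrite -[f _ - _](subrK (d * E x y * ((s - x) +i* (t - y))%C)).
  rewrite (le_lt_trans (ler_cabsD _ _))//.
  apply: (@le_lt_trans _ _ (K * (`|s - x| + `|t - y|))).
    rewrite mulrDl lerD ?H// cabsM ler_wpM2l ?cabs_ge0//; exact: cabs_le_ReIm.
  rewrite (_ : eps = K * (eps / (2 * K) + eps / (2 * K))); last by field; rewrite gt_eqF.
  by rewrite ltr_pM2l// ltrD.
have := @green_rectangle R (fun s t => complex.Re (f (E s t)))
  (fun s t => - complex.Im (f (E s t))) a0 b0 c0 d0 ab0 cd0.
have -> : (\int[mu]_(s in `]a0, b0]) (complex.Re (f (E s c0)) - complex.Re (f (E s d0))) = 0)%R.
  under eq_Rintegral do rewrite E_periodic subrr.
  by rewrite /Rintegral integral0.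
rewrite add0r -/(polar_range) => H.
have cont s : a0 <= s <= b0 -> ccont (fun t => f (E s t)).
  move=> /andP[_ sb].
  apply: (@circle_continuous (@pdisc R)) => //.
    by move=> z; exact: holomorphic_continuous hf.
  by move=> t; exact: Ein.
have [ia ib] : a0 <= a0 <= b0 /\ a0 <= b0 <= b0 by rewrite lexx ab0 lexx.
have [_ iIa] := ccont_cintegrable (cont _ ia).
have [_ iIb] := ccont_cintegrable (cont _ ib).
have : (\int[mu]_(t in polar_range) (- complex.Im (f (E b0 t)) - - complex.Im (f (E a0 t))) = 0)%R.
  apply: H.
  - move=> s t sab; apply/cvgrPdist_lt => eps eps0.
    have [delta delta0 H] := cE s t sab _ eps0; near=> s'.
    rewrite -cReB (le_lt_trans (Re_le_cabs _))// cabs_distC.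
    apply: H; last by rewrite subrr normr0.
    by near: s'; exists delta => // y /=; rewrite distrC.
  - move=> s t sab; apply: cvgN; exact: (cont s sab t).2.
  - move=> x y xab; have [d hd _] := hloc x y xab; set z := E x y in hd.
    exists (- complex.Im (d * z)) => eps eps0.
    have e20 : 0 < eps / 2 by rewrite divr_gt0.
    have [delta delta0 H] := cderiv_polar hd e20.
    exists delta => // s s' t t' _ _ s1 s'1 t1 t'1.
    pose e s t := f (E s t) - f z - d * z * ((s - x) +i* (t - y))%C.
    have A1 : `|complex.Re (e s t) - complex.Re (e s t')| <=
        eps / 2 * (`|s - x| + `|t - y|) + eps / 2 * (`|s - x| + `|t' - y|).
      rewrite (le_trans (ler_normB _ _))// lerD// (le_trans (Re_le_cabs _))//; exact: H.
    have A2 : `|complex.Im (e s t) - complex.Im (e s' t)| <=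
        eps / 2 * (`|s - x| + `|t - y|) + eps / 2 * (`|s' - x| + `|t - y|).
      rewrite (le_trans (ler_normB _ _))// lerD// (le_trans (Im_le_cabs _))//; exact: H.
    have t0 := mulr_ge0 (ltW eps0) (normr_ge0 (t - y)).
    have t'0 := mulr_ge0 (ltW eps0) (normr_ge0 (t' - y)).
    have s0 := mulr_ge0 (ltW eps0) (normr_ge0 (s - x)).
    have s'0 := mulr_ge0 (ltW eps0) (normr_ge0 (s' - x)).
    split.
      rewrite (_ : _ - _ - _ = complex.Re (e s t) - complex.Re (e s t')); first by lra.
      by rewrite /e !cReB ![complex.Re (d * z * _)]cReM /=; ring.
    rewrite (_ : _ - _ - _ = - (complex.Im (e s t) - complex.Im (e s' t))).
      by rewrite normrN; lra.
    by rewrite /e !cImB ![complex.Im (d * z * _)]cImM /=; ring.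
have EE r t : 0 < r -> r%:C%C * cis t = E (ln r) t by move=> r0; rewrite /E lnK.
have NE : (\int[mu]_(t in polar_range) (- complex.Im (f (E b0 t)) - - complex.Im (f (E a0 t))) =
   \int[mu]_(t in polar_range) complex.Im (f (E a0 t)) - \int[mu]_(t in polar_range) complex.Im (f (E b0 t)))%R.
  rewrite -RintegralB//; last exact: measurable_polar_range.
  by apply: eq_Rintegral => t _; rewrite opprK addrC.
rewrite NE => /eqP; rewrite subr_eq0 => /eqP.
under eq_Rintegral do rewrite /a0 -EE//.
by under [in RHS]eq_Rintegral do rewrite /b0 -EE//.
Unshelve. all: by end_near. Qed.

Definition circ f (r : R) := ang (fun t => f (r%:C%C * cis t)).

Lemma pdisc_polar r t : 0 < r < 1 -> @pdisc R (r%:C%C * cis t).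
Proof. by move=> /andP[r0 r1]; rewrite /pdisc/= cabs_polar gtr0_norm// r0. Qed.

Lemma holomorphic_ccont f r : holomorphic_on (@pdisc R) f -> 0 < r < 1 ->
  ccont (fun t => f (r%:C%C * cis t)).
Proof.
move=> hf r01; apply: (@circle_continuous (@pdisc R)) => [z|t]; last exact: pdisc_polar.
exact: holomorphic_continuous hf.
Qed.

Lemma circ_const f (r1 r2 : R) : holomorphic_on (@pdisc R) f -> 0 < r1 < 1 -> 0 < r2 < 1 ->
  circ f r1 = circ f r2.
Proof.
move=> hf r1I r2I; wlog r12 : r1 r2 r1I r2I / r1 <= r2.
  by move=> H; have [?|/ltW ?] := leP r1 r2; [|apply/esym]; exact: H.
have [/andP[r10 r11] /andP[r20 r21]] := (r1I, r2I).
(* Applied to [i f], the statement on imaginary parts yields the one on real parts. *)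
have hif : holomorphic_on (@pdisc R) (fun z => 'i%C * f z).
  by apply: holomorphicM => //; exact: holomorphic_cst.
have := circle_im_const hif r10 r12 r21.
have := circle_im_const hf r10 r12 r21.
have iE r : (\int[mu]_(t in polar_range) complex.Im ('i%C * f (r%:C%C * cis t)) =
  \int[mu]_(t in polar_range) complex.Re (f (r%:C%C * cis t)))%R.
  by apply: eq_Rintegral => t _; rewrite cImM/= mul0r add0r mul1r.
by rewrite !iE => h1 h2; apply: complex_eq.
Qed.

End circle_mean.

(** * Orthogonality on the circle and the Poisson kernel *)

Section laurent.
Context {R : realType}.
Local Notation mu := (@lebesgue_measure R).
Implicit Types (f h : R[i] -> R[i]).

(** The circle integral of [z^n] does not depend on the radius and is proportional to its [n]-th
    power; comparing the radii 1/2 and 1/4 leaves only 0. *)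
Lemma ang_cisX n : (0 < n)%N -> ang (fun t => cis t ^+ n) = 0 :> R[i].
Proof.
move=> n0.
have h : holomorphic_on (@pdisc R) (fun z => z ^+ n) by apply: holomorphicX; exact: holomorphic_id.
have e1 : (0 < 2^-1 :> R) && (2^-1 < 1 :> R) by apply/andP; split; lra.
have e2 : (0 < 4^-1 :> R) && (4^-1 < 1 :> R) by apply/andP; split; lra.
have := circ_const h e1 e2; rewrite /circ.
have rE (r : R) : ang (fun t => (r%:C%C * cis t) ^+ n) = (r ^+ n)%:C%C * ang (fun t => cis t ^+ n).
  rewrite -angZ; last by apply: ccontX; exact: ccont_cis.
  by congr ang; apply/funext => t; rewrite exprMn rmorphXn.
rewrite !rE => /eqP; rewrite -subr_eq0 -mulrBl mulf_eq0 => /orP[|/eqP//].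
rewrite -rmorphB/= -[0]/((0 : R)%:C%C) (inj_eq (@complexI R)) subr_eq0.
rewrite eqrXn2 ?invr_ge0 ?ler0n// => /eqP h24.
by have : (2^-1 : R) <> 4^-1 by lra.
Qed.

Lemma ang_conj (phi : R -> R[i]) : ccont phi -> ang (fun t => ((phi t)^*)%C) = ((ang phi)^*)%C.
Proof.
by move=> cp; apply: cI_conj; [exact: measurable_polar_range|exact: ccont_cintegrable].
Qed.

Lemma ang_cisVX n : (0 < n)%N -> ang (fun t => cis t ^- n) = 0 :> R[i].
Proof.
move=> n0; under eq_fun do rewrite -exprVn -conj_cis -rmorphXn.
by rewrite ang_conj ?ang_cisX// ?rmorph0//; apply: ccontX; exact: ccont_cis.
Qed.

Lemma ang_geometric_eq (phi u : R -> R[i]) (b : R[i]) B : ccont phi -> ccont u ->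
  (forall t, cabs (u t) = 1) -> (forall t, cabs (phi t) <= B) -> cabs b < 1 ->
  (forall k, (0 < k)%N -> ang (fun t => phi t * u t ^+ k) = 0) ->
  ang (fun t => phi t / (1 - b * u t)) = ang phi.
Proof.
move=> cp cu u1 pB b1 H; apply/eqP; rewrite -subr_eq0 -cabs_eq0 eq_le cabs_ge0 andbT.
apply: (@geometric_le0 _ _ (B * (2 * pi) / (1 - cabs b) * cabs b) (cabs b)).
  by rewrite cabs_ge0.
move=> N; have := ang_geometric N.+1 cp cu u1 pB b1.
rewrite big_ord_recl/= expr0 mul1r big1 ?addr0; last first.
  by move=> i _; rewrite H ?mulr0.
rewrite (_ : (fun t => phi t * u t ^+ 0) = phi); last first.
  by apply/funext => t; rewrite expr0 mulr1.
by rewrite exprS mulrA.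
Qed.

(** The Poisson kernel of the unit circle at [b], written as the sum of its two geometric series so
    that [ang_geometric] applies to each; [poissonE] gives the positive closed form. *)
Definition poisson (b : R[i]) t : R[i] :=
  (1 - b / cis t)^-1 + (1 - (b^*)%C * cis t)^-1 - 1.

Lemma poissonE b t : cabs b < 1 ->
  poisson b t = ((1 - cabs b ^+ 2) / cabs (1 - (b^*)%C * cis t) ^+ 2)%:C%C.
Proof.
move=> b1; have c0 := cis_neq0 t.
have h1 : 1 - (b^*)%C * cis t != 0.
  by rewrite subr_eq0 eq_sym cabs_lt1_neq1// cabsM cabs_cis cabs_conj mulr1.
have h2 : 1 - b / cis t != 0.
  by rewrite subr_eq0 eq_sym cabs_lt1_neq1// cabs_div cabs_cis divr1.
rewrite (_ : _%:C%C = (1 - (cabs b ^+ 2)%:C%C) / (cabs (1 - (b^*)%C * cis t) ^+ 2)%:C%C); last first.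
  by rewrite rmorphM fmorphV rmorphB rmorph1.
have DC : ((1 - (b^*)%C * cis t)^*)%C = 1 - b / cis t.
  by rewrite -conj_cis rmorphB rmorph1 rmorphM; congr (1 - _ * _); exact: conjcK.
rewrite -!mul_conj /poisson DC; move: (cis t) c0 h1 h2 => c c0 h1 h2.
have h3 : c - b != 0.
  by rewrite (_ : c - b = c * (1 - b / c)) ?mulf_neq0//; field.
by field; rewrite h1 h3 c0.
Qed.

Lemma ccont_poisson b : cabs b < 1 -> ccont (poisson b).
Proof.
move=> b1; apply: ccontD; last exact: ccont_cst.
have N z : cabs z < 1 -> 1 - z != 0.
  by move=> z1; rewrite subr_eq0 eq_sym cabs_lt1_neq1.
have S (f g : R -> R[i]) : ccont f -> ccont (fun t => 1 - f t).
  move=> cf; under eq_fun do rewrite -mulN1r.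
  by apply: ccontD; [exact: ccont_cst|apply: ccontM => //; exact: ccont_cst].
apply: ccontD; apply: ccontV.
- by move=> t; apply: N; rewrite cabs_div cabs_cis divr1.
- apply: S => //; apply: ccontM; first exact: ccont_cst.
  by apply: ccontV; [exact: cis_neq0|exact: ccont_cis].
- by move=> t; apply: N; rewrite cabsM cabs_cis cabs_conj mulr1.
- by apply: S => //; apply: ccontM; [exact: ccont_cst|exact: ccont_cis].
Qed.

Lemma ccont_cisV : ccont (fun t : R => (cis t)^-1).
Proof. by apply: ccontV; [exact: cis_neq0|exact: ccont_cis]. Qed.

(** The hypothesis on [phi] says that its Fourier coefficients of negative index vanish. The series
    in [cis t] then contributes [ang phi] only, which the term [- 1] of the kernel cancels: the
    Poisson integral is the Cauchy integral. *)
Lemma ang_poisson_mul (b : R[i]) (phi : R -> R[i]) B : cabs b < 1 -> ccont phi ->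
  (forall t, cabs (phi t) <= B) ->
  (forall k, (0 < k)%N -> ang (fun t => phi t * cis t ^+ k) = 0) ->
  ang (fun t => phi t * poisson b t) = ang (fun t => phi t / (1 - b * (cis t)^-1)).
Proof.
move=> b1 cp pB H.
have N z : cabs z < 1 -> 1 - z != 0.
  by move=> z1; rewrite subr_eq0 eq_sym cabs_lt1_neq1.
have S (f g : R -> R[i]) : ccont f -> ccont (fun t => 1 - f t).
  move=> cf; under eq_fun do rewrite -mulN1r.
  by apply: ccontD; [exact: ccont_cst|apply: ccontM => //; exact: ccont_cst].
have c1 : ccont (fun t => phi t * (1 - b * (cis t)^-1)^-1).
  apply: ccontM => //; apply: ccontV.
    by move=> t; apply: N; rewrite cabs_div cabs_cis divr1.
  by apply: S => //; apply: ccontM; [exact: ccont_cst|exact: ccont_cisV].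
have c2 : ccont (fun t => phi t * (1 - (b^*)%C * cis t)^-1).
  apply: ccontM => //; apply: ccontV.
    by move=> t; apply: N; rewrite cabsM cabs_cis cabs_conj mulr1.
  by apply: S => //; apply: ccontM; [exact: ccont_cst|exact: ccont_cis].
rewrite (_ : (fun t => phi t * poisson b t) = (fun t => phi t * (1 - b * (cis t)^-1)^-1 +
   (phi t * (1 - (b^*)%C * cis t)^-1 + (- 1) * phi t))); last first.
  by apply/funext => t; rewrite /poisson; ring.
have c3 : ccont (fun t => (-1) * phi t) by apply: ccontM => //; exact: ccont_cst.
rewrite angD//; last exact: ccontD.
rewrite angD// angZ// (@ang_geometric_eq phi (@cis R) ((b^*)%C) B) ?cabs_conj//.
- by rewrite mulN1r subrr addr0.
- exact: ccont_cis.
- exact: cabs_cis.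
Qed.

Lemma ang_poisson b : cabs b < 1 -> ang (poisson b) = (2 * pi)%:C%C.
Proof.
move=> b1; rewrite (_ : poisson b = fun t => 1 * poisson b t); last first.
  by apply/funext => t; rewrite mul1r.
rewrite (@ang_poisson_mul b (fun=> 1) 1)//.
- rewrite (@ang_geometric_eq (fun=> 1) (fun t => (cis t)^-1) b 1) ?ang_cst ?mul1r//.
  + exact: ccont_cst.
  + exact: ccont_cisV.
  + by move=> t; rewrite cabsV cabs_cis invr1.
  + by move=> t; rewrite cabs1.
  + by move=> k k0; under eq_fun do rewrite mul1r exprVn; exact: ang_cisVX.
- exact: ccont_cst.
- by move=> t; rewrite cabs1.
- by move=> k k0; under eq_fun do rewrite mul1r; exact: ang_cisX.
Qed.

(** The integrand is a Poisson kernel divided by [1 - |b|^2], and the Poisson kernel has total mass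
    [2 pi]. *)
Lemma integral_poisson (b : R[i]) : cabs b < 1 ->
  (\int[mu]_(t in polar_range) ((cabs (1 - b * cis t) ^+ 2)^-1)%:E =
   (2 * pi / (1 - cabs b ^+ 2))%:E)%E.
Proof.
move=> b1; have b2 : 1 - cabs b ^+ 2 != 0.
  by rewrite subr_eq0 eq_sym lt_eqF// expr_lt1// cabs_ge0.
have b1' : cabs (b^*)%C < 1 by rewrite cabs_conj.
have E1 t : complex.Re (poisson (b^*)%C t) / (1 - cabs b ^+ 2) = (cabs (1 - b * cis t) ^+ 2)^-1.
  by rewrite poissonE//= conjcK cabs_conj mulrC mulKf.
have [iP _] := ccont_cintegrable (ccont_poisson b1').
have := ang_poisson b1' => /(congr1 (@complex.Re R))/= IE.
rewrite (_ : (2 * pi / _)%R = (1 - cabs b ^+ 2)^-1 *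
   Rintegral mu polar_range (fun t => complex.Re (poisson (b^*)%C t))); last by rewrite IE mulrC.
rewrite EFinM fineK; last first.
  by apply: (integrable_fin_num _ iP); exact: measurable_polar_range.
rewrite -integralZl//; last exact: measurable_polar_range.
by apply: eq_integral => t _; rewrite -EFinM -E1 mulrC.
Qed.

End laurent.

(** * Taylor expansion *)

Section taylor.
Context {R : realType}.
Local Notation mu := (@lebesgue_measure R).
Implicit Types (f h : R[i] -> R[i]).

Lemma continuous_toC (g : R[i] -> R) (xy : R * R) :
  (forall eps, 0 < eps -> exists2 delta, 0 < delta &
     forall w, cabs (w - toC xy) < delta -> `|g w - g (toC xy)| < eps) ->
  {for xy, continuous (g \o @toC R)}.
Proof.
move=> H; apply/cvgrPdist_lt => eps eps0; have [delta delta0 hd] := H _ eps0.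
near=> w; rewrite distrC; apply: hd; apply: (le_lt_trans (cabs_le_ReIm _)).
rewrite cReB cImB/= (splitr delta) ltrD//.
  near: w; apply: (@cvgr_distC_lt _ _ _ _ _ fst xy.1) => //; last by rewrite divr_gt0.
  exact: cvg_fst.
near: w; apply: (@cvgr_distC_lt _ _ _ _ _ snd xy.2) => //; last by rewrite divr_gt0.
exact: cvg_snd.
Unshelve. all: by end_near. Qed.

Lemma annulus_bounded f (r1 r2 : R) : holomorphic_on (@pdisc R) f -> 0 < r1 -> r2 < 1 ->
  exists2 B, 0 < B & forall z, r1 <= cabs z <= r2 -> cabs (f z) <= B.
Proof.
move=> hf r10 r21; pose A := [set xy : R * R | r1 <= cabs (toC xy) <= r2].
have cc : continuous (@cabs R \o @toC R).
  move=> xy; apply: continuous_toC => eps eps0; exists eps => // w.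
  apply: le_lt_trans; rewrite ler_norml ler_cabs_sub andbT.
  by rewrite lerNl opprB cabs_distC ler_cabs_sub.
have cA : compact A.
  apply: (@subclosed_compact _ A (`[-1, 1]%classic `*` `[-1, 1]%classic)).
  - rewrite (_ : A = (@cabs R \o @toC R) @^-1` `[r1, r2]); last first.
      by apply/seteqP; split => x /=; rewrite in_itv.
    by apply: closed_comp => //; exact: interval_closed.
  - by apply: compact_setX; exact: segment_compact.
  - move=> xy /= /andP[_ xr2]; rewrite !in_itv/= -!ler_norml; split.
      by rewrite (le_trans (Re_le_cabs (toC xy)))// (le_trans xr2)// ltW.
    by rewrite (le_trans (Im_le_cabs (toC xy)))// (le_trans xr2)// ltW.
have cf : {within A, continuous ((fun z => cabs (f z)) \o @toC R)}.
  apply: continuous_in_subspaceT => xy /set_mem/= /andP[A1 A2].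
  apply: (@continuous_toC (fun z => cabs (f z))) => eps eps0.
  have xyp : @pdisc R (toC xy) by apply/andP; split; [exact: lt_le_trans A1|exact: le_lt_trans r21].
  have [delta delta0 hd] := holomorphic_continuous hf xyp eps0.
  exists delta => // w /hd; apply: le_lt_trans; rewrite ler_norml ler_cabs_sub andbT.
  by rewrite lerNl opprB cabs_distC ler_cabs_sub.
have [M [_ HM]] := compact_bounded (continuous_compact cf cA).
exists (`|M| + 1) => [|z zr]; first by rewrite ltr_wpDl.
have := HM (`|M| + 1); rewrite (le_lt_trans (ler_norm M)) ?ltrDl// => /(_ erefl).
move=> /(_ (cabs (f z))); rewrite /globally/= ger0_norm ?cabs_ge0//; apply.
exists (complex.Re z, complex.Im z); last by rewrite /= /toC/=; case: z zr.
by rewrite /A/toC/=; case: z zr.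
Qed.

(** The Laurent coefficient of index [n], read on the circle of radius 1/2; by [circ_const] every
    radius below 1 gives the same value. *)
Definition tcoef f n : R[i] := circ (fun z => f z * z ^- n) 2^-1 / (2 * pi)%:C%C.

(** All Laurent coefficients of negative index vanish: the circle integral for [j] is [2 pi] times
    the coefficient of index [-(j + 1)]. *)
Definition pole_free f := forall j : nat, circ (fun z => f z * z ^+ j.+1) 2^-1 = 0.

Let half01 : (0 < 2^-1 :> R) && (2^-1 < 1 :> R).
Proof. by apply/andP; split; lra. Qed.

Let pdisc_neq0 z : @pdisc R z -> z != 0.
Proof. by move=> /andP[z0 _]; rewrite -cabs_gt0. Qed.

Let h_VX f n : holomorphic_on (@pdisc R) f -> holomorphic_on (@pdisc R) (fun z => f z * z ^- n).
Proof. by move=> hf; apply: holomorphicM => //; exact: holomorphicVX. Qed.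

Let h_X f n : holomorphic_on (@pdisc R) f -> holomorphic_on (@pdisc R) (fun z => f z * z ^+ n).
Proof.
by move=> hf; apply: holomorphicM => //; apply: holomorphicX; exact: holomorphic_id.
Qed.

Lemma circ_VX f n (r : R) : holomorphic_on (@pdisc R) f -> 0 < r < 1 ->
  ang (fun t => f (r%:C%C * cis t) * cis t ^- n) = r%:C%C ^+ n * (2 * pi)%:C%C * tcoef f n.
Proof.
move=> hf r01; have [r0 _] := andP r01.
have rn0 : r%:C%C ^+ n != 0 :> R[i].
  by rewrite expf_neq0// -[0]/((0 : R)%:C%C) (inj_eq (@complexI R)) gt_eqF.
have p0 : (2 * pi)%:C%C != 0 :> R[i].
  by rewrite -[0]/((0 : R)%:C%C) (inj_eq (@complexI R)) mulf_neq0// gt_eqF// pi_gt0.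
rewrite /tcoef (circ_const (h_VX n hf) half01 r01) -mulrA mulrCA mulrC mulrA.
rewrite (divfK p0).
rewrite /circ -angZ; last exact: (holomorphic_ccont (h_VX n hf)).
congr ang; apply/funext => t.
by rewrite mulrCA exprMn invfM [_ * (_^-1 * _)]mulrA mulfV// mul1r.
Qed.

Lemma circ_X f n (r : R) : holomorphic_on (@pdisc R) f -> 0 < r < 1 -> pole_free f -> (0 < n)%N ->
  ang (fun t => f (r%:C%C * cis t) * cis t ^+ n) = 0.
Proof.
move=> hf r01 pf; case: n => // n _; have [r0 _] := andP r01.
have rn0 : (r ^+ n.+1)%:C%C != 0 :> R[i].
  by rewrite -[0]/((0 : R)%:C%C) (inj_eq (@complexI R)) expf_neq0// gt_eqF.
apply: (mulfI rn0); rewrite mulr0 -(pf n) (circ_const (h_X n.+1 hf) half01 r01) /circ -angZ.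
  by congr ang; apply/funext => t; rewrite exprMn -rmorphXn mulrCA.
apply: ccontM; first exact: holomorphic_ccont.
by apply: ccontX; exact: ccont_cis.
Qed.

(** [2 pi] times the Cauchy integral over the circle of radius [r], in the shape required by
    [ang_geometric]. *)
Let Cau f (r : R) z := ang (fun t => f (r%:C%C * cis t) / (1 - z / r%:C%C * (cis t)^-1)).

Lemma Cau_taylor f (r : R) z B N : holomorphic_on (@pdisc R) f -> 0 < r < 1 -> cabs z < r ->
  (forall t, cabs (f (r%:C%C * cis t)) <= B) ->
  cabs (Cau f r z / (2 * pi)%:C%C - \sum_(k < N) tcoef f k * z ^+ k) <=
  B / (1 - cabs z / r) * (cabs z / r) ^+ N.
Proof.
move=> hf r01 zr fB; have [r0 _] := andP r01.
have r0C : r%:C%C != 0 :> R[i].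
  by rewrite -[0]/((0 : R)%:C%C) (inj_eq (@complexI R)) gt_eqF.
have p0 : 0 < 2 * pi :> R by rewrite mulr_gt0// pi_gt0.
have p0C : (2 * pi)%:C%C != 0 :> R[i].
  by rewrite -[0]/((0 : R)%:C%C) (inj_eq (@complexI R)) gt_eqF.
have bE : cabs (z / r%:C%C) = cabs z / r by rewrite cabs_div cabs_real gtr0_norm.
have b1 : cabs (z / r%:C%C) < 1 by rewrite bE ltr_pdivrMr// mul1r.
have u1 t : cabs ((cis t)^-1) = 1 :> R by rewrite cabsV cabs_cis invr1.
have := ang_geometric N (holomorphic_ccont hf r01) (@ccont_cisV R) u1 fB b1.
rewrite -/(Cau f r z) bE => H.
have -> : Cau f r z / (2 * pi)%:C%C - \sum_(k < N) tcoef f k * z ^+ k =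
  (Cau f r z - \sum_(k < N) (z / r%:C%C) ^+ k * ang (fun t => f (r%:C%C * cis t) * (cis t)^-1 ^+ k)) /
  (2 * pi)%:C%C.
  rewrite mulrBl; congr (_ - _); rewrite mulr_suml; apply: eq_bigr => k _.
  under eq_fun do rewrite exprVn.
  rewrite circ_VX// expr_div_n; have := expf_neq0 k r0C.
  by move: (r%:C%C ^+ k) ((2 * pi)%:C%C) p0C => X P P0 X0; field; rewrite P0.
rewrite cabs_div cabs_real gtr0_norm// ler_pdivrMr// (le_trans H)//.
by rewrite le_eqVlt; apply/orP; left; apply/eqP; ring.
Qed.

Lemma Cau_poisson f (r : R) z B : holomorphic_on (@pdisc R) f -> pole_free f ->
  0 < r < 1 -> cabs z < r -> (forall t, cabs (f (r%:C%C * cis t)) <= B) ->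
  Cau f r z = ang (fun t => f (r%:C%C * cis t) * poisson (z / r%:C%C) t).
Proof.
move=> hf pf r01 zr fB; have [r0 _] := andP r01.
rewrite (@ang_poisson_mul _ _ _ B)//.
- by rewrite cabs_div cabs_real gtr0_norm// ltr_pdivrMr// mul1r.
- exact: holomorphic_ccont.
- by move=> k k0; exact: circ_X.
Qed.


(** Allows a modulus of continuity quadratic in the distance to be integrated against the Poisson
    kernel. *)
Lemma poisson_dist (r : R) z t : 0 < r -> cabs z < r ->
  cabs (poisson (z / r%:C%C) t) * cabs (r%:C%C * cis t - z) ^+ 2 = r ^+ 2 - cabs z ^+ 2.
Proof.
move=> r0 zr.
have r0C : r%:C%C != 0 :> R[i].
  by rewrite -[0]/((0 : R)%:C%C) (inj_eq (@complexI R)) gt_eqF.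
have bE : cabs (z / r%:C%C) = cabs z / r by rewrite cabs_div cabs_real gtr0_norm.
have b1 : cabs (z / r%:C%C) < 1 by rewrite bE ltr_pdivrMr// mul1r.
have -> : r%:C%C * cis t - z = r%:C%C * cis t * (1 - z / r%:C%C / cis t).
  by field; rewrite cis_neq0 r0C.
have -> : cabs (r%:C%C * cis t * (1 - z / r%:C%C / cis t)) =
    r * cabs (1 - ((z / r%:C%C)^*)%C * cis t).
  rewrite !cabsM cabs_real cabs_cis gtr0_norm// mulr1 -[in RHS]cabs_conj; congr (_ * cabs _).
  by rewrite -conj_cis rmorphB rmorph1 rmorphM; congr (1 - _ * _); apply/esym; exact: conjcK.
have n0 : 0 < cabs (1 - ((z / r%:C%C)^*)%C * cis t).
  by rewrite cabs_gt0 subr_eq0 eq_sym cabs_lt1_neq1// cabsM cabs_cis cabs_conj mulr1.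
rewrite poissonE// cabs_real ger0_norm ?bE.
  by field; rewrite !gt_eqF.
rewrite divr_ge0 ?sqr_ge0// subr_ge0 expr_le1// ?divr_ge0 ?cabs_ge0 ?(ltW r0)//.
by rewrite ler_pdivrMr// mul1r ltW.
Qed.

(** Without poles the Cauchy integral is a Poisson integral, and the Poisson kernel concentrates at
    [z] as the radius decreases to [|z|]. *)
Lemma Cau_near f z eps : holomorphic_on (@pdisc R) f -> pole_free f ->
  @pdisc R z -> 0 < eps -> exists2 r : R, cabs z < r < 1 &
  cabs (Cau f r z / (2 * pi)%:C%C - f z) <= eps.
Proof.
move=> hf pf zp eps0; have [s0 s1] := andP zp; set s := cabs z in s0 s1 *.
have r11 : (1 + s) / 2 < 1 by lra.
have [B B0 HB] := annulus_bounded hf s0 r11.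
have e20 : 0 < eps / 2 by rewrite divr_gt0.
have [delta delta0 hd] := holomorphic_continuous hf zp e20.
pose M := 2 * B / delta ^+ 2.
have M0 : 0 < M by rewrite divr_gt0 ?exprn_gt0// mulr_gt0.
have sann : s <= s <= (1 + s) / 2 by rewrite lexx/=; lra.
(* Near [z] continuity gives [eps / 2]; at distance at least [delta] the bound [2 B] is below
   [M |w - z|^2]. The square is what [poisson_dist] turns into [r^2 - |z|^2]. *)
have key w : s <= cabs w <= (1 + s) / 2 -> cabs (f w - f z) <= eps / 2 + M * cabs (w - z) ^+ 2.
  move=> wr; have [/hd/ltW H|dw] := ltP (cabs (w - z)) delta.
    by rewrite (le_trans H)// lerDl mulr_ge0 ?sqr_ge0// ltW.
  rewrite (le_trans (ler_cabsB _ _))// (le_trans (lerD (HB _ wr) (HB _ sann)))//.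
  rewrite -[leLHS]add0r lerD ?(ltW e20)// /M mulrAC ler_pdivlMr ?exprn_gt0//.
  rewrite (_ : B + B = 2 * B); last by ring.
  by rewrite ler_wpM2l// ?mulr_ge0 ?(ltW B0)// lerXn2r// ?nnegrE ?(ltW delta0) ?cabs_ge0.
(* The mass of the quadratic term is at most [M (r^2 - |z|^2) <= 2 M e <= eps / 2]. *)
pose e := Num.min ((1 - s) / 2) (eps / (4 * M)).
have e0 : 0 < e by rewrite lt_min !divr_gt0 ?subr_gt0// mulr_gt0.
have e1 : e <= (1 - s) / 2 by rewrite ge_min lexx.
have e2 : e <= eps / (4 * M) by rewrite ge_min lexx orbT.
pose r := s + e.
have sr : s < r by rewrite /r; lra.
have rr1 : r <= (1 + s) / 2 by rewrite /r; lra.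
have r1 : r < 1 by lra.
have r0 : 0 < r by lra.
have r01 : 0 < r < 1 by rewrite r0.
exists r; first by rewrite sr.
have p0 : 0 < 2 * pi :> R by rewrite mulr_gt0// pi_gt0.
have p0C : (2 * pi)%:C%C != 0 :> R[i].
  by rewrite -[0]/((0 : R)%:C%C) (inj_eq (@complexI R)) gt_eqF.
have annr t : s <= cabs (r%:C%C * cis t) <= (1 + s) / 2 by rewrite cabs_polar gtr0_norm// (ltW sr).
have b1 : cabs (z / r%:C%C) < 1 by rewrite cabs_div cabs_real gtr0_norm// ltr_pdivrMr// mul1r.
rewrite (@Cau_poisson f r z B)//; last by move=> t; exact: HB.
have cp := ccont_poisson b1; have cphi := holomorphic_ccont hf r01.
have -> : ang (fun t => f (r%:C%C * cis t) * poisson (z / r%:C%C) t) / (2 * pi)%:C%C - f z =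
    ang (fun t => (f (r%:C%C * cis t) - f z) * poisson (z / r%:C%C) t) / (2 * pi)%:C%C.
  have fzE : f z * (2 * pi)%:C%C = ang (fun t => f z * poisson (z / r%:C%C) t).
    by rewrite angZ// ang_poisson.
  rewrite -[X in _ - X](mulfK p0C) fzE -mulrBl -[- ang _]mulN1r -angZ; last first.
    by apply: ccontM => //; exact: ccont_cst.
  rewrite -angD; last 2 first.
  - exact: ccontM.
  - by apply: ccontM; [|apply: ccontM => //]; exact: ccont_cst.
  by congr (_ / _); congr ang; apply/funext => t; ring.
rewrite cabs_div cabs_real gtr0_norm// ler_pdivrMr//.
have cF : ccont (fun t => (f (r%:C%C * cis t) - f z) * poisson (z / r%:C%C) t).
  by apply: ccontM => //; apply: ccontD => //; exact: ccont_cst.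
have iF := ccont_cintegrable cF; have [iP _] := ccont_cintegrable cp.
have mP : measurable (@polar_range R : set (measurableTypeR R)) := @measurable_polar_range R.
rewrite (le_trans (cabs_cI _ iF))//.
have ReP t : cabs (poisson (z / r%:C%C) t) = complex.Re (poisson (z / r%:C%C) t).
  rewrite poissonE//= cabs_real ger0_norm// divr_ge0 ?sqr_ge0// subr_ge0 expr_le1//.
    exact: ltW.
  exact: cabs_ge0.
have i1 : mu.-integrable polar_range (EFin \o (fun t => eps / 2 * complex.Re (poisson (z / r%:C%C) t))).
  by apply: integrable_ext (integrableZl mP (eps / 2) iP) => t.
have i2 : mu.-integrable polar_range (EFin \o (fun t : R => M * (r ^+ 2 - s ^+ 2))).
  by have [] := ccont_cintegrable (ccont_cst (M * (r ^+ 2 - s ^+ 2))%:C%C).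
apply: (@le_trans _ _ (\int[mu]_(t in polar_range) (eps / 2 * complex.Re (poisson (z / r%:C%C) t) + M * (r ^+ 2 - s ^+ 2)))%R).
  apply: le_Rintegral => //.
  - exact: cintegrable_cabs.
  - by apply: integrable_ext (integrableD mP i1 i2) => t.
  - move=> t _; rewrite cabsM -(poisson_dist t r0 sr) -ReP.
    rewrite (le_trans (ler_wpM2r (cabs_ge0 _) (key _ (annr t))))//.
    by rewrite le_eqVlt; apply/orP; left; apply/eqP; ring.
rewrite RintegralD// RintegralZl//.
have -> : (\int[mu]_(x in polar_range) complex.Re (poisson (z / r%:C%C) x))%R = 2 * pi.
  by have /(congr1 (@complex.Re R))/= := ang_poisson b1.
rewrite Rintegral_cst//= polar_range_measure/= -mulrDl ler_wpM2r ?(ltW p0)//.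
have : r ^+ 2 - s ^+ 2 <= 2 * e.
  rewrite (_ : _ - _ = (2 * s + e) * e); last by rewrite /r; ring.
  by rewrite ler_wpM2r ?(ltW e0)//; lra.
move=> /(ler_wpM2l (ltW M0)); have := ler_wpM2l (ltW M0) e2.
rewrite (_ : M * (eps / (4 * M)) = eps / 4); last by field; rewrite gt_eqF.
by lra.
Qed.

(** Cauchy's formula: the Cauchy integrals over two circles outside [|z|] have the same Taylor
    polynomials with geometrically small remainders, hence the same value, and on circles close to
    [|z|] this value is [f z] up to [eps]. *)
Lemma taylor_remainder f r z B N : holomorphic_on (@pdisc R) f -> pole_free f -> 0 < r < 1 ->
  0 < cabs z < r -> (forall t, cabs (f (r%:C%C * cis t)) <= B) ->
  cabs (f z - \sum_(k < N) tcoef f k * z ^+ k) <= B / (1 - cabs z / r) * (cabs z / r) ^+ N.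
Proof.
move=> hf pf r01 /andP[z0 zr] fB; have [r0 r1] := andP r01.
suff -> : f z = Cau f r z / (2 * pi)%:C%C by exact: Cau_taylor.
apply/eqP; rewrite eq_sym -subr_eq0 -cabs_eq0 eq_le cabs_ge0 andbT.
apply/ler_addgt0Pl => eps eps0; rewrite addr0.
have [|r' /andP[zr' r'1] H] := @Cau_near f z _ hf pf _ eps0.
  by apply/andP; split => //; exact: lt_trans r1.
have r'0 : 0 < r' by exact: lt_trans zr'.
have r'01 : 0 < r' < 1 by rewrite r'0.
have [B' B'0 fB'] := annulus_bounded hf r'0 r'1.
have {}fB' t : cabs (f (r'%:C%C * cis t)) <= B'.
  by apply: fB'; rewrite cabs_polar gtr0_norm// lexx.
suff -> : Cau f r z / (2 * pi)%:C%C = Cau f r' z / (2 * pi)%:C%C by [].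
apply/eqP; rewrite -subr_eq0 -cabs_eq0 eq_le cabs_ge0 andbT.
have B0 : 0 <= B by rewrite (le_trans _ (fB 0))// cabs_ge0.
pose K := B / (1 - cabs z / r); pose K' := B' / (1 - cabs z / r').
have K0 : 0 <= K by rewrite divr_ge0// subr_ge0 ler_pdivrMr// mul1r ltW.
have K'0 : 0 <= K' by rewrite divr_ge0// ?(ltW B'0)// subr_ge0 ler_pdivrMr// mul1r ltW.
pose c := Num.max (cabs z / r) (cabs z / r').
apply: (@geometric_le0 _ _ (K + K') c).
  rewrite le_max divr_ge0 ?(ltW z0) ?(ltW r0)//= gt_max.
  by rewrite !ltr_pdivrMr// !mul1r zr.
move=> n; have H1 := Cau_taylor n hf r01 zr fB; have H2 := Cau_taylor n hf r'01 zr' fB'.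
rewrite -[X in cabs (X - _)](subrK (\sum_(k < n) tcoef f k * z ^+ k)) -addrA (le_trans (ler_cabsD _ _))// [leRHS]mulrDl lerD//.
  rewrite (le_trans H1)// ler_wpM2l// lerXn2r ?nnegrE ?le_max ?lexx//.
    by rewrite divr_ge0 ?(ltW z0) ?(ltW r0).
  by rewrite divr_ge0 ?(ltW z0) ?(ltW r0).
rewrite cabs_distC (le_trans H2)// ler_wpM2l// lerXn2r ?nnegrE ?le_max ?lexx ?orbT//.
  by rewrite divr_ge0 ?(ltW z0) ?(ltW r'0).
by rewrite divr_ge0 ?(ltW z0) ?(ltW r0).
Qed.

End taylor.

(** * Integration over the disc *)

Lemma powR_lt1 (R : realType) (x a : R) : 0 < a -> 0 <= x -> (x `^ a < 1) = (x < 1).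
Proof.
move=> a0 x0; have a1 : 1 `^ a = 1 :> R by rewrite powR1.
apply/idP/idP => [|x1].
  apply: contraTT; rewrite -!leNgt => x1; rewrite -[leLHS]a1.
  by rewrite ge0_ler_powR ?nnegrE// ltW.
by rewrite -[ltRHS]a1 gt0_ltr_powR ?nnegrE.
Qed.

Section polar_integrals.
Context {R : realType}.
Local Notation mu := (@lebesgue_measure R).
Implicit Types (U : set R[i]) (G : R * R -> \bar R).
Local Open Scope ereal_scope.

Definition angE G (r : R) : \bar R :=
  \int[mu]_(t in polar_range) G (r * cos t, r * sin t)%R.

Let mfst2 : measurable_fun [set: R * R] (fun z : R * R => z.1).
Proof. exact: measurable_fst. Qed.
Let msnd2 : measurable_fun [set: R * R] (fun z : R * R => z.2).
Proof. exact: measurable_snd. Qed.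

Let mcos : measurable_fun [set: R] (@cos R).
Proof. exact: measurable_cos. Qed.
Let msin : measurable_fun [set: R] (@sin R).
Proof. exact: measurable_sin. Qed.

Let mrt : measurable_fun [set: R * R] (fun z : R * R => (z.1 * cos z.2, z.1 * sin z.2)%R).
Proof.
apply: measurable_fun_pair.
  by apply: measurable_funM; [exact: mfst2|exact: (measurableT_comp mcos msnd2)].
by apply: measurable_funM; [exact: mfst2|exact: (measurableT_comp msin msnd2)].
Qed.

Lemma angE_ge0 G r : (forall x, 0 <= G x) -> 0 <= angE G r.
Proof. by move=> G0; exact: integral_ge0. Qed.

Lemma measurable_angE G : measurable_fun [set: R * R] G -> (forall x, 0 <= G x) ->
  measurable_fun [set: R] (angE G).
Proof.
move=> mG G0.
pose g (z : R * R) := G (z.1 * cos z.2, z.1 * sin z.2)%R * (\1_(@polar_range R) z.2)%:E.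
have mg : measurable_fun [set: R * R] g.
  apply: emeasurable_funM; first exact: (measurableT_comp mG mrt).
  apply/measurable_EFinP; apply: (measurableT_comp _ msnd2).
  by rewrite /polar_range; exact: measurable_indic.
rewrite (_ : angE G = fun r => \int[mu]_t g (r, t)).
  apply: (measurable_fun_fubini_tonelli_F (m2 := mu) g) => //.
  by move=> z; rewrite /g mule_ge0// lee_fin.
apply/funext => r; rewrite /angE integral_mkcond; apply: eq_integral => t _.
by rewrite patchE /g indicE/=; case: ifPn => _; rewrite ?mule1 ?mule0.
Qed.

Lemma ge0_polarE G : measurable_fun [set: R * R] G -> (forall x, 0 <= G x) ->
  \int[@dV R]_x G x = \int[mu]_(r in `]0%R, +oo[) (angE G r * r%:E).
Proof.
move=> mG G0; rewrite polarE//.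
pose g (z : R * R) := G (z.2 * cos z.1, z.2 * sin z.1)%R * z.2%:E.
have mg : measurable_fun (@polar_range R `*` (`]0%R, +oo[%classic : set R)) g.
  apply: (@measurable_funS _ _ _ _ [set: R * R]) => //.
  apply: emeasurable_funM; last by apply/measurable_EFinP; exact: msnd2.
  apply: (measurableT_comp mG); apply: measurable_fun_pair.
    by apply: measurable_funM; [exact: msnd2|exact: (measurableT_comp mcos mfst2)].
  by apply: measurable_funM; [exact: msnd2|exact: (measurableT_comp msin mfst2)].
have := ge0_tonelli_set mu mu (@measurable_polar_range R) (measurable_itv `]0%R, +oo[) mg.
rewrite /g/= => -> //; last first.
  by move=> x y _; rewrite in_itv/= andbT => y0; rewrite mule_ge0// lee_fin ltW.
apply: eq_integral => r; rewrite inE/= in_itv/= andbT => r0.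
rewrite /angE muleC -ge0_integralZl//; last 3 first.
- exact: measurable_polar_range.
- apply: (measurable_funS measurableT) => //.
  apply: (measurableT_comp mG); apply: measurable_fun_pair.
    by apply: measurable_funM; [exact: measurable_cst|exact: measurable_cos].
  by apply: measurable_funM; [exact: measurable_cst|exact: measurable_sin].
- by rewrite lee_fin ltW.
by apply: eq_integral => t _; rewrite muleC.
Qed.

Definition discs U := U = @disc R \/ U = @pdisc R.

Lemma copen_discs U : discs U -> copen U.
Proof. by move=> [->|->]; [exact: copen_disc|exact: copen_pdisc]. Qed.

Lemma pdisc_sub U : discs U -> @pdisc R `<=` U.
Proof. by move=> [->|-> //] z /andP[]. Qed.

Lemma measurable_discs U : discs U -> measurable (@toC R @^-1` U).
Proof. by move=> /copen_discs; exact: measurable_copen. Qed.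

Lemma discs_polar U r t : discs U -> (0 < r)%R -> U (toC (r * cos t, r * sin t)%R) <-> (r < 1)%R.
Proof.
move=> dU r0; rewrite toC_polar; case: dU => ->; rewrite /disc/pdisc/= cabs_polar gtr0_norm//.
by rewrite r0.
Qed.

Lemma angE_patch U G r : discs U -> (0 < r)%R ->
  angE (G \_ (@toC R @^-1` U)) r = if (r < 1)%R then angE G r else 0.
Proof.
move=> dU r0; case: ifPn => r1.
  apply: eq_integral => t _; rewrite patchE ifT// inE /=.
  exact/discs_polar.
apply: integral0_eq => t _; rewrite patchE ifF//; apply/negP; rewrite inE/=.
by move/(discs_polar _ dU r0); exact/negP.
Qed.

Lemma ge0_polar_discs U G : discs U -> measurable_fun (@toC R @^-1` U) G ->
  (forall x, U (toC x) -> 0 <= G x) ->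
  \int[@dV R]_(x in @toC R @^-1` U) G x = \int[mu]_(r in `]0%R, 1%R[) (angE G r * r%:E).
Proof.
move=> dU mG G0; have mU := measurable_discs dU.
rewrite integral_mkcond ge0_polarE; last 2 first.
- exact/(measurable_restrictT _ mU).
- by move=> x; rewrite patchE; case: ifPn => //; rewrite inE; exact: G0.
rewrite integral_mkcond [RHS]integral_mkcond; apply: eq_integral => r _.
rewrite !patchE !mem_setE !in_itv/= andbT; case: ifPn => //= r0.
by rewrite angE_patch//; case: ifPn => //; rewrite mul0e.
Qed.

Lemma measurable_angE_discs U G : discs U -> measurable_fun (@toC R @^-1` U) G ->
  (forall x, U (toC x) -> 0 <= G x) ->
  measurable_fun (`]0%R, 1%R[%classic : set R) (fun r => angE G r * r%:E).
Proof.
move=> dU mG G0; have mU := measurable_discs dU.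
apply: (@eq_measurable_fun _ _ _ _ _ (fun r : R => angE (G \_ (@toC R @^-1` U)) r * r%:E)).
  by move=> r; rewrite inE/= in_itv/= => /andP[r0 r1]; rewrite angE_patch// r1.
apply: emeasurable_funM => //; apply: (measurable_funS measurableT) => //; apply: measurable_angE.
  exact/(measurable_restrictT _ mU).
by move=> x; rewrite patchE; case: ifPn => //; rewrite inE; exact: G0.
Qed.

(** The origin does not show in polar coordinates. Integrals over the disc are thus moved to the
    punctured disc, where powers of [z] are invertible. *)
Lemma ge0_integral_discs U G : discs U -> measurable_fun (@toC R @^-1` U) G ->
  (forall x, U (toC x) -> 0 <= G x) ->
  \int[@dV R]_(x in @toC R @^-1` U) G x = \int[@dV R]_(x in @toC R @^-1` (@pdisc R)) G x.
Proof.
move=> dU mG G0; rewrite !ge0_polar_discs//.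
- by right.
- by apply: (measurable_funS (measurable_discs dU)) mG => x /=; exact: pdisc_sub.
- by move=> x /(pdisc_sub dU); exact: G0.
Qed.

Lemma integral_discs U G : discs U -> measurable_fun (@toC R @^-1` U) G ->
  \int[@dV R]_(x in @toC R @^-1` U) G x = \int[@dV R]_(x in @toC R @^-1` (@pdisc R)) G x.
Proof.
move=> dU mG; rewrite [LHS]integralE [RHS]integralE.
rewrite !(ge0_integral_discs dU)//.
- exact: measurable_funeneg.
- exact: measurable_funepos.
Qed.

Lemma cmeasurable_toC : cmeasurable [set: R * R] (@toC R).
Proof. by split; [exact: mfst2|exact: msnd2]. Qed.

Lemma cabs_chi (p : R) z : (1 < p)%R -> cabs (chi p z) = (cabs z `^ (p - 1))%R.
Proof.
move=> p1; rewrite /chi cabsM cabs_real ger0_norm ?powR_ge0//.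
have [->|z0] := eqVneq z 0%R; first by rewrite cabs0 mul0r powR0// gt_eqF// subr_gt0.
rewrite -[X in (X * _)%R](powRr1 (cabs_ge0 z)) -powRD; last first.
  by rewrite cabs_eq0 (negbTE z0) implybT.
by congr (_ `^ _)%R; ring.
Qed.

(** In polar coordinates [chi_p] is the radial substitution [r^(p - 1)], and [eta_q] is the Jacobian
    of its inverse. This is where the weight of the dual space comes from. *)
Lemma ge0_integral_chi (p : R) (F : R[i] -> \bar R) : (1 < p)%R ->
  measurable_fun (@toC R @^-1` (@pdisc R)) (F \o @toC R) ->
  measurable_fun (@toC R @^-1` (@pdisc R)) (F \o chi p \o @toC R) ->
  (forall z, pdisc z -> 0 <= F z) ->
  \int[@dV R]_(x in @toC R @^-1` (@pdisc R)) F (chi p (toC x)) =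
  \int[@dV R]_(x in @toC R @^-1` (@pdisc R)) (F (toC x) * (eta_q (p / (p - 1)) (toC x))%:E).
Proof.
move=> p1 mF mFc F0; set q := (p / (p - 1))%R; set D := (_ @^-1` _).
have dp : discs (@pdisc R) by right.
have mD : measurable D := measurable_discs dp.
have p10 : (0 < p - 1)%R by rewrite subr_gt0.
have chi_polar (r t : R) : (0 < r)%R -> chi p (toC (r * cos t, r * sin t)%R) = toC (r `^ (p - 1) * cos t, r `^ (p - 1) * sin t)%R.
  move=> r0; rewrite !toC_polar /chi cabs_polar gtr0_norm// mulrAC -rmorphM; congr (_%:C%C * _)%R.
  rewrite -[X in (X * _)%R](powRr1 (ltW r0)) -powRD; last by rewrite (gt_eqF r0) implybT.
  by congr (_ `^ _)%R; ring.
pose Fp := (F \o @toC R) \_ D.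
have mFp : measurable_fun [set: R * R] Fp by exact/(measurable_restrictT _ mD).
have Fp0 x : 0 <= Fp x by rewrite /Fp patchE; case: ifPn => //; rewrite inE; exact: F0.
pose Gc := (F \o chi p \o @toC R) \_ D.
have mGc : measurable_fun [set: R * R] Gc by exact/(measurable_restrictT _ mD).
have chi_pdisc z : pdisc z -> pdisc (chi p z).
  by move=> /andP[z0 z1]; rewrite /pdisc/= cabs_chi// powR_gt0//= powR_lt1// cabs_ge0.
have Gc0 x : 0 <= Gc x.
  by rewrite /Gc patchE; case: ifPn => //; rewrite inE => xD; apply: F0; exact: chi_pdisc.
have q10 : (0 <= q - 1)%R by rewrite /q -[X in (_ - X)%R](divff (lt0r_neq0 p10)) -mulrBl divr_ge0 ?(ltW p10)//; lra.
(* The radial density [eta_q r], whence the exponent [2 q - 3]. *)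
pose h (r : R) := angE Fp r * ((q - 1) * r `^ (2 * q - 3))%:E.
have h0 r : 0 <= h r by rewrite mule_ge0 ?angE_ge0// lee_fin mulr_ge0// powR_ge0.
have mh : measurable_fun [set: R] h.
  apply: emeasurable_funM; first exact: measurable_angE.
  apply/measurable_EFinP; apply: measurable_funM => //; exact: measurable_powR.
transitivity (\int[mu]_(r in `]0%R, +oo[) h r).
  rewrite (ge0_subst_powR p10)// integral_mkcond -/Gc ge0_polarE//.
  apply: eq_integral => r; rewrite inE/= in_itv/= andbT => r0.
  have -> : angE Gc r = angE Fp (r `^ (p - 1))%R.
    rewrite /Gc /Fp !angE_patch// ?powR_gt0//.
    rewrite powR_lt1 ?(ltW r0)//.
    by case: ifPn => // _; apply: eq_integral => t _; rewrite /= chi_polar.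
  rewrite /h -muleA -EFinM; congr (_ * _%:E).
  rewrite -powRrM mulrACA -powRD; last by rewrite (gt_eqF r0) implybT.
  (* Since [q - 1] is the inverse of [p - 1], the powers of [r] combine to the area factor [r] and
     the constants to 1. *)
  rewrite (_ : ((p - 1) * (2 * q - 3) + (p - 1 - 1) = 1)%R); last by rewrite /q; field; rewrite gt_eqF.
  rewrite powRr1 ?(ltW r0)// (_ : ((q - 1) * (p - 1) = 1)%R) ?mul1r//.
  by rewrite /q; field; rewrite gt_eqF.
rewrite [RHS]integral_mkcond.
have -> : ((fun x => F (toC x) * (eta_q q (toC x))%:E) \_ D) = fun x => Fp x * (eta_q q (toC x))%:E.
  by apply/funext => x; rewrite /Fp !patchE; case: ifPn => //; rewrite mul0e.
have eta0 z : (0 <= eta_q q z)%R by rewrite mulr_ge0 ?powR_ge0.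
rewrite ge0_polarE; last 2 first.
- apply: emeasurable_funM => //; apply/measurable_EFinP.
  apply: measurable_funM => //; apply: measurable_cabs_powR.
  exact: cmeasurable_toC.
- by move=> x; rewrite mule_ge0// lee_fin.
apply: eq_integral => r; rewrite inE/= in_itv/= andbT => r0.
have -> : angE (fun x => Fp x * (eta_q q (toC x))%:E) r = angE Fp r * ((q - 1) * r `^ (2 * q - 4))%:E.
  rewrite /angE; transitivity (\int[mu]_(t in polar_range)
      (Fp (r * cos t, r * sin t)%R * ((q - 1) * r `^ (2 * q - 4))%:E)).
    by apply: eq_integral => t _; rewrite /eta_q toC_polar cabs_polar gtr0_norm.
  apply: ge0_integralZr => //.
  - exact: measurable_polar_range.
  - apply: (measurable_funS measurableT) => //.
    apply: (measurableT_comp mFp); apply: measurable_fun_pair.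
      by apply: measurable_funM; [exact: measurable_cst|exact: measurable_cos].
    by apply: measurable_funM; [exact: measurable_cst|exact: measurable_sin].
  - by rewrite lee_fin mulr_ge0 ?powR_ge0.
rewrite /h -muleA -EFinM; congr (_ * _%:E); rewrite -mulrA; congr (_ * _)%R.
rewrite -[X in (_ = _ * X)%R](powRr1 (ltW r0)) -powRD; last by rewrite (gt_eqF r0) implybT.
by congr (_ `^ _)%R; ring.
Qed.

(** Only an inequality, because the dilation maps onto the smaller disc of radius [c]. It bounds the
    norms of the dilations [f (c z)]. *)
Lemma ge0_integral_scale (c : R) (F : R[i] -> \bar R) : (0 < c < 1)%R ->
  measurable_fun (@toC R @^-1` (@pdisc R)) (F \o @toC R) ->
  measurable_fun (@toC R @^-1` (@pdisc R)) (fun x => F (c%:C%C * toC x)%R) ->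
  (forall z, pdisc z -> 0 <= F z) ->
  \int[@dV R]_(x in @toC R @^-1` (@pdisc R)) F (c%:C%C * toC x)%R <=
  (c ^- 2)%:E * \int[@dV R]_(x in @toC R @^-1` (@pdisc R)) F (toC x).
Proof.
move=> /andP[c0 c1] mF mFc F0; set D := (_ @^-1` _).
have dp : discs (@pdisc R) by right.
have mD : measurable D := measurable_discs dp.
pose Fp := (F \o @toC R) \_ D.
have mFp : measurable_fun [set: R * R] Fp by exact/(measurable_restrictT _ mD).
have Fp0 x : 0 <= Fp x by rewrite /Fp patchE; case: ifPn => //; rewrite inE; exact: F0.
have cpol r t : (c%:C%C * toC (r * cos t, r * sin t))%R = toC (c * r * cos t, c * r * sin t)%R.
  by rewrite !toC_polar rmorphM mulrA.
rewrite ge0_polar_discs//; last first.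
  move=> x /andP[x0 x1]; apply: F0; rewrite /pdisc/= cabsM cabs_real gtr0_norm//.
  by rewrite mulr_gt0//= mulr_ilt1 ?ltW.
rewrite [X in (_ * X)%E]integral_mkcond -/Fp ge0_polarE//.
pose h (r : R) := angE Fp r * `|r|%:E.
have h0 r : 0 <= h r by rewrite mule_ge0 ?angE_ge0// lee_fin.
have mh : measurable_fun [set: R] h.
  apply: emeasurable_funM; first exact: measurable_angE.
  by apply/measurable_EFinP; exact: normr_measurable.
have -> : \int[mu]_(r in `]0%R, +oo[) (angE Fp r * r%:E) = \int[mu]_(r in `]0%R, +oo[) h r.
  by apply: eq_integral => r; rewrite inE/= in_itv/= andbT => r0; rewrite /h gtr0_norm.
rewrite (ge0_subst_scale c0)// -ge0_integralZl//; last 3 first.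
- apply: (measurable_funS measurableT) => //; apply: emeasurable_funM => //.
  by apply: (measurableT_comp mh); exact: measurable_funM.
- by move=> r _; rewrite mule_ge0// lee_fin ltW.
- by rewrite lee_fin invr_ge0 exprn_ge0// ltW.
have mhc : measurable_fun [set: R] (fun r => (c ^- 2)%:E * (h (c * r)%R * c%:E)).
  apply: emeasurable_funM => //; apply: emeasurable_funM => //.
  by apply: (measurableT_comp mh); exact: measurable_funM.
apply: (@le_trans _ _ (\int[mu]_(r in `]0%R, 1%R[) ((c ^- 2)%:E * (h (c * r)%R * c%:E)))).
  rewrite le_eqVlt; apply/orP; left; apply/eqP; apply: eq_integral => r.
  rewrite inE/= in_itv/= => /andP[r0 r1].
  rewrite /h -muleA -EFinM muleCA -EFinM.
  rewrite (_ : (c ^- 2 * (`|c * r| * c))%R = r); last first.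
    by rewrite gtr0_norm ?mulr_gt0//; field; rewrite gt_eqF.
  rewrite /Fp angE_patch ?mulr_gt0// ifT; last by rewrite mulr_ilt1 ?ltW.
  by congr (_ * _); apply: eq_integral => t _; rewrite cpol.
apply: ge0_subset_integral => //.
- by apply: (measurable_funS measurableT).
- move=> r _; apply: mule_ge0; first by rewrite lee_fin invr_ge0 exprn_ge0// ltW.
  by apply: mule_ge0 => //; rewrite lee_fin ltW.
- by move=> r /=; rewrite !in_itv/= andbT => /andP[].
Qed.

End polar_integrals.

(** * Integrals of powers over the unit interval *)

Section power_integral.
Context {R : realType}.
Local Notation mu := (@lebesgue_measure R).
Local Open Scope ereal_scope.

(** Substitute [x^(b + 1)] in the integral of the indicator of []0, 1[], which is 1. *)
Lemma integral_powR01 (b : R) : (-1 < b)%R ->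
  \int[mu]_(x in `]0%R, 1%R[) (x `^ b)%:E = ((b + 1)^-1)%:E.
Proof.
move=> b1; have a0 : (0 < b + 1)%R by lra.
pose h (x : R) : \bar R := (\1_(`]0%R, 1%R[%classic : set R) x)%:E.
have mh : measurable_fun [set: R] h by apply/measurable_EFinP; exact: measurable_indic.
have h0 x : 0 <= h x by rewrite lee_fin.
have := ge0_subst_powR a0 mh h0.
have -> : \int[mu]_(x in `]0%R, +oo[) h x = 1.
  have -> : \int[mu]_(x in `]0%R, +oo[) h x = mu (`]0%R, 1%R[%classic `&` `]0%R, +oo[%classic).
    exact: integral_indic.
  rewrite setIidl; last by move=> x /=; rewrite !in_itv/= andbT => /andP[].
  by rewrite lebesgue_measure_itv/= lte_fin ltr01 oppr0 addr0.
have -> : \int[mu]_(x in `]0%R, +oo[) (h (x `^ (b + 1))%R * ((b + 1) * x `^ (b + 1 - 1))%:E) =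
    \int[mu]_(x in `]0%R, 1%R[) ((b + 1)%:E * (x `^ b)%:E).
  rewrite integral_mkcond [RHS]integral_mkcond; apply: eq_integral => x _.
  rewrite !patchE !mem_setE !in_itv/= andbT; case: ifPn => //= x0.
  rewrite /h indicE mem_setE in_itv/= powR_gt0// powR_lt1 ?(ltW x0)//=.
  by case: ifPn => _; rewrite ?mul0e// mul1e addrK EFinM.
rewrite ge0_integralZl//; last 3 first.
- apply/measurable_EFinP; apply: (measurable_funS measurableT) => //; exact: measurable_powR.
- by move=> x _; rewrite lee_fin powR_ge0.
- by rewrite lee_fin ltW.
move=> /(congr1 (fun x => ((b + 1)^-1)%:E * x)).
by rewrite mule1 muleA -EFinM mulVf ?gt_eqF// mul1e => <-.
Qed.

Lemma integral_powR_neg1 (b : R) : (b <= -1)%R ->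
  \int[mu]_(x in `]0%R, 1%R[) (x `^ b)%:E = +oo.
Proof.
move=> b1; apply/eqyP => A A0; 
have e0 : (0 < A^-1)%R by rewrite invr_gt0.
(* The exponent [1 / A - 1] exceeds [b], and its power has integral exactly [A], for every positive
   [A]. *)
apply: (@le_trans _ _ (\int[mu]_(x in `]0%R, 1%R[) (x `^ (A^-1 - 1))%:E)).
  rewrite integral_powR01; last by rewrite ltrBrDl subrr.
  by rewrite subrK invrK.
have mpow (c : R) : measurable_fun (`]0%R, 1%R[%classic : set R) (fun x : R => (x `^ c)%:E).
  apply/measurable_EFinP; apply: (measurable_funS measurableT) => //; exact: measurable_powR.
apply: ge0_le_integral => //.
- by move=> x _; rewrite lee_fin powR_ge0.
- exact: mpow.
- exact: mpow.
move=> x /=; rewrite in_itv/= => /andP[x0 x1]; rewrite lee_fin.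
by rewrite ger_powR ?x0 ?ltW//; lra.
Qed.

End power_integral.

(** * Growth of circle means, exclusion of poles, pairing with monomials *)

Section circle_means.
Context {R : realType}.
Local Notation mu := (@lebesgue_measure R).
Implicit Types (U : set R[i]) (f g : R[i] -> R[i]).

(** Jensen's inequality, obtained from Young's: integrate [a^(s - 1) |phi| <= |phi|^s / s + a^s /
    s'] with [a] the modulus of the mean, for which both sides balance. *)
Lemma jensen_ang (phi : R -> R[i]) (s : R) : 1 < s -> ccont phi ->
  ((2 * pi * (cabs (ang phi) / (2 * pi)) `^ s)%:E <=
   \int[mu]_(t in polar_range) ((cabs (phi t)) `^ s)%:E)%E.
Proof.
move=> s1 cphi; set a := cabs (ang phi) / (2 * pi).
have p0 : 0 < 2 * pi :> R by rewrite mulr_gt0// pi_gt0.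
have a0 : 0 <= a by rewrite divr_ge0 ?cabs_ge0// ltW.
have s0 : 0 < s by lra.
pose s' := s / (s - 1); have s10 : 0 < s - 1 by rewrite subr_gt0.
have s'0 : 0 < s' by rewrite divr_gt0.
have ss' : s^-1 + s'^-1 = 1 by rewrite /s'; field; rewrite !gt_eqF.
have mP := @measurable_polar_range R.
have iphi := ccont_cintegrable cphi; have mphi := cintegrable_cmeasurable iphi.
have mX : measurable_fun polar_range (fun t => (cabs (phi t)) `^ s) by exact: measurable_cabs_powR.
set I := (\int[mu]_(t in polar_range) ((cabs (phi t)) `^ s)%:E)%E.
have I0 : (0 <= I)%E by apply: integral_ge0 => t _; rewrite lee_fin powR_ge0.
have aa : (a `^ (s - 1)) `^ s' = a `^ s by rewrite -powRrM; congr (_ `^ _); rewrite /s'; field; rewrite gt_eqF.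
have key : ((a `^ (s - 1) * (a * (2 * pi)))%:E <= (s^-1)%:E * I + (a `^ s / s' * (2 * pi))%:E)%E.
  apply: (@le_trans _ _ (\int[mu]_(t in polar_range) ((a `^ (s - 1))%:E * (cabs (phi t))%:E))%E).
    rewrite ge0_integralZl//; last 3 first.
    - by apply/measurable_EFinP; exact: measurable_cabs.
    - by move=> t _; rewrite lee_fin cabs_ge0.
    - by rewrite lee_fin powR_ge0.
    rewrite EFinM lee_wpmul2l ?lee_fin ?powR_ge0// /a divfK ?gt_eqF//.
    have Hc : cabs (ang phi) <= Rintegral mu polar_range (fun t => cabs (phi t)).
      by apply: (cabs_cI _ iphi); exact: mP.
    move: Hc; rewrite -lee_fin => /le_trans; apply.
    rewrite fineK//; apply: (integrable_fin_num _ (cintegrable_cabs _ iphi)); exact: mP.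
  apply: (@le_trans _ _ (\int[mu]_(t in polar_range) ((s^-1)%:E * ((cabs (phi t)) `^ s)%:E + (a `^ s / s')%:E))%E).
    apply: ge0_le_integral => //.
    - by move=> t _; rewrite -EFinM lee_fin mulr_ge0 ?powR_ge0 ?cabs_ge0.
    - apply: emeasurable_funM => //; apply/measurable_EFinP; exact: measurable_cabs.
    - by apply: emeasurable_funD => //; apply: emeasurable_funM => //; exact/measurable_EFinP.
    - move=> t _; rewrite -EFinM -EFinM -EFinD lee_fin.
      rewrite mulrC (le_trans (conjugate_powR (cabs_ge0 _) (powR_ge0 _ _) s0 s'0 ss'))//.
      by rewrite aa mulrC.
  rewrite ge0_integralD//; last 3 first.
  - by move=> t _; rewrite -EFinM lee_fin mulr_ge0 ?invr_ge0 ?powR_ge0// ltW.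
  - by apply: emeasurable_funM => //; exact/measurable_EFinP.
  - by move=> t _; rewrite lee_fin mulr_ge0 ?invr_ge0 ?powR_ge0// ltW.
  rewrite ge0_integralZl//; last 3 first.
  - exact/measurable_EFinP.
  - by move=> t _; rewrite lee_fin powR_ge0.
  - by rewrite lee_fin invr_ge0 ltW.
  by rewrite leeD// integral_cst//= polar_range_measure EFinM.
clearbody I; case: I I0 key => [x| |] x0 key; [|by rewrite leey|by []].
move: key; rewrite -EFinM -EFinD !lee_fin => key.
have aS : a `^ (s - 1) * (a * (2 * pi)) = a `^ s * (2 * pi).
  by rewrite mulrA [a `^ _ * a]mulrC mulr_powRB1.
rewrite -(ler_pM2l (_ : 0 < s^-1)) ?invr_gt0//; move: key; rewrite aS.
have -> : s'^-1 = 1 - s^-1 by rewrite -ss' addrAC subrr add0r.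
by lra.
Qed.

(** A nonzero Laurent coefficient of index [-j] forces the circle means of [|f|^s] to be at least a
    multiple of [r^(- s j)], by [jensen_ang]. With the weight and the area factor the radial
    integrand is at least a multiple of [r^(beta + 1 - s j)], whose exponent is at most [-1], so the
    integral diverges. *)
Lemma pole_vanish f (s K beta : R) (j : nat) : holomorphic_on (@pdisc R) f -> 1 < s -> 0 < K ->
  beta + 2 <= s * j%:R ->
  (wint (@pdisc R) s (fun z => (K * cabs z `^ beta)%R) f < +oo)%E ->
  circ (fun z => f z * z ^+ j) 2^-1 = 0.
Proof.
move=> hf s1 K0 bj; apply: contraPP; move ZE : (circ _ _) => Z /eqP c0; apply/negP; rewrite -leNgt leye_eq.
have dp : discs (@pdisc R) by right.
have p0 : 0 < 2 * pi :> R by rewrite mulr_gt0// pi_gt0.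
have half01 : (0 < 2^-1 :> R) && (2^-1 < 1 :> R) by apply/andP; split; lra.
have hfj : holomorphic_on (@pdisc R) (fun z => f z * z ^+ j).
  by apply: holomorphicM => //; apply: holomorphicX; exact: holomorphic_id.
set c := cabs Z / (2 * pi).
have cc0 : 0 < c by rewrite divr_gt0// cabs_gt0.
have hmf : cmeasurable (@toC R @^-1` (@pdisc R)) (f \o @toC R).
  by apply: holomorphic_cmeasurable => //; exact: copen_pdisc.
have mT : cmeasurable (@toC R @^-1` (@pdisc R)) (@toC R).
  apply: cmeasurableS measurableT _ _ => //; exact: cmeasurable_toC.
rewrite /wint ge0_polar_discs//; last 2 first.
- apply/measurable_EFinP; apply: measurable_funM; first exact: measurable_cabs_powR hmf.
  by apply: measurable_funM => //; exact: measurable_cabs_powR mT.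
- by move=> x _; rewrite lee_fin !mulr_ge0 ?powR_ge0// ltW.
have C0 : 0 < K * (2 * pi * c `^ s) by rewrite !mulr_gt0// ?powR_gt0// pi_gt0.
rewrite -leye_eq.
have -> : +oo%E = (\int[mu]_(r in `]0%R, 1%R[) ((K * (2 * pi * c `^ s))%:E * (r `^ (beta + 1 - s * j%:R))%:E))%E.
  rewrite ge0_integralZl//; last 3 first.
  - apply/measurable_EFinP; apply: (measurable_funS measurableT) => //; exact: measurable_powR.
  - by move=> x _; rewrite lee_fin powR_ge0.
  - by rewrite lee_fin ltW.
  by rewrite integral_powR_neg1 ?gt0_muley ?lte_fin//; lra.
have mr (D : set R) (e : R) : measurable_fun D (fun r : R => (r `^ e)%:E).
  apply/measurable_EFinP; apply: (measurable_funS measurableT) => //; exact: measurable_powR.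
apply: ge0_le_integral => //.
- by move=> r _; rewrite -EFinM lee_fin mulr_ge0 ?powR_ge0// ltW.
- exact: (emeasurable_funM (measurable_cst _) (mr _ _)).
- apply: (@measurable_angE_discs _ (@pdisc R)) => //.
  + apply/measurable_EFinP; apply: measurable_funM; first exact: measurable_cabs_powR hmf.
    by apply: measurable_funM => //; exact: measurable_cabs_powR mT.
  + by move=> x _; rewrite lee_fin !mulr_ge0 ?powR_ge0// ltW.
move=> r /=; rewrite in_itv/= => r01; have [r0 r1] := andP r01.
have cr := holomorphic_ccont hf r01.
have cphi : ccont (fun t => f (r%:C%C * cis t) * cis t ^+ j).
  by apply: ccontM => //; apply: ccontX; exact: ccont_cis.
have aE : cabs (ang (fun t => f (r%:C%C * cis t) * cis t ^+ j)) / (2 * pi) = c * r `^ (- j%:R).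
  have : (r ^+ j)%:C%C * ang (fun t => f (r%:C%C * cis t) * cis t ^+ j) = Z.
    rewrite -ZE (circ_const hfj half01 r01) -angZ//; congr ang; apply/funext => t.
    by rewrite exprMn -rmorphXn mulrCA.
  move=> /(congr1 (@cabs R)); rewrite cabsM cabs_real gtr0_norm ?exprn_gt0// => cE.
  have -> : r `^ (- j%:R) = (r ^+ j)^-1 by rewrite powRN powR_mulrn// ltW.
  rewrite /c -cE; set A := cabs (ang _).
  have := expf_neq0 j (lt0r_neq0 r0).
  by move: A (r ^+ j) => A X X0; rewrite [RHS]mulrAC (mulrC X) mulfK.
have := jensen_ang s1 cphi; rewrite aE.
rewrite powRM ?(ltW cc0) ?powR_ge0// -powRrM.
have -> : (\int[mu]_(t in polar_range) ((cabs (f (r%:C%C * cis t) * cis t ^+ j)) `^ s)%:E =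
  \int[mu]_(t in polar_range) ((cabs (f (r%:C%C * cis t))) `^ s)%:E)%E.
  by apply: eq_integral => t _; rewrite cabsM cabsX cabs_cis expr1n mulr1.
set J := (\int[mu]_(t in polar_range) _)%E => HJ.
have -> : angE (fun x => ((cabs (f (toC x)) `^ s) * (K * cabs (toC x) `^ beta))%:E) r = ((K * r `^ beta)%:E * J)%E.
  rewrite /angE; transitivity (\int[mu]_(t in polar_range) ((K * r `^ beta)%:E * ((cabs (f (r%:C%C * cis t))) `^ s)%:E))%E.
    by apply: eq_integral => t _; rewrite toC_polar cabs_polar gtr0_norm// -EFinM mulrC.
  apply: ge0_integralZl => //.
  - exact: measurable_polar_range.
  - apply/measurable_EFinP; apply: measurable_cabs_powR.
    exact: cintegrable_cmeasurable (ccont_cintegrable cr).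
  - by move=> t _; rewrite lee_fin powR_ge0.
  - by rewrite lee_fin mulr_ge0 ?powR_ge0// ltW.
rewrite muleAC -EFinM; apply: (@le_trans _ _ ((K * r `^ beta * r)%:E * (2 * pi * (c `^ s * r `^ (- j%:R * s)))%:E)%E); last first.
  by rewrite lee_wpmul2l// lee_fin !mulr_ge0 ?powR_ge0// ltW.
rewrite -!EFinM lee_fin.
have -> : r `^ (beta + 1 - s * j%:R) = r `^ beta * r * r `^ (- j%:R * s).
  rewrite -[X in _ * X * _](powRr1 (ltW r0)) -!powRD ?(gt_eqF r0) ?implybT//.
  by congr (_ `^ _); ring.
by rewrite le_eqVlt; apply/orP; left; apply/eqP; ring.
Qed.


Lemma Rintegral_polar U (f : R * R -> R) : discs U ->
  (@dV R).-integrable (@toC R @^-1` U) (EFin \o f) ->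
  (forall r : R, 0 < r < 1 -> mu.-integrable polar_range (fun t : R => (f (r * cos t, r * sin t))%:E)) ->
  Rintegral (@dV R) (@toC R @^-1` U) f =
  Rintegral mu `]0%R, 1%R[%classic (fun r => Rintegral mu polar_range (fun t : R => f (r * cos t, r * sin t)) * r).
Proof.
move=> dU jf fr; have mU := measurable_discs dU.
have mf := measurable_int _ jf.
have mp := measurable_funepos mf; have mn := measurable_funeneg mf.
rewrite /Rintegral; congr fine; rewrite [LHS]integralE.
have ip : (\int[@dV R]_(x in @toC R @^-1` U) ((EFin \o f)^\+ x)%E < +oo)%E.
  by apply: integrable_lty => //; exact: integrable_funepos.
have in_ : (\int[@dV R]_(x in @toC R @^-1` U) ((EFin \o f)^\- x)%E < +oo)%E.
  by apply: integrable_lty => //; exact: integrable_funeneg.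
rewrite !ge0_polar_discs// in ip in_ *.
have E1 (G : R * R -> \bar R) : measurable_fun (@toC R @^-1` U) G -> (forall x, (0 <= G x)%E) ->
  (\int[mu]_(r in `]0%R, 1%R[) (angE G r * r%:E) < +oo)%E ->
  mu.-integrable `]0%R, 1%R[%classic (fun r => angE G r * r%:E)%E.
  move=> mG G0 Goo; apply/integrableP; split.
    by apply: (measurable_angE_discs dU).
  apply: le_lt_trans Goo; rewrite le_eqVlt; apply/orP; left; apply/eqP.
  apply: eq_integral => r; rewrite inE/= in_itv/= => /andP[r0 _].
  by rewrite gee0_abs// mule_ge0 ?angE_ge0// lee_fin ltW.
rewrite -integralB//; [|exact: E1|exact: E1].
apply: eq_integral => r; rewrite inE/= in_itv/= => r01; have [r0 r1] := andP r01.
have jr := fr _ r01.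
rewrite EFinM fineK; last first.
  by apply: (integrable_fin_num _ jr); exact: measurable_polar_range.
have Hn : (\int[mu]_(t in polar_range) ((fun t : R => (f (r * cos t, r * sin t)%R)%:E)^\- t) \is a fin_num)%E.
  by apply: (@integrable_neg_fin_num _ _ _ mu polar_range) => //; exact: measurable_polar_range.
have -> : angE ((EFin \o f)^\-)%E r =
    (\int[mu]_(t in polar_range) ((fun t : R => (f (r * cos t, r * sin t)%R)%:E)^\- t))%E.
  by apply: eq_integral => t _; rewrite !funenegE.
have -> : angE ((EFin \o f)^\+)%E r =
    (\int[mu]_(t in polar_range) ((fun t : R => (f (r * cos t, r * sin t)%R)%:E)^\+ t))%E.
  by apply: eq_integral => t _; rewrite !funeposE.
have gen (a b : \bar R) : (b \is a fin_num -> a * r%:E - b * r%:E = (a - b) * r%:E)%E.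
  by move=> bf; rewrite muleBl// fin_num_adde_defl// fin_numN.
by rewrite gen// -integralE.
Qed.

Lemma cI_polar U (F : R * R -> R[i]) : discs U -> cintegrable (@dV R) (@toC R @^-1` U) F ->
  (forall r : R, 0 < r < 1 -> ccont (fun t : R => F (r * cos t, r * sin t))) ->
  cI (@dV R) (@toC R @^-1` U) F =
  cI mu `]0%R, 1%R[%classic (fun r => ang (fun t : R => F (r * cos t, r * sin t)) * r%:C%C).
Proof.
move=> dU [i1 i2] cF; apply: complex_eq => /=.
- rewrite (Rintegral_polar dU i1); last by move=> r /cF /ccont_cintegrable [].
  by apply: eq_Rintegral => r _; rewrite mulr0 subr0.
- rewrite (Rintegral_polar dU i2); last by move=> r /cF /ccont_cintegrable [].
  by apply: eq_Rintegral => r _; rewrite mulr0 add0r.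
Qed.

Definition mono m k (z : R[i]) : R[i] := z ^+ k * z ^- m.

Lemma chi_polar (p r : R) t : 0 < r ->
  chi p (r%:C%C * cis t) = (r `^ (p - 1))%:C%C * cis t.
Proof.
move=> r0; rewrite /chi cabs_polar gtr0_norm// mulrAC -rmorphM; congr (_%:C%C * _).
rewrite -[X in X * _](powRr1 (ltW r0)) -powRD; last by rewrite (gt_eqF r0) implybT.
by congr (_ `^ _); ring.
Qed.

(** On the circle of radius [r], [g o chi_p] is [g] on the circle of radius [r^(p - 1)] with the
    same argument. The angular integral therefore picks one coefficient, and what remains is the
    integral of [r^(p (k - m) + 1)]. *)
Lemma pairing_mono p m k g : 1 < p -> holomorphic_on (@pdisc R) g ->
  0 < p * (k%:R - m%:R) + 2 ->
  cintegrable (@dV R) (@toC R @^-1` (@pdisc R)) ((fun z => mono m k z * (g (chi p z))^*%C) \o @toC R) ->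
  pairing (@pdisc R) p (mono m k) g =
  (tcoef (fun z => g z * z ^+ m) k)^*%C * (2 * pi / (p * (k%:R - m%:R) + 2))%:C%C.
Proof.
move=> p1 hg km iF; have dp : discs (@pdisc R) by right.
have p10 : 0 < p - 1 by rewrite subr_gt0.
set h := fun z => g z * z ^+ m; set c := tcoef h k.
have hh : holomorphic_on (@pdisc R) h.
  by apply: holomorphicM => //; apply: holomorphicX; exact: holomorphic_id.
(* The radial factor: [r^(k - m)] from the monomial, and [r^(p - 1)] to the power [-m] from writing
   [g = h z^-m] on the smaller circle. *)
pose C (r : R) := r ^+ k / r ^+ m / (r `^ (p - 1)) ^+ m.
have FE (r : R) t : 0 < r < 1 -> ((fun z => mono m k z * (g (chi p z))^*%C) \o @toC R) (r * cos t, r * sin t) =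
    (C r)%:C%C * (h ((r `^ (p - 1))%:C%C * cis t) * cis t ^- k)^*%C.
  move=> /andP[r0 r1]; rewrite /= toC_polar chi_polar//; set rho := r `^ (p - 1).
  have rho0 : rho%:C%C != 0 :> R[i].
    by rewrite -[0]/((0 : R)%:C%C) (inj_eq (@complexI R)) gt_eqF// powR_gt0.
  have r0C : r%:C%C != 0 :> R[i].
    by rewrite -[0]/((0 : R)%:C%C) (inj_eq (@complexI R)) gt_eqF.
  have -> : (C r)%:C%C = r%:C%C ^+ k / r%:C%C ^+ m / rho%:C%C ^+ m.
    by rewrite /C !rmorphM !fmorphV !rmorphXn.
  have cX n : ((cis t ^+ n)^*)%C = cis t ^- n by rewrite -exprVn -conj_cis rmorphXn.
  have cVX n : ((cis t ^- n)^*)%C = cis t ^+ n.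
    by rewrite -exprVn -conj_cis -rmorphXn; exact: conjcK.
  have cR : ((rho%:C%C ^+ m)^*)%C = rho%:C%C ^+ m by rewrite -rmorphXn; exact: conjc_real.
  have -> : ((h (rho%:C%C * cis t) / cis t ^+ k)^*)%C =
      (g (rho%:C%C * cis t))^*%C * (rho%:C%C ^+ m * cis t ^- m) * cis t ^+ k.
    have cM (x y : R[i]) : ((x * y)^*)%C = (x^*)%C * (y^*)%C by exact: rmorphM.
    by rewrite /h exprMn !cM cVX cX cR.
  rewrite /mono !exprMn.
  have := cis_neq0 t; move: (cis t) => u u0.
  have := expf_neq0 m u0; have := expf_neq0 k u0.
  have := expf_neq0 m rho0; have := expf_neq0 m r0C.
  move: (u ^+ k) (u ^+ m) (rho%:C%C ^+ m) (r%:C%C ^+ m) (r%:C%C ^+ k) ((g _)^*%C).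
  by move=> uk um Rm rm rk gg rm0 Rm0 uk0 um0; field; rewrite rm0 Rm0 um0.
have rho01 (r : R) : 0 < r < 1 -> 0 < r `^ (p - 1) < 1.
  by move=> /andP[r0 r1]; rewrite powR_gt0//= powR_lt1// ltW.
have cinner (r : R) : 0 < r < 1 -> ccont (fun t => h ((r `^ (p - 1))%:C%C * cis t) * cis t ^- k).
  move=> r01; apply: ccontM; first exact: (holomorphic_ccont hh (rho01 r r01)).
  under eq_fun do rewrite -exprVn.
  by apply: ccontX; exact: ccont_cisV.
apply: etrans (cI_polar dp iF _) _.
  move=> r r01; under eq_fun do rewrite FE//.
  by apply: ccontM; [exact: ccont_cst|apply: ccont_conj; exact: cinner].
(* The sum of the exponents [k - m] of the monomial, [(p - 1) (k - m)] of [g o chi_p] and 1 of the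
   area. *)
pose e := p * (k%:R - m%:R) + 1.
transitivity (cI mu `]0%R, 1%R[%classic (fun r => (c^*%C * (2 * pi)%:C%C) * (r `^ e)%:C%C)).
  apply: eq_cI => r rI.
  have r01 : 0 < r < 1 by move: rI; rewrite /= in_itv.
  have [r0 r1] := andP r01.
  under eq_fun do rewrite FE//.
  rewrite angZ; last by apply: ccont_conj; exact: cinner.
  rewrite ang_conj; last exact: cinner.
  rewrite (circ_VX k hh (rho01 r r01)) -/c.
  have -> : ((((r `^ (p - 1))%:C%C ^+ k * (2 * pi)%:C%C * c)^*)%C = (r `^ (p - 1))%:C%C ^+ k * (2 * pi)%:C%C * c^*%C).
    rewrite -rmorphXn -rmorphM [LHS]rmorphM; congr (_ * _); exact: conjc_real.
  have -> : (r `^ e)%:C%C = (C r)%:C%C * (r `^ (p - 1))%:C%C ^+ k * r%:C%C.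
    rewrite -rmorphXn -!rmorphM; congr (_%:C%C).
    rewrite /C -!powR_mulrn ?powR_ge0 ?(ltW r0)// -!powRrM -!powRN -!powRD ?(gt_eqF r0) ?implybT//.
    rewrite -[X in _ = _ * X](powRr1 (ltW r0)) -!powRD ?(gt_eqF r0) ?implybT//.
    by congr (_ `^ _); rewrite /e; ring.
  by ring.
have e1 : -1 < e by rewrite /e; lra.
have me (D : set R) : measurable_fun D (fun r : R => r `^ e).
  apply: (measurable_funS measurableT) => //; exact: measurable_powR.
rewrite cIZ; last 2 first.
- exact: measurable_itv.
- apply: cintegrable_lty.
  + exact: measurable_itv.
  + by apply: cmeasurable_real; exact: me.
  + under eq_integral do rewrite cabs_real ger0_norm ?powR_ge0//.
    by rewrite integral_powR01// ltry.
have -> : (2 * pi / (p * (k%:R - m%:R) + 2))%:C%C = (2 * pi)%:C%C * ((p * (k%:R - m%:R) + 2)^-1)%:C%C :> R[i].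
  by rewrite -rmorphM.
rewrite [RHS]mulrA; congr (_ * _); apply: complex_eq => /=.
  by rewrite /Rintegral integral_powR01//= /e; congr (_^-1); ring.
by rewrite /Rintegral integral0.
Qed.

End circle_means.

(** * A Schur test *)

Section schur.
Context {R : realType}.
Local Notation mu := (@lebesgue_measure R).
Local Open Scope ereal_scope.

Lemma ge0_integral_translate (c : R) (h : R -> \bar R) :
  measurable_fun [set: R] h -> (forall x, 0 <= h x) ->
  \int[mu]_x h x = \int[mu]_x h (x + c)%R.
Proof.
move=> mh h0.
transitivity (\int[mu]_(x in setT) (h (x + c)%R * 1%:E)); last first.
  by apply: eq_integral => x _; rewrite mule1.
apply: (@ge0_subst_bij R setT setT (fun x => x + c)%R (fun=> 1%R) (fun x => x - c)%R
  (fun n => - n%:R)%R (fun n => n%:R)%R) => //.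
- by move=> x _; rewrite addrK.
- by move=> x _; rewrite subrK.
- by move=> x y _ _; rewrite ltrD2r.
- move=> x _; have := is_deriveD (is_derive_id x 1%R) (is_derive_cst c x 1%R).
  by rewrite addr0.
- by move=> x _; exact: cst_continuous.
- by move=> m n mn; rewrite lerN2 ler_nat.
- by move=> m n mn; rewrite ler_nat.
- by move=> n; rewrite (@le_trans _ _ 0%R)// oppr_le0.
apply/seteqP; split => // x _; have [n xn] : exists n : nat, (`|x| < n%:R)%R.
  by exists (Num.bound `|x|); exact: archi_boundP.
exists n => //=; rewrite in_itv/=; move: xn; rewrite ltr_norml => /andP[-> /ltW ->]//.
Qed.

Lemma ge0_integral_onem (h : R -> \bar R) : measurable_fun [set: R] h -> (forall x, 0 <= h x) ->
  \int[mu]_(x in `]0%R, 1%R[) h x = \int[mu]_(x in `]0%R, 1%R[) h (1 - x)%R.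
Proof.
move=> mh h0; rewrite integral_mkcond [RHS]integral_mkcond.
have m1 (g : R -> \bar R) : measurable_fun [set: R] g -> measurable_fun [set: R] (g \_ (`]0%R, 1%R[%classic : set R)).
  by move=> mg; apply/(measurable_restrictT _ (measurable_itv _)); exact: measurable_funTS.
have p0 (g : R -> \bar R) (x : R) : (forall x, 0 <= g x) -> 0 <= (g \_ (`]0%R, 1%R[%classic : set R)) x.
  by move=> g0; rewrite patchE; case: ifPn.
rewrite (ge0_integral_translate 1 (m1 _ mh)); last by move=> x; exact: p0.
rewrite ge0_integral_opp; last 2 first.
- apply: (measurableT_comp (m1 _ mh)); exact: measurable_funD.
- by move=> x; exact: p0.
apply: eq_integral => x _; rewrite !patchE !mem_setE !in_itv/= addrC.
by congr (if _ then _ else _); apply/andP/andP => -[? ?]; split; lra.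
Qed.

Lemma integral_powR_below (b d : R) : (-1 < b)%R -> (0 < d)%R ->
  \int[mu]_(x in `]0%R, d[) (x `^ b)%:E = (d `^ (b + 1) / (b + 1))%:E.
Proof.
move=> b1 d0; rewrite integral_mkcond.
pose h : R -> \bar R := (fun x : R => (x `^ b)%:E) \_ (`]0%R, d[%classic : set R).
have mh : measurable_fun [set: R] h.
  apply/(measurable_restrictT _ (measurable_itv _)); apply: measurable_funTS.
  by apply/measurable_EFinP; exact: measurable_powR.
have h0 x : 0 <= h x by rewrite /h patchE; case: ifPn => // _; rewrite lee_fin powR_ge0.
have -> : \int[mu]_x h x = \int[mu]_(x in `]0%R, +oo[) h x.
  rewrite [RHS]integral_mkcond; apply: eq_integral => x _; rewrite /h !patchE !mem_setE !in_itv/= andbT.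
  by case: ltP.
rewrite (ge0_subst_scale d0)//.
have -> : \int[mu]_(x in `]0%R, +oo[) (h (d * x)%R * d%:E) = \int[mu]_(x in `]0%R, 1%R[) ((d `^ (b + 1))%:E * (x `^ b)%:E).
  rewrite integral_mkcond [RHS]integral_mkcond; apply: eq_integral => x _.
  rewrite /h !patchE !mem_setE !in_itv/= andbT; case: (ltP 0%R x) => //= x0.
  rewrite mulr_gt0//= gtr_pMr//; case: ifPn => _; last by rewrite mul0e.
  rewrite -!EFinM; congr _%:E; rewrite powRM ?(ltW d0) ?(ltW x0)//.
  rewrite powRD ?(gt_eqF d0) ?implybT// powRr1 ?(ltW d0)//; ring.
rewrite ge0_integralZl//; last 3 first.
- apply/measurable_EFinP; apply: (measurable_funS measurableT) => //; exact: measurable_powR.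
- by move=> x _; rewrite lee_fin powR_ge0.
- by rewrite lee_fin powR_ge0.
by rewrite integral_powR01// -EFinM.
Qed.

Lemma integral_powR_above (b d : R) : (0 < b)%R -> (0 < d <= 1)%R ->
  \int[mu]_(x in `]d, 1%R]) (x `^ (- b - 1))%:E <= (d `^ (- b) / b)%:E.
Proof.
move=> b0 /andP[d0 d1].
have dF (x : R) : (d <= x <= 1)%R -> is_derive x 1%R (fun x : R => - b^-1 * x `^ (- b))%R (x `^ (- b - 1))%R.
  move=> /andP[dx _]; have x0 : (0 < x)%R by exact: lt_le_trans dx.
  have H : is_derive x 1%R (fun x : R => x `^ (- b))%R (- b * x `^ (- b - 1))%R.
    apply: DeriveDef; first by apply: derivable_powR; rewrite in_itv/= x0.
    by rewrite -derive1E powR_derive1// in_itv/= x0.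
  have := is_deriveZ (- b^-1)%R H; rewrite /GRing.scale/=.
  by rewrite (_ : (- b^-1 * (- b * x `^ (- b - 1)))%R = (x `^ (- b - 1))%R)//; field; rewrite gt_eqF.
have cf (x : R) : (d <= x <= 1)%R -> {for x, continuous (fun x : R => x `^ (- b - 1))%R}.
  move=> /andP[dx _]; have x0 : (0 < x)%R by exact: lt_le_trans dx.
  apply/differentiable_continuous; rewrite -derivable1_diffP.
  by apply: derivable_powR; rewrite in_itv/= x0.
rewrite (FTC2_oc d1 dF cf) lee_fin powR1/=.
have : (0 < b^-1)%R by rewrite invr_gt0.
by lra.
Qed.


Let half_le (x e : R) : (2^-1 <= x)%R -> (0 <= e)%R -> (x `^ (- e) <= (2^-1) `^ (- e))%R.
Proof.
move=> x2 e0; have h0 : (0 < 2^-1 :> R)%R by rewrite invr_gt0.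
rewrite !powRN lef_pV2 ?posrE ?powR_gt0//; last exact: lt_le_trans x2.
by rewrite ge0_ler_powR// nnegrE ltW//; exact: lt_le_trans x2.
Qed.

(** After the reflection [v = 1 - u] the denominator is comparable with the larger of [v] and
    [d = 1 - s], so the integral near [v = 0] has size [d^(-b)]; the condition [0 < b < 1] makes
    both the part below [d] and the part above it of this size. *)
Lemma schur1D (a b : R) : (-1 < a)%R -> (0 < b < 1)%R ->
  exists2 C : R, (0 < C)%R & forall s : R, (0 <= s < 1)%R ->
  \int[mu]_(u in `]0%R, 1%R[) (u `^ a * (1 - u) `^ (- b) / (1 - s * u))%:E <=
  (C * (1 - s) `^ (- b))%:E.
Proof.
move=> a1 /andP[b0 b1].
have h0 : (0 < 2^-1 :> R)%R by rewrite invr_gt0.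
pose A : R := ((2^-1) `^ (- `|a|))%R; have A0 : (0 < A)%R by exact: powR_gt0.
have B0 : (0 < 1 - b)%R by lra.
have a10 : (0 < a + 1)%R by lra.
have t1 : (0 < 4 / (a + 1))%R by rewrite divr_gt0.
have t2 : (0 < A / (1 - b))%R by rewrite divr_gt0.
have t3 : (0 < A * ((2^-1) `^ (- b) / b))%R by rewrite mulr_gt0 ?divr_gt0 ?powR_gt0.
(* The three summands are the contributions of [g1], [g2] and [g3] below, each up to the factor
   [D = d^(-b)]. *)
exists (4 / (a + 1) + A / (1 - b) + A * ((2^-1) `^ (- b) / b))%R; first by lra.
move=> s /andP[s0 s1]; set d := (1 - s)%R.
have d0 : (0 < d)%R by rewrite subr_gt0.
have d1 : (d <= 1)%R by rewrite /d; lra.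
set D := (d `^ (- b))%R; have D0 : (0 < D)%R by exact: powR_gt0.
have D1 : (1 <= D)%R.
  have b11 : (1 `^ b = 1 :> R)%R by rewrite powR1.
  have : (d `^ b <= 1)%R by rewrite -b11 ge0_ler_powR// ?nnegrE ?(ltW b0) ?(ltW d0).
  by rewrite /D powRN -[in X in _ -> X](invr1 R) lef_pV2 ?posrE ?powR_gt0.
pose F (u : R) : \bar R := (u `^ a * (1 - u) `^ (- b) * (`|1 - s * u|)^-1)%:E.
have F0 x : 0 <= F x by rewrite lee_fin !mulr_ge0 ?powR_ge0// invr_ge0.
have mpow (f : R -> R) (e : R) : measurable_fun [set: R] f -> measurable_fun [set: R] (fun x : R => f x `^ e)%R.
  by move=> mf; exact: (measurableT_comp (measurable_powR e) mf).
have mid : measurable_fun [set: R] (fun x : R => x) by exact: measurable_id.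
have monem : measurable_fun [set: R] (fun x : R => 1 - x)%R by exact: measurable_funB.
have mF : measurable_fun [set: R] F.
  apply/measurable_EFinP; apply: measurable_funM.
    by apply: measurable_funM; apply: mpow.
  apply: measurable_funV; apply: measurableT_comp => //; apply: measurable_funB => //.
have -> : \int[mu]_(u in `]0%R, 1%R[) (u `^ a * (1 - u) `^ (- b) / (1 - s * u))%:E =
    \int[mu]_(u in `]0%R, 1%R[) F u.
  apply: eq_integral => u; rewrite inE/= in_itv/= => /andP[u0 u1]; rewrite /F ger0_norm//.
  by rewrite subr_ge0 mulr_ile1// ltW.
rewrite ge0_integral_onem//.
pose g2 : R -> \bar R := (fun v : R => (v `^ (- b))%:E) \_ (`]0%R, d[%classic : set R).
(* The interval starts at [d / 2] because the half-open interval starting at [d] would miss the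
   point [v = d]. *)
pose g3 : R -> \bar R := (fun v : R => (v `^ (- b - 1))%:E) \_ (`](d / 2)%R, 1%R]%classic : set R).
have mg2 : measurable_fun [set: R] g2.
  apply/(measurable_restrictT _ (measurable_itv _)); apply: measurable_funTS.
  by apply/measurable_EFinP; exact: mpow.
have mg3 : measurable_fun [set: R] g3.
  apply/(measurable_restrictT _ (measurable_itv _)); apply: measurable_funTS.
  by apply/measurable_EFinP; exact: mpow.
have g20 x : 0 <= g2 x by rewrite /g2 patchE; case: ifPn => // _; rewrite lee_fin powR_ge0.
have g30 x : 0 <= g3 x by rewrite /g3 patchE; case: ifPn => // _; rewrite lee_fin powR_ge0.
pose g1 (v : R) : \bar R := ((1 - v) `^ a)%:E.
have mg1 : measurable_fun [set: R] g1 by apply/measurable_EFinP; exact: mpow.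
have g10 x : 0 <= g1 x by rewrite lee_fin powR_ge0.
have c1 : 0 <= (4 * D)%:E by rewrite lee_fin mulr_ge0// ltW.
have c2 : 0 <= (A / d)%:E by rewrite lee_fin divr_ge0// ltW.
have c3 : 0 <= A%:E by rewrite lee_fin ltW.
have mI (g : R -> \bar R) : measurable_fun [set: R] g -> measurable_fun (`]0%R, 1%R[%classic : set R) g.
  exact: measurable_funTS.
apply: (@le_trans _ _ (\int[mu]_(v in `]0%R, 1%R[) ((4 * D)%:E * g1 v + (A / d)%:E * g2 v + A%:E * g3 v))).
  apply: ge0_le_integral => //.
  - by apply: mI; exact: (measurableT_comp mF).
  - apply: mI; apply: emeasurable_funD; last exact: emeasurable_funM.
    by apply: emeasurable_funD; exact: emeasurable_funM.
  move=> v /=; rewrite in_itv/= => /andP[v0 v1].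
  have cv0 : (0 < 1 - v)%R by rewrite subr_gt0.
  have den : (0 < 1 - s * (1 - v))%R.
    have := mulr_ge0 s0 (ltW v0); rewrite mulrBr mulr1; rewrite /d in d0; lra.
  rewrite /F ger0_norm ?(ltW den)// (_ : (1 - (1 - v) = v)%R); last by ring.
  have p20 : 0 <= (A / d)%:E * g2 v by exact: mule_ge0.
  have p30 : 0 <= A%:E * g3 v by exact: mule_ge0.
  have p10 : 0 <= (4 * D)%:E * g1 v by exact: mule_ge0.
  (* For [v >= 1/2] both [v^(-b)] and the inverse denominator are at most 2, and [D >= 1] brings in
     the factor [D]. Below 1/2 the power of [1 - v] is at most [A], and the denominator is at least
     [d] if [v < d] and at least [v] otherwise. *)
  have [v2|v2] := leP (2^-1)%R v.
    rewrite -addeA; apply: (@le_trans _ _ ((4 * D)%:E * g1 v)); last by rewrite leeDl// adde_ge0.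
    rewrite /g1 -EFinM lee_fin -mulrA mulrC ler_wpM2r ?powR_ge0//.
    apply: (@le_trans _ _ (2 * 2 * 1)%R); last by rewrite ler_pM// -natrM.
    rewrite mulr1 ler_pM ?powR_ge0 ?invr_ge0 ?(ltW den)//.
      rewrite (le_trans (half_le v2 (ltW b0)))// powRN -[leRHS]invrK lef_pV2 ?posrE ?powR_gt0//.
      by rewrite ger1_powR ?h0//=; lra.
    rewrite -[leRHS]invrK lef_pV2 ?posrE//.
    have := mulr_ge0 (ltW d0) (ltW cv0); rewrite /d; lra.
  have Av : ((1 - v) `^ a <= A)%R.
    apply: (@le_trans _ _ ((1 - v) `^ (- `|a|)))%R; last by apply: half_le => //; lra.
    apply: ger_powR; first by rewrite cv0 gerBl ltW.
    by rewrite lerNl -normrN ler_norm.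
  have [vd|vd] := ltP v d.
    apply: (@le_trans _ _ ((A / d)%:E * g2 v)).
      rewrite /g2 patchE ifT; last by rewrite inE/= in_itv/= v0.
      rewrite -EFinM lee_fin mulrAC ler_wpM2r ?powR_ge0// ler_pM ?powR_ge0 ?invr_ge0 ?(ltW den)//.
      rewrite lef_pV2 ?posrE//.
      by have := mulr_ge0 s0 (ltW v0); rewrite /d; lra.
    by rewrite addeAC leeDr// adde_ge0.
  apply: (@le_trans _ _ (A%:E * g3 v)); last by rewrite leeDr// adde_ge0.
  rewrite /g3 patchE ifT; last by rewrite inE/= in_itv/= (ltW v1) andbT; lra.
  rewrite -EFinM lee_fin powRD; last by rewrite (gt_eqF v0) implybT.
  rewrite powR_inv1 ?(ltW v0)// mulrA ler_pM ?mulr_ge0 ?powR_ge0 ?invr_ge0 ?(ltW den)//.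
    by rewrite ler_wpM2r ?powR_ge0.
  rewrite lef_pV2 ?posrE//.
  by have := mulr_ge0 (ltW d0) (ltW cv0); rewrite /d; lra.
have sub (B : set R) (g : R -> \bar R) : measurable B -> measurable_fun [set: R] (g \_ B) ->
    (forall x, 0 <= (g \_ B) x) ->
    \int[mu]_(x in `]0%R, 1%R[) (g \_ B) x <= \int[mu]_(x in B) g x.
  move=> mB mg gge; rewrite [leRHS]integral_mkcond; apply: ge0_subset_integral => //.
rewrite ge0_integralD//; last 4 first.
- by move=> v _; rewrite adde_ge0 ?mule_ge0.
- by apply: mI; apply: emeasurable_funD; exact: emeasurable_funM.
- by move=> v _; rewrite mule_ge0.
- by apply: mI; exact: emeasurable_funM.
rewrite ge0_integralD//; last 4 first.
- by move=> v _; rewrite mule_ge0.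
- by apply: mI; exact: emeasurable_funM.
- by move=> v _; rewrite mule_ge0.
- by apply: mI; exact: emeasurable_funM.
rewrite !ge0_integralZl//; [|exact: mI..].
rewrite !mulrDl !EFinD; apply: leeD; [apply: leeD|].
- rewrite /g1 -(@ge0_integral_onem (fun v => (v `^ a)%:E)); last 2 first.
  + by apply/measurable_EFinP; exact: mpow.
  + by move=> x; rewrite lee_fin powR_ge0.
  by rewrite integral_powR01// -EFinM lee_fin le_eqVlt; apply/orP; left; apply/eqP; ring.
- apply: (@le_trans _ _ ((A / d)%:E * \int[mu]_(v in `]0%R, d[) (v `^ (- b))%:E)).
    by rewrite lee_wpmul2l//; exact: sub.
  rewrite integral_powR_below//; last by lra.
  rewrite -EFinM lee_fin powRD; last by rewrite (gt_eqF d0) implybT.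
  rewrite powRr1 ?(ltW d0)// -/D (addrC (- b)%R) le_eqVlt; apply/orP; left; apply/eqP.
  by field; rewrite !gt_eqF.
- apply: (@le_trans _ _ (A%:E * \int[mu]_(v in `](d / 2)%R, 1%R]) (v `^ (- b - 1))%:E)).
    by rewrite lee_wpmul2l//; exact: sub.
  apply: (@le_trans _ _ (A%:E * ((d / 2) `^ (- b) / b)%:E)).
    by rewrite lee_wpmul2l// integral_powR_above//; apply/andP; split; lra.
  rewrite -EFinM lee_fin powRM ?(ltW d0) ?(ltW h0)// -/D le_eqVlt; apply/orP; left; apply/eqP.
  by field; rewrite gt_eqF.
Qed.

End schur.

(** * The positive kernel on the disc *)

Section kernel.
Context {R : realType}.
Local Notation mu := (@lebesgue_measure R).
Local Open Scope ereal_scope.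
Local Notation PD := (@toC R @^-1` (@pdisc R)).

Lemma dV_sigma_finite : sigma_finite setT (@dV R).
Proof.
pose F (n : nat) : set R := `](- n%:R)%R, n%:R]%classic.
exists (fun n => F n `*` F n) => [|n]; last first.
  have mF : measurable (F n) by exact: measurable_itv.
  split; first exact: measurableX.
  have Foo : mu (F n) < +oo.
    by rewrite /F lebesgue_measure_itv/=; case: ifP => _; rewrite // -EFinD ltry.
  rewrite (_ : @dV R (F n `*` F n) = mu (F n) * mu (F n)); last exact: product_measure1E.
  by rewrite lte_mul_pinfty// ge0_fin_numE.
apply/seteqP; split => // -[x y] _.
exists (Num.bound (`|x| + `|y|)) => //; rewrite /F; set n := Num.bound _.
have xn : (`|x| + `|y| < n%:R)%R by apply: archi_boundP; rewrite addr_ge0.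
have x0 := normr_ge0 x; have y0 := normr_ge0 y.
have : (`|x| < n%:R)%R by lra.
have : (`|y| < n%:R)%R by lra.
rewrite !ltr_norml => /andP[y1 /ltW y2] /andP[x1 /ltW x2].
by split; rewrite /= in_itv/= ?x1 ?x2 ?y1 ?y2.
Qed.

HB.instance Definition _ := Measure.copy (@dV R) ((@lebesgue_measure R) \x (@lebesgue_measure R)).
HB.instance Definition _ := Measure_isSigmaFinite.Build _ _ _ (@dV R) dV_sigma_finite.

Lemma measurable_PD : measurable PD.
Proof. by apply: measurable_discs; right. Qed.

Lemma PD_integralZl (k : R) (f : R * R -> \bar R) : measurable_fun PD f ->
  (forall x, 0 <= f x) -> (0 <= k)%R ->
  \int[@dV R]_(x in PD) (k%:E * f x) = k%:E * \int[@dV R]_(x in PD) f x.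
Proof.
by move=> mf f0 k0; apply: ge0_integralZl; [exact: measurable_PD|exact: mf|move=> x _; exact: f0|].
Qed.

Lemma measurable_mod : measurable_fun [set: R * R] (fun x : R * R => cabs (toC x)).
Proof. by apply: measurable_cabs; exact: cmeasurable_toC. Qed.

Lemma cmeasurable_chi (p : R) : cmeasurable [set: R * R] (fun x => chi p (toC x)).
Proof.
apply: cmeasurableM; first exact: cmeasurable_toC.
by apply: cmeasurable_real; apply: measurable_cabs_powR; exact: cmeasurable_toC.
Qed.

Lemma measurable_powR_comp d (T : measurableType d) (D : set T) (f : T -> R) (e : R) :
  measurable_fun D f -> measurable_fun D (fun x => f x `^ e)%R.
Proof. by move=> mf; exact: (measurableT_comp (measurable_powR e) mf). Qed.

Lemma cmeasurable_1Bmul (c : R[i]) : cmeasurable [set: R * R] (fun x => 1 - c * toC x)%R.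
Proof.
under eq_fun do rewrite -mulNr; apply: cmeasurableD; first exact: cmeasurable_cst.
by apply: cmeasurableM; [exact: cmeasurable_cst|exact: cmeasurable_toC].
Qed.

(** The angular integral is that of the Poisson kernel, [2 pi / (1 - (|c| r)^2)], which is at most
    [2 pi / (1 - |c| r)]; this leaves [schur1D]. The exponent [a - 1] becomes [a] through the area
    factor. *)
Lemma disc_kernel (a b : R) : (-1 < a)%R -> (0 < b < 1)%R ->
  exists2 C : R, (0 < C)%R & forall c : R[i], (cabs c < 1)%R ->
  \int[@dV R]_(x in PD) (cabs (toC x) `^ (a - 1) * (1 - cabs (toC x)) `^ (- b) /
     cabs (1 - c * toC x) ^+ 2)%:E <= (C * (1 - cabs c) `^ (- b))%:E.
Proof.
move=> a1 b01; have [C C0 HC] := schur1D a1 b01.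
have p0 : (0 < 2 * pi :> R)%R by rewrite mulr_gt0// pi_gt0.
exists (2 * pi * C)%R; first by rewrite mulr_gt0.
move=> c c1; have cc0 := cabs_ge0 c.
have dp : discs (@pdisc R) by right.
have mT := @cmeasurable_toC R.
rewrite ge0_polar_discs//; last 2 first.
- apply/measurable_EFinP; apply: measurable_funTS; apply: measurable_funM.
    apply: measurable_funM; apply: measurable_powR_comp; first exact: measurable_mod.
    by apply: measurable_funB => //; exact: measurable_mod.
  apply: measurable_funV; apply: measurable_funX; apply: measurable_cabs.
  exact: cmeasurable_1Bmul.
- by move=> x _; rewrite lee_fin !mulr_ge0 ?powR_ge0// invr_ge0 sqr_ge0.
have := HC (cabs c); rewrite cc0 c1 => /(_ isT) {}HC.
rewrite -mulrA EFinM; apply: (@le_trans _ _ ((2 * pi)%:E * \int[mu]_(u in `]0%R, 1%R[) (u `^ a * (1 - u) `^ (- b) / (1 - cabs c * u))%:E)); last first.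
  by rewrite lee_wpmul2l// lee_fin ltW.
have den (u : R) : (0 < u < 1)%R -> (0 < 1 - cabs c * u)%R.
  by move=> /andP[u0 u1]; rewrite subr_gt0 mulr_ilt1// ltW.
have mk : measurable_fun (`]0%R, 1%R[%classic : set R) (fun u : R => (u `^ a * (1 - u) `^ (- b) / (1 - cabs c * u))%:E).
  apply/measurable_EFinP; apply: measurable_funTS; apply: measurable_funM.
    by apply: measurable_funM; apply: measurable_powR_comp => //; exact: measurable_funB.
  by apply: measurable_funV; apply: measurable_funB => //; exact: measurable_funM.
rewrite -ge0_integralZl//; last 2 first.
- by move=> u /=; rewrite in_itv/= => /den /ltW u1; rewrite lee_fin !mulr_ge0 ?powR_ge0 ?invr_ge0.
- by rewrite lee_fin ltW.
apply: ge0_le_integral => //.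
- by move=> r /=; rewrite in_itv/= => /andP[r0 _]; rewrite mule_ge0 ?angE_ge0 ?lee_fin ?(ltW r0)// => x; rewrite lee_fin !mulr_ge0 ?powR_ge0// invr_ge0 sqr_ge0.
- apply: (measurable_angE_discs dp).
    apply/measurable_EFinP; apply: measurable_funTS; apply: measurable_funM.
      apply: measurable_funM; apply: measurable_powR_comp; first exact: measurable_mod.
      by apply: measurable_funB => //; exact: measurable_mod.
    apply: measurable_funV; apply: measurable_funX; apply: measurable_cabs.
    exact: cmeasurable_1Bmul.
  by move=> x _; rewrite lee_fin !mulr_ge0 ?powR_ge0// invr_ge0 sqr_ge0.
- exact: emeasurable_funM.
move=> r /=; rewrite in_itv/= => r01; have [r0 r1] := andP r01.
have crE : cabs (c * r%:C%C)%R = (cabs c * r)%R by rewrite cabsM cabs_real gtr0_norm.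
have cr1 : (cabs (c * r%:C%C)%R < 1)%R by rewrite crE -subr_gt0 den.
have k0 : (0 <= r `^ (a - 1) * (1 - r) `^ (- b))%R by rewrite mulr_ge0 ?powR_ge0.
have -> : angE (fun x => (cabs (toC x) `^ (a - 1) * (1 - cabs (toC x)) `^ (- b) / cabs (1 - c * toC x) ^+ 2)%:E) r =
    (r `^ (a - 1) * (1 - r) `^ (- b))%:E * (2 * pi / (1 - (cabs c * r) ^+ 2))%:E.
  rewrite -crE -integral_poisson// /angE.
  transitivity (\int[mu]_(t in polar_range) ((r `^ (a - 1) * (1 - r) `^ (- b))%:E * ((cabs (1 - c * r%:C%C * cis t)%R ^+ 2)^-1)%:E)).
    by apply: eq_integral => t _; rewrite toC_polar cabs_polar gtr0_norm// mulrA EFinM.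
  apply: ge0_integralZl => //.
  - exact: measurable_polar_range.
  - apply/measurable_EFinP; apply: measurable_funV; apply: measurable_funX; apply: measurable_cabs.
    apply: (cintegrable_cmeasurable (ccont_cintegrable _)).
    under eq_fun do rewrite -mulNr.
    by apply: ccontD; [exact: ccont_cst|apply: ccontM; [exact: ccont_cst|exact: ccont_cis]].
  - by move=> t _; rewrite lee_fin invr_ge0 sqr_ge0.
rewrite -!EFinM lee_fin.
have ra : (r `^ a = r `^ (a - 1) * r)%R.
  rewrite -[X in (_ = _ * X)%R](powRr1 (ltW r0)) -powRD; last by rewrite (gt_eqF r0) implybT.
  by congr (_ `^ _)%R; ring.
have d0 := den r r01.
have s0 : (0 <= cabs c * r)%R by rewrite mulr_ge0// ltW.
rewrite ra; set s := (cabs c * r)%R in s0 d0 *.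
have le1 : ((1 - s ^+ 2)^-1 <= (1 - s)^-1)%R.
  rewrite lef_pV2 ?posrE//; last by rewrite subr_gt0 expr_lt1// -subr_gt0.
  by rewrite lerD2l lerN2 expr2 ler_piMl// ltW// -subr_gt0.
move: (r `^ (a - 1))%R ((1 - r) `^ (- b))%R k0 le1 => X Y k0 le1.
have := ler_wpM2l (mulr_ge0 (mulr_ge0 k0 (ltW p0)) (ltW r0)) le1.
rewrite (_ : (X * Y * (2 * pi / (1 - s ^+ 2)) * r = X * Y * (2 * pi) * r * (1 - s ^+ 2)^-1)%R); last by ring.
by move/le_trans; apply; rewrite le_eqVlt; apply/orP; left; apply/eqP; ring.
Qed.

Lemma measurable_integral_fst (f : (R * R) * (R * R) -> \bar R) :
  measurable_fun [set: (R * R) * (R * R)] f -> (forall x, 0 <= f x) ->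
  measurable_fun PD (fun z => \int[@dV R]_(w in PD) f (z, w)).
Proof.
move=> mf f0; apply: measurable_funTS.
pose g (x : (R * R) * (R * R)) := f x * (\1_PD x.2)%:E.
have mg : measurable_fun [set: (R * R) * (R * R)] g.
  apply: emeasurable_funM => //; apply/measurable_EFinP.
  have ms : measurable_fun [set: (R * R) * (R * R)] (fun x : (R * R) * (R * R) => x.2) by exact: measurable_snd.
  have mi : measurable_fun [set: R * R] (\1_PD : R * R -> R).
    by apply: measurable_indic; exact: measurable_PD.
  exact: (measurableT_comp mi ms).
rewrite (_ : (fun z => _) = fun z => \int[@dV R]_w g (z, w)).
  apply: (measurable_fun_fubini_tonelli_F (m2 := @dV R) g) => // x.
  by rewrite mule_ge0// lee_fin.
apply/funext => z; rewrite integral_mkcond; apply: eq_integral => w _.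
by rewrite patchE /g indicE/=; case: ifPn => _; rewrite ?mule1 ?mule0.
Qed.

(** By [kernel_bound] and [|chi_p w| = |w|^(p - 1)], this majorises, up to a constant, the truncated
    sums of [kappa_k r^k e_k(z) (e_k (chi_p w))^*]. *)
Definition kern (p r : R) (m : nat) (z w : R[i]) : R :=
  ((cabs z * cabs w `^ (p - 1)) `^ (- m%:R) / cabs (1 - r%:C%C * z * (chi p w)^*%C) ^+ 2)%R.

(** Schur's test with the two norms kept additive: the scale [T] is left free so that the
    coefficient of the second integral can later be made as small as wanted. The constant does not
    depend on [r]. *)
Lemma schur_bilinear (p : R) (m : nat) : (1 < p)%R -> (p * m%:R < 2)%R ->
  exists2 C : R, (0 < C)%R & forall (A B : R * R -> R) (r T : R),
    measurable_fun [set: R * R] A -> measurable_fun [set: R * R] B ->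
    (forall x, 0 <= A x)%R -> (forall x, 0 <= B x)%R -> (0 <= r <= 1)%R -> (0 < T)%R ->
    \int[@dV R]_(z in PD) \int[@dV R]_(w in PD) (kern p r m (toC z) (toC w) * A w * B z)%:E <=
    (C * T `^ p)%:E * \int[@dV R]_(w in PD) (A w `^ p)%:E +
    (C * T `^ (- (p / (p - 1))))%:E * \int[@dV R]_(z in PD) (B z `^ (p / (p - 1)))%:E.
Proof.
move=> p1 pm; set q := (p / (p - 1))%R.
have p0 : (0 < p)%R by lra.
have p10 : (0 < p - 1)%R by lra.
have q0 : (0 < q)%R by rewrite divr_gt0.
have pq : (p^-1 + q^-1 = 1)%R by rewrite /q; field; rewrite !gt_eqF.
have q1 : (1 < q)%R by rewrite /q ltr_pdivlMr//; lra.
pose bp : R := (p^-1)%R; pose bq : R := (q^-1)%R.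
have bp0 : (0 < bp)%R by rewrite invr_gt0.
have bq0 : (0 < bq)%R by rewrite invr_gt0.
have bp1 : (bp < 1)%R by move: pq; rewrite -/bp -/bq; lra.
have bq1 : (bq < 1)%R by move: pq; rewrite -/bp -/bq; lra.
(* Multiplied by [p - 1] this is [p m < 2]. It gives convergence at 0 of the integral in [w], as
   [p m < 2] does for the integral in [z]. *)
have mq : (m%:R * q < 2 * q - 2)%R.
  rewrite -(ltr_pM2r p10) (_ : m%:R * q * (p - 1) = p * m%:R)%R.
    by rewrite (_ : (2 * q - 2) * (p - 1) = 2)%R// /q; field; rewrite gt_eqF.
  by rewrite /q; field; rewrite gt_eqF.
have a1 : (-1 < 1 - m%:R * p)%R by rewrite [(m%:R * p)%R]mulrC; lra.
have a2 : (-1 < 2 * q - 3 - m%:R * q)%R by lra.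
have [|C1 C10 HC1] := @disc_kernel _ bq a1; first by rewrite bq0.
have [|C2 C20 HC2] := @disc_kernel _ bp a2; first by rewrite bp0.
exists (C1 + (q - 1) * C2)%R; first by rewrite addr_gt0// mulr_gt0// subr_gt0.
move=> A B r T mA mB A0 B0 /andP[r0 r1] T0.
pose S (x : R * R) := cabs (toC x); pose W (x : R * R) := (S x `^ (p - 1))%R.
pose k2 (x : (R * R) * (R * R)) := ((cabs (1 - r%:C%C * toC x.1 * (chi p (toC x.2))^*%C) ^+ 2)^-1)%R.
pose E1 (x : (R * R) * (R * R)) := (T `^ p * A x.2 `^ p * (1 - W x.2) `^ bq *
  (S x.1 `^ (- (m%:R * p)) * (1 - S x.1) `^ (- bq) * k2 x))%R.
pose E2 (x : (R * R) * (R * R)) := (T `^ (- q) * B x.1 `^ q * (1 - S x.1) `^ bp *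
  (W x.2 `^ (- (m%:R * q)) * (1 - W x.2) `^ (- bp) * k2 x))%R.
have k20 x : (0 <= k2 x)%R by rewrite invr_ge0 sqr_ge0.
have E10 x : (0 <= E1 x)%R by rewrite !mulr_ge0 ?powR_ge0.
have E20 x : (0 <= E2 x)%R by rewrite !mulr_ge0 ?powR_ge0.
have mfst : measurable_fun [set: (R * R) * (R * R)] (fun x : (R * R) * (R * R) => x.1) by exact: measurable_fst.
have msnd : measurable_fun [set: (R * R) * (R * R)] (fun x : (R * R) * (R * R) => x.2) by exact: measurable_snd.
have mS1 : measurable_fun [set: (R * R) * (R * R)] (fun x : (R * R) * (R * R) => S x.1).
  exact: (measurableT_comp measurable_mod mfst).
have mS2 : measurable_fun [set: (R * R) * (R * R)] (fun x : (R * R) * (R * R) => S x.2).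
  exact: (measurableT_comp measurable_mod msnd).
have mW2 : measurable_fun [set: (R * R) * (R * R)] (fun x : (R * R) * (R * R) => W x.2).
  exact: measurable_powR_comp.
have mk2 : measurable_fun [set: (R * R) * (R * R)] k2.
  apply: measurable_funV; apply: measurable_funX; apply: measurable_cabs.
  under eq_fun do rewrite -mulNr.
  apply: cmeasurableD; first exact: cmeasurable_cst.
  apply: cmeasurableM.
    under eq_fun do rewrite -mulNr; apply: cmeasurableM; first exact: cmeasurable_cst.
    by apply: (cmeasurable_comp measurableT _ (@cmeasurable_toC R) mfst).
  apply: cmeasurable_conj.
  by apply: (cmeasurable_comp measurableT _ (cmeasurable_chi p) msnd).
have mE1 : measurable_fun [set: (R * R) * (R * R)] E1.
  apply: measurable_funM.
    apply: measurable_funM; last by apply: measurable_powR_comp; exact: measurable_funB.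
    apply: measurable_funM => //; apply: measurable_powR_comp; exact: (measurableT_comp mA msnd).
  apply: measurable_funM => //; apply: measurable_funM; apply: measurable_powR_comp => //.
  exact: measurable_funB.
have mE2 : measurable_fun [set: (R * R) * (R * R)] E2.
  apply: measurable_funM.
    apply: measurable_funM; last by apply: measurable_powR_comp; exact: measurable_funB.
    apply: measurable_funM => //; apply: measurable_powR_comp; exact: (measurableT_comp mB mfst).
  apply: measurable_funM => //; apply: measurable_funM; apply: measurable_powR_comp => //.
  exact: measurable_funB.
have mpair z : measurable_fun [set: R * R] (fun w : R * R => (z, w) : (R * R) * (R * R)) by apply: measurable_fun_pair.
have W01 w : PD w -> (0 < W w < 1)%R.
  by move=> /andP[w0 w1]; rewrite powR_gt0//= powR_lt1 ?cabs_ge0.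
have young z w : PD z -> PD w ->
    (kern p r m (toC z) (toC w) * A w * B z <= E1 (z, w) + E2 (z, w))%R.
  move=> /andP[z0 z1] wD; have /andP[u0 u1] := W01 w wD.
  rewrite -[kern p r m (toC z) (toC w)]/((S z * W w) `^ (- m%:R) * k2 (z, w))%R.
  rewrite -[E1 (z, w)]/(T `^ p * A w `^ p * (1 - W w) `^ bq *
    (S z `^ (- (m%:R * p)) * (1 - S z) `^ (- bq) * k2 (z, w)))%R.
  rewrite -[E2 (z, w)]/(T `^ (- q) * B z `^ q * (1 - S z) `^ bp *
    (W w `^ (- (m%:R * q)) * (1 - W w) `^ (- bp) * k2 (z, w)))%R.
  move: (k2 (z, w)) (k20 (z, w)) => k k0; move: (W w) u0 u1 => u u0 u1.
  rewrite -/(S z) in z0 z1 *; move: (S z) z0 z1 => s s0 s1.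
  (* The Schur weight, put into one factor and taken out of the other. Its exponent [1 / (p q)]
     turns into [1 / q] in the [p]-th power and into [1 / p] in the [q]-th, both of which lie in the
     range allowed by [disc_kernel]. *)
  pose om : R := (((1 - u) / (1 - s)) `^ (bp * bq))%R.
  have v0 : (0 < 1 - u)%R by rewrite subr_gt0.
  have t0 : (0 < 1 - s)%R by rewrite subr_gt0.
  have om0 : (0 < om)%R by rewrite powR_gt0// divr_gt0.
  (* The integrand is [X Y k], and Young's inequality bounds it by [X^p k + Y^q k], which are [E1]
     and [E2]; the factors [1 / p] and [1 / q] are dropped. *)
  pose X := (T * A w * s `^ (- m%:R) * om)%R.
  pose Y := (T^-1 * B z * u `^ (- m%:R) * om^-1)%R.
  have X0 : (0 <= X)%R by rewrite !mulr_ge0 ?powR_ge0// ltW.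
  have Y0 : (0 <= Y)%R by rewrite !mulr_ge0 ?powR_ge0// invr_ge0 ltW.
  have XY : ((s * u) `^ (- m%:R) * k * A w * B z = X * Y * k)%R.
    rewrite powRM ?ltW// /X /Y; field; by rewrite !gt_eqF.
  rewrite XY.
  have omp : (om `^ p = (1 - u) `^ bq * (1 - s) `^ (- bq))%R.
    rewrite /om -powRrM mulrAC /bp mulVf ?gt_eqF// mul1r powRM ?invr_ge0 ?ltW//.
    by congr (_ * _)%R; rewrite -powR_inv1 ?ltW// -powRrM mulN1r.
  have omq : (om^-1 `^ q = (1 - s) `^ bp * (1 - u) `^ (- bp))%R.
    rewrite /om -powRN -powRrM mulNr -mulrA /bq mulVf ?gt_eqF// mulr1 powRM ?invr_ge0 ?ltW//.
    rewrite mulrC; congr (_ * _)%R.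
    by rewrite -powR_inv1 ?ltW// -powRrM mulrNN mul1r.
  have Xp : (X `^ p = T `^ p * A w `^ p * (1 - u) `^ bq * (s `^ (- (m%:R * p)) * (1 - s) `^ (- bq)))%R.
    rewrite /X !powRM ?mulr_ge0 ?powR_ge0 ?(ltW T0) ?(ltW om0)// omp -powRrM mulNr; ring.
  have Yq : (Y `^ q = T `^ (- q) * B z `^ q * (1 - s) `^ bp * (u `^ (- (m%:R * q)) * (1 - u) `^ (- bp)))%R.
    rewrite /Y !powRM ?mulr_ge0 ?powR_ge0 ?invr_ge0 ?(ltW T0) ?(ltW om0)// omq -powRrM mulNr.
    have -> : (T^-1 `^ q = T `^ (- q))%R by rewrite -(powR_inv1 (ltW T0)) -powRrM mulN1r.
    by ring.
  rewrite [leRHS](_ : _ = (X `^ p + Y `^ q) * k)%R; last by rewrite Xp Yq; ring.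
  rewrite ler_wpM2r//.
  rewrite (le_trans (conjugate_powR X0 Y0 p0 q0 pq))// lerD// ler_piMr ?powR_ge0//; exact: ltW.
have mE1' z : measurable_fun PD (fun w => (E1 (z, w))%:E).
  by apply/measurable_EFinP; apply: measurable_funTS; exact: (measurableT_comp mE1 (mpair z)).
have mE2' z : measurable_fun PD (fun w => (E2 (z, w))%:E).
  by apply/measurable_EFinP; apply: measurable_funTS; exact: (measurableT_comp mE2 (mpair z)).
have mEE1 : measurable_fun [set: (R * R) * (R * R)] (EFin \o E1) by exact/measurable_EFinP.
have mEE2 : measurable_fun [set: (R * R) * (R * R)] (EFin \o E2) by exact/measurable_EFinP.
pose KAB (x : (R * R) * (R * R)) := (kern p r m (toC x.1) (toC x.2) * A x.2 * B x.1)%R.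
have KAB0 x : (0 <= KAB x)%R by rewrite !mulr_ge0 ?powR_ge0// invr_ge0 sqr_ge0.
have mKAB : measurable_fun [set: (R * R) * (R * R)] KAB.
  apply: measurable_funM; last exact: (measurableT_comp mB mfst).
  apply: measurable_funM; last exact: (measurableT_comp mA msnd).
  by apply: measurable_funM => //; apply: measurable_powR_comp; exact: measurable_funM.
have mEKAB : measurable_fun [set: (R * R) * (R * R)] (EFin \o KAB) by exact/measurable_EFinP.
have mPD := measurable_PD.
apply: (@le_trans _ _ (\int[@dV R]_(z in PD) (\int[@dV R]_(w in PD) (E1 (z, w))%:E + \int[@dV R]_(w in PD) (E2 (z, w))%:E))).
  apply: ge0_le_integral => //.
  - by move=> z _; apply: integral_ge0 => w _; rewrite lee_fin; exact: (KAB0 (z, w)).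
  - exact: (measurable_integral_fst mEKAB).
  - by apply: emeasurable_funD; [exact: (measurable_integral_fst mEE1)|exact: (measurable_integral_fst mEE2)].
  move=> z zD.
  have <- : \int[@dV R]_(w in PD) ((E1 (z, w))%:E + (E2 (z, w))%:E) =
      \int[@dV R]_(w in PD) (E1 (z, w))%:E + \int[@dV R]_(w in PD) (E2 (z, w))%:E.
    apply: ge0_integralD; [exact: mPD| |exact: mE1'| |exact: mE2'].
      by move=> w _; rewrite lee_fin.
    by move=> w _; rewrite lee_fin.
  apply: ge0_le_integral => //.
  - by move=> w _; rewrite lee_fin; exact: (KAB0 (z, w)).
  - by apply/measurable_EFinP; apply: measurable_funTS; exact: (measurableT_comp mKAB (mpair z)).
  - exact: (emeasurable_funD (mE1' z) (mE2' z)).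
  - by move=> w wD; rewrite -EFinD lee_fin; exact: young.
have -> : \int[@dV R]_(z in PD) (\int[@dV R]_(w in PD) (E1 (z, w))%:E + \int[@dV R]_(w in PD) (E2 (z, w))%:E) =
    \int[@dV R]_(z in PD) \int[@dV R]_(w in PD) (E1 (z, w))%:E + \int[@dV R]_(z in PD) \int[@dV R]_(w in PD) (E2 (z, w))%:E.
  apply: ge0_integralD; [exact: mPD| |exact: (measurable_integral_fst mEE1)| |exact: (measurable_integral_fst mEE2)].
    by move=> z _; apply: integral_ge0 => w _; rewrite lee_fin.
  by move=> z _; apply: integral_ge0 => w _; rewrite lee_fin.
have S01 z : PD z -> (0 < S z < 1)%R by [].
have pow_le1 (x y e : R) : (0 < x)%R -> (x <= y)%R -> (0 < e)%R -> (x `^ e * y `^ (- e) <= 1)%R.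
  move=> x0 xy e0; rewrite powRN ler_pdivrMr ?mul1r; last by apply: powR_gt0; exact: lt_le_trans xy.
  by rewrite ge0_ler_powR ?nnegrE ?(ltW e0) ?(ltW x0)// (le_trans (ltW x0)).
have mk2z z : measurable_fun [set: R * R] (fun w => k2 (z, w)) by exact: (measurableT_comp mk2 (mpair z)).
have mS : measurable_fun [set: R * R] S by exact: measurable_mod.
have mWw : measurable_fun [set: R * R] W by exact: measurable_powR_comp.
have mBm (f : R * R -> R) : measurable_fun [set: R * R] f -> measurable_fun [set: R * R] (fun x => 1 - f x)%R.
  by move=> mf; exact: measurable_funB.
apply: leeD.
  have -> : \int[@dV R]_(z in PD) \int[@dV R]_(w in PD) (E1 (z, w))%:E =
      \int[@dV R]_(w in PD) \int[@dV R]_(z in PD) (E1 (z, w))%:E.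
    apply: (ge0_tonelli_set (@dV R) (@dV R) mPD mPD (f := EFin \o E1)) => //.
      by apply: measurable_funTS.
    by move=> x y _ _; rewrite lee_fin.
  rewrite -ge0_integralZl//; last 3 first.
  - by apply/measurable_EFinP; apply: measurable_funTS; exact: measurable_powR_comp.
  - by move=> x _; rewrite lee_fin powR_ge0.
  - by rewrite lee_fin mulr_ge0 ?powR_ge0// addr_ge0 ?mulr_ge0 ?subr_ge0 ?ltW.
  apply: ge0_le_integral => //.
  - by move=> x _; apply: integral_ge0 => y _; rewrite lee_fin.
  - have := measurable_integral_fst (f := fun x => (E1 (x.2, x.1))%:E); apply.
      have msw : measurable_fun [set: (R * R) * (R * R)] (fun x : (R * R) * (R * R) => (x.2, x.1) : (R * R) * (R * R)).
        exact: measurable_fun_pair.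
      exact: (measurableT_comp mEE1 msw).
    by move=> x; rewrite lee_fin.
  - by apply: emeasurable_funM => //; apply/measurable_EFinP; apply: measurable_funTS; exact: measurable_powR_comp.
  move=> w wD; have /andP[u0 u1] := W01 w wD.
  pose c : R[i] := (r%:C%C * (chi p (toC w))^*%C)%R.
  have cE : cabs c = (r * W w)%R by rewrite /c cabsM cabs_real cabs_conj cabs_chi// ger0_norm.
  (* Since [r <= 1], the factor [(1 - |c|)^(- 1 / q)] produced by [disc_kernel] is compensated by
     the weight [(1 - W w)^(1 / q)], whatever [r] is. *)
  have cu : (cabs c <= W w)%R by rewrite cE ler_piMl// ltW.
  have c1 : (cabs c < 1)%R by exact: le_lt_trans u1.
  have kc0 : (0 <= T `^ p * A w `^ p * (1 - W w) `^ bq)%R by rewrite !mulr_ge0 ?powR_ge0.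
  have -> : \int[@dV R]_(z in PD) (E1 (z, w))%:E = (T `^ p * A w `^ p * (1 - W w) `^ bq)%:E *
     \int[@dV R]_(x in PD) (cabs (toC x) `^ (1 - m%:R * p - 1) * (1 - cabs (toC x)) `^ (- bq) / cabs (1 - c * toC x) ^+ 2)%:E.
    rewrite -ge0_integralZl//; last 2 first.
    - apply/measurable_EFinP; apply: measurable_funTS; apply: measurable_funM.
        by apply: measurable_funM; apply: measurable_powR_comp => //; exact: mBm.
      apply: measurable_funV; apply: measurable_funX; apply: measurable_cabs.
      exact: cmeasurable_1Bmul.
    - by move=> x _; rewrite lee_fin !mulr_ge0 ?powR_ge0// invr_ge0 sqr_ge0.
    apply: eq_integral => z _; rewrite -EFinM; congr (_ * (_ `^ _ * _ * (cabs (1 - _) ^+ 2)^-1))%:E.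
      by rewrite addrAC subrr add0r.
    by rewrite /c mulrAC.
  apply: (le_trans (lee_wpmul2l _ (HC1 c c1))); first by rewrite lee_fin.
  rewrite -!EFinM lee_fin.
  have := pow_le1 (1 - W w)%R (1 - cabs c)%R bq; rewrite subr_gt0 lerD2l lerN2 => /(_ u1 cu bq0) le1.
  have TA : (0 <= C1 * (T `^ p * A w `^ p))%R by rewrite !mulr_ge0 ?powR_ge0// ltW.
  rewrite [leLHS](_ : _ = C1 * (T `^ p * A w `^ p) * ((1 - W w) `^ bq * (1 - cabs c) `^ (- bq)))%R; last by ring.
  apply: (le_trans (ler_wpM2l TA le1)); rewrite mulr1 mulrA -!mulrA ler_wpM2r ?mulr_ge0 ?powR_ge0//.
  by rewrite lerDl mulr_ge0 ?subr_ge0 ?ltW.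
rewrite -ge0_integralZl//; last 3 first.
- by apply/measurable_EFinP; apply: measurable_funTS; exact: measurable_powR_comp.
- by move=> x _; rewrite lee_fin powR_ge0.
- by rewrite lee_fin mulr_ge0 ?powR_ge0// addr_ge0 ?mulr_ge0 ?subr_ge0 ?ltW.
apply: ge0_le_integral => //.
- by move=> x _; apply: integral_ge0 => y _; rewrite lee_fin.
- exact: (measurable_integral_fst mEE2).
- by apply: emeasurable_funM => //; apply/measurable_EFinP; apply: measurable_funTS; exact: measurable_powR_comp.
move=> z zD; have /andP[s0 s1] := S01 z zD.
pose c : R[i] := (r%:C%C * (toC z)^*%C)%R.
have cE : cabs c = (r * S z)%R by rewrite /c cabsM cabs_real cabs_conj ger0_norm.
have cu : (cabs c <= S z)%R by rewrite cE ler_piMl// ltW.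
have c1 : (cabs c < 1)%R by exact: le_lt_trans s1.
have kc0 : (0 <= T `^ (- q) * B z `^ q * (1 - S z) `^ bp)%R by rewrite !mulr_ge0 ?powR_ge0.
have q1' : (0 <= q - 1)%R by rewrite subr_ge0 ltW.
(* Here [w] enters through [chi_p w] only. [ge0_integral_chi] replaces [chi_p w] by a plain variable
   at the price of [eta_q], which adds [2 q - 4] to the exponent of the modulus. *)
pose F (w : R[i]) : \bar R := (cabs w `^ (- (m%:R * q)) * (1 - cabs w) `^ (- bp) / cabs (1 - r%:C%C * toC z * w^*%C) ^+ 2)%:E.
have F0 w : 0 <= F w by rewrite lee_fin !mulr_ge0 ?powR_ge0// invr_ge0 sqr_ge0.
have mF (g : R * R -> R[i]) : cmeasurable [set: R * R] g -> measurable_fun PD (fun x => F (g x)).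
  move=> mg; apply/measurable_EFinP; apply: measurable_funTS; apply: measurable_funM.
    apply: measurable_funM; apply: measurable_powR_comp; first exact: measurable_cabs.
    by apply: mBm; exact: measurable_cabs.
  apply: measurable_funV; apply: measurable_funX; apply: measurable_cabs.
  under eq_fun do rewrite -mulNr; apply: cmeasurableD; first exact: cmeasurable_cst.
  by apply: cmeasurableM; [exact: cmeasurable_cst|exact: cmeasurable_conj].
have -> : \int[@dV R]_(w in PD) (E2 (z, w))%:E = (T `^ (- q) * B z `^ q * (1 - S z) `^ bp)%:E *
    \int[@dV R]_(w in PD) F (chi p (toC w)).
  have mFc : measurable_fun PD (fun w => F (chi p (toC w))) by apply: mF; exact: cmeasurable_chi.
  rewrite -(PD_integralZl mFc (fun w => F0 _) kc0).
  by apply: eq_integral => w _; rewrite /F cabs_chi// -EFinM.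
rewrite ge0_integral_chi//; last 2 first.
- by apply: mF; exact: cmeasurable_toC.
- by apply: mF; exact: cmeasurable_chi.
have -> : \int[@dV R]_(x in PD) (F (toC x) * (eta_q (p / (p - 1)) (toC x))%:E) = (q - 1)%:E *
   \int[@dV R]_(x in PD) (cabs (toC x) `^ (2 * q - 3 - m%:R * q - 1) * (1 - cabs (toC x)) `^ (- bp) / cabs (1 - c * toC x) ^+ 2)%:E.
  rewrite -ge0_integralZl//; last 2 first.
  - apply/measurable_EFinP; apply: measurable_funTS; apply: measurable_funM.
      by apply: measurable_funM; apply: measurable_powR_comp => //; exact: mBm.
    apply: measurable_funV; apply: measurable_funX; apply: measurable_cabs.
    exact: cmeasurable_1Bmul.
  - by move=> x _; rewrite lee_fin !mulr_ge0 ?powR_ge0// invr_ge0 sqr_ge0.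
  apply: eq_integral => x; rewrite inE => /andP[x0 x1].
  rewrite /F /eta_q -/q -!EFinM; congr _%:E.
  have -> : cabs (1 - r%:C%C * toC z * (toC x)^*%C)%R = cabs (1 - c * toC x)%R.
    rewrite -[RHS]cabs_conj; congr cabs; rewrite /c.
    have cM (a b : R[i]) : ((a * b)^*%C = a^*%C * b^*%C)%R by exact: rmorphM.
    have c1B (a : R[i]) : ((1 - a)^*%C = 1 - a^*%C)%R by rewrite [LHS]rmorphB rmorph1.
    rewrite c1B !cM conjcK; congr (1 - _ * _ * _)%R.
    by apply/esym; exact: conjc_real.
  rewrite (_ : (2 * q - 3 - m%:R * q - 1 = - (m%:R * q) + (2 * q - 4))%R); last by ring.
  rewrite [(_ `^ (- (m%:R * q) + _))%R]powRD; last by rewrite (gt_eqF x0) implybT.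
  by ring.
rewrite muleA -EFinM.
apply: (le_trans (lee_wpmul2l _ (HC2 c c1))); first by rewrite lee_fin mulr_ge0.
rewrite -!EFinM lee_fin.
have := pow_le1 (1 - S z)%R (1 - cabs c)%R bp; rewrite subr_gt0 lerD2l lerN2 => /(_ s1 cu bp0) le1.
have TA : (0 <= (q - 1) * C2 * (T `^ (- q) * B z `^ q))%R by rewrite !mulr_ge0 ?powR_ge0// ltW.
rewrite [leLHS](_ : _ = (q - 1) * C2 * (T `^ (- q) * B z `^ q) * ((1 - S z) `^ bp * (1 - cabs c) `^ (- bp)))%R; last by ring.
apply: (le_trans (ler_wpM2l TA le1)); rewrite mulr1 [leRHS](_ : _ = (C1 + (q - 1) * C2) * (T `^ (- q) * B z `^ q))%R; last by ring.
by rewrite ler_wpM2r ?mulr_ge0 ?powR_ge0// lerDr ltW.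
Qed.

End kernel.

(** * The a priori estimate *)

Section disc_integrability.
Context {R : realType}.
Local Notation mu := (@lebesgue_measure R).
Local Notation PD := (@toC R @^-1` (@pdisc R)).

Lemma PD_powR_lty (e : R) : e < 2 ->
  (\int[@dV R]_(x in PD) (cabs (toC x) `^ (- e))%:E < +oo)%E.
Proof.
move=> e2; have dp : discs (@pdisc R) by right.
have p0 : 0 < 2 * pi :> R by rewrite mulr_gt0// pi_gt0.
have mf : measurable_fun PD (fun x => (cabs (toC x) `^ (- e))%:E).
  by apply/measurable_EFinP; apply: measurable_funTS; apply: measurable_powR_comp; exact: measurable_mod.
rewrite ge0_polar_discs//; last by move=> x _; rewrite lee_fin powR_ge0.
have -> : (\int[mu]_(r in `]0%R, 1%R[) (angE (fun x => (cabs (toC x) `^ (- e))%:E) r * r%:E) =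
    \int[mu]_(r in `]0%R, 1%R[) ((2 * pi)%:E * (r `^ (1 - e))%:E))%E.
  apply: eq_integral => r; rewrite inE/= in_itv/= => /andP[r0 r1].
  have -> : angE (fun x => (cabs (toC x) `^ (- e))%:E) r = ((r `^ (- e))%:E * (2 * pi)%:E)%E.
    rewrite -polar_range_measure /angE.
    transitivity (\int[mu]_(t in polar_range) (r `^ (- e))%:E)%E.
      by apply: eq_integral => t _; rewrite toC_polar cabs_polar gtr0_norm.
    by apply: integral_cst; exact: measurable_polar_range.
  rewrite -!EFinM; congr _%:E.
  rewrite [1 - e]addrC powRD; last by rewrite (gt_eqF r0) implybT.
  by rewrite powRr1 ?(ltW r0)//; ring.
rewrite ge0_integralZl//; last 3 first.
- by apply/measurable_EFinP; apply: measurable_funTS; exact: measurable_powR.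
- by move=> x _; rewrite lee_fin powR_ge0.
- by rewrite lee_fin ltW.
rewrite integral_powR01; last by lra.
by rewrite -EFinM ltry.
Qed.

Lemma PD_le_lty (f : R * R -> R) (K e : R) : measurable_fun [set: R * R] f ->
  (forall x, 0 <= f x) -> e < 2 -> (forall x, PD x -> f x <= K * cabs (toC x) `^ (- e)) ->
  (\int[@dV R]_(x in PD) (f x)%:E < +oo)%E.
Proof.
move=> mf f0 e2 fK.
apply: (@le_lt_trans _ _ (\int[@dV R]_(x in PD) (`|K|%:E * (cabs (toC x) `^ (- e))%:E))%E).
  apply: ge0_le_integral; [exact: measurable_PD|by move=> x _; rewrite lee_fin| | |].
  - by apply/measurable_EFinP; exact: measurable_funTS.
  - apply/measurable_EFinP; apply: measurable_funTS; apply: measurable_funM => //.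
    by apply: measurable_powR_comp; exact: measurable_mod.
  - move=> x xD; rewrite -EFinM lee_fin (le_trans (fK _ xD))// ler_wpM2r ?powR_ge0//.
    exact: ler_norm.
rewrite PD_integralZl//; last 2 first.
- by apply/measurable_EFinP; apply: measurable_funTS; apply: measurable_powR_comp; exact: measurable_mod.
- by move=> x; rewrite lee_fin powR_ge0.
by rewrite lte_mul_pinfty// PD_powR_lty.
Qed.

Lemma PD_cintegrable (F : R * R -> R[i]) (K e : R) : cmeasurable [set: R * R] F ->
  e < 2 -> (forall x, PD x -> cabs (F x) <= K * cabs (toC x) `^ (- e)) ->
  cintegrable (@dV R) PD F.
Proof.
move=> mF e2 FK; have mPD := @measurable_PD R.
apply: cintegrable_lty => //; first exact: cmeasurableS mF.
by apply: (PD_le_lty _ _ e2 FK); [exact: measurable_cabs|move=> x; exact: cabs_ge0].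
Qed.

Lemma cabs_mono m k (z : R[i]) : pdisc z -> cabs (mono m k z) <= cabs z `^ (- m%:R).
Proof.
move=> /andP[z0 z1]; rewrite /mono cabsM cabsV !cabsX powRN powR_mulrn ?cabs_ge0//.
by rewrite ler_piMl ?invr_ge0 ?exprn_ge0 ?cabs_ge0// exprn_ile1 ?cabs_ge0// ltW.
Qed.

Lemma cabs_mono_sum m N (c : nat -> R[i]) z : pdisc z ->
  cabs (\sum_(k < N) c k * mono m k z) <= (\sum_(k < N) cabs (c k)) * cabs z `^ (- m%:R).
Proof.
move=> zD; rewrite (le_trans (cabs_sum _ _))// mulr_suml; apply: ler_sum => k _.
by rewrite cabsM ler_wpM2l ?cabs_ge0// cabs_mono.
Qed.

Lemma cmeasurable_mono_sum d (T : measurableType d) (g : T -> R[i]) m N (c : nat -> R[i]) :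
  cmeasurable setT g -> cmeasurable setT (fun x => \sum_(k < N) c k * mono m k (g x)).
Proof.
move=> mg; apply: cmeasurable_sum => k; apply: cmeasurableM; first exact: cmeasurable_cst.
by apply: cmeasurableM; [|apply: cmeasurableV]; exact: cmeasurableX.
Qed.

Lemma pdisc_chi (p : R) z : 1 < p -> pdisc z -> pdisc (chi p z).
Proof.
move=> p1 /andP[z0 z1]; rewrite /pdisc/= cabs_chi// powR_gt0//= powR_lt1 ?cabs_ge0//.
by rewrite subr_gt0.
Qed.

End disc_integrability.

(** * Truncations of the damped kernel *)

Section kernel_bound.
Context {R : realType}.

Lemma sum_arith_geom (a p : R[i]) (tau : R[i]) N :
  (1 - tau) ^+ 2 * \sum_(k < N) (p * k%:R + a) * tau ^+ k =
  a + (p - a) * tau - tau ^+ N * (a + p * N%:R + (p - a - p * N%:R) * tau).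
Proof.
elim: N => [|N IH]; first by rewrite big_ord0 expr0; ring.
by rewrite big_ord_recr/= mulrDr IH [tau ^+ N.+1]exprS -[in RHS]natr1; ring.
Qed.

(** Write [r^N = s^N s^N] with [s] the square root of [r]: one factor tames [N], because [N s^N] is
    at most the geometric sum of [s], and the other tends to 0. *)
Lemma geom_lin_small (r c d : R) : 0 < r < 1 -> 0 <= c -> 0 <= d ->
  exists N0 : nat, forall N, (N0 <= N)%N -> r ^+ N * (c + d * N%:R) <= 1.
Proof.
move=> /andP[r0 r1] c0 d0; pose s := Num.sqrt r.
have s0 : 0 < s by rewrite sqrtr_gt0.
have s1 : s < 1 by rewrite -sqrtr1 ltr_sqrt.
have sr : s ^+ 2 = r by rewrite sqr_sqrtr// ltW.
have s10 : 0 < 1 - s by rewrite subr_gt0.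
have K0 : 0 < c + d / (1 - s) + 1 by rewrite ltr_wpDl// addr_ge0// divr_ge0// ltW.
have Ns N : N%:R * s ^+ N <= (1 - s)^-1.
  have : N%:R * s ^+ N <= \sum_(k < N) s ^+ k.
    rewrite mulrC mulr_natr -[X in _ *+ X]card_ord -sumr_const; apply: ler_sum => k _.
    by apply: ler_wiXn2l; rewrite ?(ltW s0) ?(ltW s1)// ltnW.
  move=> /le_trans; apply; rewrite -(ler_pM2l s10) divff ?gt_eqF//.
  have := subrX1 s N; move=> /(congr1 -%R); rewrite opprB -mulNr opprB => <-.
  by rewrite gerBl exprn_ge0// ltW.
have cv : s ^+ n @[n --> \oo] --> (0 : R) by apply: cvg_expr; rewrite ger0_norm// ltW.
have eK : 0 < (c + d / (1 - s) + 1)^-1 by rewrite invr_gt0.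
have /cvgrPdist_lt/(_ _ eK)[N0 _ H] := cv.
exists N0 => N /H /=; rewrite sub0r normrN ger0_norm ?exprn_ge0 ?(ltW s0)// => HN.
rewrite -sr exprAC expr2 -mulrA.
have A : s ^+ N * (c + d * N%:R) <= c + d / (1 - s) + 1.
  rewrite mulrDr -[leRHS]addrA lerD//.
    by rewrite ler_piMl// exprn_ile1 ?ltW.
  rewrite mulrCA -[leLHS]addr0 lerD// [s ^+ N * _]mulrC; exact: ler_wpM2l.
rewrite (le_trans (ler_wpM2l (exprn_ge0 _ (ltW s0)) A))//.
by rewrite -ler_pdivlMr// mul1r ltW.
Qed.

Definition kappa (p : R) m (k : nat) : R := (p * (k%:R - m%:R) + 2) / (2 * pi).

Lemma kappa_gt0 (p : R) m k : 0 < p -> p * m%:R < 2 -> 0 < kappa p m k.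
Proof.
move=> p0 pm; rewrite divr_gt0 ?mulr_gt0 ?pi_gt0// mulrBr.
by have : 0 <= p * k%:R; [rewrite mulr_ge0// ltW|lra].
Qed.

(** The sum is arithmetico-geometric in [tau = r z v^*], so [sum_arith_geom] divides it by
    [(1 - tau)^2]. The head [a + (p - a) tau] is at most [2 a + p]; the tail, of order [N tau^N], is
    at most 1 by the hypothesis on [N], because [|tau| <= r]. *)
Lemma kernel_bound (p r : R) m N (z v : R[i]) : 0 < p -> p * m%:R < 2 -> 0 < r < 1 ->
  r ^+ N * (2 * (2 - p * m%:R) + p + 2 * p * N%:R) <= 1 -> pdisc z -> pdisc v ->
  cabs (\sum_(k < N) (kappa p m k * r ^+ k)%:C%C * mono m k z * (mono m k v)^*%C) <=
  (2 * (2 - p * m%:R) + p + 1) / (2 * pi) *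
  ((cabs z * cabs v) `^ (- m%:R) / cabs (1 - r%:C%C * z * v^*%C) ^+ 2).
Proof.
move=> p0 pm /andP[r0 r1] HN /andP[z0 z1] /andP[v0 v1].
set a := 2 - p * m%:R; have a0 : 0 < a by rewrite subr_gt0.
have p20 : 0 < 2 * pi :> R by rewrite mulr_gt0// pi_gt0.
set tau := r%:C%C * z * v^*%C.
have taur : cabs tau <= r.
  rewrite /tau !cabsM cabs_real cabs_conj gtr0_norm// -mulrA ler_piMr ?(ltW r0)//.
  by rewrite mulr_ile1 ?cabs_ge0// ltW.
have tau1 : cabs tau < 1 by exact: le_lt_trans r1.
have d0 : 1 - tau != 0 by rewrite subr_eq0 eq_sym cabs_lt1_neq1.
have cd0 : 0 < cabs (1 - tau) by rewrite cabs_gt0.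
have zn0 : z != 0 by rewrite -cabs_gt0.
have vn0 : v^*%C != 0 by rewrite -cabs_gt0 cabs_conj.
have P0 : (2 * pi)%:C%C != 0 :> R[i] by rewrite -[0]/((0 : R)%:C%C) (inj_eq (@complexI R)) gt_eqF.
have termE k : (kappa p m k * r ^+ k)%:C%C * mono m k z * (mono m k v)^*%C =
    (z ^- m * v^*%C ^- m / (2 * pi)%:C%C) * ((p%:C%C * k%:R + a%:C%C) * tau ^+ k).
  have -> : (mono m k v)^*%C = v^*%C ^+ k * v^*%C ^- m.
    by rewrite /mono [LHS]rmorphM -rmorphXn; congr (_ * _); rewrite [LHS]fmorphV -rmorphXn.
  have -> : (kappa p m k * r ^+ k)%:C%C = (p%:C%C * k%:R + a%:C%C) / (2 * pi)%:C%C * r%:C%C ^+ k :> R[i].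
    rewrite /kappa -rmorphXn [LHS]rmorphM; congr (_ * _); rewrite [LHS]rmorphM fmorphV; congr (_ / _).
    have -> : p * (k%:R - m%:R) + 2 = p * k%:R + a by rewrite /a; ring.
    by rewrite rmorphD rmorphM rmorph_nat.
  by rewrite /mono /tau !exprMn; ring.
under eq_bigr do rewrite termE; rewrite -mulr_sumr.
set S := \sum_(k < N) _.
have SE : S = (a%:C%C + (p%:C%C - a%:C%C) * tau - tau ^+ N * (a%:C%C + p%:C%C * N%:R + (p%:C%C - a%:C%C - p%:C%C * N%:R) * tau)) / (1 - tau) ^+ 2.
  by rewrite -sum_arith_geom mulrC mulKf// expf_neq0.
rewrite cabsM SE.
have cR (x : R) : 0 <= x -> cabs x%:C%C = x by move=> x0; rewrite cabs_real ger0_norm.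
have cN : cabs (N%:R : R[i]) = N%:R by rewrite -(rmorph_nat (@real_complex R)) cR.
have B1 : cabs (a%:C%C + (p%:C%C - a%:C%C) * tau) <= 2 * a + p.
  rewrite (le_trans (ler_cabsD _ _))// cR ?(ltW a0)// (_ : 2 * a + p = a + (p + a)); last by ring.
  rewrite lerD2l cabsM -[leRHS]mulr1 ler_pM ?cabs_ge0// ?(ltW tau1)//.
  by rewrite (le_trans (ler_cabsB _ _))// !cR ?(ltW p0) ?(ltW a0).
have pN0 : 0 <= p * N%:R by rewrite mulr_ge0// ltW.
have B2 : cabs (a%:C%C + p%:C%C * N%:R + (p%:C%C - a%:C%C - p%:C%C * N%:R) * tau) <= 2 * a + p + 2 * p * N%:R.
  rewrite (_ : 2 * a + p + 2 * p * N%:R = a + p * N%:R + (p + a + p * N%:R)); last by ring.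
  rewrite (le_trans (ler_cabsD _ _))// lerD//.
    by rewrite (le_trans (ler_cabsD _ _))// cabsM cN !cR ?(ltW p0) ?(ltW a0).
  rewrite cabsM -[leRHS]mulr1 ler_pM ?cabs_ge0// ?(ltW tau1)//.
  rewrite (le_trans (ler_cabsB _ _))// cabsM cN [cabs p%:C%C]cR ?(ltW p0)// lerD2r.
  by rewrite (le_trans (ler_cabsB _ _))// !cR ?(ltW p0) ?(ltW a0).
have B3 : cabs (a%:C%C + (p%:C%C - a%:C%C) * tau - tau ^+ N * (a%:C%C + p%:C%C * N%:R + (p%:C%C - a%:C%C - p%:C%C * N%:R) * tau)) <= 2 * a + p + 1.
  rewrite (le_trans (ler_cabsB _ _))// lerD// cabsM cabsX (le_trans _ HN)//.
  by rewrite ler_pM ?cabs_ge0 ?exprn_ge0 ?cabs_ge0// lerXn2r ?nnegrE ?cabs_ge0 ?(ltW r0).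
rewrite !cabs_div cabsM !cabsV !cabsX cabs_conj cR ?(ltW p20)//.
rewrite powRM ?cabs_ge0// !powRN !powR_mulrn ?cabs_ge0//.
set X := cabs _ in B3 *; set zm := (cabs z ^+ m)^-1; set vm := (cabs v ^+ m)^-1.
have zm0 : 0 <= zm by rewrite invr_ge0 exprn_ge0 ?cabs_ge0.
have vm0 : 0 <= vm by rewrite invr_ge0 exprn_ge0 ?cabs_ge0.
have D0 : 0 <= (cabs (1 - tau) ^+ 2)^-1 by rewrite invr_ge0 sqr_ge0.
have P0' : 0 <= (2 * pi)^-1 :> R by rewrite invr_ge0 ltW.
rewrite (_ : zm * vm / (2 * pi) * (X / cabs (1 - tau) ^+ 2) =
  X * (zm * vm * (2 * pi)^-1 * (cabs (1 - tau) ^+ 2)^-1)); last by ring.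
rewrite (_ : (2 * a + p + 1) / (2 * pi) * (zm * vm / cabs (1 - tau) ^+ 2) =
  (2 * a + p + 1) * (zm * vm * (2 * pi)^-1 * (cabs (1 - tau) ^+ 2)^-1)); last by ring.
by rewrite ler_wpM2r// !mulr_ge0.
Qed.

End kernel_bound.

Lemma ge0_fin_ex (R : realType) (x : \bar R) : (0 <= x)%E -> (x < +oo)%E ->
  exists2 r : R, 0 <= r & x = r%:E.
Proof. by case: x => // r r0 _; exists r. Qed.

Lemma measurable_kern (R : realType) (p r : R) m :
  measurable_fun [set: (R * R) * (R * R)] (fun x : (R * R) * (R * R) => kern p r m (toC x.1) (toC x.2)).
Proof.
have mfst : measurable_fun [set: (R * R) * (R * R)] (fun x : (R * R) * (R * R) => x.1) by exact: measurable_fst.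
have msnd : measurable_fun [set: (R * R) * (R * R)] (fun x : (R * R) * (R * R) => x.2) by exact: measurable_snd.
apply: measurable_funM.
  apply: measurable_powR_comp; apply: measurable_funM; first exact: (measurableT_comp (@measurable_mod R) mfst).
  by apply: measurable_powR_comp; exact: (measurableT_comp (@measurable_mod R) msnd).
apply: measurable_funV; apply: measurable_funX; apply: measurable_cabs.
under eq_fun do rewrite -mulNr.
apply: cmeasurableD; first exact: cmeasurable_cst.
apply: cmeasurableM.
  under eq_fun do rewrite -mulNr; apply: cmeasurableM; first exact: cmeasurable_cst.
  by apply: (cmeasurable_comp measurableT _ (@cmeasurable_toC R) mfst).
apply: cmeasurable_conj.
by apply: (cmeasurable_comp measurableT _ (cmeasurable_chi p) msnd).
Qed.

Lemma measurable_kern_r (R : realType) (p r : R) m (z : R * R) :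
  measurable_fun [set: R * R] (fun w : R * R => kern p r m (toC z) (toC w)).
Proof.
have mpair : measurable_fun [set: R * R] (fun w : R * R => (z, w) : (R * R) * (R * R)) by apply: measurable_fun_pair.
exact: (measurableT_comp (measurable_kern p r m) mpair).
Qed.

Section apriori.
Context {R : realType}.
Local Notation PD := (@toC R @^-1` (@pdisc R)).
Variables (p : R) (m : nat).
Hypotheses (p1 : 1 < p) (pm : p * m%:R < 2).
Let q := p / (p - 1).

Let p0 : 0 < p. Proof. exact: lt_trans p1. Qed.
Let p10 : 0 < p - 1. Proof. by rewrite subr_gt0. Qed.
Let q0 : 0 < q. Proof. exact: divr_gt0. Qed.
Let q1 : 1 < q. Proof. by rewrite /q ltr_pdivlMr// mul1r gtrBl. Qed.
Let q1p : (q - 1) * p = q. Proof. by rewrite /q; field; rewrite gt_eqF. Qed.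
Let p1q : (p - 1) * q = p. Proof. by rewrite /q; field; rewrite gt_eqF. Qed.
Let pqV : p^-1 + q^-1 = 1. Proof. by rewrite /q; field; rewrite !gt_eqF. Qed.

Lemma cabs_mul_powR (w : R[i]) (s : R) : 1 < s ->
  cabs (w * ((cabs w) `^ (s - 2))%:C%C) = cabs w `^ (s - 1).
Proof. by move=> s1; exact: cabs_chi. Qed.

(** Divide by [x^(1/s)] when [x] is nonzero. This extracts a bound from an estimate that has the
    unknown on both sides. *)
Lemma powR_self_bound (x c s : R) : 0 <= x -> 0 <= c -> 1 < s ->
  x <= c * x `^ s^-1 -> x <= c `^ (s / (s - 1)).
Proof.
move=> x0 c0 s1 H; have s0 : 0 < s by lra.
have s10 : 0 < s - 1 by lra.
have [->|xn0] := eqVneq x 0; first by rewrite powR_ge0.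
have xp : 0 < x by rewrite lt0r xn0.
have e0 : 0 < s / (s - 1) by rewrite divr_gt0.
have H2 : x `^ (1 - s^-1) <= c.
  rewrite powRB ?xn0 ?implybT// powRr1// ler_pdivrMr// powR_gt0//.
rewrite (_ : x = (x `^ (1 - s^-1)) `^ (s / (s - 1))); last first.
  rewrite -powRrM (_ : (1 - s^-1) * (s / (s - 1)) = 1) ?powRr1//.
  by field; rewrite !gt_eqF.
by rewrite ge0_ler_powR ?nnegrE ?powR_ge0// ltW.
Qed.

(** Let [X] be the integral of [|G|^q] and [Y] that of [|Q|^p], with [Q] the test combination. The
    bound on [l] gives [X <= M Y^(1/p)], the Schur estimate gives [Y <= C3 X], and [powR_self_bound]
    concludes. Only the numbers [l k] enter, so the constant is independent of the functional. *)
Lemma apriori : exists2 C : R, 0 < C & forall (l : nat -> R[i]) (M : R), 0 <= M ->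
  (forall N (x : nat -> R[i]), cabs (\sum_(k < N) x k * l k) <=
     M * (fine (\int[@dV R]_(z in PD) (cabs (\sum_(k < N) x k * mono m k (toC z)) `^ p)%:E)%E) `^ p^-1) ->
  forall r : R, 0 < r < 1 -> exists N0 : nat, forall N, (N0 <= N)%N ->
  (\int[@dV R]_(w in PD)
    (cabs (\sum_(k < N) ((kappa p m k * r ^+ k)%:C%C * (l k)^*%C) * mono m k (chi p (toC w))) `^ q)%:E
   <= ((C * M) `^ q)%:E)%E.
Proof.
have [Cs Cs0 HS] := schur_bilinear p1 pm.
have pp0 : (0 : R) < p by exact: p0.
pose a : R := 2 - p * m%:R; have a0 : 0 < a by rewrite subr_gt0.
have p20 : 0 < 2 * pi :> R by rewrite mulr_gt0// pi_gt0.
pose C0 : R := (2 * a + p + 1) / (2 * pi).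
have C00 : 0 < C0 by rewrite divr_gt0//; lra.
(* Chosen so that the coefficient [C0 Cs T^(-q)] of [Y] becomes 1/2. *)
pose T := (2 * (C0 * Cs)) `^ q^-1.
have CC0 : 0 < C0 * Cs by rewrite mulr_gt0.
have T0 : 0 < T by rewrite powR_gt0// mulr_gt0.
have Tq : C0 * Cs * T `^ (- q) = 2^-1.
  have -> : T `^ (- q) = (2 * (C0 * Cs))^-1.
    by rewrite /T -powRrM mulrN mulVf ?gt_eqF// powR_inv1// ltW// mulr_gt0.
  by rewrite invfM mulrCA mulfV ?gt_eqF// mulr1.
pose C3 := 2 * (C0 * Cs * T `^ p).
have TP0 : 0 < T `^ p by exact: powR_gt0.
have C30 : 0 < C3 by rewrite /C3; apply: mulr_gt0 => //; exact: mulr_gt0.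
exists (C3 `^ p^-1); first by rewrite powR_gt0.
move=> l M M0 H r r01; have [r0 r1] := andP r01.
have [||N0 HN0] := @geom_lin_small R r (2 * a + p) (2 * p) r01; [lra|lra|].
exists N0 => N /HN0 HN.
pose b k := (kappa p m k * r ^+ k)%:C%C * (l k)^*%C.
pose G (x : R * R) := \sum_(k < N) b k * mono m k (chi p (toC x)).
have mG : cmeasurable setT G by apply: cmeasurable_mono_sum; exact: cmeasurable_chi.
(* The function dual to [G]: [G^* Phi = |G|^q] and [|Phi|^p = |G|^q]. *)
pose Phi x := G x * ((cabs (G x)) `^ (q - 2))%:C%C.
have mPhi : cmeasurable setT Phi.
  by apply: cmeasurableM => //; apply: cmeasurable_real; exact: measurable_cabs_powR.
pose A x := cabs (G x) `^ (q - 1).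
have PhiA x : cabs (Phi x) = A x by exact: cabs_mul_powR.
have mA : measurable_fun [set: R * R] A by exact: measurable_cabs_powR.
have A0 x : 0 <= A x by exact: powR_ge0.
have Ap x : A x `^ p = cabs (G x) `^ q by rewrite /A -powRrM q1p.
pose KG := \sum_(k < N) cabs (b k).
have KG0 : 0 <= KG by apply: sumr_ge0 => k _; exact: cabs_ge0.
pose e1 := (p - 1) * m%:R.
have We (x : R * R) : cabs (chi p (toC x)) `^ (- m%:R) = cabs (toC x) `^ (- e1).
  by rewrite cabs_chi// -powRrM mulrN.
have GK x : PD x -> cabs (G x) <= KG * cabs (toC x) `^ (- e1).
  by move=> xD; rewrite -We; apply: cabs_mono_sum; exact: pdisc_chi.
have GKs x (s : R) : 0 < s -> PD x -> cabs (G x) `^ s <= KG `^ s * cabs (toC x) `^ (- (e1 * s)).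
  move=> s0 xD; rewrite -mulNr powRrM -powRM ?powR_ge0//.
  by rewrite ge0_ler_powR ?nnegrE ?cabs_ge0 ?mulr_ge0 ?powR_ge0 ?(ltW s0)//; exact: GK.
have e1q : e1 * q = p * m%:R by rewrite /e1 mulrAC p1q.
have mGq : measurable_fun [set: R * R] (fun x => cabs (G x) `^ q) by exact: measurable_cabs_powR.
set X := (\int[@dV R]_(w in PD) _)%E.
have XE : X = (\int[@dV R]_(x in PD) (cabs (G x) `^ q)%:E)%E by [].
(* The integrals are finite because finitely many monomials occur and the integrand is at most a
   multiple of [|w|^(- p m)]; the same reason applies to [Y]. The absorption below needs this. *)
have Xoo : (X < +oo)%E.
  rewrite XE; apply: (PD_le_lty mGq _ pm) => [x|x xD]; first exact: powR_ge0.
  by rewrite -e1q; exact: GKs.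
have X0 : (0 <= X)%E by apply: integral_ge0 => x _; rewrite lee_fin powR_ge0.
have [Xr Xr0 XrE] : exists2 Xr : R, 0 <= Xr & X = Xr%:E.
  exact: ge0_fin_ex.
have mPD := @measurable_PD R.
pose F k (x : R * R) := (mono m k (chi p (toC x)))^*%C * Phi x.
have mF k : cmeasurable setT (F k).
  apply: cmeasurableM => //; apply: cmeasurable_conj.
  by apply: cmeasurableM; [|apply: cmeasurableV]; apply: cmeasurableX; exact: cmeasurable_chi.
have iF k : cintegrable (@dV R) PD (F k).
  apply: (PD_cintegrable (K := KG `^ (q - 1)) (mF k) pm) => x xD.
  rewrite /F cabsM cabs_conj PhiA mulrC.
  have q10 : 0 < q - 1 by rewrite subr_gt0.
  apply: (@le_trans _ _ (KG `^ (q - 1) * cabs (toC x) `^ (- (e1 * (q - 1))) * cabs (toC x) `^ (- e1))).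
    rewrite ler_pM ?powR_ge0 ?cabs_ge0//; first exact: GKs.
    by rewrite -We; apply: cabs_mono; exact: pdisc_chi.
  have [x0 _] := andP xD.
  rewrite -mulrA -powRD; last by rewrite (gt_eqF x0) implybT.
  by rewrite (_ : - (e1 * (q - 1)) - e1 = - (p * m%:R))//; rewrite -e1q; ring.
pose I k := cI (@dV R) PD (F k).
pose x k := (kappa p m k * r ^+ k)%:C%C * I k.
have conjb k : (b k)^*%C = (kappa p m k * r ^+ k)%:C%C * l k.
  by rewrite /b [LHS]rmorphM; congr (_ * _); [exact: conjc_real|exact: conjcK].
(* [X] is the integral of [G^* Phi]. Expanding [G^*] over its terms exhibits [X] as the functional
   evaluated at the coefficients [x] of the test combination [Q]. *)
have XI : Xr%:C%C = \sum_(k < N) x k * l k.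
  transitivity (cI (@dV R) PD (fun w => (cabs (G w) `^ q)%:C%C)).
    apply: complex_eq => /=; last by rewrite /Rintegral integral0.
    by rewrite /Rintegral -XE XrE.
  transitivity (cI (@dV R) PD (fun w => \sum_(k < N) (b k)^*%C * F k w)).
    apply: eq_cI => w _; rewrite /F; under eq_bigr do rewrite mulrA; rewrite -mulr_suml.
    have -> : \sum_(k < N) (b k)^*%C * (mono m k (chi p (toC w)))^*%C = (G w)^*%C.
      by rewrite /G [RHS]rmorph_sum; apply: eq_bigr => k _; rewrite [RHS]rmorphM.
    rewrite /Phi mulrA [_^*%C * _]mulrC mul_conj -rmorphM; congr (_%:C%C).
    have [->|G0] := eqVneq (G w) 0; first by rewrite cabs0 expr0n/= mul0r powR0// gt_eqF.
    rewrite -powR_mulrn ?cabs_ge0// -powRD; last by rewrite cabs_eq0 G0 implybT.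
    by congr (_ `^ _); ring.
  rewrite cI_sum//; last by move=> k; exact: cintegrableZ.
  by apply: eq_bigr => k _; rewrite cIZ// conjb /x mulrAC.
pose Q z := \sum_(k < N) x k * mono m k z.
have mQ : cmeasurable setT (fun z : R * R => Q (toC z)).
  by apply: cmeasurable_mono_sum; exact: cmeasurable_toC.
pose Y := (\int[@dV R]_(z in PD) (cabs (Q (toC z)) `^ p)%:E)%E.
have Y0 : (0 <= Y)%E by apply: integral_ge0 => z _; rewrite lee_fin powR_ge0.
have Yoo : (Y < +oo)%E.
  apply: (@PD_le_lty _ (fun z => cabs (Q (toC z)) `^ p) ((\sum_(k < N) cabs (x k)) `^ p) _ _ _ pm) => [|z|z zD].
  - exact: measurable_cabs_powR.
  - exact: powR_ge0.
  rewrite [p * m%:R]mulrC -mulNr powRrM -powRM ?powR_ge0//; last by apply: sumr_ge0 => k _; exact: cabs_ge0.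
  rewrite ge0_ler_powR ?nnegrE ?cabs_ge0 ?mulr_ge0 ?powR_ge0 ?(ltW p0)//.
    by apply: sumr_ge0 => k _; exact: cabs_ge0.
  exact: cabs_mono_sum.
have [Yr Yr0 YrE] : exists2 Yr : R, 0 <= Yr & Y = Yr%:E.
  exact: ge0_fin_ex.
have HX : Xr <= M * Yr `^ p^-1.
  have := H N x; rewrite -XI cabs_real ger0_norm//.
  by rewrite -/(Y) YrE.
pose B z := cabs (Q (toC z)) `^ (p - 1).
have B0 z : 0 <= B z by exact: powR_ge0.
have mB : measurable_fun [set: R * R] B by exact: measurable_cabs_powR.
have Bq z : B z `^ q = cabs (Q (toC z)) `^ p by rewrite /B -powRrM p1q.
pose KA (z w : R * R) := kern p r m (toC z) (toC w) * A w.
have KA0 z w : 0 <= KA z w by rewrite mulr_ge0// mulr_ge0 ?powR_ge0// invr_ge0 sqr_ge0.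
have mKA z : measurable_fun [set: R * R] (KA z).
  by apply: measurable_funM; [exact: measurable_kern_r|exact: mA].
have KAE0 z w : (0 <= (KA z w)%:E)%E by rewrite lee_fin.
have mKAE z : measurable_fun PD (fun w => (KA z w)%:E).
  by apply/measurable_EFinP; apply: measurable_funTS; exact: mKA.
(* [Q] is the image of [Phi] under the integral operator whose kernel is the truncated damped sum;
   its majorant [kern] requires [N] large, through [HN]. *)
have Qbound z : PD z -> ((cabs (Q (toC z)))%:E <= C0%:E * \int[@dV R]_(w in PD) (KA z w)%:E)%E.
  move=> zD.
  have QE : Q (toC z) = cI (@dV R) PD (fun w => \sum_(k < N) ((kappa p m k * r ^+ k)%:C%C * mono m k (toC z)) * F k w).
    rewrite cI_sum//; last by move=> k; exact: cintegrableZ.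
    by apply: eq_bigr => k _; rewrite cIZ// /x /I mulrAC.
  have iQ : cintegrable (@dV R) PD (fun w => \sum_(k < N) ((kappa p m k * r ^+ k)%:C%C * mono m k (toC z)) * F k w).
    by apply: cintegrable_sum => // k; exact: cintegrableZ.
  have Hc : cabs (Q (toC z)) <= Rintegral (@dV R) PD (fun w => cabs (\sum_(k < N) ((kappa p m k * r ^+ k)%:C%C * mono m k (toC z)) * F k w)).
    by rewrite QE; exact: cabs_cI.
  rewrite -lee_fin in Hc; apply: (le_trans Hc).
  have iQc : (@dV R).-integrable PD (fun w => (cabs (\sum_(k < N) ((kappa p m k * r ^+ k)%:C%C * mono m k (toC z)) * F k w))%:E).
    by apply: (cintegrable_cabs _ iQ); exact: mPD.
  rewrite /Rintegral fineK; last by apply: (integrable_fin_num _ iQc); exact: mPD.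
  rewrite -(PD_integralZl (mKAE z) (KAE0 z) (ltW C00)).
  apply: ge0_le_integral; [exact: mPD|by move=> w _; rewrite lee_fin cabs_ge0| | |].
  - exact: (measurable_int _ iQc).
  - exact: (emeasurable_funM (measurable_cst _) (mKAE z)).
  move=> w wD; rewrite -EFinM lee_fin /KA mulrA.
  under eq_bigr do rewrite mulrA; rewrite -mulr_suml cabsM PhiA ler_wpM2r//.
  rewrite /kern -(cabs_chi _ p1); apply: kernel_bound => //; exact: pdisc_chi.
have KAB0 z w : (0 <= (KA z w * B z)%:E)%E.
  by rewrite lee_fin; exact: (mulr_ge0 (KA0 z w) (B0 z)).
have YB : (Y <= C0%:E * \int[@dV R]_(z in PD) \int[@dV R]_(w in PD) (KA z w * B z)%:E)%E.
  have mKABi : measurable_fun PD (fun z => (\int[@dV R]_(w in PD) (KA z w * B z)%:E)%E).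
    apply: (@measurable_integral_fst _ (fun x => (KA x.1 x.2 * B x.1)%:E)); last first.
      by move=> y; exact: KAB0.
    apply/measurable_EFinP; apply: measurable_funM.
      apply: measurable_funM; first exact: measurable_kern.
      exact: (measurableT_comp mA measurable_snd).
    exact: (measurableT_comp mB measurable_fst).
  rewrite -(PD_integralZl mKABi _ (ltW C00)); last first.
    by move=> z; apply: integral_ge0 => w _; exact: KAB0.
  apply: ge0_le_integral; [exact: mPD|by move=> z _; rewrite lee_fin powR_ge0| | |].
  - by apply/measurable_EFinP; apply: measurable_funTS; exact: measurable_cabs_powR.
  - exact: (emeasurable_funM (measurable_cst _) mKABi).
  move=> z zD.
  have -> : ((cabs (Q (toC z)) `^ p)%:E = (cabs (Q (toC z)))%:E * (B z)%:E)%E.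
    by rewrite -EFinM /B mulr_powRB1 ?cabs_ge0.
  have -> : (\int[@dV R]_(w in PD) (KA z w * B z)%:E = (\int[@dV R]_(w in PD) (KA z w)%:E) * (B z)%:E)%E.
    rewrite muleC -(PD_integralZl (mKAE z) (KAE0 z) (B0 z)).
    by apply: eq_integral => w _; rewrite -EFinM mulrC.
  have BE : (0 <= (B z)%:E)%E by rewrite lee_fin; exact: B0.
  by move: (lee_wpmul2r BE (Qbound z zD)); rewrite muleA.
have r01' : 0 <= r <= 1 by rewrite !ltW.
have EA : (\int[@dV R]_(w in PD) (A w `^ p)%:E = Xr%:E)%E.
  by rewrite -XrE; apply: eq_integral => w _; rewrite Ap.
have EB : (\int[@dV R]_(z in PD) (B z `^ q)%:E = Yr%:E)%E.
  by rewrite -YrE; apply: eq_integral => w _; rewrite Bq.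
have HS' : (\int[@dV R]_(z in PD) \int[@dV R]_(w in PD) (KA z w * B z)%:E <=
    (Cs * T `^ p * Xr + Cs * T `^ (- q) * Yr)%:E)%E.
  by rewrite EFinD !(EFinM (_ * _)) -EA -EB; exact: (HS A B r T mA mB A0 B0 r01' T0).
have C0E : (0 <= C0%:E)%E by rewrite lee_fin ltW.
have := le_trans YB (lee_wpmul2l C0E HS'); rewrite YrE -EFinM lee_fin => HY.
(* By the choice of [T] the right-hand side contains [Yr / 2], which is absorbed on the left. *)
have YX : Yr <= C3 * Xr.
  rewrite /C3; move: HY; rewrite (_ : C0 * (Cs * T `^ p * Xr + Cs * T `^ (- q) * Yr) =
    C0 * Cs * T `^ p * Xr + C0 * Cs * T `^ (- q) * Yr); last by ring.
  by rewrite Tq; lra.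
rewrite XrE lee_fin; apply: powR_self_bound => //.
  by rewrite mulr_ge0// powR_ge0.
rewrite (le_trans HX)// [_ * M]mulrC -mulrA -powRM ?(ltW C30)// ler_wpM2l//.
have CX0 : 0 <= C3 * Xr by exact: mulr_ge0 (ltW C30) Xr0.
have pV0 : 0 <= p^-1 by rewrite invr_ge0 ltW.
by apply: (ge0_ler_powR pV0).
Qed.

End apriori.

(** * Bergman spaces *)

Lemma fatou_bound d (T : measurableType d) (R : realType) (mu : {measure set T -> \bar R})
    (D : set T) (f : nat -> T -> \bar R) (F : T -> \bar R) (c : \bar R) :
  measurable D -> (forall n, measurable_fun D (f n)) ->
  (forall n x, D x -> (0 <= f n x)%E) ->
  (forall x, D x -> f n x @[n --> \oo] --> F x) ->
  (forall n, (\int[mu]_(x in D) f n x <= c)%E) -> (\int[mu]_(x in D) F x <= c)%E.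
Proof.
move=> mD mf f0 fF fc.
have -> : (\int[mu]_(x in D) F x = \int[mu]_(x in D) limn_einf (f ^~ x))%E.
  by apply: eq_integral => x /set_mem Dx; have [-> _] := cvg_limn_einf_sup (fF x Dx).
apply: (le_trans (fatou _ mD mf f0)); rewrite limn_einf_lim.
apply: lime_le; first exact: is_cvg_einfs.
by apply: nearW => n; apply: le_trans (fc n); apply: ereal_inf_lbound; exists n => /=.
Qed.

Section powR_lemmas.
Context {R : realType}.

Lemma cvg_powR (u : nat -> R) (l p : R) : 0 < p -> (forall n, 0 <= u n) -> 0 <= l ->
  u n @[n --> \oo] --> l -> u n `^ p @[n --> \oo] --> l `^ p.
Proof.
(* The power need not be differentiable at 0, so the limit 0 is treated by hand. *)
move=> p0 u0; rewrite le_eqVlt => /predU1P[<- u_0|l0 ul].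
  rewrite powR0 ?gt_eqF//; apply/cvgrPdist_lt => e e0.
  have e1 : 0 < e `^ p^-1 by exact: powR_gt0.
  move/cvgrPdist_lt : u_0 => /(_ _ e1); apply: filterS => n.
  rewrite !sub0r !normrN !ger0_norm ?powR_ge0// => une.
  rewrite (_ : e = (e `^ p^-1) `^ p); last by rewrite -powRrM mulVf ?gt_eqF// powRr1// ltW.
  by rewrite gt0_ltr_powR ?nnegrE// ltW.
have cl : {for l, continuous (fun x : R => x `^ p)}.
  apply/differentiable_continuous; rewrite -derivable1_diffP.
  by apply: derivable_powR; rewrite in_itv/= l0.
exact: (continuous_cvg _ cl ul).
Qed.

Lemma powRD_le (x y p : R) : 0 <= p -> 0 <= x -> 0 <= y -> (x + y) `^ p <= 2 `^ p * (x `^ p + y `^ p).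
Proof.
move=> p0 x0 y0; wlog xy : x y x0 y0 / x <= y.
  by move=> H; have [?|/ltW ?] := leP x y; [|rewrite addrC [_ `^ p + _]addrC]; exact: H.
apply: (@le_trans _ _ ((2 * y) `^ p)).
  by rewrite ge0_ler_powR ?nnegrE ?addr_ge0 ?mulr_ge0//; lra.
by rewrite powRM// ler_wpM2l ?powR_ge0// lerDr powR_ge0.
Qed.

End powR_lemmas.

Section bergman_space.
Context {R : realType}.
Local Notation PD := (@toC R @^-1` (@pdisc R)).
Variables (U : set R[i]).
Hypothesis dU : discs U.
Implicit Types f g : R[i] -> R[i].

Lemma holomorphic_PD f : holomorphic_on U f -> cmeasurable PD (fun x => f (toC x)).
Proof.
move=> hf; apply: (holomorphic_cmeasurable (@copen_pdisc R)).
exact: holomorphicS (pdisc_sub dU) hf.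
Qed.

Lemma wint_discs (s : R) (lam : R[i] -> R) f : holomorphic_on U f ->
  measurable_fun [set: R * R] (fun x => lam (toC x)) -> (forall z, 0 <= lam z) ->
  wint U s lam f = (\int[@dV R]_(x in PD) (cabs (f (toC x)) `^ s * lam (toC x))%:E)%E.
Proof.
move=> hf ml l0; rewrite /wint; apply: ge0_integral_discs => //.
  apply/measurable_EFinP; apply: measurable_funM; last exact: measurable_funTS.
  apply: measurable_cabs_powR; exact: holomorphic_cmeasurable (copen_discs dU) hf.
by move=> x _; rewrite lee_fin mulr_ge0 ?powR_ge0.
Qed.

Lemma wint1E p f : holomorphic_on U f ->
  wint U p (fun=> 1) f = (\int[@dV R]_(x in PD) (cabs (f (toC x)) `^ p)%:E)%E.
Proof.
move=> hf; rewrite wint_discs//.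
by apply: eq_integral => x _; rewrite mulr1.
Qed.

Lemma measurable_cabs_PD p f : holomorphic_on U f ->
  measurable_fun PD (fun x => (cabs (f (toC x)) `^ p)%:E).
Proof.
by move=> hf; apply/measurable_EFinP; apply: measurable_cabs_powR; exact: holomorphic_PD.
Qed.

Lemma measurable_cabs_weight (s : R) (lam : R[i] -> R) f : holomorphic_on U f ->
  measurable_fun [set: R * R] (fun x => lam (toC x)) ->
  measurable_fun PD (fun x => (cabs (f (toC x)) `^ s * lam (toC x))%:E).
Proof.
move=> hf ml; apply/measurable_EFinP; apply: measurable_funM; last exact: measurable_funTS.
by apply: measurable_cabs_powR; exact: holomorphic_PD.
Qed.

Lemma Aspace_lin (s : R) (lam : R[i] -> R) (a : R[i]) f g : 0 < s ->
  measurable_fun [set: R * R] (fun x => lam (toC x)) -> (forall z, 0 <= lam z) ->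
  Aspace U s lam f -> Aspace U s lam g -> Aspace U s lam (fun z => a * f z + g z).
Proof.
move=> s0 ml l0 [hf fo] [hg go].
have h : holomorphic_on U (fun z => a * f z + g z).
  by apply: holomorphicD => //; apply: holomorphicM => //; exact: holomorphic_cst.
move: fo go; rewrite (wint_discs s hf ml l0) (wint_discs s hg ml l0) => fo go.
split; first exact: h.
rewrite (wint_discs s h ml l0).
have mf := measurable_cabs_weight s hf ml; have mg := measurable_cabs_weight s hg ml.
have mPD := @measurable_PD R.
have c0 : 0 <= 2 `^ s * cabs a `^ s by rewrite mulr_ge0 ?powR_ge0.
have d0 : (0 : R) <= 2 `^ s by rewrite powR_ge0.
have w0 k z : (0 <= (cabs (k z) `^ s * lam z)%:E)%E by rewrite lee_fin mulr_ge0 ?powR_ge0.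
have mfc : measurable_fun PD (fun x => ((2 `^ s * cabs a `^ s)%:E * (cabs (f (toC x)) `^ s * lam (toC x))%:E)%E).
  exact: (emeasurable_funM (measurable_cst _) mf).
have mgc : measurable_fun PD (fun x => ((2 `^ s)%:E * (cabs (g (toC x)) `^ s * lam (toC x))%:E)%E).
  exact: (emeasurable_funM (measurable_cst _) mg).
apply: (@le_lt_trans _ _ (\int[@dV R]_(x in PD) ((2 `^ s * cabs a `^ s)%:E * (cabs (f (toC x)) `^ s * lam (toC x))%:E +
   (2 `^ s)%:E * (cabs (g (toC x)) `^ s * lam (toC x))%:E))%E).
  apply: ge0_le_integral; [exact: mPD|by move=> x _; exact: (w0 (fun z => a * f z + g z))| | |].
  - exact: (measurable_cabs_weight s h ml).
  - exact: emeasurable_funD mfc mgc.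
  move=> x _; rewrite -!EFinM -EFinD lee_fin !mulrA -mulrDl ler_wpM2r//.
  apply: (@le_trans _ _ ((cabs a * cabs (f (toC x)) + cabs (g (toC x))) `^ s)).
    rewrite ge0_ler_powR ?nnegrE ?addr_ge0 ?mulr_ge0 ?cabs_ge0 ?(ltW s0)//.
    by rewrite (le_trans (ler_cabsD _ _))// cabsM.
  rewrite (le_trans (powRD_le _ _ _)) ?mulr_ge0 ?cabs_ge0 ?(ltW s0)//.
  by rewrite powRM ?cabs_ge0// mulrDr mulrA.
have -> : (\int[@dV R]_(x in PD) ((2 `^ s * cabs a `^ s)%:E * (cabs (f (toC x)) `^ s * lam (toC x))%:E +
   (2 `^ s)%:E * (cabs (g (toC x)) `^ s * lam (toC x))%:E) =
   (2 `^ s * cabs a `^ s)%:E * \int[@dV R]_(x in PD) (cabs (f (toC x)) `^ s * lam (toC x))%:E +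
   (2 `^ s)%:E * \int[@dV R]_(x in PD) (cabs (g (toC x)) `^ s * lam (toC x))%:E)%E.
  rewrite -(PD_integralZl mf _ c0); last by move=> x; exact: (w0 f).
  rewrite -(PD_integralZl mg _ d0); last by move=> x; exact: (w0 g).
  apply: ge0_integralD; [exact: mPD| |exact: mfc| |exact: mgc].
  - by move=> x _; apply: mule_ge0; [rewrite lee_fin|exact: (w0 f)].
  - by move=> x _; apply: mule_ge0; [rewrite lee_fin|exact: (w0 g)].
apply: lte_add_pinfty.
- by apply: lte_mul_pinfty; [rewrite lee_fin; exact: c0|exact: isT|exact: fo].
- by apply: lte_mul_pinfty; [rewrite lee_fin; exact: d0|exact: isT|exact: go].
Qed.

Lemma Ap_lin p (a : R[i]) f g : 0 < p -> Ap U p f -> Ap U p g -> Ap U p (fun z => a * f z + g z).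
Proof. by move=> p0; apply: Aspace_lin. Qed.

Lemma ApnormE p f : holomorphic_on U f ->
  Apnorm U p f = (fine (\int[@dV R]_(x in PD) (cabs (f (toC x)) `^ p)%:E)%E) `^ p^-1.
Proof. by move=> hf; rewrite /Apnorm /Anorm wint1E. Qed.

(** Turns a uniform bound on [z^m f] into a norm bound, since [|z|^(- p m)] is integrable. *)
Lemma Ap_le (p : R) (m : nat) f (K : R) : 0 < p -> p * m%:R < 2 -> 0 <= K -> holomorphic_on U f ->
  (forall z, pdisc z -> cabs (f z) <= K * cabs z `^ (- m%:R)) ->
  Ap U p f /\ Apnorm U p f <=
    K * (fine (\int[@dV R]_(x in PD) (cabs (toC x) `^ (- (p * m%:R)))%:E)%E) `^ p^-1.
Proof.
move=> p0 pm K0 hf fK.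
have [E E0 EE] : exists2 E : R, 0 <= E &
    (\int[@dV R]_(x in PD) (cabs (toC x) `^ (- (p * m%:R)))%:E = E%:E)%E.
  apply: ge0_fin_ex; last exact: PD_powR_lty.
  by apply: integral_ge0 => x _; rewrite lee_fin powR_ge0.
have le : (\int[@dV R]_(x in PD) (cabs (f (toC x)) `^ p)%:E <= (K `^ p * E)%:E)%E.
  rewrite EFinM -EE -PD_integralZl ?powR_ge0//; last 2 first.
  - by apply/measurable_EFinP; apply: measurable_funTS; apply: measurable_powR_comp; exact: measurable_mod.
  - by move=> x; rewrite lee_fin powR_ge0.
  apply: ge0_le_integral; [exact: measurable_PD|by move=> x _; rewrite lee_fin powR_ge0| | |].
  - exact: measurable_cabs_PD.
  - apply/measurable_EFinP; apply: measurable_funTS; apply: measurable_funM => //.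
    by apply: measurable_powR_comp; exact: measurable_mod.
  move=> x xD; rewrite lee_fin [p * _]mulrC -mulNr powRrM -powRM ?powR_ge0//.
  by rewrite ge0_ler_powR ?nnegrE ?cabs_ge0 ?mulr_ge0 ?powR_ge0 ?(ltW p0)//; exact: fK.
have [F F0 FE] : exists2 r : R, 0 <= r & (\int[@dV R]_(x in PD) (cabs (f (toC x)) `^ p)%:E = r%:E)%E.
  apply: ge0_fin_ex; first by apply: integral_ge0 => x _; rewrite lee_fin powR_ge0.
  by apply: (le_lt_trans le); rewrite ltry.
split; first by split => //; rewrite wint1E// FE ltry.
rewrite ApnormE// EE/= FE/=; move: le; rewrite FE lee_fin => le.
have pV0 : 0 <= p^-1 by rewrite invr_ge0 ltW.
rewrite (le_trans (ge0_ler_powR pV0 _ _ le)) ?nnegrE ?mulr_ge0 ?powR_ge0//.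
by rewrite powRM ?powR_ge0// -powRrM mulfV ?gt_eqF// powRr1.
Qed.

End bergman_space.

(** [f] is bounded near 0, so the circle integral of [f z^(j+1)], which does not depend on the
    radius, is [O(r)]. *)
Lemma pole_free_disc (R : realType) (f : R[i] -> R[i]) : holomorphic_on (@disc R) f -> pole_free f.
Proof.
move=> hf j; set c := circ _ _; apply/eqP; rewrite -cabs_eq0 eq_le cabs_ge0 andbT.
have z0 : disc (0 : R[i]) by rewrite /disc/= cabs0.
have [delta delta0 hd] := holomorphic_continuous hf z0 ltr01.
have hp : holomorphic_on (@pdisc R) (fun z => f z * z ^+ j.+1).
  apply: holomorphicM; last by apply: holomorphicX; exact: holomorphic_id.
  by apply: holomorphicS hf => z /andP[].
have half01 : (0 < 2^-1 :> R) && (2^-1 < 1 :> R) by apply/andP; split; lra.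
pose B := cabs (f 0) + 1; have B0 : 0 < B by rewrite ltr_wpDl// cabs_ge0.
have p0 : 0 < 2 * pi :> R by rewrite mulr_gt0// pi_gt0.
have key (r : R) : 0 < r < 1 -> r < delta -> cabs c <= B * (2 * pi) * r.
  move=> r01 rd; have [r0 r1] := andP r01.
  rewrite /c (circ_const hp half01 r01) mulrAC.
  apply: ang_bound; first exact: (holomorphic_ccont hp r01).
  move=> t; rewrite cabsM cabsX cabs_polar gtr0_norm// ler_pM ?cabs_ge0 ?exprn_ge0 ?(ltW r0)//.
    have := hd (r%:C%C * cis t); rewrite subr0 cabs_polar gtr0_norm// => /(_ rd) H.
    rewrite -[f _](subrK (f 0)) (le_trans (ler_cabsD _ _))// addrC lerD2l ltW//.
  by rewrite exprS ler_piMr ?exprn_ile1 ?(ltW r0) ?(ltW r1).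
apply/ler_addgt0Pl => eps eps0; rewrite addr0.
have BP : 0 < B * (2 * pi) by rewrite mulr_gt0.
pose r := Num.min (2^-1) (Num.min (delta / 2) (eps / (B * (2 * pi)))).
have r0 : 0 < r by rewrite !lt_min !divr_gt0// invr_gt0 ltr0n.
have r1 : r < 1 by rewrite gt_min; apply/orP; left; lra.
have rd : r < delta by rewrite !gt_min; apply/orP; right; apply/orP; left; lra.
have r01 : 0 < r < 1 by rewrite r0.
rewrite (le_trans (key r r01 rd))// mulrC -ler_pdivlMr// !ge_min; apply/orP; right; apply/orP; right.
exact: lexx.
Qed.

(** * Density of the monomials in the Bergman space *)

Section density_of_monomials.
Context {R : realType}.
Local Notation PD := (@toC R @^-1` (@pdisc R)).
Variables (U : set R[i]) (p : R) (m : nat).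
(* With [p * m < 2], this says that [m] is the largest order of a pole at 0 of a function in [A^p(U)]. *)
Hypothesis Um : (U = @disc R /\ m = 0%N) \/ (U = @pdisc R /\ 2 <= p * m.+1%:R).
Hypotheses (p1 : 1 < p) (pm : p * m%:R < 2).
Implicit Types f g : R[i] -> R[i].

Lemma discs_of : discs U.
Proof. by case: Um => -[-> _]; [left|right]. Qed.
Let dU := discs_of.
Let p0 : 0 < p. Proof. exact: lt_trans p1. Qed.

Lemma holomorphic_mulVX f : holomorphic_on U f -> holomorphic_on U (fun z => f z * z ^- m).
Proof.
case: Um => -[-> h] hf.
  by rewrite h; apply: holomorphicM => //; under eq_fun do rewrite expr0 invr1; exact: holomorphic_cst.
apply: holomorphicM => //; apply: holomorphicVX => z /andP[z0 _].
by rewrite -cabs_gt0.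
Qed.

Lemma holomorphic_mono k : holomorphic_on U (mono m k).
Proof. by apply: holomorphic_mulVX; apply: holomorphicX; exact: holomorphic_id. Qed.

Lemma Ap_mono k : Ap U p (mono m k).
Proof.
have h := @holomorphic_mono k.
have := @Ap_le R U dU p m (mono m k) 1 p0 pm ler01 h.
by case=> // z zD; rewrite mul1r; exact: cabs_mono.
Qed.

(** Stated for a power weight to cover [A^p] ([K = 1], [beta = 0]) as well as [A^q] with [eta_q]
    ([K = q - 1], [beta = 2 q - 4]). *)
Lemma pole_free_Aspace f (s K beta : R) : 1 < s -> 0 < K -> beta + 2 <= s * m.+1%:R ->
  measurable_fun [set: R * R] (fun x => (K * cabs (toC x) `^ beta)%R) ->
  Aspace U s (fun z => K * cabs z `^ beta) f -> pole_free (fun z => f z * z ^+ m).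
Proof.
move=> s1 K0 bs ml [hf fo].
have fo' : (wint (@pdisc R) s (fun z => (K * cabs z `^ beta)%R) f < +oo)%E.
  have hf' := holomorphicS (pdisc_sub dU) hf.
  have l0 z : (0 <= K * cabs z `^ beta)%R by rewrite mulr_ge0 ?powR_ge0// ltW.
  move: fo; rewrite (@wint_discs R U dU s _ f hf ml l0).
  by rewrite (@wint_discs R (@pdisc R) (or_intror erefl) s _ f hf' ml l0).
case: Um => -[UE h]; rewrite UE in hf.
  by rewrite h; under eq_fun do rewrite expr0 mulr1; exact: pole_free_disc.
move=> j; have := @pole_vanish R f s K beta (m + j.+1) hf s1 K0.
have -> : (fun z => f z * z ^+ m * z ^+ j.+1) = (fun z => f z * z ^+ (m + j.+1)).
  by apply/funext => z; rewrite exprD mulrA.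
apply => //.
rewrite (le_trans bs)// ler_wpM2l ?(ltW (lt_trans ltr01 s1))//.
by rewrite ler_nat addnS ltnS leq_addr.
Qed.

Section functional.
Variables (L : (R[i] -> R[i]) -> R[i]) (M : R).
Hypotheses (lL : linear_on_Ap U p L) (M0 : 0 <= M).
Hypothesis bL : forall f, Ap U p f -> cabs (L f) <= M * Apnorm U p f.

(** Linearity is given on [A^p] in the form [a f + g] only, so the zero function is produced as
    [- e_0 + e_0]. *)
Lemma linear_on_Ap0 : L (fun=> 0) = 0.
Proof.
have H := lL (-1) (Ap_mono 0) (Ap_mono 0); rewrite mulN1r addNr in H.
by rewrite -[RHS]H; congr L; apply/funext => z; rewrite mulN1r addNr.
Qed.

Lemma Ap0 : Ap U p (fun=> 0).
Proof.
have := Ap_lin dU (-1) p0 (Ap_mono 0) (Ap_mono 0).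
by congr (Ap U p _); apply/funext => z; rewrite mulN1r addNr.
Qed.

Lemma linear_on_ApZ a f : Ap U p f -> Ap U p (fun z => a * f z) /\ L (fun z => a * f z) = a * L f.
Proof.
move=> Af; have E : (fun z => a * f z) = (fun z => a * f z + 0) by apply/funext => z; rewrite addr0.
have H := lL a Af Ap0; split; rewrite E; first exact: Ap_lin Af Ap0.
by rewrite H linear_on_Ap0 addr0.
Qed.

Lemma linear_on_ApB f g : Ap U p f -> Ap U p g ->
  Ap U p (fun z => f z - g z) /\ L (fun z => f z - g z) = L f - L g.
Proof.
move=> Af Ag; have E : (fun z => f z - g z) = (fun z => -1 * g z + f z).
  by apply/funext => z; rewrite mulN1r addrC.
have H := lL (-1) Ag Af; split; rewrite E; first exact: Ap_lin Ag Af.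
by rewrite H mulN1r; exact: addrC.
Qed.

Lemma linear_on_Ap_sum (c : nat -> R[i]) N : Ap U p (fun z => \sum_(k < N) c k * mono m k z) /\
  L (fun z => \sum_(k < N) c k * mono m k z) = \sum_(k < N) c k * L (mono m k).
Proof.
elim: N => [|N [IHA IHL]].
  have E : (fun z => \sum_(k < 0) c k * mono m k z) = (fun=> 0) :> (R[i] -> R[i]).
    by apply/funext => z; rewrite big_ord0.
  by rewrite E big_ord0; split; [exact: Ap0|exact: linear_on_Ap0].
have E : (fun z => \sum_(k < N.+1) c k * mono m k z) =
    (fun z => c N * mono m N z + \sum_(k < N) c k * mono m k z).
  by apply/funext => z; rewrite big_ord_recr/= addrC.
have H := lL (c N) (Ap_mono N) IHA; split; rewrite E; first exact: Ap_lin (Ap_mono N) IHA.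
by rewrite H IHL big_ord_recr; exact: addrC.
Qed.

Lemma holomorphic_dilate f (r : R) : 0 < r < 1 -> holomorphic_on U f ->
  holomorphic_on U (fun z => f (r%:C%C * z)).
Proof.
move=> /andP[r0 r1] hf; have rC : cabs (r%:C%C : R[i]) = r by rewrite cabs_real gtr0_norm.
have UU z : U z -> U (r%:C%C * z).
  case: dU => -> /=; rewrite /disc /pdisc /= cabsM rC.
    by move=> z1; rewrite (lt_trans _ r1)// gtr_pMr.
  by move=> /andP[z0 z1]; rewrite mulr_gt0//= (lt_trans _ r1)// gtr_pMr.
move=> z /UU /hf [d hd]; exists (r%:C%C * d) => eps eps0.
have r0' : (r%:C%C : R[i]) != 0 by rewrite -cabs_gt0 rC.
have [delta delta0 H] := hd eps eps0; exists delta => // h h0 hdelta.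
have := H (r%:C%C * h); rewrite mulf_neq0// cabsM rC => /(_ erefl) H'.
have {H'}/H' : r * cabs h < delta by rewrite (le_lt_trans _ hdelta)// ler_piMl ?cabs_ge0// ltW.
rewrite mulrDr; set A := f _ - f _ => H'.
have -> : A / h - r%:C%C * d = r%:C%C * (A / (r%:C%C * h) - d).
  by rewrite invfM mulrBr [r%:C%C * (A * _)]mulrCA mulVKf.
rewrite cabsM rC (le_lt_trans _ H')// ler_piMl ?cabs_ge0// ltW//.
Qed.

(** After multiplication by [z^m], the Taylor polynomials approximate the dilation uniformly on the
    disc with geometric error; by [Ap_le] this is approximation in norm, and [L] vanishes on the
    polynomials. *)
Lemma dilate_functional0 f (r : R) : (forall k, L (mono m k) = 0) -> 0 < r < 1 ->
  Ap U p f -> pole_free (fun z => f z * z ^+ m) ->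
  Ap U p (fun z => f (r%:C%C * z)) /\ L (fun z => f (r%:C%C * z)) = 0.
Proof.
move=> L0 r01 [hf _] pf; have [r0 r1] := andP r01.
have rC : cabs (r%:C%C : R[i]) = r by rewrite cabs_real gtr0_norm.
have r0' : (r%:C%C : R[i]) != 0 by rewrite -cabs_gt0 rC.
pose h z := f z * z ^+ m.
have hh : holomorphic_on (@pdisc R) h.
  apply: holomorphicM; first exact: holomorphicS (pdisc_sub dU) hf.
  by apply: holomorphicX; exact: holomorphic_id.
(* Coefficients are estimated on a circle strictly between [r] and 1, which gives the ratio
   [c = r / s < 1]. *)
pose s := (1 + r) / 2.
have s01 : 0 < s < 1 by rewrite /s; apply/andP; split; lra.
have rs : r < s by rewrite /s; lra.
have [s0 s1] := andP s01.
have [B B0 hB] := annulus_bounded hh s0 s1.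
have hB' t : cabs (h (s%:C%C * cis t)) <= B.
  by apply: hB; rewrite cabs_polar gtr0_norm// lexx.
pose c := r / s.
have c01 : 0 <= c < 1 by rewrite /c divr_ge0 ?(ltW r0) ?(ltW s0)//= ltr_pdivrMr// mul1r.
have [c0 c1] := andP c01.
pose a k := tcoef h k * r%:C%C ^+ k * r%:C%C ^- m.
pose K := B / (1 - c) * r ^- m.
have K0 : 0 <= K by rewrite /K mulr_ge0 ?invr_ge0 ?exprn_ge0 ?(ltW r0)// divr_ge0 ?subr_ge0 ?(ltW B0) ?(ltW c1).
pose D N z := f (r%:C%C * z) - \sum_(k < N) a k * mono m k z.
have hD N : holomorphic_on U (D N).
  rewrite (_ : D N = fun z => f (r%:C%C * z) + -1 * \sum_(k < N) a k * mono m k z); last first.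
    by apply/funext => z; rewrite mulN1r.
  apply: holomorphicD; first exact: holomorphic_dilate.
  apply: holomorphicM; first exact: holomorphic_cst.
  by have [[]] := linear_on_Ap_sum a N.
have bD N z : pdisc z -> cabs (D N z) <= K * c ^+ N * cabs z `^ (- m%:R).
  move=> /andP[z0 z1]; have zN0 : z != 0 by rewrite -cabs_gt0.
  have rz : 0 < cabs (r%:C%C * z) < s.
    by rewrite cabsM rC mulr_gt0//= (lt_trans _ rs)// gtr_pMr.
  have := taylor_remainder N hh pf s01 rz hB'.
  have -> : D N z = (h (r%:C%C * z) - \sum_(k < N) tcoef h k * (r%:C%C * z) ^+ k) * (r%:C%C * z) ^- m.
    rewrite mulrBl /h mulfK ?expf_neq0 ?mulf_neq0// /D mulr_suml; congr (_ - _).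
    by apply: eq_bigr => k _; rewrite /a /mono !exprMn invfM; ring.
  rewrite [cabs (_ / _)]cabsM cabsV cabsX !cabsM rC => H.
  rewrite powRN powR_mulrn ?cabs_ge0// exprMn invfM mulrA ler_wpM2r ?invr_ge0 ?exprn_ge0 ?cabs_ge0//.
  rewrite /K mulrAC ler_wpM2r ?invr_ge0 ?exprn_ge0 ?(ltW r0)// (le_trans H)//.
  have le1 : r * cabs z / s <= c by rewrite /c ler_wpM2r ?invr_ge0 ?(ltW s0)// ler_piMr ?(ltW r0) ?(ltW z1).
  have ge0 : 0 <= r * cabs z / s by rewrite !mulr_ge0 ?invr_ge0 ?(ltW r0) ?(ltW z0) ?(ltW s0).
  rewrite ler_pM ?exprn_ge0//.
  - by rewrite divr_ge0 ?(ltW B0)// subr_ge0 (le_trans le1 (ltW c1)).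
  - by rewrite ler_wpM2l ?(ltW B0)// lef_pV2 ?posrE ?subr_gt0// ?(le_lt_trans le1 c1)// lerB.
  - by rewrite lerXn2r.
have AD N := @Ap_le R U dU p m (D N) (K * c ^+ N) p0 pm (mulr_ge0 K0 (exprn_ge0 N c0)) (hD N) (bD N).
have Ar : Ap U p (fun z => f (r%:C%C * z)).
  have [+ _] := AD 0%N; congr (Ap U p _).
  by apply/funext => z; rewrite /D big_ord0 subr0.
split => //; apply/eqP; rewrite -cabs_eq0 eq_le cabs_ge0 andbT.
pose E := (fine (\int[@dV R]_(x in PD) (cabs (toC x) `^ (- (p * m%:R)))%:E)%E) `^ p^-1.
apply: (@geometric_le0 _ _ (M * K * E) c c01) => N.
have [As Ls] := linear_on_Ap_sum a N.
have [_ LD] := linear_on_ApB Ar As.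
have -> : L (fun z => f (r%:C%C * z)) = L (D N).
  rewrite /D LD Ls big1 ?subr0// => k _.
  by rewrite L0 mulr0.
have [AN nN] := AD N; rewrite (le_trans (bL AN))//.
have -> : M * K * E * c ^+ N = M * (K * c ^+ N * E) by ring.
exact: ler_wpM2l.
Qed.

(** If [L f] were nonzero, boundedness of [L] would keep all dilations of [f] at distance at least
    [|L f| / M] from [f], as [L] vanishes on them. Fatou's lemma shows that the [p]-th power [d] of
    this distance is at most [X (rho^-2 - 1)] for every [rho < 1], which is impossible. *)
Lemma functional0 f : (forall k, L (mono m k) = 0) ->
  Ap U p f -> pole_free (fun z => f z * z ^+ m) -> L f = 0.
Proof.
move=> L0 Af pf; apply/eqP/contraT => Lf0.
have hf := Af.1.
pose I (g : R[i] -> R[i]) := (\int[@dV R]_(x in PD) (cabs (g (toC x)) `^ p)%:E)%E.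
have I0 g : (0 <= I g)%E by apply: integral_ge0 => x _; rewrite lee_fin powR_ge0.
have IE g : Ap U p g -> exists2 i, 0 <= i & I g = i%:E.
  move=> [hg go]; apply: ge0_fin_ex; first exact: I0.
  by move: go; rewrite (wint1E dU p hg).
have [i i0 If] := IE f Af.
have delta0 : 0 < cabs (L f) by rewrite cabs_gt0.
have Mgt0 : 0 < M.
  rewrite lt_neqAle M0 andbT; apply/eqP => M_0.
  by have := bL Af; rewrite -M_0 mul0r leNgt delta0.
pose d := (cabs (L f) / M) `^ p.
have d0 : 0 < d by rewrite powR_gt0// divr_gt0.
have low (r : R) : 0 < r < 1 -> exists2 j, d <= j & I (fun z => f (r%:C%C * z) - f z) = j%:E.
  move=> r01; have [Ar Lr] := dilate_functional0 L0 r01 Af pf.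
  have [AB LB] := linear_on_ApB Ar Af.
  have [j j0 Ij] := IE _ AB; exists j => //.
  have := bL AB; rewrite LB Lr sub0r cabsN (ApnormE dU p AB.1) [X in fine X](_ : _ = j%:E); last exact: Ij.
  rewrite [fine _]/=.
  rewrite -ler_pdivrMl// mulrC => H; rewrite /d.
  rewrite (le_trans (ge0_ler_powR (ltW p0) _ _ H)) ?nnegrE ?divr_ge0 ?cabs_ge0 ?powR_ge0//.
  by rewrite -powRrM mulVf ?gt_eqF// powRr1.
pose X := 2 `^ p * i; have X0 : 0 <= X by rewrite mulr_ge0 ?powR_ge0.
(* Fatou's lemma for [2^p (|f_n|^p + |f|^p) - |f_n - f|^p >= 0], with [f_n] dilations of [f]. *)
have key (rho : R) : 0 < rho < 1 -> d <= X * (rho ^- 2 - 1).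
  move=> /andP[rho0 rho1].
  (* These radii tend to 1 and stay above [rho], so the integrals of [|f_n|^p] are all at most
     [rho^-2] times that of [|f|^p]. *)
  pose r (n : nat) : R := 1 - (1 - rho) * n.+1%:R^-1.
  have nV (n : nat) : 0 < (n.+1%:R^-1 : R) <= 1 by rewrite invr_gt0 ltr0Sn invf_le1 ?ler1n ?ltr0Sn.
  have rrho n : rho <= r n.
    have /andP[n0 n1] := nV n; rewrite /r lerBrDr -lerBrDl -[leRHS]mulr1 ler_wpM2l//.
    by rewrite subr_ge0 ltW.
  have r01 n : 0 < r n < 1.
    have /andP[n0 n1] := nV n; rewrite (lt_le_trans rho0 (rrho n))/= /r gtrBl mulr_gt0//.
    by rewrite subr_gt0.
  have mPD := @measurable_PD R.
  pose A n x := (cabs (f ((r n)%:C%C * toC x)) `^ p)%R.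
  pose A' x := (cabs (f (toC x)) `^ p)%R.
  pose Bn n x := (cabs (f ((r n)%:C%C * toC x) - f (toC x)) `^ p)%R.
  have mA n : measurable_fun PD (EFin \o A n).
    exact: (measurable_cabs_PD dU p (holomorphic_dilate (r01 n) hf)).
  have mA' : measurable_fun PD (EFin \o A') by exact: (measurable_cabs_PD dU p hf).
  have hB n : Ap U p (fun z => f ((r n)%:C%C * z) - f z).
    by have [Ar _] := dilate_functional0 L0 (r01 n) Af pf; have [] := linear_on_ApB Ar Af.
  have mB n : measurable_fun PD (EFin \o Bn n) by exact: (measurable_cabs_PD dU p (hB n).1).
  pose F n x := (2 `^ p * (A n x + A' x) - Bn n x)%R.
  have F0 n x : 0 <= F n x.
    rewrite /F subr_ge0 /Bn; apply: le_trans (powRD_le (ltW p0) (cabs_ge0 _) (cabs_ge0 _)).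
    by rewrite ge0_ler_powR ?nnegrE ?addr_ge0 ?cabs_ge0 ?(ltW p0)// ler_cabsB.
  have mS n : measurable_fun PD (EFin \o (fun x => 2 `^ p * (A n x + A' x))%R).
    apply/measurable_EFinP; apply: measurable_funM; first exact: measurable_cst.
    by apply: measurable_funD; exact/measurable_EFinP.
  have mF n : measurable_fun PD (EFin \o F n).
    by apply/measurable_EFinP; apply: measurable_funB; exact/measurable_EFinP.
  have FI n : (\int[@dV R]_(x in PD) (F n x)%:E <= (X * (rho ^- 2 + 1) - d)%:E)%E.
    have [j dj Ij] := low (r n) (r01 n).
    have s1 : (\int[@dV R]_(x in PD) (2 `^ p * (A n x + A' x))%:E =
               \int[@dV R]_(x in PD) (F n x)%:E + j%:E)%E.
      rewrite -Ij -ge0_integralD; [|exact: mPD|by move=> x _; rewrite lee_fin F0|exact: mF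
        |by move=> x _; rewrite lee_fin powR_ge0|exact: mB].
      by apply: eq_integral => x _; rewrite -EFinD subrK.
    have s2 : (\int[@dV R]_(x in PD) (2 `^ p * (A n x + A' x))%:E =
               (2 `^ p)%:E * (\int[@dV R]_(x in PD) (A n x)%:E + i%:E))%E.
      rewrite -If -ge0_integralD; [|exact: mPD|by move=> x _; rewrite lee_fin powR_ge0|exact: mA
        |by move=> x _; rewrite lee_fin powR_ge0|exact: mA'].
      rewrite -(PD_integralZl _ _ (powR_ge0 2 p)); last 2 first.
      - by apply: emeasurable_funD; [exact: mA|exact: mA'].
      - by move=> x; rewrite -EFinD lee_fin addr_ge0 ?powR_ge0.
      by apply: eq_integral => x _; rewrite EFinM EFinD.
    have s3 : (\int[@dV R]_(x in PD) (A n x)%:E <= (rho ^- 2 * i)%:E)%E.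
      have := @ge0_integral_scale R (r n) (fun z => (cabs (f z) `^ p)%:E) (r01 n) mA' (mA n).
      rewrite -/(I f) If => H.
      apply: (le_trans (H _)); first by move=> z pz; rewrite lee_fin powR_ge0.
      rewrite -EFinM lee_fin ler_wpM2r// lef_pV2 ?posrE ?exprn_gt0//; last by have /andP[] := r01 n.
      by rewrite lerXn2r ?nnegrE// ltW//; have /andP[] := r01 n.
    have : (\int[@dV R]_(x in PD) (F n x)%:E + j%:E <= (X * (rho ^- 2 + 1))%:E)%E.
      rewrite -s1 s2 (_ : X * _ = 2 `^ p * (rho ^- 2 * i + i)); last by rewrite /X; ring.
      rewrite EFinM EFinD; apply: lee_wpmul2l; first by rewrite lee_fin powR_ge0.
      by rewrite leeD2r.
    rewrite -leeBrDr// -EFinB => H; apply: (le_trans H).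
    by rewrite lee_fin lerB.
  have := @fatou_bound _ _ R (@dV R) PD (fun n x => (F n x)%:E) (fun x => (2 `^ p * (A' x + A' x))%:E)
    (X * (rho ^- 2 + 1) - d)%:E mPD mF.
  move=> /(_ (fun n x _ => F0 n x)).
  have lim x : PD x -> (F n x)%:E @[n --> \oo] --> (2 `^ p * (A' x + A' x))%:E.
    move=> xD; have Ux := pdisc_sub dU xD.
    have small eps : 0 < eps -> \forall n \near \oo,
        cabs (f ((r n)%:C%C * toC x) - f (toC x)) < eps.
      move=> eps0; have [delta dl0 H] := holomorphic_continuous hf Ux eps0.
      have := @near_infty_natSinv_lt R (PosNum dl0); apply: filterS => n /= nd.
      apply: H; rewrite -[X in _ - X]mul1r -mulrBl cabsM.
      have -> : (r n)%:C%C - 1 = ((r n - 1)%:C)%C by rewrite [RHS]rmorphB rmorph1.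
      rewrite cabs_real /r addrC addKr normrN ger0_norm; last first.
        by rewrite mulr_ge0 ?subr_ge0 ?(ltW rho1)//; have /andP[/ltW] := nV n.
      apply: le_lt_trans nd; have /andP[n0 _] := nV n.
      have /andP[x0 x1] := xD.
      rewrite mulrAC ler_piMl ?(ltW n0)//.
      rewrite mulr_ile1 ?cabs_ge0 ?subr_ge0 ?(ltW rho1) ?(ltW x1)//.
      by rewrite gerBl ltW.
    have c1 : A n x @[n --> \oo] --> A' x.
      apply: cvg_powR => //; [by move=> n; exact: cabs_ge0|exact: cabs_ge0|].
      apply/cvgrPdist_lt => eps eps0; apply: filterS (small eps eps0) => n H.
      rewrite (le_lt_trans _ H)// ler_norml; apply/andP; split.
        by rewrite lerNl opprB ler_cabs_sub.
      by rewrite cabs_distC ler_cabs_sub.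
    have c2 : Bn n x @[n --> \oo] --> (0 : R).
      have p0E : p != 0 by rewrite gt_eqF.
      rewrite -[X in _ --> X](powR0 p0E).
      apply: cvg_powR => //; [by move=> n; exact: cabs_ge0|].
      apply/cvgrPdist_lt => eps eps0; apply: filterS (small eps eps0) => n H.
      by rewrite sub0r normrN ger0_norm ?cabs_ge0.
    apply: cvg_EFin; first by apply: nearW.
    rewrite -[X in _ --> X]subr0; apply: cvgB => //.
    by apply: cvgMr; apply: cvgD => //; exact: cvg_cst.
  move=> /(_ lim FI).
  have -> : (\int[@dV R]_(x in PD) (2 `^ p * (A' x + A' x))%:E = (X + X)%:E)%E.
    rewrite -mulrDr EFinM EFinD -If -ge0_integralD; [|exact: mPD|by move=> x _; rewrite lee_fin powR_ge0|exact: mA'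
        |by move=> x _; rewrite lee_fin powR_ge0|exact: mA'].
    rewrite -(PD_integralZl _ _ (powR_ge0 2 p)); last 2 first.
    - by apply: emeasurable_funD; exact: mA'.
    - by move=> x; rewrite -EFinD lee_fin addr_ge0 ?powR_ge0.
    by apply: eq_integral => x _; rewrite EFinM EFinD.
  by rewrite lee_fin => H; rewrite mulrBr mulr1; move: H; rewrite mulrDr mulr1; lra.
(* With [rho = 1 / (1 + y)] one has [rho^-2 - 1 <= 3 y], hence [d <= 3 X y]; the [X + 1] in place of
   [X] makes [3 X y < d] strict. *)
pose y := Num.min 1 (d / (3 * (X + 1))).
have y0 : 0 < y by rewrite lt_min ltr01 divr_gt0// mulr_gt0// ltr_wpDl.
have y1 : y <= 1 by rewrite ge_min lexx.
have yd : 3 * (X + 1) * y <= d.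
  by rewrite mulrC -ler_pdivlMr ?mulr_gt0 ?ltr_wpDl// ge_min lexx orbT.
have := key (1 + y)^-1; rewrite exprVn invrK.
have -> : 0 < (1 + y)^-1 < 1 by rewrite invr_gt0 addr_gt0//= invf_lt1 ?addr_gt0// ltrDl.
move=> /(_ erefl) H.
have : X * ((1 + y) ^+ 2 - 1) <= X * (3 * y).
  rewrite ler_wpM2l// expr2; have : y * y <= y by rewrite ler_piMr// ltW.
  lra.
by nra.
Qed.

End functional.
End density_of_monomials.

(** * The pairing *)

Lemma hoelder_on d (T : measurableType d) (R : realType) (mu : {measure set T -> \bar R})
    (D : set T) (f g : T -> R) (p q A B : R) :
  measurable D -> measurable_fun D f -> measurable_fun D g ->
  (forall x, 0 <= f x) -> (forall x, 0 <= g x) -> 0 < p -> 0 < q -> p^-1 + q^-1 = 1 ->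
  (\int[mu]_(x in D) (f x `^ p)%:E = A%:E)%E -> (\int[mu]_(x in D) (g x `^ q)%:E = B%:E)%E ->
  (\int[mu]_(x in D) (f x * g x)%:E <= (A `^ p^-1 * B `^ q^-1)%:E)%E.
Proof.
move=> mD mf mg f0 g0 p0 q0 pq fA gB.
have mf' : measurable_fun [set: T] (f \_ D) by apply/(measurable_restrictT _ mD).
have mg' : measurable_fun [set: T] (g \_ D) by apply/(measurable_restrictT _ mD).
have N (h : T -> R) (s C : R) : (forall x, 0 <= h x) -> 0 < s ->
    (\int[mu]_(x in D) (h x `^ s)%:E = C%:E)%E -> (Lnorm mu s%:E (EFin \o (h \_ D)) = (C `^ s^-1)%:E)%E.
  move=> h0 s0 hC; rewrite unlock -poweR_EFin -hC [in RHS]integral_mkcond; congr (_ `^ _)%E.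
  apply: eq_integral => x _; rewrite /= !patchE; case: ifPn => xD.
    by rewrite ger0_norm.
  by rewrite normr0 powR0 ?gt_eqF.
have := @hoelder _ T R mu _ _ p q mf' mg' p0 q0 pq.
rewrite (N f p A)// (N g q B)// Lnorm1 EFinM; apply: le_trans.
rewrite integral_mkcond le_eqVlt; apply/orP; left; apply/eqP; apply: eq_integral => x _.
rewrite /= !patchE; case: ifPn => xD; first by rewrite ger0_norm ?mulr_ge0.
by rewrite mul0r normr0.
Qed.

Section pairing.
Context {R : realType}.
Local Notation PD := (@toC R @^-1` (@pdisc R)).
Variables (U : set R[i]) (p : R).
Hypotheses (dU : discs U) (p1 : 1 < p).
Let q := p / (p - 1).
Implicit Types f g : R[i] -> R[i].

Let p0 : 0 < p. Proof. exact: lt_trans p1. Qed.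
Let p10 : 0 < p - 1. Proof. by rewrite subr_gt0. Qed.
Let q0 : 0 < q. Proof. exact: divr_gt0. Qed.
Let q1 : 1 < q. Proof. by rewrite /q ltr_pdivlMr// mul1r gtrBl. Qed.
Let pqV : p^-1 + q^-1 = 1. Proof. by rewrite /q; field; rewrite !gt_eqF. Qed.

Lemma PD_cI_lin (a : R[i]) (F G : R * R -> R[i]) : cintegrable (@dV R) PD F ->
  cintegrable (@dV R) PD G -> cI (@dV R) PD (fun x => a * F x + G x) =
  a * cI (@dV R) PD F + cI (@dV R) PD G.
Proof.
move=> iF iG.
have iaF : cintegrable (@dV R) PD (fun x => a * F x).
  by apply: (cintegrableZ _ _ iF); exact: measurable_PD.
have -> : a * cI (@dV R) PD F = cI (@dV R) PD (fun x => a * F x).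
  by apply/esym; apply: (cIZ _ _ iF); exact: measurable_PD.
by apply: (cID _ iaF iG); exact: measurable_PD.
Qed.

Lemma measurable_eta (s : R) : measurable_fun [set: R * R] (fun x => eta_q s (toC x)).
Proof.
apply: measurable_funM; first exact: measurable_cst.
by apply: measurable_powR_comp; exact: measurable_mod.
Qed.

Lemma eta_ge0 z : 0 <= eta_q q z.
Proof. by rewrite /eta_q mulr_ge0 ?powR_ge0// subr_ge0 ltW. Qed.

Lemma chi_discs V z : discs V -> V z -> V (chi p z).
Proof.
case=> ->; last exact: pdisc_chi.
by rewrite /disc/= cabs_chi// powR_lt1 ?cabs_ge0.
Qed.

Lemma cmeasurable_comp_chi V g : discs V -> holomorphic_on V g ->
  cmeasurable (@toC R @^-1` V) (fun x => g (chi p (toC x))).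
Proof.
move=> dV hg; have [m1 m2] := @cmeasurable_chi R p.
have mV := measurable_discs dV.
pose X x := (complex.Re (chi p (toC x)), complex.Im (chi p (toC x))) : R * R.
have XE x : toC (X x) = chi p (toC x) by exact: complex_eq.
have -> : (fun x => g (chi p (toC x))) = (g \o @toC R) \o X by apply/funext => x /=; rewrite XE.
apply: (cmeasurable_comp mV); last first.
- apply: measurable_funTS; apply/measurable_fun_pairP; split; [exact: m1|exact: m2].
- exact: holomorphic_cmeasurable (copen_discs dV) hg.
- by move=> _ [x xV <-] /=; rewrite XE; exact: chi_discs.
Qed.

(** Composition with [chi_p] is an isometry from the weighted space into unweighted [L^q], which
    reduces the pairing to Hoelder's inequality. *)
Lemma wint_eta g : holomorphic_on U g ->
  wint U q (eta_q q) g = (\int[@dV R]_(x in PD) (cabs (g (chi p (toC x))) `^ q)%:E)%E.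
Proof.
move=> hg; have hg' := holomorphicS (pdisc_sub dU) hg.
rewrite (wint_discs dU q hg (measurable_eta q) eta_ge0).
have := @ge0_integral_chi R p (fun z => (cabs (g z) `^ q)%:E) p1.
move=> ->; first by apply: eq_integral => x _; rewrite -EFinM.
- exact: (measurable_cabs_PD dU q hg).
- apply/measurable_EFinP; apply: measurable_cabs_powR.
  exact: (cmeasurable_comp_chi (or_intror erefl) hg').
- by move=> z _; rewrite lee_fin powR_ge0.
Qed.

Lemma pairing_cmeasurable V f g : discs V -> holomorphic_on V f -> holomorphic_on V g ->
  cmeasurable (@toC R @^-1` V) (fun x => f (toC x) * (g (chi p (toC x)))^*%C).
Proof.
move=> dV hf hg; apply: cmeasurableM.
  exact: holomorphic_cmeasurable (copen_discs dV) hf.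
by apply: cmeasurable_conj; exact: cmeasurable_comp_chi.
Qed.

Lemma pairingE f g : holomorphic_on U f -> holomorphic_on U g ->
  pairing U p f g = cI (@dV R) PD (fun x => f (toC x) * (g (chi p (toC x)))^*%C).
Proof.
move=> hf hg; have [m1 m2] := pairing_cmeasurable dU hf hg.
rewrite /pairing /cint /cI /Rintegral; congr (fine _ +i* fine _)%C.
- by apply: (integral_discs dU); exact/measurable_EFinP.
- by apply: (integral_discs dU); exact/measurable_EFinP.
Qed.

Lemma pairing_hoelder f g : Ap U p f -> Aspace U q (eta_q q) g ->
  cintegrable (@dV R) PD (fun x => f (toC x) * (g (chi p (toC x)))^*%C) /\
  cabs (pairing U p f g) <= Apnorm U p f * Anorm U q (eta_q q) g.
Proof.
move=> [hf fo] [hg go].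
have dPD : discs (@pdisc R) by right.
have hf' := holomorphicS (pdisc_sub dU) hf; have hg' := holomorphicS (pdisc_sub dU) hg.
have mPD := @measurable_PD R.
have mF := pairing_cmeasurable dPD hf' hg'.
have fE := wint1E dU p hf; have gE := wint_eta hg.
have [A A0 AE] : exists2 A, 0 <= A & (\int[@dV R]_(x in PD) (cabs (f (toC x)) `^ p)%:E = A%:E)%E.
  apply: ge0_fin_ex; first by apply: integral_ge0 => x _; rewrite lee_fin powR_ge0.
  by move: fo; rewrite fE.
have [B B0 BE] : exists2 B, 0 <= B & (\int[@dV R]_(x in PD) (cabs (g (chi p (toC x))) `^ q)%:E = B%:E)%E.
  apply: ge0_fin_ex; first by apply: integral_ge0 => x _; rewrite lee_fin powR_ge0.
  by move: go; rewrite gE.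
have mf : measurable_fun PD (fun x => cabs (f (toC x))).
  exact: measurable_cabs (holomorphic_PD dU hf).
have mg : measurable_fun PD (fun x => cabs (g (chi p (toC x)))).
  exact: measurable_cabs (cmeasurable_comp_chi dPD hg').
have H := @hoelder_on _ _ R (@dV R) PD _ _ p q A B mPD mf mg (fun x => cabs_ge0 _)
  (fun x => cabs_ge0 _) p0 q0 pqV AE BE.
have HE : (\int[@dV R]_(x in PD) (cabs (f (toC x) * (g (chi p (toC x)))^*%C))%:E <= (A `^ p^-1 * B `^ q^-1)%:E)%E.
  apply: le_trans H; rewrite le_eqVlt; apply/orP; left; apply/eqP.
  by apply: eq_integral => x _; rewrite cabsM cabs_conj.
have iF : cintegrable (@dV R) PD (fun x => f (toC x) * (g (chi p (toC x)))^*%C).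
  apply: cintegrable_lty; [exact: mPD|exact: mF|].
  by apply: (le_lt_trans HE); rewrite ltry.
split => //; rewrite (pairingE hf hg).
have le := cabs_cI _ iF; apply: (le_trans (le _)); first exact: mPD.
rewrite /Apnorm /Anorm fE gE AE BE -lee_fin; apply: le_trans HE.
rewrite /Rintegral fineK//; have ic := cintegrable_cabs _ iF.
by apply: (integrable_fin_num _ (ic _)); exact: mPD.
Qed.

Lemma pairing_linear g : Aspace U q (eta_q q) g -> linear_on_Ap U p (fun f => pairing U p f g).
Proof.
move=> Ag a f1 f2 A1 A2; have A3 := Ap_lin dU a p0 A1 A2.
have [i1 _] := pairing_hoelder A1 Ag; have [i2 _] := pairing_hoelder A2 Ag.
have mPD := @measurable_PD R.
rewrite (pairingE A1.1 Ag.1) (pairingE A2.1 Ag.1) (pairingE A3.1 Ag.1).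
rewrite -(PD_cI_lin a i1 i2).
by apply: eq_cI => x _; rewrite mulrDl mulrA.
Qed.

Lemma pairing_conj_linear (a : R[i]) f g1 g2 : Ap U p f ->
  Aspace U q (eta_q q) g1 -> Aspace U q (eta_q q) g2 ->
  pairing U p f (fun z => a * g1 z + g2 z) = (a^*)%C * pairing U p f g1 + pairing U p f g2.
Proof.
move=> Af A1 A2; have A3 := Aspace_lin dU a q0 (measurable_eta q) eta_ge0 A1 A2.
have [i1 _] := pairing_hoelder Af A1; have [i2 _] := pairing_hoelder Af A2.
have mPD := @measurable_PD R.
rewrite (pairingE Af.1 A1.1) (pairingE Af.1 A2.1) (pairingE Af.1 A3.1).
rewrite -(PD_cI_lin (a^*)%C i1 i2).
apply: eq_cI => x _.
have -> : ((a * g1 (chi p (toC x)) + g2 (chi p (toC x)))^*)%C =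
  (a^*)%C * ((g1 (chi p (toC x)))^*)%C + ((g2 (chi p (toC x)))^*)%C.
  by rewrite [LHS]rmorphD; congr (_ + _); exact: rmorphM.
by ring.
Qed.

End pairing.

(** * Representation of functionals *)

(** A linear factor is absorbed by a slightly larger ratio, here [s = (1 + rho) / 2]. The finitely
    many [N] below the threshold of [geom_lin_small] are covered by the second summand of [K]. *)
Lemma geom_lin_le (R : realType) (rho c d : R) : 0 < rho < 1 -> 0 <= c -> 0 <= d ->
  exists s K : R, [/\ 0 <= s < 1, 0 <= K & forall N : nat, rho ^+ N * (c + d * N%:R) <= K * s ^+ N].
Proof.
move=> /andP[r0 r1] c0 d0; pose s := (1 + rho) / 2.
have s0 : 0 < s by rewrite /s; lra.
have s1 : s < 1 by rewrite /s; lra.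
have rs : rho < s by rewrite /s; lra.
have rs01 : 0 < rho / s < 1 by rewrite divr_gt0//= ltr_pdivrMr// mul1r.
have [N0 hN0] := geom_lin_small rs01 c0 d0.
have sN0 : 0 < s ^+ N0 by rewrite exprn_gt0.
have K0 : 0 <= (c + d * N0%:R) / s ^+ N0.
  by rewrite divr_ge0 ?(ltW sN0)// addr_ge0// mulr_ge0.
exists s, (1 + (c + d * N0%:R) / s ^+ N0); split; first by rewrite (ltW s0).
  by rewrite addr_ge0.
move=> N; have sN : 0 < s ^+ N by rewrite exprn_gt0.
have [NN|/ltnW NN] := leqP N0 N.
  have := hN0 N NN; rewrite expr_div_n mulrAC ler_pdivrMr// mul1r => /le_trans; apply.
  by rewrite ler_peMl ?(ltW sN)// lerDl.
rewrite mulrDl mul1r.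
have cd0 : 0 <= c + d * N%:R by rewrite addr_ge0// mulr_ge0.
have : rho ^+ N * (c + d * N%:R) <= c + d * N0%:R.
  rewrite (@le_trans _ _ (c + d * N%:R))//.
    by rewrite ler_piMl// exprn_ile1// ltW.
  by rewrite lerD2l ler_wpM2l// ler_nat.
move=> /le_trans; apply; rewrite -[leLHS]add0r lerD ?(ltW sN)//.
rewrite mulrAC ler_pdivlMr// ler_wpM2l//; last first.
  by rewrite ler_wiXn2l// ltW.
by rewrite addr_ge0// mulr_ge0.
Qed.

(** * Second-order expansions of inverses *)

Section inverse_expansion.
Context {R : realType}.
Implicit Types d e : R[i].

(** The constant depends on [delta] only. With [d = 1 - z b] and [e = z h], this differentiates the
    rational kernel in its parameter uniformly in [z]. *)
Lemma inv_expansion d e (delta : R) : 0 < delta -> delta <= cabs d -> delta <= cabs (d - e) ->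
  cabs ((d - e)^-1 - d^-1 - e * d^-1 ^+ 2) <= cabs e ^+ 2 / delta ^+ 3.
Proof.
move=> delta0 dd de; have d0 : d != 0 by rewrite -cabs_gt0 (lt_le_trans delta0).
have e0 : d - e != 0 by rewrite -cabs_gt0 (lt_le_trans delta0).
have -> : (d - e)^-1 - d^-1 - e * d^-1 ^+ 2 = e ^+ 2 * (d^-1 ^+ 2 * (d - e)^-1).
  by field; rewrite d0 e0.
have -> : cabs e ^+ 2 / delta ^+ 3 = cabs e ^+ 2 * (delta^-1 ^+ 2 * delta^-1).
  by rewrite -exprVn; ring.
rewrite cabsM cabsX ler_wpM2l ?exprn_ge0 ?cabs_ge0// cabsM cabsX !cabsV.
rewrite ler_pM ?exprn_ge0 ?invr_ge0 ?cabs_ge0//.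
  by rewrite lerXn2r ?nnegrE ?invr_ge0 ?cabs_ge0 ?(ltW delta0)// lef_pV2// posrE (lt_le_trans delta0).
by rewrite lef_pV2// posrE (lt_le_trans delta0).
Qed.

Lemma inv2_expansion d e (delta : R) : 0 < delta -> delta <= cabs d -> delta <= cabs (d - e) ->
  cabs ((d - e)^-1 ^+ 2 - d^-1 ^+ 2 - 2 * e * d^-1 ^+ 3) <= 3 * cabs e ^+ 2 / delta ^+ 4.
Proof.
move=> delta0 dd de; have d0 : d != 0 by rewrite -cabs_gt0 (lt_le_trans delta0).
have e0 : d - e != 0 by rewrite -cabs_gt0 (lt_le_trans delta0).
have -> : (d - e)^-1 ^+ 2 - d^-1 ^+ 2 - 2 * e * d^-1 ^+ 3 =
   e ^+ 2 * (d^-1 ^+ 2 * (d - e)^-1 ^+ 2 + 2 * (d^-1 ^+ 3 * (d - e)^-1)).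
  by field; rewrite d0 e0.
have D0 : 0 <= delta^-1 by rewrite invr_ge0 ltW.
have u1 : cabs d^-1 <= delta^-1 by rewrite cabsV lef_pV2// posrE (lt_le_trans delta0).
have v1 : cabs (d - e)^-1 <= delta^-1 by rewrite cabsV lef_pV2// posrE (lt_le_trans delta0).
have -> : 3 * cabs e ^+ 2 / delta ^+ 4 = cabs e ^+ 2 * (delta^-1 ^+ 4 * 3).
  by rewrite -exprVn; ring.
rewrite cabsM cabsX ler_wpM2l ?exprn_ge0 ?cabs_ge0//.
apply: (le_trans (ler_cabsD _ _)).
have -> : cabs (d^-1 ^+ 2 * (d - e)^-1 ^+ 2) = cabs d^-1 ^+ 2 * cabs (d - e)^-1 ^+ 2.
  by rewrite cabsM !cabsX.
have -> : cabs (2 * (d^-1 ^+ 3 * (d - e)^-1)) = cabs (2 : R[i]) * (cabs d^-1 ^+ 3 * cabs (d - e)^-1).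
  by rewrite cabsM [cabs (_ / _)]cabsM cabsX.
have -> : cabs (2 : R[i]) = 2 by rewrite -[2]/(2%:R) -(rmorph_nat (real_complex R)) cabs_real ger0_norm.
have U2 : cabs d^-1 ^+ 2 <= delta^-1 ^+ 2 by rewrite lerXn2r ?nnegrE ?cabs_ge0.
have U3 : cabs d^-1 ^+ 3 <= delta^-1 ^+ 3 by rewrite lerXn2r ?nnegrE ?cabs_ge0.
have V2 : cabs (d - e)^-1 ^+ 2 <= delta^-1 ^+ 2 by rewrite lerXn2r ?nnegrE ?cabs_ge0.
have H1 : cabs d^-1 ^+ 2 * cabs (d - e)^-1 ^+ 2 <= delta^-1 ^+ 2 * delta^-1 ^+ 2.
  by rewrite ler_pM ?exprn_ge0 ?cabs_ge0.
have H2 : cabs d^-1 ^+ 3 * cabs (d - e)^-1 <= delta^-1 ^+ 3 * delta^-1.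
  by rewrite ler_pM ?exprn_ge0 ?cabs_ge0.
have -> : delta^-1 ^+ 4 * 3 = delta^-1 ^+ 2 * delta^-1 ^+ 2 + 2 * (delta^-1 ^+ 3 * delta^-1) by ring.
by rewrite lerD// ler_wpM2l.
Qed.

Lemma cabs_1B_mul (z b : R[i]) : cabs z < 1 -> 1 - cabs b <= cabs (1 - z * b).
Proof.
move=> z1; apply: le_trans (cabs_1B _); rewrite cabsM lerB//.
by rewrite ler_piMl ?cabs_ge0// ltW.
Qed.

Lemma holomorphic_inv1B (b : R[i]) : cabs b < 1 -> holomorphic_on (@disc R) (fun z => (1 - z * b)^-1).
Proof.
move=> b1; apply/holomorphicP => z z1; exists (b * (1 - z * b)^-1 ^+ 2) => eps eps0.
pose delta := (1 - cabs b) / 2.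
have delta0 : 0 < delta by rewrite /delta divr_gt0// subr_gt0.
have d3 : 0 < delta ^+ 3 by rewrite exprn_gt0.
exists (Num.min delta (eps * delta ^+ 3)); first by rewrite lt_min delta0 mulr_gt0.
move=> h; rewrite lt_min => /andP[hd he].
have db : delta <= 1 - cabs b.
  have : 0 < 1 - cabs b by rewrite subr_gt0.
  by rewrite /delta; lra.
have D1 : delta <= cabs (1 - z * b) by rewrite (le_trans db)// cabs_1B_mul.
have D2 : delta <= cabs (1 - z * b - h * b).
  have H := ler_cabs_sub (1 - z * b) (h * b); apply: le_trans H.
  have H1 := cabs_1B_mul b z1.
  have H2 : cabs (h * b) <= delta by rewrite cabsM (le_trans _ (ltW hd))// ler_piMr ?cabs_ge0 ?ltW.
  have : 1 - cabs b = delta * 2 by rewrite /delta mulfVK.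
  lra.
have := inv_expansion delta0 D1 D2.
have -> : 1 - (z + h) * b = 1 - z * b - h * b by ring.
have -> : b * (1 - z * b)^-1 ^+ 2 * h = h * b * (1 - z * b)^-1 ^+ 2 by ring.
move=> /le_trans; apply; rewrite ler_pdivrMr// cabsM.
have b0 := cabs_ge0 b; have h0 := cabs_ge0 h.
apply: (@le_trans _ _ (cabs h ^+ 2)).
  by rewrite exprMn ler_piMr ?exprn_ge0// exprn_ile1// ltW.
have -> : eps * cabs h * delta ^+ 3 = cabs h * (eps * delta ^+ 3) by ring.
by rewrite expr2 ler_wpM2l// ltW.
Qed.

End inverse_expansion.

(** * The representing function obtained by applying the functional to a rational kernel *)

Section kernel_functional.
Context {R : realType}.
Local Notation PD := (@toC R @^-1` (@pdisc R)).
Variables (U : set R[i]) (p : R) (m : nat).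
Hypothesis Um : (U = @disc R /\ m = 0%N) \/ (U = @pdisc R /\ 2 <= p * m.+1%:R).
Hypotheses (p1 : 1 < p) (pm : p * m%:R < 2).
Variables (L : (R[i] -> R[i]) -> R[i]) (M : R).
Hypotheses (lL : linear_on_Ap U p L) (M0 : 0 <= M).
Hypothesis bL : forall f, Ap U p f -> cabs (L f) <= M * Apnorm U p f.
Implicit Types G H : R[i] -> R[i].

Let dU : discs U := discs_of Um.
Let p0 : 0 < p. Proof. exact: lt_trans p1. Qed.
Let E : R := (fine (\int[@dV R]_(x in PD) (cabs (toC x) `^ (- (p * m%:R)))%:E)%E) `^ p^-1.
Let E0 : 0 <= E. Proof. exact: powR_ge0. Qed.

Let sub_disc : U `<=` @disc R.
Proof. by case: dU => -> // z /andP[]. Qed.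

(** The functions to which [T] below is applied. They live on the whole disc even when [U] is
    punctured; the factor [z^-m] then brings them into [A^p(U)]. *)
Definition bounded_holomorphic G := holomorphic_on (@disc R) G /\
  exists K, forall z, disc z -> cabs (G z) <= K.

Lemma bounded_holomorphic_lin (a : R[i]) G H : bounded_holomorphic G -> bounded_holomorphic H ->
  bounded_holomorphic (fun z => a * G z + H z).
Proof.
move=> [hG [K GK]] [hH [K' HK]]; split.
  apply: holomorphicD => //; apply: holomorphicM => //; exact: holomorphic_cst.
exists (cabs a * K + K') => z z1; rewrite (le_trans (ler_cabsD _ _))// lerD//; last exact: HK.
by rewrite cabsM ler_wpM2l ?cabs_ge0//; exact: GK.
Qed.

Lemma bounded_holomorphicM G H : bounded_holomorphic G -> bounded_holomorphic H ->
  bounded_holomorphic (fun z => G z * H z).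
Proof.
move=> [hG [K GK]] [hH [K' HK]]; split; first exact: holomorphicM.
exists (K * K') => z z1; rewrite cabsM ler_pM ?cabs_ge0//; [exact: GK|exact: HK].
Qed.

Lemma bounded_holomorphic_id : bounded_holomorphic id.
Proof. by split; [exact: holomorphic_id|exists 1 => z /ltW]. Qed.

Lemma bounded_holomorphic_cst c : bounded_holomorphic (fun=> c).
Proof. by split; [exact: holomorphic_cst|exists (cabs c)]. Qed.

Lemma bounded_holomorphic_inv1B b : cabs b < 1 -> bounded_holomorphic (fun z => (1 - z * b)^-1).
Proof.
move=> b1; split; first exact: holomorphic_inv1B.
exists (1 - cabs b)^-1 => z z1; have H := cabs_1B_mul b z1.
by rewrite cabsV lef_pV2// posrE ?subr_gt0// (lt_le_trans _ H)// subr_gt0.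
Qed.

Let T G := L (fun z => G z * z ^- m).

Lemma T_bound G K : holomorphic_on (@disc R) G -> 0 <= K -> (forall z, disc z -> cabs (G z) <= K) ->
  Ap U p (fun z => G z * z ^- m) /\ cabs (T G) <= M * E * K.
Proof.
move=> hG K0 GK.
have h : holomorphic_on U (fun z => G z * z ^- m).
  by apply: holomorphic_mulVX Um _ _; exact: holomorphicS hG.
have b z : pdisc z -> cabs (G z * z ^- m) <= K * cabs z `^ (- m%:R).
  move=> /andP[z0 z1]; rewrite cabsM cabsV cabsX powRN powR_mulrn ?cabs_ge0// ler_wpM2r//.
    by rewrite invr_ge0 exprn_ge0 ?cabs_ge0.
  exact: GK.
have [A nA] := Ap_le dU p0 pm K0 h b.
split => //; apply: (le_trans (bL A)).
by rewrite -mulrA ler_wpM2l// [E * K]mulrC.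
Qed.

Lemma Ap_bounded G : bounded_holomorphic G -> Ap U p (fun z => G z * z ^- m).
Proof.
move=> [hG [K GK]]; have K0 : 0 <= K.
  by apply: (le_trans (cabs_ge0 (G 0))); apply: GK; rewrite /disc/= cabs0.
by have [] := T_bound hG K0 GK.
Qed.

Lemma T_lin a G H : bounded_holomorphic G -> bounded_holomorphic H ->
  T (fun z => a * G z + H z) = a * T G + T H.
Proof.
move=> /Ap_bounded bG /Ap_bounded bH; rewrite /T -(lL a bG bH); congr L.
by apply/funext => z; rewrite mulrDl mulrA.
Qed.

Let a : R := 2 - p * m%:R.
Let a0 : 0 < a. Proof. by rewrite subr_gt0. Qed.
Let c2 : R := (2 * pi)^-1.
Let c20 : 0 < c2. Proof. by rewrite invr_gt0 mulr_gt0// pi_gt0. Qed.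

(** The sum of all [kappa_k z^k w^k] in closed form: [kappa_k = c2 (p k + a)], and [sum (p k + a)
    t^k = (a - p) / (1 - t) + p / (1 - t)^2]. [K'] is its derivative in [w]. *)
Let K (w z : R[i]) : R[i] := (c2 * (a - p))%:C%C * (1 - z * w)^-1 + (c2 * p)%:C%C * (1 - z * w)^-1 ^+ 2.
Let K' (w z : R[i]) : R[i] := z * ((c2 * (a - p))%:C%C * (1 - z * w)^-1 ^+ 2 +
  (c2 * p)%:C%C * (2 * (1 - z * w)^-1 ^+ 3)).

Let bK w : cabs w < 1 -> bounded_holomorphic (K w).
Proof.
move=> w1; have bu := bounded_holomorphic_inv1B w1.
apply: bounded_holomorphic_lin => //; apply: bounded_holomorphicM; first exact: bounded_holomorphic_cst.
exact: bounded_holomorphicM.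
Qed.

Let bK' w : cabs w < 1 -> bounded_holomorphic (K' w).
Proof.
move=> w1; have bu := bounded_holomorphic_inv1B w1.
apply: bounded_holomorphicM; first exact: bounded_holomorphic_id.
apply: bounded_holomorphic_lin; first exact: bounded_holomorphicM.
apply: bounded_holomorphicM; first exact: bounded_holomorphic_cst.
apply: bounded_holomorphicM; first exact: bounded_holomorphic_cst.
by apply: bounded_holomorphicM => //; exact: bounded_holomorphicM.
Qed.

Let h w : R[i] := ((T (K (w^*)%C))^*)%C.

(** [K] is differentiable in its parameter uniformly in [z], hence in the norm of [A^p] after
    multiplication by [z^-m], and the bounded [L] preserves this. The conjugation of the parameter
    and that of the value cancel, so the result is holomorphic and not antiholomorphic. *)
Lemma kernel_functional_holomorphic : holomorphic_on (@disc R) h.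
Proof.
apply/holomorphicP => w w1; pose b := (w^*)%C.
have b1 : cabs b < 1 by rewrite cabs_conj.
pose delta := (1 - cabs b) / 2.
have delta0 : 0 < delta by rewrite /delta divr_gt0// subr_gt0.
have db : 1 - cabs b = delta * 2 by rewrite /delta mulfVK.
pose C := cabs ((c2 * (a - p))%:C%C : R[i]) / delta ^+ 3 + cabs ((c2 * p)%:C%C : R[i]) * 3 / delta ^+ 4.
have C0 : 0 <= C.
  have d1 n : 0 <= delta ^- n by rewrite invr_ge0 exprn_ge0 ?(ltW delta0).
  by apply: addr_ge0; rewrite mulr_ge0 ?mulr_ge0 ?cabs_ge0.
have MEC : 0 <= M * E * C by rewrite !mulr_ge0.
exists ((T (K' b))^*)%C => eps eps0.
exists (Num.min delta (eps / (M * E * C + 1))).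
  by rewrite lt_min delta0 divr_gt0// ltr_wpDl.
move=> eta; rewrite lt_min => /andP[ed ee]; pose e := (eta^*)%C.
have ed' : cabs e < delta by rewrite cabs_conj.
have be1 : cabs (b + e) < 1 by rewrite (le_lt_trans (ler_cabsD _ _))//; lra.
have -> : h (w + eta) - h w - (T (K' b))^*%C * eta = ((T (K (b + e)) - T (K b) - e * T (K' b))^*)%C.
  rewrite /h; have -> : ((w + eta)^*)%C = b + e by exact: rmorphD.
  rewrite [RHS]rmorphB; congr (_ - _); first exact/esym/rmorphB.
  rewrite [RHS]rmorphM mulrC; congr (_ * _); exact/esym/conjcK.
rewrite cabs_conj.
(* The first-order remainder of [K] in its parameter, nested in the form [a G + H] in which
   linearity of [T] is stated. *)
pose D z := - e * K' b z + (-1 * K b z + K (b + e) z).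
have b2 : bounded_holomorphic (fun z => -1 * K b z + K (b + e) z).
  by apply: bounded_holomorphic_lin; exact: bK.
have bD : bounded_holomorphic D by apply: bounded_holomorphic_lin => //; exact: bK'.
have -> : T (K (b + e)) - T (K b) - e * T (K' b) = T D.
  have -> : T D = - e * T (K' b) + T (fun z => -1 * K b z + K (b + e) z) by apply: T_lin; [exact: bK'|].
  have -> : T (fun z => -1 * K b z + K (b + e) z) = -1 * T (K b) + T (K (b + e)) by apply: T_lin; exact: bK.
  by ring.
have Dle z : disc z -> cabs (D z) <= C * cabs e ^+ 2.
  move=> z1; pose d := 1 - z * b; pose t := z * e.
  have te : cabs t <= cabs e by rewrite cabsM ler_piMl ?cabs_ge0// ltW.
  have D1 : delta <= cabs d.
    by rewrite (le_trans _ (cabs_1B_mul b z1))// db; lra.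
  have D2 : delta <= cabs (d - t).
    have H1 := cabs_1B_mul b z1; have H2 := ler_cabs_sub d t.
    move: H1; rewrite db -/d; lra.
  have dE : 1 - z * (b + e) = d - t by rewrite /d /t; ring.
  have -> : D z = (c2 * (a - p))%:C%C * ((d - t)^-1 - d^-1 - t * d^-1 ^+ 2) +
    (c2 * p)%:C%C * ((d - t)^-1 ^+ 2 - d^-1 ^+ 2 - 2 * t * d^-1 ^+ 3).
    by rewrite /D /K /K' dE -/d /t; ring.
  have t2 : cabs t ^+ 2 <= cabs e ^+ 2 by rewrite lerXn2r ?nnegrE ?cabs_ge0.
  have i3 : 0 <= delta ^- 3 by rewrite invr_ge0 exprn_ge0 ?(ltW delta0).
  have i4 : 0 <= delta ^- 4 by rewrite invr_ge0 exprn_ge0 ?(ltW delta0).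
  apply: (le_trans (ler_cabsD _ _)); rewrite /C [leRHS]mulrDl; apply: lerD.
    rewrite cabsM -mulrA ler_wpM2l ?cabs_ge0// (le_trans (inv_expansion delta0 D1 D2))//.
    by rewrite mulrC ler_wpM2l.
  have -> : cabs ((c2 * p)%:C%C : R[i]) * 3 / delta ^+ 4 * cabs e ^+ 2 =
      cabs ((c2 * p)%:C%C : R[i]) * (3 * cabs e ^+ 2 / delta ^+ 4) by ring.
  rewrite cabsM ler_wpM2l ?cabs_ge0// (le_trans (inv2_expansion delta0 D1 D2))//.
  by rewrite ler_wpM2r// ler_wpM2l.
have Ce0 : 0 <= C * cabs e ^+ 2 by rewrite mulr_ge0 ?exprn_ge0 ?cabs_ge0.
have [_ /le_trans] := T_bound bD.1 Ce0 Dle; apply.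
rewrite -/e cabs_conj expr2 !mulrA ler_wpM2r ?cabs_ge0//.
have : cabs eta * (M * E * C + 1) <= eps by rewrite -ler_pdivlMr ?ltW// ltr_wpDl.
by have := cabs_ge0 eta; rewrite mulrDr mulr1 [cabs eta * _]mulrC; lra.
Qed.

Let b k : R[i] := (kappa p m k)%:C%C * ((L (mono m k))^*)%C.

(** [sum_arith_geom] gives the difference of [K] and its truncation as [t^N] times a linear factor
    over [(1 - t)^2], uniformly in [z]; [T_bound] transports the bound through [L]. *)
Lemma kernel_functional_trunc N w : cabs w < 1 ->
  cabs (h w - \sum_(k < N) b k * w ^+ k) <=
  M * E * (c2 * (cabs w ^+ N * ((2 * a + p) + (2 * p) * N%:R)) / (1 - cabs w) ^+ 2).
Proof.
move=> w1; pose v := (w^*)%C; have v1 : cabs v < 1 by rewrite cabs_conj.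
pose c k : R[i] := (kappa p m k)%:C%C * v ^+ k.
have [AS LS] := linear_on_Ap_sum Um p1 pm lL c N.
have [AB LB] := linear_on_ApB Um p1 lL (Ap_bounded (bK v1)) AS.
pose D z := K v z - \sum_(k < N) c k * z ^+ k.
have -> : h w - \sum_(k < N) b k * w ^+ k = ((T D)^*)%C.
  have -> : T D = T (K v) - \sum_(k < N) c k * L (mono m k).
    rewrite -LS /T -LB; congr L; apply/funext => z; rewrite /D mulrBl mulr_suml.
    by congr (_ - _); apply: eq_bigr => k _; rewrite /mono mulrA.
  rewrite [RHS]rmorphB; congr (_ - _); rewrite [RHS]raddf_sum; apply: eq_bigr => k _.
  have ckc : ((c k)^*)%C = (kappa p m k)%:C%C * w ^+ k.
    rewrite /c [LHS]rmorphM; congr (_ * _); first exact: conjc_real.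
    by rewrite [LHS]rmorphXn; congr (_ ^+ _); exact: conjcK.
  transitivity (((c k)^*)%C * ((L (mono m k))^*)%C); last exact/esym/rmorphM.
  by rewrite ckc /b mulrAC.
rewrite cabs_conj.
have hD : holomorphic_on (@disc R) D.
  rewrite (_ : D = fun z => K v z + -1 * \sum_(k < N) c k * z ^+ k); last first.
    by apply/funext => z; rewrite mulN1r.
  apply: holomorphicD; first by have [] := bK v1.
  apply: holomorphicM; first exact: holomorphic_cst.
  apply: holomorphic_sum => k; apply: holomorphicM; first exact: holomorphic_cst.
  by apply: holomorphicX; exact: holomorphic_id.
have w10 : 0 < 1 - cabs w by rewrite subr_gt0.
set B := (X in _ <= M * E * X).
have B0 : 0 <= B.
  rewrite /B divr_ge0 ?exprn_ge0 ?(ltW w10)// mulr_ge0 ?(ltW c20)// mulr_ge0 ?exprn_ge0 ?cabs_ge0//.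
  by rewrite !addr_ge0 ?mulr_ge0 ?(ltW a0) ?(ltW p0).
suff DB z : disc z -> cabs (D z) <= B by have [_] := T_bound hD B0 DB.
move=> z1; pose t := z * v.
have tw : cabs t <= cabs w by rewrite cabsM cabs_conj ler_piMl ?cabs_ge0// ltW.
have H1 : 1 - cabs w <= cabs (1 - t) by rewrite (le_trans _ (cabs_1B_mul v z1))// cabs_conj.
have t0 : 1 - t != 0 by rewrite -cabs_gt0 (lt_le_trans w10).
pose aC : R[i] := a%:C%C; pose pC : R[i] := p%:C%C; pose cC : R[i] := c2%:C%C.
have e1 : (c2 * (a - p))%:C%C = cC * (aC - pC) by rewrite [LHS]rmorphM; congr (_ * _); exact: rmorphB.
have e2 : (c2 * p)%:C%C = cC * pC by exact: rmorphM.
have ck k : c k * z ^+ k = cC * ((pC * k%:R + aC) * t ^+ k).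
  have kE : (kappa p m k)%:C%C = cC * (pC * k%:R + aC).
    have -> : kappa p m k = c2 * (p * k%:R + a) by rewrite /kappa /c2 /a [RHS]mulrC; congr (_ / _); ring.
    rewrite [LHS]rmorphM; congr (_ * _); rewrite [LHS]rmorphD; congr (_ + _).
    by rewrite [LHS]rmorphM; congr (_ * _); exact: rmorph_nat.
  by rewrite /c kE /t exprMn; ring.
have := sum_arith_geom aC pC t N; set S := \sum_(k < N) _ => SE.
have -> : D z = cC * (t ^+ N * (aC + pC * N%:R + (pC - aC - pC * N%:R) * t)) / (1 - t) ^+ 2.
  have -> : D z = cC * ((aC - pC) * (1 - t)^-1 + pC * (1 - t)^-1 ^+ 2 - S).
    have SS : \sum_(k < N) c k * z ^+ k = cC * S.
      by rewrite mulr_sumr; apply: eq_bigr => k _; exact: ck.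
    by rewrite /D SS /K e1 e2 -/t; ring.
  have -> : t ^+ N * (aC + pC * N%:R + (pC - aC - pC * N%:R) * t) = aC + (pC - aC) * t - (1 - t) ^+ 2 * S.
    by rewrite SE; ring.
  by field.
have aE : cabs aC = a by rewrite cabs_real gtr0_norm.
have pE : cabs pC = p by rewrite cabs_real gtr0_norm.
have NE : cabs (pC * N%:R) = p * N%:R.
  rewrite cabsM pE; congr (_ * _); rewrite -(rmorph_nat (real_complex R)) cabs_real ger0_norm//.
have t1 : cabs t <= 1 by rewrite (le_trans tw)// ltW.
have H2 : cabs (aC + pC * N%:R + (pC - aC - pC * N%:R) * t) <= 2 * a + p + 2 * p * N%:R.
  rewrite (le_trans (ler_cabsD _ _))//.
  have H3 : cabs (aC + pC * N%:R) <= a + p * N%:R by rewrite (le_trans (ler_cabsD _ _))// aE NE.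
  have H4 : cabs (pC - aC - pC * N%:R) <= p + a + p * N%:R.
    by rewrite (le_trans (ler_cabsB _ _))// NE lerD2r (le_trans (ler_cabsB _ _))// aE pE.
  have H5 : cabs ((pC - aC - pC * N%:R) * t) <= p + a + p * N%:R.
    by rewrite cabsM (le_trans _ H4)// ler_piMr ?cabs_ge0.
  lra.
move: H2; set W := aC + _ + _ => H2.
rewrite cabs_div cabsM [cabs (_ * _)]cabsM !cabsX /B -!mulrA.
rewrite (_ : cabs cC = c2); last by rewrite cabs_real gtr0_norm.
rewrite ler_wpM2l ?(ltW c20)// !mulrA.
rewrite ler_pM ?mulr_ge0 ?exprn_ge0 ?cabs_ge0 ?invr_ge0 ?exprn_ge0 ?cabs_ge0//.
  by rewrite ler_pM ?exprn_ge0 ?cabs_ge0// lerXn2r ?nnegrE ?cabs_ge0.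
rewrite lef_pV2 ?posrE ?exprn_gt0// ?(lt_le_trans w10)//.
by rewrite lerXn2r ?nnegrE ?cabs_ge0 ?(ltW w10).
Qed.

Lemma kernel_functional : exists2 h : R[i] -> R[i], holomorphic_on (@disc R) h &
  forall rho : R, 0 < rho < 1 -> exists c C : R, [/\ 0 <= c < 1, 0 <= C & forall N w, cabs w <= rho ->
    cabs (h w - \sum_(k < N) ((kappa p m k)%:C%C * ((L (mono m k))^*)%C) * w ^+ k) <= C * c ^+ N].
Proof.
exists h; first exact: kernel_functional_holomorphic.
move=> rho r01; have [r0 r1] := andP r01.
have A0 : 0 <= 2 * a + p by rewrite addr_ge0 ?mulr_ge0 ?(ltW a0) ?(ltW p0).
have P0 : 0 <= 2 * p by rewrite mulr_ge0 ?(ltW p0).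
have [c [C [c01 C0 H]]] := geom_lin_le r01 A0 P0.
have X0 : 0 <= M * E * (c2 / (1 - rho) ^+ 2).
  have r10 : 0 <= (1 - rho) ^- 2 by rewrite invr_ge0 exprn_ge0// subr_ge0 ltW.
  exact: (mulr_ge0 (mulr_ge0 M0 E0) (mulr_ge0 (ltW c20) r10)).
exists c, (M * E * (c2 / (1 - rho) ^+ 2) * C); split => //; first exact: mulr_ge0.
move=> N w wr; have w1 : cabs w < 1 by exact: le_lt_trans r1.
apply: (le_trans (kernel_functional_trunc N w1)).
have -> : M * E * (c2 / (1 - rho) ^+ 2) * C * c ^+ N = M * E * (c2 * (C * c ^+ N) / (1 - rho) ^+ 2) by ring.
rewrite ler_wpM2l ?mulr_ge0//.
have N0 : 0 <= 2 * a + p + 2 * p * N%:R by rewrite addr_ge0// mulr_ge0.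
have w10 : 0 <= (1 - cabs w) ^- 2 by rewrite invr_ge0 exprn_ge0// subr_ge0 ltW.
have n0 : 0 <= c2 * (cabs w ^+ N * (2 * a + p + 2 * p * N%:R)).
  exact: (mulr_ge0 (ltW c20) (mulr_ge0 (exprn_ge0 _ (cabs_ge0 _)) N0)).
rewrite ler_pM//.
  apply: (ler_wpM2l (ltW c20)); apply: le_trans (H N).
  by rewrite ler_wpM2r// lerXn2r ?nnegrE ?cabs_ge0 ?(ltW r0).
rewrite lef_pV2 ?posrE ?exprn_gt0 ?subr_gt0//.
by rewrite lerXn2r ?nnegrE ?subr_ge0 ?(ltW r1) ?(ltW w1)// lerB.
Qed.

End kernel_functional.

(** * Taylor coefficients of a limit of polynomials *)

Section approximation.
Context {R : realType}.
Implicit Types (x : nat -> R[i]) (y : R[i]).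

Lemma cvg_cabs_of_dist x y (e : nat -> R) : e n @[n --> \oo] --> (0 : R) ->
  (forall n, cabs (y - x n) <= e n) -> cabs (x n) @[n --> \oo] --> cabs y.
Proof.
move=> e0 xe; apply/cvgrPdist_lt => eps eps0.
move/cvgrPdist_lt : e0 => /(_ _ eps0); apply: filterS => n.
rewrite sub0r normrN => en; apply: le_lt_trans (le_lt_trans (ler_norm _) en).
apply: le_trans (xe n); rewrite ler_norml; apply/andP; split.
  by rewrite lerNl opprB cabs_distC ler_cabs_sub.
exact: ler_cabs_sub.
Qed.

Lemma cvg_geometric0 (K c : R) : 0 <= c < 1 -> K * c ^+ n @[n --> \oo] --> (0 : R).
Proof.
move=> /andP[c0 c1]; rewrite -[X in _ --> X](mulr0 K); apply: cvgMr.
by apply: cvg_expr; rewrite ger0_norm.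
Qed.

(** By orthogonality the polynomials with more than [n] terms have [n]-th coefficient exactly [b n],
    and the circle integral carries the geometric error over to the coefficient of [h]. *)
Lemma tcoef_approx (h : R[i] -> R[i]) (b : nat -> R[i]) (c C : R) n : holomorphic_on (@pdisc R) h ->
  0 <= c < 1 ->
  (forall N w, cabs w <= 2^-1 -> cabs (h w - \sum_(k < N) b k * w ^+ k) <= C * c ^+ N) ->
  tcoef h n = b n.
Proof.
move=> hh c01 H.
have half : 0 < (2^-1 : R) < 1 by apply/andP; split; lra.
pose r : R[i] := (2^-1 : R)%:C%C.
have rE : cabs r = 2^-1 by rewrite cabs_real ger0_norm// invr_ge0.
have r0 : r != 0 by rewrite -cabs_gt0 rE invr_gt0.
pose P : R[i] := (2 * pi)%:C%C.
have p20 : 0 < 2 * pi :> R by rewrite mulr_gt0// pi_gt0.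
have P0 : P != 0 by rewrite -cabs_gt0 cabs_real gtr0_norm.
have cc1 : ccont (fun t => h (r * cis t)) by exact: holomorphic_ccont hh half.
have cV : ccont (fun t : R => (cis t)^-1) by exact: ccont_cisV.
have cVn : ccont (fun t : R => (cis t ^- n : R[i])).
  by under eq_fun do rewrite -exprVn; exact: ccontX.
have cX k : ccont (fun t : R => (r * cis t) ^+ k).
  by apply: ccontX; apply: ccontM; [exact: ccont_cst|exact: ccont_cis].
have cS N : ccont (fun t : R => \sum_(k < N) b k * (r * cis t) ^+ k).
  by apply: ccont_sum => k; apply: ccontM; [exact: ccont_cst|exact: cX].
have angS N : (n < N)%N -> ang (fun t => (\sum_(k < N) b k * (r * cis t) ^+ k) * cis t ^- n) = b n * r ^+ n * P.
  move=> nN.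
  have -> : (fun t => (\sum_(k < N) b k * (r * cis t) ^+ k) * cis t ^- n) =
            (fun t => \sum_(k < N) (b k * r ^+ k) * (cis t ^+ k * cis t ^- n)).
    by apply/funext => t; rewrite mulr_suml; apply: eq_bigr => k _; rewrite exprMn !mulrA.
  have ck k : ccont (fun t : R => (cis t ^+ k * cis t ^- n : R[i])).
    by apply: ccontM => //; apply: ccontX; exact: ccont_cis.
  rewrite ang_sum; last by move=> k; apply: ccontM; [exact: ccont_cst|exact: ck].
  rewrite (bigD1 (Ordinal nN))//= big1 ?addr0 => [|k kn]; last first.
    rewrite angZ//; have [kn'|nk|E] := ltngtP k n.
    - have -> : (fun t : R => cis t ^+ k * cis t ^- n) = (fun t => cis t ^- (n - k)).
        apply/funext => t; rewrite -[in LHS](subnK (ltnW kn')) exprD invfM mulrCA mulfV ?mulr1//.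
        by rewrite expf_neq0// cis_neq0.
      by rewrite ang_cisVX ?mulr0// subn_gt0.
    - have -> : (fun t : R => cis t ^+ k * cis t ^- n) = (fun t => cis t ^+ (k - n)).
        apply/funext => t; rewrite -[in LHS](subnK (ltnW nk)) exprD -mulrA mulfV ?mulr1//.
        by rewrite expf_neq0// cis_neq0.
      by rewrite ang_cisX ?mulr0// subn_gt0.
    - by move: kn; rewrite -val_eqE /= E eqxx.
  rewrite angZ//; congr (_ * _).
  have -> : (fun t : R => cis t ^+ n * cis t ^- n) = (fun=> 1).
    by apply/funext => t; rewrite mulfV// expf_neq0// cis_neq0.
  by rewrite ang_cst mul1r.
have angh := circ_VX n hh half.
have key N : (n < N)%N -> cabs (tcoef h n - b n) * (2^-1 ^+ n * (2 * pi)) <= C * c ^+ N * (2 * pi).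
  move=> nN; have -> : 2^-1 ^+ n * (2 * pi) = cabs (r ^+ n * P).
    by rewrite cabsM cabsX rE cabs_real gtr0_norm.
  rewrite -cabsM.
  have -> : (tcoef h n - b n) * (r ^+ n * P) =
     ang (fun t => (h (r * cis t) - \sum_(k < N) b k * (r * cis t) ^+ k) * cis t ^- n).
    have -> : (fun t => (h (r * cis t) - \sum_(k < N) b k * (r * cis t) ^+ k) * cis t ^- n) =
       (fun t => h (r * cis t) * cis t ^- n + (-1) * ((\sum_(k < N) b k * (r * cis t) ^+ k) * cis t ^- n)).
      by apply/funext => t; rewrite mulrBl mulN1r.
    have cSn : ccont (fun t : R => (\sum_(k < N) b k * (r * cis t) ^+ k) * cis t ^- n) by exact: ccontM.
    rewrite angD; [|exact: ccontM|apply: ccontM; [exact: ccont_cst|exact: cSn]].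
    by rewrite angZ// angS// angh -/r -/P; ring.
  apply: ang_bound.
    apply: ccontM => //.
    have -> : (fun t => h (r * cis t) - \sum_(k < N) b k * (r * cis t) ^+ k) =
      (fun t => h (r * cis t) + (-1) * \sum_(k < N) b k * (r * cis t) ^+ k) by apply/funext => t; rewrite mulN1r.
    by apply: ccontD => //; apply: ccontM; [exact: ccont_cst|exact: cS].
  move=> t; rewrite cabsM cabsV cabsX cabs_cis expr1n invr1 mulr1.
  by apply: H; rewrite cabs_polar ger0_norm// invr_ge0.
apply/eqP; rewrite -subr_eq0 -cabs_eq0 eq_le cabs_ge0 andbT.
pose X : R := 2^-1 ^+ n * (2 * pi).
have X0 : 0 < X by rewrite mulr_gt0// exprn_gt0// invr_gt0.
apply: (@geometric_le0 _ _ (C * c ^+ n.+1 * (2 * pi) / X) c c01) => N.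
have := key (n.+1 + N)%N; rewrite ltnS leq_addr => /(_ erefl).
rewrite -ler_pdivlMr// => /le_trans; apply.
rewrite exprD le_eqVlt; apply/orP; left; apply/eqP.
by rewrite /X; ring.
Qed.

End approximation.

(** * Existence and norm bound of the representing function *)

Section representation.
Context {R : realType}.
Local Notation PD := (@toC R @^-1` (@pdisc R)).
Variables (U : set R[i]) (p : R) (m : nat).
Hypothesis Um : (U = @disc R /\ m = 0%N) \/ (U = @pdisc R /\ 2 <= p * m.+1%:R).
Hypotheses (p1 : 1 < p) (pm : p * m%:R < 2).
Let q := p / (p - 1).

Let dU : discs U := discs_of Um.
Let p0 : 0 < p. Proof. exact: lt_trans p1. Qed.
Let p10 : 0 < p - 1. Proof. by rewrite subr_gt0. Qed.
Let q0 : 0 < q. Proof. exact: divr_gt0. Qed.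
Let sub_disc : U `<=` @disc R.
Proof. by case: dU => -> // z /andP[]. Qed.

Lemma kappa_neq0 k : ((kappa p m k)%:C%C : R[i]) != 0.
Proof. by rewrite -cabs_gt0 cabs_real gtr0_norm ?kappa_gt0. Qed.

Lemma tcoef_mulVX h k : tcoef (fun z => h z * z ^- m * z ^+ m) k = tcoef h k :> R[i].
Proof.
rewrite /tcoef /circ; congr (_ / _); apply: eq_cI => t _.
have z0 : ((2^-1 : R)%:C%C * cis t : R[i]) != 0.
  by rewrite mulf_neq0 ?cis_neq0// -cabs_gt0 cabs_real ger0_norm ?invr_ge0// invr_gt0.
by rewrite mulfVK// expf_neq0.
Qed.

(** The constant [C] precedes [L] and [M]: this uniformity is what later bounds the inverse map. *)
Lemma representation : exists2 C : R, 0 < C & forall L M, 0 <= M -> linear_on_Ap U p L ->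
  (forall f, Ap U p f -> cabs (L f) <= M * Apnorm U p f) ->
  exists2 g, Aspace U q (eta_q q) g /\ Anorm U q (eta_q q) g <= C * M &
    forall f, Ap U p f -> L f = pairing U p f g.
Proof.
have [C C0 HC] := apriori p1 pm; exists C => // L M M0 lL bL.
have [h hh happ] := kernel_functional Um p1 pm lL M0 bL.
pose l k := L (mono m k).
pose b k : R[i] := (kappa p m k)%:C%C * ((l k)^*)%C.
pose g z := h z * z ^- m.
have hU : holomorphic_on U h by exact: holomorphicS hh.
have hg : holomorphic_on U g by exact: (holomorphic_mulVX Um).
have hP : holomorphic_on (@pdisc R) h by apply: holomorphicS hh => z /andP[].
have mPD := @measurable_PD R.
have dPD : discs (@pdisc R) by right.
have CM0 : 0 <= C * M by rewrite mulr_ge0// ltW.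
have lN N (x : nat -> R[i]) : cabs (\sum_(k < N) x k * l k) <=
     M * (fine (\int[@dV R]_(z in PD) (cabs (\sum_(k < N) x k * mono m k (toC z)) `^ p)%:E)%E) `^ p^-1.
  have [A Ls] := linear_on_Ap_sum Um p1 pm lL x N.
  by have := bL _ A; rewrite Ls (ApnormE dU p A.1).
(* Fatou's lemma in the order of truncation, at fixed damping. The order is shifted by [N0] because
   [apriori] holds for large orders only. *)
have step1 (r : R) : 0 < r < 1 -> (\int[@dV R]_(w in PD)
   (cabs (h (r%:C%C * chi p (toC w)) * chi p (toC w) ^- m) `^ q)%:E <= ((C * M) `^ q)%:E)%E.
  move=> r01; have [r0 r1] := andP r01; have [N0 HN] := HC l M M0 lN r r01.
  have [c [K [c01 K0 hK]]] := happ r r01.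
  pose a k : R[i] := (kappa p m k * r ^+ k)%:C%C * ((l k)^*)%C.
  have mF N : measurable_fun PD (fun w : R * R => (cabs (\sum_(k < N) a k * mono m k (chi p (toC w))) `^ q)%:E).
    apply/measurable_EFinP; apply: measurable_funTS; apply: measurable_cabs_powR.
    by apply: cmeasurable_mono_sum; exact: cmeasurable_chi.
  apply: (@fatou_bound _ _ R (@dV R) PD (fun N w =>
    (cabs (\sum_(k < N + N0) a k * mono m k (chi p (toC w))) `^ q)%:E)); [exact: mPD|by move=> N; exact: mF| | |].
  - by move=> N w _; rewrite lee_fin powR_ge0.
  - move=> w wD; apply: cvg_EFin; first exact: nearW.
    apply: cvg_powR => //; [by move=> N; exact: cabs_ge0|exact: cabs_ge0|].
    set v := chi p (toC w); have /andP[v0 v1] : pdisc v by exact: pdisc_chi.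
    have vN0 : v != 0 by rewrite -cabs_gt0.
    have rC : cabs (r%:C%C : R[i]) = r by rewrite cabs_real gtr0_norm.
    apply: (@cvg_cabs_of_dist _ _ _ (fun N => (K * c ^+ N0 * cabs v ^- m) * c ^+ N)).
      exact: cvg_geometric0.
    move=> N; have rv : cabs (r%:C%C * v) <= r by rewrite cabsM rC ler_piMr// ltW.
    have -> : \sum_(k < N + N0) a k * mono m k v = (\sum_(k < N + N0) b k * (r%:C%C * v) ^+ k) * v ^- m.
      rewrite mulr_suml; apply: eq_bigr => k _; rewrite /a /b /mono [(_ * v) ^+ _]exprMn.
      have -> : ((kappa p m k * r ^+ k)%:C%C : R[i]) = (kappa p m k)%:C%C * r%:C%C ^+ k.
        by rewrite [LHS]rmorphM; congr (_ * _); exact: rmorphXn.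
      by ring.
    rewrite -mulrBl cabsM cabsV cabsX.
    have -> : K * c ^+ N0 * cabs v ^- m * c ^+ N = K * c ^+ (N + N0) * cabs v ^- m by rewrite exprD; ring.
    by rewrite ler_wpM2r ?invr_ge0 ?exprn_ge0 ?cabs_ge0//; exact: hK.
  - by move=> N; apply: HN; exact: leq_addl.
have step2 : (\int[@dV R]_(w in PD) (cabs (g (chi p (toC w))) `^ q)%:E <= ((C * M) `^ q)%:E)%E.
  (* Fatou's lemma now removes the damping; the shift by 2 keeps every [r n] positive. *)
  pose r (n : nat) : R := 1 - n.+2%:R^-1.
  have r01 n : 0 < r n < 1.
    have n0 : 0 < n.+2%:R :> R by rewrite ltr0Sn.
    by rewrite /r subr_gt0 invf_lt1// ltr1n/= gtrBl invr_gt0.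
  have hr n : holomorphic_on (@pdisc R) (fun z => h ((r n)%:C%C * z) * z ^- m).
    apply: holomorphicS (pdisc_sub dU) _; apply: (holomorphic_mulVX Um).
    exact: (holomorphic_dilate Um (r01 n)).
  apply: (@fatou_bound _ _ R (@dV R) PD (fun n w =>
    (cabs (h ((r n)%:C%C * chi p (toC w)) * chi p (toC w) ^- m) `^ q)%:E)); [exact: mPD| | | |].
  - move=> n; apply/measurable_EFinP; apply: measurable_cabs_powR.
    exact: (cmeasurable_comp_chi p1 dPD (hr n)).
  - by move=> N w _; rewrite lee_fin powR_ge0.
  - move=> w wD; apply: cvg_EFin; first exact: nearW.
    apply: cvg_powR => //; [by move=> N; exact: cabs_ge0|exact: cabs_ge0|].
    set v := chi p (toC w); have vD : pdisc v by exact: pdisc_chi.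
    have [v0 v1] := andP vD.
    have -> : cabs (g v) = cabs (h v) * cabs v ^- m by rewrite cabsM cabsV cabsX.
    under eq_fun do rewrite cabsM cabsV cabsX.
    apply: cvgMl.
    apply/cvgrPdist_lt => eps eps0.
    have [delta dl0 H] := holomorphic_continuous hP vD eps0.
    have := @near_infty_natSinv_lt R (PosNum dl0); apply: filterS => n /= nd.
    have Hn : cabs ((r n)%:C%C * v - v) < delta.
      rewrite -[X in _ - X]mul1r -mulrBl cabsM.
      have -> : (r n)%:C%C - 1 = ((r n - 1)%:C)%C by rewrite [RHS]rmorphB rmorph1.
      rewrite cabs_real /r addrC addKr normrN ger0_norm ?invr_ge0 ?ler0n//.
      apply: le_lt_trans nd; rewrite (@le_trans _ _ n.+2%:R^-1)//.
        by rewrite ler_piMr ?invr_ge0 ?ler0n// ltW.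
      by rewrite lef_pV2 ?posrE ?ltr0Sn// ler_nat.
    apply: le_lt_trans (H _ Hn); rewrite ler_norml; apply/andP; split.
      by rewrite lerNl opprB ler_cabs_sub.
    by rewrite cabs_distC ler_cabs_sub.
  - by move=> n; exact: step1.
have [B B0 BE] : exists2 B, 0 <= B & (\int[@dV R]_(w in PD) (cabs (g (chi p (toC w))) `^ q)%:E = B%:E)%E.
  apply: ge0_fin_ex; first by apply: integral_ge0 => x _; rewrite lee_fin powR_ge0.
  by apply: (le_lt_trans step2); rewrite ltry.
have gA : Aspace U q (eta_q q) g.
  by split => //; rewrite (wint_eta dU p1 hg) BE ltry.
exists g.
  split => //; rewrite /Anorm (wint_eta dU p1 hg) BE/=.
  move: step2; rewrite BE lee_fin => BC.
  have qV : 0 <= q^-1 by rewrite invr_ge0 ltW.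
  rewrite (le_trans (ge0_ler_powR qV _ _ BC)) ?nnegrE ?powR_ge0//.
  by rewrite -powRrM mulfV ?gt_eqF// powRr1.
have tb k : tcoef h k = b k.
  have half : 0 < (2^-1 : R) < 1 by apply/andP; split; lra.
  have [c [K [c01 K0 hK]]] := happ _ half.
  exact: (@tcoef_approx _ h b c K k hP c01 hK).
have pm0 k : 0 < p * (k%:R - m%:R) + 2.
  rewrite mulrBr -addrA [- _ + _]addrC ltr_wpDl ?mulr_ge0 ?(ltW p0)//.
  by rewrite subr_gt0.
have pk k : pairing U p (mono m k) g = l k.
  have Ak := Ap_mono Um p1 pm k.
  have [ik _] := pairing_hoelder dU p1 Ak gA.
  have hgP := holomorphicS (pdisc_sub dU) hg.
  have hkP := holomorphicS (pdisc_sub dU) Ak.1.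
  rewrite (pairingE dU p1 Ak.1 hg) -(pairingE dPD p1 hkP hgP).
  rewrite pairing_mono// tcoef_mulVX tb /b.
  have -> : (((kappa p m k)%:C%C * (l k)^*%C)^*)%C = (kappa p m k)%:C%C * l k.
    by rewrite [LHS]rmorphM; congr (_ * _); [exact: conjc_real|exact: conjcK].
  have -> : ((2 * pi / (p * (k%:R - m%:R) + 2))%:C%C : R[i]) = ((kappa p m k)%:C%C)^-1.
    by rewrite -[RHS]fmorphV /kappa invf_div.
  by rewrite mulrAC mulfV ?mul1r// kappa_neq0.
move=> f Af; apply/eqP; rewrite -subr_eq0; apply/eqP.
(* The difference of the two functionals is bounded and vanishes on the monomials, so [functional0]
   applies to it. *)
pose D (f : R[i] -> R[i]) := L f - pairing U p f g.
have lD : linear_on_Ap U p D.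
  move=> a f1 f2 A1 A2; rewrite /D lL// (pairing_linear dU p1 gA)//.
  by ring.
have nA : 0 <= Anorm U q (eta_q q) g by exact: powR_ge0.
have bD f' : Ap U p f' -> cabs (D f') <= (M + Anorm U q (eta_q q) g) * Apnorm U p f'.
  move=> Af'; rewrite (le_trans (ler_cabsB _ _))// mulrDl lerD//; first exact: bL.
  by rewrite mulrC; have [] := pairing_hoelder dU p1 Af' gA.
have D0 k : D (mono m k) = 0 by rewrite /D pk subrr.
have MA0 : 0 <= M + Anorm U q (eta_q q) g by exact: addr_ge0.
apply: (functional0 Um p1 pm lD MA0 bD D0 Af).
have p2 : (0 : R) + 2 <= p * m.+1%:R \/ m = 0%N /\ U = @disc R.
  by case: Um => -[UE mE]; [right|left; rewrite add0r].
case: p2 => [p2|[mE UE]]; last first.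
  rewrite mE; under eq_fun do rewrite expr0 mulr1.
  by apply: pole_free_disc; rewrite -UE; exact: Af.1.
apply: (pole_free_Aspace Um p1 ltr01 p2).
  by under eq_fun do rewrite powRr0 mulr1; exact: measurable_cst.
have -> : (fun z : R[i] => 1 * cabs z `^ 0) = (fun=> 1) by apply/funext => z; rewrite powRr0 mulr1.
exact: Af.
Qed.

End representation.

(** * Injectivity and equivalence of norms *)

Section duality.
Context {R : realType}.
Local Notation PD := (@toC R @^-1` (@pdisc R)).
Variables (U : set R[i]) (p : R) (m : nat).
Hypothesis Um : (U = @disc R /\ m = 0%N) \/ (U = @pdisc R /\ 2 <= p * m.+1%:R).
Hypotheses (p1 : 1 < p) (pm : p * m%:R < 2).
Let q := p / (p - 1).

Let dU : discs U := discs_of Um.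
Let p0 : 0 < p. Proof. exact: lt_trans p1. Qed.
Let p10 : 0 < p - 1. Proof. by rewrite subr_gt0. Qed.
Let q0 : 0 < q. Proof. exact: divr_gt0. Qed.
Let q1 : 1 < q. Proof. by rewrite /q ltr_pdivlMr// mul1r gtrBl. Qed.
Let pq : p * (q - 1) = q. Proof. by rewrite /q; field; rewrite gt_eqF. Qed.

Lemma pole_free_eta g : Aspace U q (eta_q q) g -> pole_free (fun z => g z * z ^+ m).
Proof.
move=> Ag; have bm : 2 * q - 4 + 2 <= q * m.+1%:R \/ m = 0%N /\ U = @disc R.
  case: Um => -[UE mE]; [by right|left].
  (* Multiplying the pole condition for [A^p] by [q - 1] gives the one for [A^q] with [eta_q],
     because [(q - 1) p = q]: the same [m] bounds the poles in both spaces. *)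
  have : (q - 1) * 2 <= (q - 1) * (p * m.+1%:R) by rewrite ler_wpM2l// subr_ge0 ltW.
  by rewrite mulrA [(q - 1) * p]mulrC pq; lra.
case: bm => [bm|[mE UE]]; last first.
  rewrite mE; under eq_fun do rewrite expr0 mulr1.
  by apply: pole_free_disc; rewrite -UE; exact: Ag.1.
have q10 : 0 < q - 1 by rewrite subr_gt0.
by apply: (pole_free_Aspace Um q1 q10 bm) => //; exact: measurable_eta.
Qed.

(** Pairing with the monomials annihilates every Taylor coefficient of [z^m g], and [z^m g] has no
    negative Laurent coefficients by [pole_free_eta]. *)
Lemma pairing_inj g : Aspace U q (eta_q q) g -> (forall f, Ap U p f -> pairing U p f g = 0) ->
  forall z, U z -> g z = 0.
Proof.
move=> Ag g0; have pf := pole_free_eta Ag; have [hg _] := Ag.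
have dPD : discs (@pdisc R) by right.
have hgP := holomorphicS (pdisc_sub dU) hg.
pose h z := g z * z ^+ m.
have hh : holomorphic_on (@pdisc R) h.
  by apply: holomorphicM => //; apply: holomorphicX; exact: holomorphic_id.
have pm0 k : 0 < p * (k%:R - m%:R) + 2.
  rewrite mulrBr -addrA [- _ + _]addrC ltr_wpDl ?mulr_ge0 ?(ltW p0)//.
  by rewrite subr_gt0.
have t0 k : tcoef h k = 0.
  have Ak := Ap_mono Um p1 pm k.
  have [ik _] := pairing_hoelder dU p1 Ak Ag.
  have hkP := holomorphicS (pdisc_sub dU) Ak.1.
  have := g0 _ Ak; rewrite (pairingE dU p1 Ak.1 hg) -(pairingE dPD p1 hkP hgP).
  rewrite pairing_mono// => /eqP; rewrite mulf_eq0 => /orP[|].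
    by rewrite -cabs_eq0 cabs_conj cabs_eq0 => /eqP.
  rewrite -cabs_eq0 cabs_real normr_eq0 gt_eqF// divr_gt0//.
  by rewrite mulr_gt0// pi_gt0.
have gP z : pdisc z -> g z = 0.
  move=> /andP[z0 z1]; have zN0 : z != 0 by rewrite -cabs_gt0.
  pose r := (1 + cabs z) / 2.
  have zr : cabs z < r by rewrite /r; lra.
  have r1 : r < 1 by rewrite /r; lra.
  have r0 : 0 < r by exact: lt_trans zr.
  have r01 : 0 < r < 1 by rewrite r0.
  have zr' : 0 < cabs z < r by rewrite z0.
  have [B B0 hB] := annulus_bounded hh r0 r1.
  have hB' t : cabs (h (r%:C%C * cis t)) <= B by apply: hB; rewrite cabs_polar gtr0_norm// lexx.
  have hz0 : h z = 0.
    apply/eqP; rewrite -cabs_eq0 eq_le cabs_ge0 andbT.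
    have c01 : 0 <= cabs z / r < 1 by rewrite divr_ge0 ?(ltW z0) ?(ltW r0)//= ltr_pdivrMr// mul1r.
    apply: (geometric_le0 c01) => N; have := taylor_remainder N hh pf r01 zr' hB'.
    rewrite big1 ?subr0; first exact.
    by move=> k _; rewrite t0 mul0r.
  by move/eqP : hz0; rewrite mulf_eq0 expf_eq0 (negbTE zN0) andbF orbF => /eqP.
(* The origin, when it lies in [U], is reached by continuity from the punctured disc. *)
move=> z Uz; have [z0|zN0] := eqVneq z 0; last first.
  by apply: gP; rewrite /pdisc/= cabs_gt0 zN0/=; case: dU Uz => -> // /andP[].
apply/eqP; rewrite -cabs_eq0 eq_le cabs_ge0 andbT; apply/ler_addgt0Pl => eps eps0; rewrite addr0.
have [delta delta0 H] := holomorphic_continuous hg Uz eps0.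
pose r := Num.min (2^-1) (delta / 2).
have r0 : 0 < r by rewrite lt_min divr_gt0// invr_gt0 ltr0n.
have r1 : r < 1 by rewrite gt_min; apply/orP; left; lra.
have rd : r < delta by rewrite gt_min; apply/orP; right; lra.
have rC : cabs (r%:C%C : R[i]) = r by rewrite cabs_real gtr0_norm.
have := H r%:C%C; rewrite {1}z0 subr0 rC gP ?sub0r ?cabsN; last by rewrite /pdisc/= rC r0.
by move=> /(_ rd)/ltW.
Qed.

Lemma ApnormZ (a : R[i]) f : Ap U p f -> Apnorm U p (fun z => a * f z) = cabs a * Apnorm U p f.
Proof.
move=> [hf fo].
have h : holomorphic_on U (fun z => a * f z) by apply: holomorphicM => //; exact: holomorphic_cst.
rewrite (ApnormE dU p h) (ApnormE dU p hf).
have [i i0 IE] : exists2 i, 0 <= i & (\int[@dV R]_(x in PD) (cabs (f (toC x)) `^ p)%:E = i%:E)%E.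
  apply: ge0_fin_ex; first by apply: integral_ge0 => x _; rewrite lee_fin powR_ge0.
  by move: fo; rewrite (wint1E dU p hf).
have -> : (\int[@dV R]_(x in PD) (cabs (a * f (toC x)) `^ p)%:E = (cabs a `^ p * i)%:E)%E.
  rewrite EFinM -IE -(PD_integralZl (measurable_cabs_PD dU p hf) _ (powR_ge0 _ _)).
    by apply: eq_integral => x _; rewrite cabsM powRM ?cabs_ge0.
  by move=> x; rewrite lee_fin powR_ge0.
by rewrite IE/= powRM ?powR_ge0// -powRrM mulfV ?gt_eqF// powRr1// cabs_ge0.
Qed.

Lemma pairing_le_Anorm g f : Aspace U q (eta_q q) g -> Ap U p f ->
  cabs (pairing U p f g) <= Anorm U q (eta_q q) g * Apnorm U p f.
Proof. by move=> Ag Af; rewrite mulrC; have [] := pairing_hoelder dU p1 Af Ag. Qed.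

(** [sup] is meaningful for a nonempty set bounded above: the zero function provides an element and
    Hoelder's inequality a bound. The last claim follows by normalising [f]. *)
Lemma dual_norm_pairing g : Aspace U q (eta_q q) g ->
  let d := dual_norm U p (fun f => pairing U p f g) in
  [/\ 0 <= d, d <= Anorm U q (eta_q q) g &
      forall f, Ap U p f -> cabs (pairing U p f g) <= d * Apnorm U p f].
Proof.
move=> Ag d; pose S := [set cabs (pairing U p f g) | f in [set f | Ap U p f /\ Apnorm U p f <= 1]].
have A0 : 0 <= Anorm U q (eta_q q) g by exact: powR_ge0.
have Af0 := Ap0 Um p1 pm.
have nf0 : Apnorm U p (fun=> 0) = 0.
  have E := ApnormZ 0 Af0; rewrite cabs0 [RHS]mul0r in E.
  by rewrite -[RHS]E; congr Apnorm; apply/funext => z; rewrite mul0r.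
have S0 : S 0.
  exists (fun=> 0); first by split; [exact: Af0|rewrite nf0].
  have := pairing_le_Anorm Ag Af0; rewrite nf0 mulr0 => H.
  by apply/eqP; rewrite eq_le H cabs_ge0.
have Sub : ubound S (Anorm U q (eta_q q) g).
  move=> _ [f [Af nf] <-]; rewrite (le_trans (pairing_le_Anorm Ag Af))// ler_piMr//.
have hS : has_ubound S by exists (Anorm U q (eta_q q) g).
have dge x : S x -> x <= d by move=> Sx; exact: ub_le_sup.
split; [exact: dge|by apply: ge_sup => //; exists 0|] => f Af.
have [n0|nN0] := eqVneq (Apnorm U p f) 0.
  by have := pairing_le_Anorm Ag Af; rewrite n0 !mulr0.
have n0 : 0 < Apnorm U p f by rewrite lt_neqAle eq_sym nN0 powR_ge0.
pose a : R[i] := ((Apnorm U p f)^-1)%:C%C.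
have aE : cabs a = (Apnorm U p f)^-1 by rewrite cabs_real ger0_norm// invr_ge0 ltW.
have [Aaf La] := linear_on_ApZ Um p1 pm (pairing_linear dU p1 Ag) a Af.
have Sa : S (cabs (pairing U p (fun z => a * f z) g)).
  exists (fun z => a * f z) => //; split; first exact: Aaf.
  by rewrite (ApnormZ a Af) aE mulVf.
by have := dge _ Sa; rewrite La cabsM aE ler_pdivrMl// [leRHS]mulrC.
Qed.

(** Apply [representation] to the functional of [g] itself, with [M] its dual norm: the function
    obtained has norm at most [C M], and by injectivity it coincides with [g] on [U]. *)
Lemma dual_norm_lower : exists2 c : R, 0 < c & forall g, Aspace U q (eta_q q) g ->
  c * Anorm U q (eta_q q) g <= dual_norm U p (fun f => pairing U p f g).
Proof.
have [C C0 H] := representation Um p1 pm.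
have scale (x y : R) : x <= C * y -> C^-1 * x <= y by rewrite ler_pdivrMl.
exists C^-1; first by rewrite invr_gt0.
move=> g Ag; have [d0 _ dle] := dual_norm_pairing Ag.
have [g' [Ag' ng'] gg'] := H _ _ d0 (pairing_linear dU p1 Ag) dle.
pose D z := -1 * g' z + g z.
have AD : Aspace U q (eta_q q) D.
  exact: (Aspace_lin dU _ q0 (measurable_eta q) (eta_ge0 p1)).
have D0 : forall z, U z -> D z = 0.
  apply: (pairing_inj AD) => f Af.
  have E := pairing_conj_linear dU p1 (-1) Af Ag' Ag; rewrite [LHS]E (gg' f Af).
  have -> : ((-1 : R[i])^*)%C = -1 by exact: rmorphN1.
  by rewrite mulN1r addNr.
suff E : Anorm U q (eta_q q) g = Anorm U q (eta_q q) g'.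
  by apply: scale; rewrite E; exact: ng'.
suff E : wint U q (eta_q q) g = wint U q (eta_q q) g' by rewrite /Anorm E.
apply: eq_integral => x /set_mem Ux.
have : g (toC x) - g' (toC x) = 0 by rewrite -(D0 _ Ux) /D mulN1r addrC.
by move/eqP; rewrite subr_eq0 => /eqP ->.
Qed.

End duality.

Unset Implicit Arguments.

Theorem theorem7p6 (R : realType) (U : set R[i]) (p : R) :
  (U = @disc R \/ U = @pdisc R) -> 1 < p ->
  let q := p / (p - 1) in
  (* g |-> {., g}_p maps A^q(U, eta_q) into the dual A^p(U)' *)
  (forall g, Aspace U q (eta_q q) g -> dual_Ap U p (fun f => pairing U p f g)) /\
  (* it is conjugate-linear *)
  (forall (a : R[i]) g1 g2, Aspace U q (eta_q q) g1 -> Aspace U q (eta_q q) g2 ->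
     Aspace U q (eta_q q) (fun z => a * g1 z + g2 z) /\
     forall f, Ap U p f ->
       pairing U p f (fun z => a * g1 z + g2 z)
       = (a^*)%C * pairing U p f g1 + pairing U p f g2) /\
  (* it is injective *)
  (forall g, Aspace U q (eta_q q) g ->
     (forall f, Ap U p f -> pairing U p f g = 0) -> forall z, U z -> g z = 0) /\
  (* it is onto A^p(U)' *)
  (forall L, dual_Ap U p L ->
     exists2 g, Aspace U q (eta_q q) g & forall f, Ap U p f -> L f = pairing U p f g) /\
  (* it is an isomorphism of Banach spaces (bounded, with bounded inverse) *)
  (exists c C : R, 0 < c /\ 0 < C /\
     forall g, Aspace U q (eta_q q) g ->
       c * Anorm U q (eta_q q) g <= dual_norm U p (fun f => pairing U p f g)
       <= C * Anorm U q (eta_q q) g).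
Proof.
move=> dU p1 q.
(* Simple poles occur only on the punctured disc with [p < 2]; otherwise [m = 0]. Double poles are
   excluded because [2 <= 2 p]. *)
have [m Um pm] : exists2 m : nat,
    (U = @disc R /\ m = 0%N) \/ (U = @pdisc R /\ 2 <= p * m.+1%:R) & p * m%:R < 2.
  case: dU => UE; first by exists 0%N; [left|rewrite mulr0].
  have [p2|p2] := leP 2 p; first by exists 0%N; [right; rewrite mulr1|rewrite mulr0].
  by exists 1%N; [right; split => //; lra|rewrite mulr1].
have q0 : 0 < q by rewrite divr_gt0 ?subr_gt0// (lt_trans ltr01).
split.
  move=> g Ag; split; first exact: pairing_linear.
  by exists (Anorm U q (eta_q q) g) => f; exact: (pairing_le_Anorm Um p1).
split.
  move=> a g1 g2 A1 A2; split; last by move=> f Af; exact: (pairing_conj_linear dU p1 a Af A1 A2).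
  exact: (Aspace_lin dU a q0 (measurable_eta q) (eta_ge0 p1)).
split; first exact: (pairing_inj Um p1 pm).
split.
  move=> L [lL [C bC]]; have [K _ H] := representation Um p1 pm.
  (* The constant of a bounded functional may be negative in the definition, hence its absolute
     value. *)
  have [f Af|g [Ag _] Lg] := H L `|C| (normr_ge0 C) lL; last by exists g.
  by rewrite (le_trans (bC f Af))// ler_wpM2r ?powR_ge0// ler_norm.
have [c c0 H] := dual_norm_lower Um p1 pm; exists c, 1; do 2! split => //.
move=> g Ag; rewrite (H g Ag) mul1r.
by have [] := dual_norm_pairing Um p1 pm Ag.
Qed.
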